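(* Assume condition (A1) (stated in the context). Let $D$ be an open, bounded Lipschitz domain in $\mathbb{R}^d$, let $f\in C(\bar D)$ and let $g\in C_b(D^c)$. Then there exists a unique viscosity solution $u\in C_b(\mathbb{R}^d)$ to $$Lu=-f\ \text{ in } D,\qquad u=g\ \text{ in } D^c .$$ Furthermore, this unique solution can be written as $$u(x)=\mathbb{E}_x\Big[\int_0^{\tau} f(X_t)\,dt\Big]+\mathbb{E}_x[g(X_\tau)],\qquad x\in D,$$ where $\tau=\tau_D=\inf\{t>0: X_t\notin D\}$ is the first exit time of $X$ from $D$.
   Context: Operator: $j:\mathbb{R}^d\setminus\{0\}\to[0,\infty)$ is a fixed measurable function with $\int_{\mathbb{R}^d}(1\wedge|y|^2)j(y)\,dy<\infty$, and $$Lu(x)=\Delta u(x)+\int_{\mathbb{R}^d}\big(u(x+y)-u(x)-\mathbf 1_{\{|y|\le1\}}\,y\cdot\nabla u(x)\big)j(y)\,dy.$$ Exponent and condition (A1): $\psi(z)=\int_{\mathbb{R}^d}(1-e^{iz\cdot\xi}+\mathbf 1_{\{|\xi|\le1\}}\,iz\cdot\xi)\,j(\xi)\,d\xi$. Condition (A1): for some constant $C>0$, $|\mathrm{Im}\,\psi(p)|\le C(|p|^2+|\mathrm{Re}\,\psi(p)|)$ for all $p\in\mathbb{R}^d$, and for all $r>0$, $\sup_{|p|\le r}(|p|^2+\mathrm{Re}\,\psi(p))>0$. Process: $X=B+Y$ is the Lévy process (on a complete probability space, with càdlàg paths) where $Y$ is a pure-jump Lévy process with Lévy–Khinchine exponent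 $\psi$ and $B$ is an independent Brownian motion running twice as fast as standard $d$-dimensional Brownian motion; thus, started from $0$, $\mathbb{E}[e^{iz\cdot X_t}]=e^{-t(|z|^2+\psi(z))}$. $\mathbb{P}_x,\mathbb{E}_x$ denote probability and expectation for the process started at $x$ (i.e. the law of $X+x$ with $X_0=0$). Viscosity solutions: functions are Borel measurable. A bounded $u:\mathbb{R}^d\to\mathbb{R}$, upper (lower) semicontinuous in $\bar D$, is a viscosity subsolution (supersolution) of $Lu=f$ in $D$, written $Lu\ge f$ ($Lu\le f$), if for every $x\in D$, every neighbourhood $N_x$ of $x$ in $D$ and every $\varphi\in C^2(\overline{N_x})$ such that $\varphi-u$ attains minimum (maximum) $0$ in $N_x$ at $x$, the function $v$ equal to $\varphi$ in $N_x$ and to $u$ elsewhere satisfies $Lv(x)\ge f(x)$ ($Lv(x)\le f(x)$). A viscosity solution is both a sub- and a supersolution. $C_b$ denotes bounded continuous functions. *)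

(* Defs.v *)
From HB Require Import structures.
From mathcomp Require Import all_boot all_order all_algebra.
From mathcomp Require Import all_classical all_reals all_analysis.
From mathcomp Require Import measurable_realfun complex.

Set Implicit Arguments.
Unset Strict Implicit.
Unset Printing Implicit Defensive.

Import Order.TTheory GRing.Theory Num.Theory.
Import numFieldNormedType.Exports.

Local Open Scope classical_set_scope.
Local Open Scope ring_scope.

(* The Borel sigma-algebra. A name for the open sets is needed because HB does
   not accept the elaborated form of open in the display of the instance. *)
Definition open_mx {R : realType} m n : set (set 'M[R]_(m, n)) := open.

HB.instance Definition _ (R : realType) (m n : nat) :=
  @isMeasurable.Build (sigma_display (@open_mx R m n)) 'M[R]_(m, n)
    <<s @open_mx R m n >>
    (@sigma_algebra0 _ setT _) (@sigma_algebraC _ _)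
    (@sigma_algebra_bigcup _ setT _).

Section borel_rV.
Context {R : realType}.

Lemma rV_ballE n (x : 'rV[R]_n) (e : R) : 0 < e ->
  ball x e = \bigcap_(i in [set: 'I_n]) [set y : 'rV[R]_n | ball (x 0 i) e (y 0 i)].
Proof.
move=> e0; apply/seteqP; split=> [y [_ xy] i _|y xy]; first exact: xy.
by split=> // i j; rewrite (ord1 i); exact: xy.
Qed.

Lemma measurable_fun_rV d (T : measurableType d) n (f : T -> 'rV[R]_n) :
  (forall i, measurable_fun setT (fun t => f t 0 i)) -> measurable_fun setT f.
Proof.
move=> mf; apply: (@measurability _ _ _ _ _ _ (@open_mx R 1 n)) => // _ [U oU <-].
rewrite setTI.
pose B (p : 'rV[rat]_n * nat) : set 'rV[R]_n :=
  ball (\row_i ratr (p.1 0 i) : 'rV[R]_n) p.2.+1%:R^-1.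
have -> : f @^-1` U = \bigcup_(p : 'rV[rat]_n * nat)
    (if `[< B p `<=` U >] then f @^-1` B p else set0).
  apply/seteqP; split=> [t Ut|t [p _]]; last by case: asboolP => // /[swap] ft; apply.
  have /nbhs_ballP[e /= e0 eU] : nbhs (f t) U by exact: open_nbhs_nbhs.
  have [N _ Ne] : exists2 N : nat, True & N.+1%:R^-1 < e / 2.
    near \oo => N; exists N => //; near: N.
    have e20 : 0 < e / 2 by rewrite divr_gt0.
    exact: near_infty_natSinv_lt (PosNum e20).
  have N0 : 0 < N.+1%:R^-1 :> R by rewrite invr_gt0.
  have /choice[q Hq] : forall i, exists r : rat, ball (f t 0 i) N.+1%:R^-1 (ratr r : R).
    move=> i; have [] := @dense_rat R (ball (f t 0 i) N.+1%:R^-1).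
    - by exists (f t 0 i); exact: ballxx.
    - exact: ball_open.
    - by move=> x [Hr [r _ rE]]; exists r; rewrite rE.
  have fq : ball (f t) N.+1%:R^-1 (\row_j ratr ((\row_i q i : 'rV[rat]_n) 0 j) : 'rV[R]_n).
    by split=> // i j; rewrite (ord1 i) !mxE; exact: Hq.
  exists (\row_i q i, N) => //=; case: asboolP => [_|]; first exact: ball_sym.
  case=> y By; apply: eU; rewrite (splitr e).
  apply: (@le_ball _ _ _ (N.+1%:R^-1 + N.+1%:R^-1)); first by rewrite lerD// ltW.
  exact: ball_triangle fq By.
apply: countable_bigcupT_measurable => [|p]; first exact: countableP.
case: ifPn => _ //.
rewrite /B rV_ballE ?invr_gt0// preimage_bigcap.
apply: fin_bigcap_measurable => [|i _]; first exact: finite_finset.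
pose b : set R := ball ((\row_i ratr (p.1 0 i) : 'rV[R]_n) 0 i) p.2.+1%:R^-1.
have mb : measurable b by by apply: open_measurable; apply: ball_open; rewrite invr_gt0.
by have := mf i measurableT b mb; rewrite setTI.
Unshelve. all: by end_near. Qed.

Lemma measurable_coord n (i : 'I_n) :
  measurable_fun setT (fun v : 'rV[R]_n => v 0 i).
Proof.
apply: (measurability _ (RGenOpens.measurableE R)) => _ [_ [a [b ->] <-]].
rewrite setTI; apply: sub_sigma_algebra.
by have /continuousP := @coord_continuous R 1 n 0 i; apply; exact: interval_open.
Qed.

Definition consrV n (p : R * 'rV[R]_n) : 'rV[R]_n.+1 :=
  \row_i oapp (p.2 0) p.1 (unlift ord0 i).

Lemma consrV0 n (p : R * 'rV[R]_n) : consrV p 0 ord0 = p.1.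
Proof. by rewrite mxE unlift_none. Qed.

Lemma consrVS n (p : R * 'rV[R]_n) i : consrV p 0 (lift ord0 i) = p.2 0 i.
Proof. by rewrite mxE liftK. Qed.

Lemma measurable_consrV n : measurable_fun setT (@consrV n).
Proof.
apply: measurable_fun_rV => i; have [j ->|->] := unliftP ord0 i.
  under eq_fun do rewrite consrVS.
  exact: measurableT_comp (measurable_coord j) measurable_snd.
under eq_fun do rewrite consrV0.
exact: measurable_fst.
Qed.

Definition unconsrV n (v : 'rV[R]_n.+1) : R * 'rV[R]_n :=
  (v 0 ord0, \row_i v 0 (lift ord0 i)).

Lemma consrVK n : cancel (@consrV n) (@unconsrV n).
Proof.
move=> p; rewrite /unconsrV consrV0; case: p => a v; congr (_, _).
by apply/rowP => i; rewrite mxE consrVS.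
Qed.

Lemma measurable_unconsrV n : measurable_fun setT (@unconsrV n).
Proof.
apply/measurable_fun_pairP; split; first exact: measurable_coord.
apply: measurable_fun_rV => i /=.
by under eq_fun do rewrite mxE; exact: measurable_coord.
Qed.

End borel_rV.

Section lebesgue_rV.
Context {R : realType}.

Section step.
Context n (m : {sigma_finite_measure set 'rV[R]_n -> \bar R}).

Definition lebesgue_step : set 'rV[R]_n.+1 -> \bar R :=
  pushforward (lebesgue_measure \x m)%E (@consrV R n).

Let lebesgue_step0 : lebesgue_step set0 = 0%E.
Proof. by rewrite /lebesgue_step /pushforward preimage_set0 measure0. Qed.

Let lebesgue_step_ge0 A : (0 <= lebesgue_step A)%E.
Proof. exact: (measure_ge0 (lebesgue_measure \x m)%E). Qed.

Let lebesgue_step_sigma_additive : semi_sigma_additive lebesgue_step.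
Proof.
apply: (@measure_semi_sigma_additive _ _ _
  (pushforward (lebesgue_measure \x m)%E (@consrV R n))).
exact: measurable_consrV.
Qed.

HB.instance Definition _ := isMeasure.Build _ _ _ lebesgue_step
  lebesgue_step0 lebesgue_step_ge0 lebesgue_step_sigma_additive.

Let lebesgue_step_sigma_finite : sigma_finite setT lebesgue_step.
Proof.
pose l : {sigma_finite_measure set (measurableTypeR R) -> \bar R} := lebesgue_measure.
have /sigma_finiteP[F [UF ndF Foo]] := sigma_finiteT l.
have /sigma_finiteP[G [UG ndG Goo]] := sigma_finiteT m.
pose H k := @unconsrV R n @^-1` (F k `*` G k).
have mH k : measurable (H k).
  rewrite -[X in measurable X]setTI; apply: measurable_unconsrV => //.
  by apply: measurableX; [exact: (Foo k).1 | exact: (Goo k).1].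
exists H => [|k]; last split=> //.
  apply/esym; rewrite -subTset => v _.
  have [i _ Fi] : (\bigcup_i F i) (unconsrV v).1 by rewrite -UF.
  have [k _ Gk] : (\bigcup_i G i) (unconsrV v).2 by rewrite -UG.
  exists (maxn i k) => //; split.
    by move: Fi; exact/subsetPset/ndF/leq_maxl.
  by move: Gk; exact/subsetPset/ndG/leq_maxr.
rewrite /lebesgue_step /pushforward.
rewrite (_ : _ @^-1` _ = F k `*` G k); last first.
  by rewrite /H; apply/seteqP; split=> p; rewrite /preimage /mkset consrVK.
rewrite product_measure1E; [|exact: (Foo k).1 |exact: (Goo k).1].
rewrite lte_mul_pinfty ?ge0_fin_numE ?measure_ge0//.
  exact: (Foo k).2.
exact: (Goo k).2.
Qed.

HB.instance Definition _ := Measure_isSigmaFinite.Build _ _ _ lebesgue_step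
  lebesgue_step_sigma_finite.
End step.

Fixpoint lebesgue_rV n : {sigma_finite_measure set 'rV[R]_n -> \bar R} :=
  match n with
  | 0%N => \d_(0 : 'rV[R]_0)
  | n'.+1 => lebesgue_step (lebesgue_rV n')
  end.
End lebesgue_rV.

Section lebesgue_rV_rect.
Context {R : realType}.

Lemma measurable_rect n (A : 'I_n -> set R) :
  (forall i, measurable (A i)) ->
  measurable [set v : 'rV[R]_n | forall i, A i (v 0 i)].
Proof.
move=> mA; rewrite (_ : mkset _ =
    \bigcap_(i in [set: 'I_n]) ((fun v : 'rV[R]_n => v 0 i) @^-1` A i)).
  apply: fin_bigcap_measurable => [|i _]; first exact: finite_finset.
  by rewrite -[X in measurable X]setTI; exact: measurable_coord.
by apply/seteqP; split=> v Av i => [_|]; exact: Av.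
Qed.

Lemma lebesgue_rV_rect n (A : 'I_n -> set R) :
  (forall i, measurable (A i)) ->
  lebesgue_rV n [set v | forall i, A i (v 0 i)] =
  (\prod_(i < n) lebesgue_measure (A i))%E.
Proof.
elim: n A => [A _|n IHn A mA].
  by rewrite big_ord0 /= diracE mem_set// => -[].
rewrite big_ord_recl /= /lebesgue_step /pushforward -(IHn (fun i => A (lift ord0 i))); last first.
  by move=> i; exact: mA.
have mr := @measurable_rect n (fun i => A (lift ord0 i)) (fun i => mA _).
rewrite -product_measure1E//; last exact: (mA ord0).
congr (_ _); apply/seteqP; split=> [p Ap|p [A0 AS] i].
- split=> [|i]; first by have := Ap ord0; rewrite consrV0.
  by have := Ap (lift ord0 i); rewrite consrVS.
- by have [k ->|->] := unliftP ord0 i; rewrite ?consrVS ?consrV0; [exact: AS|exact: A0].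
Qed.

End lebesgue_rV_rect.

Section euclidean.
Context {R : realType} {d : nat}.
Implicit Types x y : 'rV[R]_d.

Definition dotv x y : R := \sum_(i < d) x 0 i * y 0 i.

(* The norm of the library on row vectors is the sup norm. *)
Definition enorm x : R := Num.sqrt (dotv x x).

Definition ebasis (i : 'I_d) : 'rV[R]_d := delta_mx 0 i.

Definition partial (i : 'I_d) (u : 'rV[R]_d -> R) : 'rV[R]_d -> R :=
  fun x => 'D_(ebasis i) u x.

Definition grad (u : 'rV[R]_d -> R) x : 'rV[R]_d := \row_i partial i u x.

Definition laplacian (u : 'rV[R]_d -> R) x : R :=
  \sum_(i < d) partial i (partial i u) x.

(* C^2 up to the boundary: the partial derivatives of order at most 2 exist
   in the open set N and have continuous extensions to its closure. *)
Definition C2_closure (N : set 'rV[R]_d) (phi : 'rV[R]_d -> R) : Prop :=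
  [/\ {within closure N, continuous phi},
      forall i x, N x -> derivable phi x (ebasis i),
      forall i k x, N x -> derivable (partial i phi) x (ebasis k),
      forall i, exists h : 'rV[R]_d -> R,
        {within closure N, continuous h} /\ {in N, partial i phi =1 h} &
      forall i k, exists h : 'rV[R]_d -> R,
        {within closure N, continuous h} /\
        {in N, partial k (partial i phi) =1 h}].

(* Near each boundary point, and in suitable orthonormal coordinates in which
   e is the last vector and {y | dotv e y = 0} carries the other coordinates,
   D is the region above the graph of a Lipschitz function. *)
Definition lipschitz_domain (D : set 'rV[R]_d) : Prop :=
  open D /\
  forall p, (closure D `\` D) p ->
    exists (r : R) (e : 'rV[R]_d) (gamma : 'rV[R]_d -> R),
      [/\ 0 < r, enorm e = 1,
          [lipschitz gamma y | y in [set y | dotv e y = 0]] &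
          forall y, enorm (y - p) < r ->
            D y <-> gamma (y - dotv e y *: e) < dotv e y].

End euclidean.

Section complex_valued.
Context {R : realType}.

Definition expi (t : R) : R[i] := (cos t +i* sin t)%C.

Definition cexp (z : R[i]) : R[i] := ((expR (complex.Re z))%:C * expi (complex.Im z))%C.

Definition cintegral d (T : measurableType d) (mu : {measure set T -> \bar R})
    (A : set T) (h : T -> R[i]) : R[i] :=
  (Rintegral mu A (fun x => complex.Re (h x)) +i* Rintegral mu A (fun x => complex.Im (h x)))%C.

End complex_valued.

Section operator.
Context {R : realType} {d : nat}.
Variable j : 'rV[R]_d -> R.

Definition unit_ball : set 'rV[R]_d := [set y | enorm y <= 1].

(* The origin is excluded because j is only given outside of it. *)
Definition L_op (u : 'rV[R]_d -> R) (x : 'rV[R]_d) : R :=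
  laplacian u x +
  \int[lebesgue_rV d]_(y in [set~ 0])
    ((u (x + y) - u x - \1_unit_ball y * dotv y (grad u x)) * j y).

Definition psi (z : 'rV[R]_d) : R[i] :=
  cintegral (lebesgue_rV d) [set~ 0] (fun xi =>
    (1 - expi (dotv z xi) + (0 +i* (\1_unit_ball xi * dotv z xi))) * (j xi)%:C)%C.

Definition condition_A1 : Prop :=
  (exists2 C : R, 0 < C & forall p,
     `|complex.Im (psi p)| <= C * (enorm p ^+ 2 + `|complex.Re (psi p)|)) /\
  (forall r : R, 0 < r ->
     (0 < ereal_sup [set (enorm p ^+ 2 + complex.Re (psi p))%:E
                    | p in [set p | (enorm p <= r)%R]])%E).

Definition usc_in (A : set 'rV[R]_d) (u : 'rV[R]_d -> R) : Prop :=
  lower_semicontinuous ((fun x => (- u x)%:E) : subspace A -> \bar R).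

Definition lsc_in (A : set 'rV[R]_d) (u : 'rV[R]_d -> R) : Prop :=
  lower_semicontinuous ((fun x => (u x)%:E) : subspace A -> \bar R).

Definition glue (N : set 'rV[R]_d) (phi u : 'rV[R]_d -> R) : 'rV[R]_d -> R :=
  fun y => if y \in N then phi y else u y.

Variables (D : set 'rV[R]_d) (f : 'rV[R]_d -> R).

Definition viscosity_subsolution (u : 'rV[R]_d -> R) : Prop :=
  [/\ measurable_fun setT u, bounded_fun u, usc_in (closure D) u &
      forall x (N : set 'rV[R]_d) phi, D x ->
        open N -> N x -> N `<=` D -> C2_closure N phi ->
        phi x - u x = 0 -> (forall y, N y -> 0 <= phi y - u y) ->
        f x <= L_op (glue N phi u) x].

Definition viscosity_supersolution (u : 'rV[R]_d -> R) : Prop :=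
  [/\ measurable_fun setT u, bounded_fun u, lsc_in (closure D) u &
      forall x (N : set 'rV[R]_d) phi, D x ->
        open N -> N x -> N `<=` D -> C2_closure N phi ->
        phi x - u x = 0 -> (forall y, N y -> phi y - u y <= 0) ->
        L_op (glue N phi u) x <= f x].

Definition viscosity_solution (u : 'rV[R]_d -> R) : Prop :=
  viscosity_subsolution u /\ viscosity_supersolution u.

End operator.

Section processes.
Context {R : realType} {d : nat} {dO : measure_display}
  {Omega : measurableType dO} (P : probability Omega R).
Implicit Types X Y : R -> Omega -> 'rV[R]_d.

(* Processes are indexed by R but only used at nonnegative times. *)

Definition cadlag (w : R -> 'rV[R]_d) : Prop :=
  (forall t, 0 <= t -> w s @[s --> t^'+] --> w t) /\
  (forall t, 0 < t -> exists l : 'rV[R]_d, w s @[s --> t^'-] --> l).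

(* For a finite index type the product rule for the full family gives the one
   for subfamilies, by taking some of the A i equal to setT. *)
Definition mutually_independent (I : finType)
    (Z : I -> Omega -> 'rV[R]_d) : Prop :=
  forall A : I -> set 'rV[R]_d, (forall i, measurable (A i)) ->
    P (\bigcap_(i in [set: I]) (Z i @^-1` A i)) =
    (\prod_(i : I) P (Z i @^-1` A i))%E.

Definition levy_process X : Prop :=
  [/\ forall t, 0 <= t -> measurable_fun setT (X t),
      {ae P, forall w, X 0 w = 0},
      forall w, cadlag (fun t => X t w),
      forall (n : nat) (t : nat -> R), 0 <= t 0%N ->
        (forall k, (k < n)%N -> t k <= t k.+1) ->
        mutually_independent (fun (k : 'I_n) w => X (t k.+1) w - X (t k) w) &
      forall s t (A : set 'rV[R]_d), 0 <= s -> 0 <= t -> measurable A ->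
        P ((fun w => X (s + t) w - X s w) @^-1` A) = P (X t @^-1` A)].

Definition standard_brownian X : Prop :=
  [/\ levy_process X,
      forall w, {within [set t | 0 <= t], continuous (fun t => X t w)} &
      forall t (A : 'I_d -> set R), 0 < t -> (forall i, measurable (A i)) ->
        P [set w | forall i, A i (X t w 0 i)] =
        (\prod_(i < d) normal_prob 0 (Num.sqrt t) (A i))%E].

Definition has_exponent X (Psi : 'rV[R]_d -> R[i]) : Prop :=
  forall t z, 0 <= t ->
    cintegral P setT (fun w => expi (dotv z (X t w))) =
    cexp (- (t%:C * Psi z)%C).

Definition sigma_process X : set (set Omega) :=
  <<s [set X t @^-1` A | t in [set t | 0 <= t] & A in measurable] >>.

Definition independent_processes X Y : Prop :=
  forall E F, sigma_process X E -> sigma_process Y F ->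
    P (E `&` F) = (P E * P F)%E.

Definition exit_time (D : set 'rV[R]_d) (w : R -> 'rV[R]_d) : \bar R :=
  ereal_inf [set t%:E | t in [set t | 0 < t /\ ~ D (w t)]].

End processes.

(* Main.v *)
(** Time is discretized: for h = t0 / 2^n and P_h the semigroup of X, let V_n solve
    V = h f + P_h V in D and V = g off D. A trigonometric polynomial beta with
    P_t beta <= beta - t on D yields existence, a maximum principle, and a bound on
    the expected discrete exit time. The exterior cone condition, a lower bound
    for Gaussian probabilities and the smallness of Y_s / sqrt s in probability make
    the exit time small near the boundary, uniformly in h; comparing V_n with its
    translates, the V_n are then asymptotically equicontinuous. Summing the
    one-step identity along the grid and following the paths, V_n converges to
    the stochastic representation u.

    The test functions are trigonometric polynomials, for which semigroup and operator
    are explicit. Averaging V_n - p, for a Bernstein approximation p of u, twice along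
    each coordinate gives a function with small increments of second order; hence
    there are trigonometric polynomials p_k -> u with L p_k -> - f, locally uniformly
    in D. A viscosity solution is compared with p_k + eps beta, which gives uniqueness.
    A test function phi touching u at x0 is compared with p_k at the minimum of
    phi + eps s - p_k near x0, where s(x) = sum_i (1 - cos (x_i - x0_i)), which gives
    existence. *)
Require Import Defs.
From HB Require Import structures.
From mathcomp Require Import all_boot all_order all_algebra.
From mathcomp Require Import all_classical all_reals all_analysis.
From mathcomp Require Import measurable_realfun complex ring lra.

Set Implicit Arguments.
Unset Strict Implicit.
Unset Printing Implicit Defensive.

Import Order.TTheory GRing.Theory Num.Theory.
Import numFieldNormedType.Exports.

Local Open Scope classical_set_scope.
Local Open Scope ring_scope.

(** The law of the process is accessible only through its characteristic function and through the
    independence of finitely many increments. This fixes the tools: the Markov property is used only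
    on deterministic grids, where it is Fubini's theorem for independent variables, and every drift
    estimate is made on cosines or averages of cosines. The limit [u] is merely continuous, so [L]
    cannot be applied to it. The estimate of [L p_k] comes from the one-step identity of [V n], with
    a mesh chosen after [p_k]; hence no smoothness of [u] and no differentiation of the semigroup on
    general functions is involved. Measurability of functionals of the exit time is not assumed:
    they are almost sure limits of functionals of grid positions, and [P] is complete. The meshes
    are dyadic, so that an exit seen on one grid is seen on all finer ones. The paths to be excluded
    touch the complement of [D] at time tau but are in [D] at all later grid times for a while; they
    form a null set because the expected discrete exit time is small near the complement, uniformly
    in the mesh. *)

Local Notation glue := Defs.glue.

(** * Bounded measurable functions *)

Section real_integrable.
Context d {T : measurableType d} {R : realType} (mu : {measure set T -> \bar R}).
Variables (D : set T) (mD : measurable D).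
Implicit Types f g : T -> R.

Lemma rintegrableB f g : mu.-integrable D (EFin \o f) -> mu.-integrable D (EFin \o g) ->
  mu.-integrable D (EFin \o (fun x => f x - g x)).
Proof. by move=> mf mg; have := integrableB mD mf mg; apply: eq_integrable. Qed.

Lemma rintegrableZ (k : R) f : mu.-integrable D (EFin \o f) ->
  mu.-integrable D (EFin \o (fun x => k * f x)).
Proof. by move=> mf; have := integrableZl mD k mf; apply: eq_integrable. Qed.

End real_integrable.

Section bounded_measurable.
Context d {T : measurableType d} {R : realType}.
Implicit Types f g : T -> R.

(** [Rintegral] is total and means nothing off the integrable functions. For a probability this
    class is integrable, so linearity, monotonicity, Fubini and dominated convergence hold on it
    without side conditions. *)
Definition bmeas f := measurable_fun [set: T] f /\ exists M : R, forall x, `|f x| <= M.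

Lemma bmeas_bound f : bmeas f -> exists2 M : R, 0 <= M & forall x, `|f x| <= M.
Proof.
move=> [_ [M fM]]; exists (Num.max M 0); first by rewrite le_max lexx orbT.
by move=> x; rewrite le_max fM.
Qed.

Lemma bmeas_cst (r : R) : bmeas (fun=> r).
Proof. by split; [exact: measurable_cst|exists `|r|]. Qed.

Lemma bmeasD f g : bmeas f -> bmeas g -> bmeas (fun x => f x + g x).
Proof.
move=> [mf [M fM]] [mg [N gN]]; split; first exact: measurable_funD.
by exists (M + N) => x; rewrite (le_trans (ler_normD _ _))// lerD.
Qed.

Lemma bmeasM f g : bmeas f -> bmeas g -> bmeas (fun x => f x * g x).
Proof.
move=> [mf [M fM]] [mg [N gN]]; split; first exact: measurable_funM.
by exists (M * N) => x; rewrite normrM ler_pM.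
Qed.

Lemma bmeasZ (r : R) f : bmeas f -> bmeas (fun x => r * f x).
Proof. by move=> ?; apply: bmeasM => //; exact: bmeas_cst. Qed.

Lemma bmeasN f : bmeas f -> bmeas (fun x => - f x).
Proof.
move=> [mf [M fM]]; split; last by exists M => x; rewrite normrN.
by apply: measurableT_comp.
Qed.

Lemma bmeasB f g : bmeas f -> bmeas g -> bmeas (fun x => f x - g x).
Proof. by move=> ? ?; apply: bmeasD => //; exact: bmeasN. Qed.

Lemma bmeas_norm f : bmeas f -> bmeas (fun x => `|f x|).
Proof.
move=> [mf [M fM]]; split; last by exists M => x; rewrite normr_id.
by apply: measurableT_comp.
Qed.

Lemma bmeas_sum I (s : seq I) (F : I -> T -> R) :
  (forall i, bmeas (F i)) -> bmeas (fun x => \sum_(i <- s) F i x).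
Proof.
move=> bF; elim: s => [|i s IH].
  by under eq_fun do rewrite big_nil; exact: bmeas_cst.
by under eq_fun do rewrite big_cons; exact: bmeasD.
Qed.

Lemma bmeas_indic (A : set T) : measurable A -> bmeas (\1_A : T -> R).
Proof.
move=> mA; split; first exact: measurable_indic.
by exists 1 => x; rewrite indicE; case: (_ \in _); rewrite ?normr1 ?normr0.
Qed.

Lemma bmeas_cvg (f_ : nat -> T -> R) f (M : R) : (forall n, bmeas (f_ n)) ->
  (forall n x, `|f_ n x| <= M) -> (forall x, f_ n x @[n --> \oo] --> f x) ->
  bmeas f.
Proof.
move=> bf fM cf; split.
  apply: (@measurable_fun_cvg _ _ _ setT f_) => [n|]; first by case: (bf n).
  by move=> x _; exact: cf.
exists M => x; have cn : `|f_ n x| @[n --> \oo] --> `|f x| by apply: cvg_norm; exact: cf.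
have <- : limn (fun n => `|f_ n x|) = `|f x| by apply: cvg_lim.
by apply: limr_le; [apply/cvg_ex; exists (`|f x|) | exact: nearW].
Qed.

End bounded_measurable.

Lemma bmeas_comp d d' (T : measurableType d) (T' : measurableType d')
    (R : realType) (h : T' -> T) (f : T -> R) :
  measurable_fun setT h -> bmeas f -> bmeas (f \o h).
Proof.
move=> mh [mf [M fM]]; split; last by exists M => x; exact: fM.
exact: measurableT_comp.
Qed.

Section expectation.
Context d {T : measurableType d} {R : realType} (P : probability T R).
Implicit Types f g : T -> R.
Local Notation E f := (\int[P]_w (f w)).

Lemma bmeas_integrable f : bmeas f -> P.-integrable setT (EFin \o f).
Proof.
move=> [mf [M fM]]; apply: measurable_bounded_integrable => //.
  by rewrite (le_lt_trans (probability_le1 _ _))// ltry.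
by exists M; split => [|x Mx y _ /=]; rewrite ?num_real// (le_trans (fM y))// ltW.
Qed.

Lemma ex_cst r : E (fun=> r) = r.
Proof.
rewrite Rintegral_cst//.
have -> : fine (P setT) = 1 by rewrite probability_setT.
by rewrite mulr1.
Qed.

Lemma exD f g : bmeas f -> bmeas g -> E (fun x => f x + g x) = E f + E g.
Proof. by move=> bf bg; rewrite RintegralD//; exact: bmeas_integrable. Qed.

Lemma exB f g : bmeas f -> bmeas g -> E (fun x => f x - g x) = E f - E g.
Proof. by move=> bf bg; rewrite RintegralB//; exact: bmeas_integrable. Qed.

Lemma exZ r f : bmeas f -> E (fun x => r * f x) = r * E f.
Proof. by move=> bf; rewrite RintegralZl//; exact: bmeas_integrable. Qed.

Lemma exN f : bmeas f -> E (fun x => - f x) = - E f.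
Proof.
move=> bf; rewrite -mulN1r -exZ//.
by apply: eq_Rintegral => x _; rewrite mulN1r.
Qed.

Lemma ex_sum I (s : seq I) (F : I -> T -> R) : (forall i, bmeas (F i)) ->
  E (fun x => \sum_(i <- s) F i x) = \sum_(i <- s) E (F i).
Proof.
move=> bF; elim: s => [|i s IH].
  by under eq_Rintegral do rewrite big_nil; rewrite big_nil ex_cst.
under eq_Rintegral do rewrite big_cons.
by rewrite exD// ?IH ?big_cons//; exact: bmeas_sum.
Qed.

Lemma ex_le f g : bmeas f -> bmeas g -> (forall x, f x <= g x) -> E f <= E g.
Proof. by move=> bf bg fg; apply: le_Rintegral => //; exact: bmeas_integrable. Qed.

Lemma ex_ge0 f : (forall x, 0 <= f x) -> 0 <= E f.
Proof. by move=> f0; apply: Rintegral_ge0 => x _. Qed.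

Lemma ex_norm f : bmeas f -> `|E f| <= E (fun x => `|f x|).
Proof. by move=> bf; apply: le_normr_Rintegral => //; exact: bmeas_integrable. Qed.

Lemma ex_norm_le f (M : R) : bmeas f -> (forall x, `|f x| <= M) -> `|E f| <= M.
Proof.
move=> bf fM; rewrite (le_trans (ex_norm bf))// -[leRHS]ex_cst.
by apply: ex_le => //; [exact: bmeas_norm|exact: bmeas_cst].
Qed.

Lemma ex_indic A : measurable A -> E (\1_A) = fine (P A).
Proof. by move=> mA; rewrite /Rintegral integral_indic// setIT. Qed.

Lemma ex_EFin f : bmeas f -> (\int[P]_w (f w)%:E = (E f)%:E)%E.
Proof.
move=> bf; rewrite /Rintegral fineK//.
by apply: integrable_fin_num => //; exact: bmeas_integrable.
Qed.

Lemma ex_dct (f_ : nat -> T -> R) f (M : R) : (forall n, bmeas (f_ n)) ->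
  (forall n x, `|f_ n x| <= M) -> (forall x, f_ n x @[n --> \oo] --> f x) ->
  E (f_ n) @[n --> \oo] --> E f.
Proof.
move=> bf fM cf; have bF := bmeas_cvg bf fM cf.
apply: fine_cvg.
rewrite fineK; last by apply: integrable_fin_num => //; exact: bmeas_integrable.
apply: (@dominated_cvg _ _ _ _ _ _ _ _ (cst M%:E)) => //.
- by move=> n; apply/measurable_EFinP; case: (bf n).
- by move=> x _; apply: cvg_EFin; [exact: nearW|exact: cf].
- by apply: (@bmeas_integrable (cst M)); exact: bmeas_cst.
- by move=> n x _; rewrite lee_fin.
Qed.

End expectation.

Section fubini.
Context d1 d2 {T1 : measurableType d1} {T2 : measurableType d2} {R : realType}.
Variables (P1 : probability T1 R) (P2 : probability T2 R).
Implicit Type F : T1 * T2 -> R.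

Lemma bmeas_pair1 F x : bmeas F -> bmeas (fun y => F (x, y)).
Proof.
move=> [mF [M FM]]; split; last by exists M.
by apply: (@measurableT_comp _ _ _ _ _ _ F) => //; exact: measurable_pair1.
Qed.

Lemma bmeas_pair2 F y : bmeas F -> bmeas (fun x => F (x, y)).
Proof.
move=> [mF [M FM]]; split; last by exists M.
by apply: (@measurableT_comp _ _ _ _ _ _ F) => //; exact: measurable_pair2.
Qed.

Lemma bmeas_prod_integrable F : bmeas F -> (P1 \x P2)%E.-integrable setT (EFin \o F).
Proof.
move=> bF; apply/integrable12ltyP; first by apply/measurable_EFinP; case: bF.
have [M M0 FM] := bmeas_bound bF.
apply: (@le_lt_trans _ _ (\int[P1]_x (cst M%:E x))%E); last first.
  by rewrite (ex_EFin P1 (bmeas_cst M)) ex_cst ltry.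
have mF : measurable_fun setT (fun z => (`|F z|)%:E).
  by apply/measurable_EFinP; case: (bmeas_norm bF).
apply: ge0_le_integral => //.
- by move=> x _; apply: integral_ge0.
- apply: (measurable_fun_fubini_tonelli_F (m2 := P2) _ mF).
  by move=> z; rewrite lee_fin.
- move=> x _; rewrite /= -[M in leRHS](ex_cst P2) -(ex_EFin P2 (bmeas_cst M)).
  apply: ge0_le_integral => //.
  + by apply/measurable_EFinP; case: (bmeas_pair1 x (bmeas_norm bF)).
  + by move=> y _; rewrite /= lee_fin.
Qed.

Lemma bmeas_ex2 F : bmeas F -> bmeas (fun x => \int[P2]_y F (x, y)).
Proof.
move=> bF; split; last first.
  have [M M0 FM] := bmeas_bound bF; exists M => x.
  by apply: ex_norm_le => //; exact: bmeas_pair1.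
have := measurable_fubini_F (bmeas_prod_integrable bF).
by move=> m; apply: measurableT_comp m; exact: fine_measurable.
Qed.

Lemma bmeas_ex1 F : bmeas F -> bmeas (fun y => \int[P1]_x F (x, y)).
Proof.
move=> bF; split; last first.
  have [M M0 FM] := bmeas_bound bF; exists M => y.
  by apply: ex_norm_le => //; exact: bmeas_pair2.
have := measurable_fubini_G (bmeas_prod_integrable bF).
by move=> m; apply: measurableT_comp m; exact: fine_measurable.
Qed.

Lemma ex_fubini F : bmeas F ->
  \int[P1]_x \int[P2]_y F (x, y) = \int[P2]_y \int[P1]_x F (x, y).
Proof.
move=> bF; have := Fubini (bmeas_prod_integrable bF).
rewrite /Rintegral => e; congr fine.
transitivity (\int[P1]_x \int[P2]_y (F (x, y))%:E)%E.
  by apply: eq_integral => x _; rewrite (ex_EFin P2 (bmeas_pair1 x bF)).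
rewrite [LHS]e.
by apply: eq_integral => y _; rewrite (ex_EFin P1 (bmeas_pair2 y bF)).
Qed.

End fubini.

Definition mfun_of d d' (T : measurableType d) (T' : measurableType d')
    (f : T -> T') (mf : measurable_fun setT f) : {mfun T >-> T'} :=
  MeasurableFun.Pack (MeasurableFun.Class (isMeasurableFun.Build _ _ _ _ _ mf)).

(** * Independence and laws of pairs *)

Section independence.
Context {R : realType} d {T : measurableType d} (P : probability T R).

Lemma ex_distribution d1 (T1 : measurableType d1) (U : T -> T1)
    (mU : measurable_fun setT U) (f : T1 -> R) : bmeas f ->
  \int[distribution P (mfun_of mU)]_y f y = \int[P]_w f (U w).
Proof.
move=> bf; rewrite /Rintegral; congr fine.
rewrite (integral_distribution (X := mfun_of mU))//.
- by apply/measurable_EFinP; case: bf.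
- by apply: (@bmeas_integrable _ _ _ P (f \o U)); exact: bmeas_comp.
Qed.

(** The law of the pair agrees with the product of the two laws on rectangles, hence everywhere, and
    Fubini applies. The targets are arbitrary measurable spaces: in [markov_step] the first one is
    [Omega] itself with the sigma-algebra of the past. *)
Lemma indep_ex d1 d2 (T1 : measurableType d1) (T2 : measurableType d2)
    (U : T -> T1) (V : T -> T2) (F : T1 * T2 -> R) :
  measurable_fun setT U -> measurable_fun setT V ->
  (forall A B, measurable A -> measurable B ->
    P (U @^-1` A `&` V @^-1` B) = (P (U @^-1` A) * P (V @^-1` B))%E) ->
  bmeas F ->
  \int[P]_w F (U w, V w) = \int[P]_w \int[P]_w' F (U w, V w').
Proof.
move=> mU mV UV bF.
have mUV : measurable_fun setT (fun w => (U w, V w)) by exact/measurable_fun_pairP.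
rewrite -(ex_distribution mUV bF).
pose P1 := distribution P (mfun_of mU); pose P2 := distribution P (mfun_of mV).
transitivity (\int[P1]_x \int[P2]_y F (x, y)).
  rewrite {1}/Rintegral.
  rewrite (@eq_measure_integral _ _ _ setT (P1 \x P2)%E); last first.
    move=> A mA _; apply/esym; exact: product_measure_unique.
  rewrite -integral12_prod_meas1; last exact: bmeas_prod_integrable.
  rewrite /Rintegral; congr fine; apply: eq_integral => x _.
  by rewrite /fubini_F (ex_EFin P2 (bmeas_pair1 x bF)).
rewrite (ex_distribution mU (bmeas_ex2 P1 P2 bF)).
by apply: eq_Rintegral => w _; rewrite (ex_distribution mV (bmeas_pair1 _ bF)).
Qed.

(* Two applications of uniqueness of measures, one for each family. *)
Lemma indep_sigma (G1 G2 : set (set T)) :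
  G1 `<=` measurable -> G2 `<=` measurable ->
  setI_closed G1 -> setI_closed G2 -> G1 setT -> G2 setT ->
  (forall A B, G1 A -> G2 B -> P (A `&` B) = (P A * P B)%E) ->
  forall A B, <<s G1 >> A -> <<s G2 >> B -> P (A `&` B) = (P A * P B)%E.
Proof.
have key (G : set (set T)) (B : set T) : G `<=` measurable -> setI_closed G ->
    G setT -> measurable B -> (forall A, G A -> P (A `&` B) = (P A * P B)%E) ->
    forall A, <<s G >> A -> P (A `&` B) = (P A * P B)%E.
  move=> Gm GI GT mB GB A sA.
  pose m1 := mrestr P mB.
  have PB0 : 0 <= fine (P B) by rewrite fine_ge0.
  pose m2 := mscale (NngNum PB0) P.
  have PBE : (fine (P B))%:E = P B by rewrite fineK// fin_num_measure.
  have m2E X : m2 X = (P X * P B)%E.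
    by rewrite /m2 /mscale /= PBE muleC.
  have : m1 A = m2 A.
    apply: (g_sigma_algebra_measure_unique G Gm (fun=> setT)) => //.
    - by rewrite bigcup_const.
    - by move=> C GC; rewrite [RHS]m2E; exact: GB.
    - move=> n; apply: (@le_lt_trans _ _ 1%E); last exact: ltry.
      exact: (probability_le1 P (measurableI _ _ measurableT mB)).
  by rewrite m2E.
move=> m1 m2 I1 I2 T1 T2 G12 A B sA sB.
have mA : measurable A by exact: (smallest_sub (@sigma_algebra_measurable _ T) m1).
rewrite setIC muleC; apply: (key G2) => // C GC.
rewrite setIC muleC; apply: (key G1) => //; first exact: m2.
by move=> D GD; exact: G12.
Qed.

End independence.

Section rV_measurability.
Context {R : realType} {n : nat} d {T : measurableType d}.
Implicit Types f g : T -> 'rV[R]_n.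

Lemma measurable_fun_coord f i : measurable_fun setT f ->
  measurable_fun setT (fun t => f t 0 i).
Proof. by move=> mf; apply: measurableT_comp (measurable_coord i) mf. Qed.

Lemma measurable_rVD f g : measurable_fun setT f -> measurable_fun setT g ->
  measurable_fun setT (fun t => f t + g t).
Proof.
move=> mf mg; apply: measurable_fun_rV => i.
under eq_fun do rewrite mxE.
by apply: measurable_funD; exact: measurable_fun_coord.
Qed.

Lemma measurable_rVN f : measurable_fun setT f -> measurable_fun setT (fun t => - f t).
Proof.
move=> mf; apply: measurable_fun_rV => i.
under eq_fun do rewrite mxE.
by apply: measurableT_comp => //; exact: measurable_fun_coord.
Qed.

Lemma measurable_rVB f g : measurable_fun setT f -> measurable_fun setT g ->
  measurable_fun setT (fun t => f t - g t).
Proof. by move=> mf mg; apply: measurable_rVD => //; exact: measurable_rVN. Qed.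

End rV_measurability.

(** * The Markov property *)

Section markov.
Context {R : realType} {d : nat} {dO : measure_display}
  {Omega : measurableType dO} (P : probability Omega R).
Implicit Types (Z V Y : R -> Omega -> 'rV[R]_d) (tt : nat -> R).

Definition incr Z tt (i : nat) : Omega -> 'rV[R]_d :=
  fun w => Z (tt i.+1) w - Z (tt i) w.

Definition grid tt := 0 <= tt 0%N /\ forall k, tt k <= tt k.+1.

Lemma grid_ge0 tt k : grid tt -> 0 <= tt k.
Proof. by move=> [t0 tS]; elim: k => // k IH; exact: le_trans (tS k). Qed.

(** Of a Levy process this keeps the increments and drops the paths and the initial value. It is
    stable under the time change [t -> 2 * t], which produces the Brownian part of [X]. *)
Record levy_like Z : Prop := LevyLike {
  ll_meas : forall t, 0 <= t -> measurable_fun setT (Z t) ;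
  ll_indep : forall (n : nat) tt, 0 <= tt 0%N ->
        (forall k, (k < n)%N -> tt k <= tt k.+1) ->
        mutually_independent P (fun (k : 'I_n) w => Z (tt k.+1) w - Z (tt k) w) ;
  ll_stat : forall s t (A : set 'rV[R]_d), 0 <= s -> 0 <= t -> measurable A ->
        P ((fun w => Z (s + t) w - Z s w) @^-1` A) = P (Z t @^-1` A) }.

Lemma measurable_incr Z tt i : levy_like Z -> grid tt -> measurable_fun setT (incr Z tt i).
Proof.
by move=> lZ gt; apply: measurable_rVB; apply: (ll_meas lZ); exact: grid_ge0.
Qed.

Lemma incr_event_indep Z tt k (A : nat -> set 'rV[R]_d) : levy_like Z -> grid tt ->
  (forall i, measurable (A i)) ->
  P (\bigcap_(i < k) (incr Z tt i @^-1` A i)) =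
  (\prod_(i < k) P (incr Z tt i @^-1` A i))%E.
Proof.
move=> lZ [t0 tS] mA.
have := @ll_indep _ lZ k tt t0 (fun j _ => tS j) (fun i => A i) (fun i => mA i).
move=> <-; congr (P _); apply/seteqP; split=> w Hw i.
  by move=> _; exact: (Hw i (ltn_ord i)).
by move=> ik; exact: (Hw (Ordinal ik) I).
Qed.

Lemma sigma_process_incr Z tt k (A : nat -> set 'rV[R]_d) : levy_like Z -> grid tt ->
  (forall i, measurable (A i)) ->
  sigma_process Z (\bigcap_(i < k) (incr Z tt i @^-1` A i)).
Proof.
move=> lZ gt mA.
pose G : set (set Omega) := [set Z t @^-1` A | t in [set t : R | 0 <= t] & A in measurable].
change (@measurable _ (g_sigma_algebraType G) (\bigcap_(i < k) (incr Z tt i @^-1` A i))).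
have mZ t : 0 <= t -> @measurable_fun _ _ (g_sigma_algebraType G) _ setT (Z t).
  move=> t0 _ B mB; rewrite setTI; apply: sub_sigma_algebra; exists t => //.
  by exists B.
apply: fin_bigcap_measurable => [|i _]; first exact: finite_II.
rewrite -[X in measurable X]setTI.
apply: (@measurable_rVB R d _ (g_sigma_algebraType G)) => //.
- exact: (mZ _ (grid_ge0 _ gt)).
- exact: (mZ _ (grid_ge0 _ gt)).
Qed.

Section pair.
Variables (V Y : R -> Omega -> 'rV[R]_d).
Hypotheses (lV : levy_like V) (lY : levy_like Y) (VY : independent_processes P V Y).

(** A pi-system on which probabilities factor completely. The increments of [V] and [Y] are recorded
    separately, because independence is given for each process and between the two, not for their
    sum. *)
Definition past_gen tt k : set (set Omega) :=
  [set H | exists A B : nat -> set 'rV[R]_d,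
    [/\ forall i, measurable (A i), forall i, measurable (B i) &
      H = \bigcap_(i < k) (incr V tt i @^-1` A i `&` incr Y tt i @^-1` B i)]].

Definition step_gen tt k : set (set Omega) :=
  [set H | exists A B : set 'rV[R]_d,
    [/\ measurable A, measurable B &
      H = incr V tt k @^-1` A `&` incr Y tt k @^-1` B]].

Definition past tt k := <<s past_gen tt k >>.

Lemma bigcap_preimage_measurable tt k (A B : nat -> set 'rV[R]_d) : grid tt ->
  (forall i, measurable (A i)) -> (forall i, measurable (B i)) ->
  measurable (\bigcap_(i < k) (incr V tt i @^-1` A i `&` incr Y tt i @^-1` B i)).
Proof.
move=> gt mA mB; apply: fin_bigcap_measurable => [|i _]; first exact: finite_II.
apply: measurableI; rewrite -[X in measurable X]setTI.
  exact: (measurable_incr i lV gt).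
exact: (measurable_incr i lY gt).
Qed.

Lemma past_gen_prob tt k (A B : nat -> set 'rV[R]_d) : grid tt ->
  (forall i, measurable (A i)) -> (forall i, measurable (B i)) ->
  P (\bigcap_(i < k) (incr V tt i @^-1` A i `&` incr Y tt i @^-1` B i)) =
  (\prod_(i < k) (P (incr V tt i @^-1` A i) * P (incr Y tt i @^-1` B i)))%E.
Proof.
move=> gt mA mB.
have -> : \bigcap_(i < k) (incr V tt i @^-1` A i `&` incr Y tt i @^-1` B i) =
  (\bigcap_(i < k) (incr V tt i @^-1` A i)) `&` (\bigcap_(i < k) (incr Y tt i @^-1` B i)).
  by rewrite bigcapI.
rewrite VY; [|exact: sigma_process_incr|exact: sigma_process_incr].
by rewrite !incr_event_indep// big_split.
Qed.

Lemma step_gen_prob tt k (A B : set 'rV[R]_d) : grid tt ->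
  measurable A -> measurable B ->
  P (incr V tt k @^-1` A `&` incr Y tt k @^-1` B) =
  (P (incr V tt k @^-1` A) * P (incr Y tt k @^-1` B))%E.
Proof.
move=> gt mA mB; pose tk i := tt (k + i)%N.
have gtk : grid tk.
  by split => [|i]; [exact: (grid_ge0 (k + 0) gt)|rewrite /tk addnS; exact: gt.2].
have E Z : incr Z tk 0 = incr Z tt k by rewrite /incr /tk addn0 addn1.
have := @past_gen_prob tk 1 (fun=> A) (fun=> B) gtk (fun=> mA) (fun=> mB).
rewrite big_ord1 /= !E => <-; congr (P _); apply/seteqP; split=> w.
  by move=> Hw [|//] _; rewrite !E.
by move=> /(_ 0%N); rewrite !E; apply.
Qed.

Lemma past_gen_measurable tt k : grid tt -> past_gen tt k `<=` measurable.
Proof. by move=> gt _ [A [B [mA mB ->]]]; exact: bigcap_preimage_measurable. Qed.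

Lemma past_measurable tt k : grid tt -> past tt k `<=` measurable.
Proof.
move=> gt; apply: smallest_sub; first exact: sigma_algebra_measurable.
exact: past_gen_measurable.
Qed.

Lemma past_step_indep tt k (H K : set Omega) : grid tt ->
  past tt k H -> <<s step_gen tt k >> K -> P (H `&` K) = (P H * P K)%E.
Proof.
move=> gt; apply: indep_sigma.
- exact: past_gen_measurable.
- move=> _ [A [B [mA mB ->]]]; apply: measurableI; rewrite -[X in measurable X]setTI.
    exact: (measurable_incr k lV gt).
  exact: (measurable_incr k lY gt).
- move=> _ _ [A [B [mA mB ->]]] [A' [B' [mA' mB' ->]]].
  exists (fun i => A i `&` A' i), (fun i => B i `&` B' i); split.
  + by move=> i; exact: measurableI.
  + by move=> i; exact: measurableI.
  + rewrite -bigcapI; apply: eq_bigcapr => i _; rewrite !preimage_setI.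
    by rewrite setIACA.
- move=> _ _ [A [B [mA mB ->]]] [A' [B' [mA' mB' ->]]].
  exists (A `&` A'), (B `&` B'); split; [exact: measurableI|exact: measurableI|].
  by rewrite !preimage_setI setIACA.
- exists (fun=> setT), (fun=> setT); split => //.
  by apply/seteqP; split=> // w _ i _.
- by exists setT, setT; split => //; rewrite !preimage_setT setTI.
- move=> _ _ [A [B [mA mB ->]]] [A' [B' [mA' mB' ->]]].
  (* The constraints on the next step are appended as the last factor of a rectangle with [k.+1]
     factors, whose probability is the full product. *)
  pose C i := if (i == k) then A' else A i; pose D i := if (i == k) then B' else B i.
  have mC i : measurable (C i) by rewrite /C; case: ifP.
  have mD i : measurable (D i) by rewrite /D; case: ifP.
  have := @past_gen_prob tt k.+1 C D gt mC mD; rewrite big_ord_recr /=.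
  rewrite [in RHS]/C [in RHS]/D !eqxx.
  have E1 i : (i < k)%N -> (C i = A i) * (D i = B i).
    by rewrite /C /D => ik; rewrite ltn_eqF.
  under eq_bigr => i _ do rewrite (ltn_eqF (ltn_ord i)).
  rewrite -past_gen_prob// => E2.
  have E0 : P (incr V tt k @^-1` A' `&` incr Y tt k @^-1` B') =
      (P (incr V tt k @^-1` A') * P (incr Y tt k @^-1` B'))%E.
    exact: step_gen_prob.
  rewrite E0 -E2; congr (P _); apply/seteqP; split=> [w [Hw Hk] i /=|w Hw].
    rewrite ltnS leq_eqVlt => /predU1P[->|ik]; first by rewrite /C /D eqxx.
    by have := Hw i ik; rewrite (E1 i ik).1 (E1 i ik).2.
  split=> [i ik|]; last by have := Hw k (ltnSn k); rewrite /C /D eqxx.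
  have := Hw i (ltnW ik); rewrite (E1 i ik).1 (E1 i ik).2; exact.
Qed.

Definition psum (t : R) : Omega -> 'rV[R]_d := fun w => V t w + Y t w.

Lemma measurable_psum t : 0 <= t -> measurable_fun setT (psum t).
Proof. by move=> t0; apply: measurable_rVD; [exact: (ll_meas lV)|exact: (ll_meas lY)]. Qed.

(** Stationarity is known for [V] and for [Y] only. Independence turns the expectation into an
    iterated one, in which the two increments are replaced one after the other. *)
Lemma psum_law t u (f : 'rV[R]_d -> R) tt k : bmeas f -> grid tt ->
  tt k = u -> tt k.+1 = u + t -> 0 <= t ->
  \int[P]_w f (incr psum tt k w) = \int[P]_w f (psum t w).
Proof.
move=> bf gt tk tk1 t0.
have u0 : 0 <= u by rewrite -tk; exact: grid_ge0.
pose F (p : 'rV[R]_d * 'rV[R]_d) := f (p.1 + p.2).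
have bF : bmeas F by apply: (bmeas_comp _ bf); apply: measurable_rVD.
have mVk := measurable_incr k lV gt; have mYk := measurable_incr k lY gt.
have mVt := ll_meas lV t0; have mYt := ll_meas lY t0.
have same Z (lZ : levy_like Z) g : bmeas g ->
    \int[P]_w g (incr Z tt k w) = \int[P]_w g (Z t w).
  move=> bg; have mZk := measurable_incr k lZ gt; have mZt := ll_meas lZ t0.
  rewrite -(ex_distribution P mZk bg) -(ex_distribution P mZt bg).
  congr fine; apply: eq_measure_integral => A mA _.
  change (P (incr Z tt k @^-1` A) = P (Z t @^-1` A)).
  rewrite /incr tk tk1.
  exact: (ll_stat lZ u0 t0 mA).
transitivity (\int[P]_w F (incr V tt k w, incr Y tt k w)).
  apply: eq_Rintegral => w _; congr f; rewrite /incr /psum /=.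
  by rewrite opprD addrACA.
rewrite (indep_ex mVk mYk _ bF); last first.
  move=> A B mA mB.
  exact: step_gen_prob.
transitivity (\int[P]_w F (V t w, Y t w)); last by [].
rewrite (indep_ex mVt mYt _ bF); last first.
  move=> A B mA mB; apply: VY; apply: sub_sigma_algebra.
    by exists t => //; exists A.
  by exists t => //; exists B.
rewrite -(same V lV (fun v => \int[P]_w' F (v, Y t w'))); last first.
  have := bmeas_ex2 (distribution P (mfun_of mVt)) (distribution P (mfun_of mYt)) bF.
  have -> // : (fun x => \int[distribution P (mfun_of mYt)]_y F (x, y)) =
    (fun v => \int[P]_w' F (v, Y t w')).
  by apply/funext => x; rewrite (ex_distribution P mYt (bmeas_pair1 x bF)).
apply: eq_Rintegral => w _; apply: (same Y lY (fun y => F (incr V tt k w, y))).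
exact: bmeas_pair1.
Qed.

(** The identity, seen as a map into [Omega] with the sigma-algebra of the past, is a random
    variable independent of the next increment. So [F] may depend on the whole past, and no
    conditional expectation has to be introduced. *)
Lemma markov_step tt k (F : g_sigma_algebraType (past_gen tt k) * 'rV[R]_d -> R) :
  grid tt -> bmeas F ->
  \int[P]_w F (w, incr psum tt k w) =
  \int[P]_w \int[P]_w' F (w, psum (tt k.+1 - tt k) w').
Proof.
move=> gt bF.
have mid : @measurable_fun _ _ Omega (g_sigma_algebraType (past_gen tt k)) setT id.
  by move=> _ A mA; rewrite setTI; exact: (past_measurable gt mA).
have minc : measurable_fun setT (incr psum tt k).
  by apply: measurable_rVB; apply: measurable_psum; exact: grid_ge0.
rewrite (indep_ex mid minc _ bF); last first.
  move=> A B mA mB; apply: (@past_step_indep tt k A _ gt) => //.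
  have mV' : @measurable_fun _ _ (g_sigma_algebraType (step_gen tt k)) _ setT (incr V tt k).
    move=> _ C mC; rewrite setTI; apply: sub_sigma_algebra; exists C, setT.
    by split=> //; rewrite preimage_setT setIT.
  have mY' : @measurable_fun _ _ (g_sigma_algebraType (step_gen tt k)) _ setT (incr Y tt k).
    move=> _ C mC; rewrite setTI; apply: sub_sigma_algebra; exists setT, C.
    by split=> //; rewrite preimage_setT setTI.
  have := @measurable_rVD R d _ (g_sigma_algebraType (step_gen tt k)) _ _ mV' mY'.
  move=> /(_ measurableT B mB); rewrite setTI.
  rewrite (_ : (fun t => incr V tt k t + incr Y tt k t) = incr psum tt k)//.
  by apply: funext => w; rewrite /incr /psum opprD addrACA.
apply: eq_Rintegral => w _.
apply: (@psum_law _ (tt k) (fun y => F (w, y))) => //.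
- exact: (@bmeas_pair1 _ _ (g_sigma_algebraType (past_gen tt k)) _ _ F w bF).
- by rewrite addrC subrK.
- by rewrite subr_ge0; exact: gt.2.
Qed.

(** The sigma-algebra contains increments only, and the value at time 0 vanishes only almost surely;
    positions are therefore measured from [psum (tt 0%N)]. *)
Lemma past_meas_incr tt k i : grid tt -> (i <= k)%N ->
  @measurable_fun _ _ (g_sigma_algebraType (past_gen tt k)) _ setT
    (fun w => psum (tt i) w - psum (tt 0%N) w).
Proof.
move=> gt; elim: i => [_|i IH ik].
  by under eq_fun do rewrite subrr; exact: measurable_cst.
have mV' : @measurable_fun _ _ (g_sigma_algebraType (past_gen tt k)) _ setT (incr V tt i).
  move=> _ C mC; rewrite setTI; apply: sub_sigma_algebra.
  exists (fun j => if j == i then C else setT), (fun=> setT); split=> //.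
    by move=> j; case: ifP.
  apply/seteqP; split=> w /=.
    by move=> Cw j jk; split=> //; case: eqVneq => [->|].
  by move=> /(_ i ik)[]; rewrite eqxx.
have mY' : @measurable_fun _ _ (g_sigma_algebraType (past_gen tt k)) _ setT (incr Y tt i).
  move=> _ C mC; rewrite setTI; apply: sub_sigma_algebra.
  exists (fun=> setT), (fun j => if j == i then C else setT); split=> //.
    by move=> j; case: ifP.
  apply/seteqP; split=> w /=.
    by move=> Cw j jk; split=> //; case: eqVneq => [->|].
  by move=> /(_ i ik)[]; rewrite eqxx.
have := @measurable_rVD R d _ (g_sigma_algebraType (past_gen tt k)) _ _ (IH (ltnW ik))
  (@measurable_rVD R d _ (g_sigma_algebraType (past_gen tt k)) _ _ mV' mY').
congr (measurable_fun _ _); apply/funext => w; rewrite /incr /psum.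
by apply/rowP => j; rewrite !mxE; ring.
Qed.

End pair.
End markov.

(** * Inequalities for circular and hyperbolic functions *)

Section elementary.
Context {R : realType}.
Implicit Types u v x : R.

Lemma increment_le (f df : R -> R) (K u : R) :
  (forall x, is_derive x 1 f (df x)) -> 0 <= u ->
  (forall x, 0 <= x <= u -> df x <= K) -> f u - f 0 <= K * u.
Proof.
move=> fd u0 dK.
have cf : {within `[0, u], continuous f}.
  apply: continuous_subspaceT => x; apply/differentiable_continuous.
  by apply/derivable1_diffP; exact: ex_derive.
have [c cu ->] := @MVT_segment R f df 0 u u0 (fun x _ => fd x) cf.
rewrite subr0 ler_wpM2r//; apply: dK.
by move: cu; rewrite in_itv.
Qed.

Lemma cos_double x : cos (x *+ 2) = 1 - 2 * sin x ^+ 2.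
Proof. by rewrite cos_mulr2n cos2sin2; ring. Qed.

Lemma oneBcos u : 1 - cos u = 2 * sin (u / 2) ^+ 2.
Proof.
have {1}-> : u = (u / 2) *+ 2 by rewrite -mulr_natr divfK.
by rewrite cos_double; ring.
Qed.

Lemma sin_le u : 0 <= u -> sin u <= u.
Proof.
move=> u0; have := @increment_le sin cos 1 u _ u0.
rewrite sin0 subr0 mul1r; apply => x _; exact: cos_le1.
Qed.

Lemma normr_sin u : `|sin u| <= `|u|.
Proof.
wlog u0 : u / 0 <= u => [hw|].
  have [u0|u0] := leP 0 u; first exact: hw.
  by rewrite -normrN -sinN -[`|u|]normrN hw// oppr_ge0 ltW.
rewrite (ger0_norm u0) ler_norml sin_le// andbT.
have := @increment_le (fun x => - sin x) (fun x => - cos x) 1 u _ u0.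
rewrite sin0 oppr0 subr0 mul1r => H; rewrite lerNl; apply: H => x _.
by rewrite lerNl cos_geN1.
Qed.

Lemma oneBcos_le u : 1 - cos u <= u ^+ 2 / 2.
Proof.
rewrite oneBcos; have := normr_sin (u / 2).
rewrite -(ler_pXn2r (n := 2))// ?nnegrE// !real_normK ?num_real// => H.
rewrite expr_div_n in H; lra.
Qed.

Lemma oneBcos_ge0 u : 0 <= 1 - cos u. Proof. by rewrite subr_ge0 cos_le1. Qed.

Lemma oneBcos_le2 u : 1 - cos u <= 2.
Proof. by have := cos_geN1 u; lra. Qed.

Lemma subr_sin_le u : `|sin u - u| <= `|u| ^+ 3.
Proof.
wlog u0 : u / 0 <= u => [hw|].
  have [u0|u0] := leP 0 u; first exact: hw.
  have := hw (- u); rewrite oppr_ge0 ltW// sinN normrN => /(_ isT).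
  by rewrite -[X in X <= _]normrN; congr (`|_| <= _); ring.
rewrite (ger0_norm u0) ler0_norm ?subr_le0 ?sin_le// opprB.
have := @increment_le (fun x => x - sin x) (fun x => 1 - cos x) (u ^+ 2 / 2) u _ u0.
rewrite sin0 !subr0 => H; apply: le_trans (H _ _) _.
- move=> x /andP[x0 xu]; apply: le_trans (oneBcos_le x) _.
  by rewrite ler_pM2r// ler_pXn2r// nnegrE.
- by have := exprn_ge0 3 u0; rewrite (exprSr u 2); lra.
Qed.

Definition cosh x : R := (expR x + expR (- x)) / 2.
Definition sinh x : R := (expR x - expR (- x)) / 2.

Lemma is_derive_expRN x : is_derive x 1 (fun y : R => expR (- y)) (- expR (- x)).
Proof.
have -> : (fun y : R => expR (- y)) = expR \o -%R by [].
have := @is_derive1_comp R expR -%R x _ _ (is_derive_expR (- x)) (is_deriveNid x 1).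
by rewrite mulrN1.
Qed.

Lemma is_derive_half (f : R -> R) x (df : R) : is_derive x 1 f df ->
  is_derive x 1 (fun y => f y / 2) (df / 2).
Proof.
move=> fd; have := is_deriveZ (2^-1 : R) fd.
have -> : 2^-1 \*: f = (fun y => f y / 2) by apply/funext => y /=; rewrite mulrC.
by rewrite /GRing.scale /= mulrC.
Qed.

Lemma is_derive_sinh x : is_derive x 1 sinh (cosh x).
Proof.
have := is_derive_half (is_deriveB (is_derive_expR x) (is_derive_expRN x)).
by rewrite opprK.
Qed.

Lemma cosh_sqr x : cosh x ^+ 2 = 1 + sinh x ^+ 2.
Proof.
have := expRxMexpNx_1 x; rewrite /cosh /sinh => H.
by field: H.
Qed.

Lemma sinh0 : sinh 0 = 0. Proof. by rewrite /sinh oppr0 expR0 subrr mul0r. Qed.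

Lemma coshN x : cosh (- x) = cosh x.
Proof. by rewrite /cosh opprK addrC. Qed.

Lemma cosh_ge1 x : 1 <= cosh x.
Proof.
have p : 0 < cosh x by rewrite /cosh divr_gt0// addr_gt0 ?expR_gt0.
have p0 := ltW p.
by rewrite -(ler_pXn2r (n := 2)) ?nnegrE// expr1n cosh_sqr lerDl sqr_ge0.
Qed.

Lemma sinh_ge u : 0 <= u -> u <= sinh u.
Proof.
move=> u0.
have := @increment_le (fun x => - sinh x) (fun x => - cosh x) (-1) u _ u0.
rewrite sinh0 oppr0 subr0 mulN1r lerN2; apply.
  by move=> x; apply: is_deriveN; exact: is_derive_sinh.
by move=> x _; rewrite lerN2 cosh_ge1.
Qed.

Lemma sinh_ge0 u : 0 <= u -> 0 <= sinh u.
Proof. by move=> u0; exact: le_trans (sinh_ge u0). Qed.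

Lemma sinh_homo u v : u <= v -> sinh u <= sinh v.
Proof.
by move=> uv; rewrite /sinh ler_pM2r// lerB// ler_expR// lerN2.
Qed.

Lemma cosh_double x : cosh (x *+ 2) = 1 + 2 * sinh x ^+ 2.
Proof.
rewrite /cosh /sinh -mulNrn !mulr2n !expRD.
by have := expRxMexpNx_1 x; rewrite /cosh /sinh => H; field: H.
Qed.

Lemma coshB1 u : cosh u - 1 = 2 * sinh (u / 2) ^+ 2.
Proof.
have {1}-> : u = (u / 2) *+ 2 by rewrite -mulr_natr divfK.
by rewrite cosh_double; ring.
Qed.

Lemma oneBcos_le_cosh u : 1 - cos u <= cosh u - 1.
Proof.
wlog u0 : u / 0 <= u => [hw|].
  have [u0|u0] := leP 0 u; first exact: hw.
  by rewrite -cosN -coshN hw// oppr_ge0 ltW.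
rewrite oneBcos coshB1 ler_pM2l// -real_normK ?num_real// ler_pXn2r ?nnegrE//; last first.
  by rewrite sinh_ge0// divr_ge0.
apply: le_trans (normr_sin _) _; rewrite ger0_norm ?divr_ge0//.
by rewrite sinh_ge// divr_ge0.
Qed.

(** The left-hand side is of fourth order at 0, and so is the square on the right. The gain is that
    the Gaussian mean of the right-hand side is explicit, being a combination of exponential
    moments. *)
Lemma cosh_cos_le u : cosh u + cos u - 2 <= 4 * (cosh u - 1) ^+ 2.
Proof.
wlog u0 : u / 0 <= u => [hw|].
  have [u0|u0] := leP 0 u; first exact: hw.
  by rewrite -cosN -coshN hw// oppr_ge0 ltW.
pose v := u / 2; have v0 : 0 <= v by rewrite divr_ge0.
have sv0 : 0 <= sinh v by exact: le_trans (sinh_ge v0).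
have -> : cosh u + cos u - 2 = 2 * (sinh v - sin v) * (sinh v + sin v).
  have := coshB1 u; have := oneBcos u; rewrite -/v => h1 h2.
  rewrite (_ : _ - 2 = (cosh u - 1) - (1 - cos u)); last by ring.
  by rewrite h1 h2; ring.
rewrite coshB1 -/v.
have h1 : sinh v + sin v <= 2 * sinh v.
  by have := sin_le v0; have := sinh_ge v0; lra.
have h1' : 0 <= sinh v + sin v.
  have := normr_sin v; rewrite (ger0_norm v0) ler_norml => /andP[+ _].
  by have := sinh_ge v0; lra.
have h2 : sinh v - sin v <= 4 * sinh v ^+ 3.
  have := @increment_le (fun x => sinh x - sin x) (fun x => cosh x - cos x) (4 * sinh v ^+ 2) v _ v0.
  rewrite sin0 sinh0 !subr0 => H; apply: le_trans (H _ _) _.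
  - by move=> x; apply: is_deriveB; exact: is_derive_sinh.
  - move=> x /andP[x0 xv].
    have := oneBcos_le_cosh x; rewrite coshB1 => a.
    have b : sinh (x / 2) ^+ 2 <= sinh v ^+ 2.
      rewrite ler_pXn2r ?nnegrE//; last by rewrite sinh_ge0// divr_ge0.
      by apply: sinh_homo; lra.
    by have := coshB1 x; lra.
  - rewrite (exprSr _ 2) mulrA; apply: ler_wpM2l; last exact: sinh_ge.
    by rewrite mulr_ge0// sqr_ge0.
have h3 : (sinh v - sin v) * (sinh v + sin v) <= (4 * sinh v ^+ 3) * (2 * sinh v).
  by apply: ler_pM => //; have := sin_le v0; have := sinh_ge v0; lra.
have -> : 4 * (2 * sinh v ^+ 2) ^+ 2 = 2 * ((4 * sinh v ^+ 3) * (2 * sinh v)) by ring.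
by rewrite -mulrA ler_pM2l.
Qed.

Lemma expRB1_le x : 0 <= x <= 1 -> expR x - 1 <= 3 * x.
Proof.
move=> /andP[x0 x1]; have := expR_ge1Dx (- x / 2) => h.
have e : expR (- x / 2) * expR (x / 2) = 1 by rewrite -expRD mulNr addNr expR0.
have E : expR x = expR (x / 2) ^+ 2 by rewrite expr2 -expRD; congr expR; field.
have p : 0 < expR (x/2) by exact: expR_gt0.
have q : expR (x / 2) * (1 - x / 2) <= 1.
  by rewrite -[leRHS]e mulrC; apply: ler_wpM2r; [exact: ltW|lra].
rewrite E.
have E1 : expR (x / 2) <= 1 + x.
  have h2 : 0 < 1 - x / 2 by lra.
  by rewrite -(ler_pM2r h2) (le_trans q)//; nra.
nra.
Qed.

End elementary.

(** * Gaussian characteristic functions *)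

Section density.
Context d (T : measurableType d) (R : realType).
Variables (nu : {finite_measure set T -> \bar R})
  (mu : {sigma_finite_measure set T -> \bar R}) (p : T -> R).
Hypotheses (p_ge0 : forall x, 0 <= p x) (mp : measurable_fun setT p)
  (nuE : forall A, measurable A -> nu A = (\int[mu]_(x in A) (p x)%:E)%E)
  (numu : nu `<< mu).

(** The Radon-Nikodym derivative of [nu] has the same integrals as [p] over measurable sets, hence
    equals [p] almost everywhere. *)
Lemma ge0_integral_density (f : T -> \bar R) :
  (forall x, 0 <= f x)%E -> measurable_fun setT f ->
  (\int[nu]_x f x = \int[mu]_x (f x * (p x)%:E))%E.
Proof.
move=> f0 mf.
rewrite -(Radon_Nikodym_SigmaFinite.change_of_variables numu f0 measurableT mf).
have irn := Radon_Nikodym_SigmaFinite.f_integrable numu.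
have mrn := measurable_int _ irn.
apply: ae_eq_integral => //.
- exact: emeasurable_funM.
- by apply: emeasurable_funM => //; exact/measurable_EFinP.
have : ae_eq mu setT (Radon_Nikodym_SigmaFinite.f nu mu) (EFin \o p).
  apply: integral_ae_eq => //; first exact/measurable_EFinP.
  move=> E _ mE; rewrite -Radon_Nikodym_SigmaFinite.f_integral//.
  exact: nuE.
by apply: filterS => x H _; rewrite H.
Qed.

End density.

Section gaussian.
Context {R : realType}.
Variable s : R.
Hypothesis s0 : 0 < s.
Local Notation N := (normal_prob 0 s).
Local Notation mu := (@lebesgue_measure R).

Let sN0 : s != 0. Proof. by rewrite gt_eqF. Qed.

Lemma ge0_integral_normal (m : R) (f : R -> \bar R) :
  (forall x, 0 <= f x)%E -> measurable_fun setT f ->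
  (\int[normal_prob m s]_x f x = \int[mu]_x (f x * (normal_pdf m s x)%:E))%E.
Proof.
move=> f0 mf; apply: ge0_integral_density => //.
- exact: measurable_normal_pdf.
- exact: normal_prob_dominates.
Qed.

Lemma normal_mgf (l : R) :
  (\int[N]_x (expR (l * x))%:E = (expR (l ^+ 2 * s ^+ 2 / 2))%:E)%E.
Proof.
have me : measurable_fun setT (fun x : R => expR (l * x)).
  by apply: measurableT_comp => //; exact: measurable_funM.
rewrite ge0_integral_normal//; last exact/measurable_EFinP.
under eq_integral => x _.
  rewrite (_ : _ * _ = (expR (l ^+ 2 * s ^+ 2 / 2))%:E * (normal_pdf (l * s ^+ 2) s x)%:E)%E.
    over.
  rewrite -!EFinM; congr EFin.
  rewrite /normal_pdf (negbTE sN0) /normal_fun mulrCA -expRD mulrCA -expRD.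
  by congr (_ * expR _); field.
rewrite ge0_integralZl//.
- by rewrite integral_normal_pdf mule1.
- by apply/measurable_EFinP; exact: measurable_normal_pdf.
- by move=> x _; rewrite lee_fin normal_pdf_ge0.
Qed.

Lemma measurable_cosh : measurable_fun setT (@cosh R).
Proof.
apply: measurable_funM => //; apply: measurable_funD; first exact: measurable_expR.
by apply: measurableT_comp => //; exact: measurable_expR.
Qed.

Lemma integral_normal_cosh (l : R) :
  (\int[N]_x (cosh (l * x))%:E = (expR (l ^+ 2 * s ^+ 2 / 2))%:E)%E.
Proof.
have me (k : R) : measurable_fun setT (fun x : R => expR (k * x)).
  by apply: measurableT_comp => //; exact: measurable_funM.
under eq_integral => x _.
  rewrite /cosh -mulNr mulrC EFinM EFinD; over.
rewrite ge0_integralZl//; [|by apply: emeasurable_funD; apply/measurable_EFinP; exact: me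
  |by move=> x _; rewrite -EFinD lee_fin addr_ge0// expR_ge0].
rewrite ge0_integralD//; [|apply/measurable_EFinP; exact: me|apply/measurable_EFinP; exact: me].
by rewrite !normal_mgf sqrrN -EFinD -EFinM; congr EFin; field.
Qed.

Lemma integrable_normal_cosh (l : R) : N.-integrable setT (fun x => (cosh (l * x))%:E).
Proof.
apply/integrableP; split.
  apply/measurable_EFinP; apply: (measurableT_comp measurable_cosh).
  exact: measurable_funM.
under eq_integral => x _ do rewrite abse_EFin ger0_norm ?(le_trans ler01 (cosh_ge1 _))//.
by rewrite integral_normal_cosh ltry.
Qed.

Lemma Rintegral_normal_cosh (l : R) :
  \int[N]_x cosh (l * x) = expR (l ^+ 2 * s ^+ 2 / 2).
Proof. by rewrite /Rintegral integral_normal_cosh. Qed.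

Lemma bmeas_cosM d (T : measurableType d) (h : T -> R) :
  measurable_fun setT h -> bmeas (fun x => cos (h x)).
Proof.
move=> mh; split; last by exists 1 => x; exact: cos_max.
by apply: measurableT_comp mh; apply: continuous_measurable_fun; exact: continuous_cos.
Qed.

Lemma bmeas_sinM d (T : measurableType d) (h : T -> R) :
  measurable_fun setT h -> bmeas (fun x => sin (h x)).
Proof.
move=> mh; split; last by exists 1 => x; exact: sin_max.
by apply: measurableT_comp mh; apply: continuous_measurable_fun; exact: continuous_sin.
Qed.

(** The characteristic function of the centred Gaussian law. Its closed form is replaced by
    two-sided bounds through the moment generating function, which are sharp to first order in the
    variance. *)
Definition gcos (l : R) : R := \int[N]_x cos (l * x).

Let bcos l : @bmeas _ (measurableTypeR R) R (fun x => cos (l * x)).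
Proof. by apply: bmeas_cosM; exact: measurable_funM. Qed.

Let bsin l : @bmeas _ (measurableTypeR R) R (fun x => sin (l * x)).
Proof. by apply: bmeas_sinM; exact: measurable_funM. Qed.

Lemma gcos_le1 l : `|gcos l| <= 1.
Proof. by apply: ex_norm_le (bcos l) _ => x; exact: cos_max. Qed.

Lemma oneBgcos l : 1 - gcos l = \int[N]_x (1 - cos (l * x)).
Proof. by rewrite (exB N (bmeas_cst 1) (bcos l)) ex_cst. Qed.

Lemma gcos_lower l : 1 - gcos l <= expR (l ^+ 2 * s ^+ 2 / 2) - 1.
Proof.
rewrite oneBgcos -Rintegral_normal_cosh -[X in _ <= _ - X](ex_cst N).
rewrite -RintegralB//; last 2 first.
- exact: integrable_normal_cosh.
- by apply: bmeas_integrable; exact: bmeas_cst.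
apply: le_Rintegral => //.
- exact: (bmeas_integrable N (bmeasB (bmeas_cst 1) (bcos l))).
- apply: rintegrableB => //; first exact: integrable_normal_cosh.
  exact: (bmeas_integrable N (bmeas_cst 1)).
- by move=> x _; exact: oneBcos_le_cosh.
Qed.

Lemma gcos_bound l : 1 - gcos l <= 3 * (l ^+ 2 * s ^+ 2 / 2).
Proof.
have p : 0 <= l ^+ 2 * s ^+ 2 / 2 by rewrite divr_ge0// mulr_ge0// sqr_ge0.
have [q|q] := leP (l ^+ 2 * s ^+ 2 / 2) 1.
  by apply: le_trans (gcos_lower l) _; apply: expRB1_le; rewrite p q.
have := gcos_le1 l; rewrite ler_norml => /andP[h _]; lra.
Qed.

(** Integrate [cosh_cos_le], after writing the square of [cosh - 1] as a combination of
    [cosh (2 * l * x)], [cosh (l * x)] and a constant. The bound is [o(a)] as [a] tends to 0, since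
    the first-order terms of the two exponentials cancel. *)
Lemma gcos_upper l a : a = l ^+ 2 * s ^+ 2 / 2 ->
  expR a - 1 - (1 - gcos l) <= 4 * (expR (4 * a) / 2 - 2 * expR a + 3 / 2).
Proof.
move=> aE.
have iE (f : measurableTypeR R -> R) : bmeas f -> N.-integrable setT (EFin \o f) by exact: bmeas_integrable.
have i1 : N.-integrable setT (EFin \o (fun=> 1 : R)) by apply: iE; exact: bmeas_cst.
have ic k := integrable_normal_cosh k.
have iF : N.-integrable setT (EFin \o (fun x => cosh (l * x) - 1)).
  exact: rintegrableB (ic l) i1.
have icos : N.-integrable setT (EFin \o (fun x => 1 - cos (l * x))).
  by apply: iE; exact: (bmeasB (bmeas_cst 1) (bcos l)).
have EF : \int[N]_x (cosh (l * x) - 1) = expR a - 1.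
  rewrite (RintegralB measurableT (ic l) i1).
  by rewrite Rintegral_normal_cosh ex_cst -aE.
rewrite -EF oneBgcos -(RintegralB measurableT iF icos).
have sq x : (cosh (l * x) - 1) ^+ 2 = 2^-1 * cosh (2 * l * x) - 2 * (cosh (l * x) - 1) - 2^-1.
  have := cosh_double (l * x); have := cosh_sqr (l * x).
  have -> : l * x *+ 2 = 2 * l * x by rewrite -mulr_natr; ring.
  by move=> h1 ->; rewrite sqrrB h1; rewrite expr1n; move: h1; lra.
have i2 : N.-integrable setT (EFin \o (fun x => 2^-1 * cosh (2 * l * x))).
  exact: rintegrableZ (ic (2 * l)).
have i3 : N.-integrable setT (EFin \o (fun x => 2 * (cosh (l * x) - 1))).
  exact: rintegrableZ iF.
have i23 : N.-integrable setT (EFin \o (fun x => 2^-1 * cosh (2 * l * x) - 2 * (cosh (l * x) - 1))).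
  exact: rintegrableB i2 i3.
have ih : N.-integrable setT (EFin \o (fun=> 2^-1 : R)) by apply: iE; exact: bmeas_cst.
have i4 : N.-integrable setT (EFin \o (fun x => (cosh (l * x) - 1) ^+ 2)).
  under [X in _.-integrable _ (EFin \o X)]eq_fun do rewrite sq.
  exact: rintegrableB i23 ih.
apply: (@le_trans _ _ (\int[N]_x (4 * (cosh (l * x) - 1) ^+ 2))).
  apply: le_Rintegral => //.
  - exact: rintegrableB iF icos.
  - exact: rintegrableZ i4.
  - by move=> x _; apply: le_trans (cosh_cos_le _); lra.
rewrite RintegralZl// ler_pM2l//.
under eq_Rintegral do rewrite sq.
rewrite (RintegralB measurableT i23 ih) (RintegralB measurableT i2 i3) ex_cst.
rewrite (RintegralZl _ measurableT (ic (2 * l))) (RintegralZl _ measurableT iF) EF.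
rewrite Rintegral_normal_cosh.
have -> : (2 * l) ^+ 2 * s ^+ 2 / 2 = 4 * a by rewrite aE; field.
lra.
Qed.

Lemma gsin0 l : \int[N]_x sin (l * x) = 0.
Proof.
have refl (f : measurableTypeR R -> R) : bmeas f -> (forall x, 0 <= f x) ->
    \int[N]_x f x = \int[N]_x f (- (x : R)).
  move=> bf f0; rewrite /Rintegral; congr fine.
  have mN : measurable_fun setT (-%R : R -> R) by exact: oppr_measurable.
  have mf := bf.1; have mfN : measurable_fun [set: measurableTypeR R] (fun x : R => f (- x)).
    by apply: (measurableT_comp mf); exact: mN.
  rewrite ge0_integral_normal//; [|by exact/measurable_EFinP].
  rewrite ge0_integral_normal//; [|by move=> x; rewrite lee_fin|by exact/measurable_EFinP].
  have mp : measurable_fun setT (fun x => ((f x)%:E * (normal_pdf 0 s x)%:E)%E).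
    apply: emeasurable_funM; apply/measurable_EFinP => //.
    exact: measurable_normal_pdf.
  transitivity (\int[pushforward mu (-%R : R -> measurableTypeR R)]_x
      ((f x)%:E * (normal_pdf 0 s x)%:E))%E.
    by apply: eq_measure_integral => A mA _; exact/esym/lebesgue_measureN.
  have mN2 : measurable_fun setT (-%R : measurableTypeR R -> measurableTypeR R) by exact: mN.
  rewrite (ge0_integral_pushforward mN2 mu measurableT mp); last first.
    by move=> x _; rewrite mule_ge0// lee_fin// normal_pdf_ge0.
  rewrite preimage_setT; apply: eq_integral => x _ /=; congr (_ * _)%E.
  by rewrite /normal_pdf (negbTE sN0) /normal_fun !subr0 sqrrN.
(* The reflection [refl] is available for nonnegative functions, hence the shift of the sine by
   1. *)
have b1 := bmeasD (bmeas_cst 1) (bsin l).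
have E : \int[N]_x (1 + sin (l * - (x : R))) = 1 - \int[N]_x sin (l * x).
  rewrite -[X in X - _](ex_cst N) -(exB N (bmeas_cst 1) (bsin l)).
  by apply: eq_Rintegral => x _; rewrite mulrN sinN.
have := refl _ b1; rewrite (exD N (bmeas_cst 1) (bsin l)) ex_cst E => H.
have : 1 + \int[N]_x sin (l * x) = 1 - \int[N]_x sin (l * x).
  by apply: H => x; have := sin_geN1 (l * x); lra.
lra.
Qed.

End gaussian.

Section gaussian_vector.
Context {R : realType} {n : nat} d {T : measurableType d} (P : probability T R).
Variables (Z : T -> 'rV[R]_n) (s : R).
Hypotheses (s0 : 0 < s) (mZ : measurable_fun setT Z)
  (ZE : forall A : 'I_n -> set R, (forall i, measurable (A i)) ->
    P [set w | forall i, A i (Z w 0 i)] = (\prod_(i < n) normal_prob 0 s (A i))%E).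

Let mZi i : measurable_fun setT (fun w => Z w 0 i).
Proof. exact: measurable_fun_coord. Qed.

Lemma gaussian_coord_prob i (B : set R) : measurable B ->
  P [set w | B (Z w 0 i)] = normal_prob 0 s B.
Proof.
move=> mB; pose A k := if k == i then B else setT.
have mA k : measurable (A k) by rewrite /A; case: ifP.
have := ZE mA; rewrite (bigD1 i)//= big1 => [|k ki].
  rewrite mule1 {2}/A eqxx => <-; congr (P _); apply/seteqP; split=> w /=.
    by move=> Bw k; rewrite /A; case: eqP => // ->.
  by move=> /(_ i); rewrite /A eqxx.
by rewrite /A (negbTE ki); exact: (@probability_setT _ _ _ (normal_prob 0 s)).
Qed.

Lemma gaussian_coord_ex i (f : R -> R) : @bmeas _ (measurableTypeR R) R f ->
  \int[P]_w f (Z w 0 i) = \int[normal_prob 0 s]_x f x.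
Proof.
move=> bf.
rewrite -(@ex_distribution R _ _ P _ (measurableTypeR R) _ (mZi i) f bf).
congr fine; apply: eq_measure_integral => A mA _.
exact: gaussian_coord_prob.
Qed.

(** [S] stands for the partial sum of the first [m] terms of a scalar product; only its
    measurability with respect to the first [m] coordinates is needed. *)
Lemma gaussian_indep (m : nat) (mn : (m < n)%N) (S : T -> R) :
  @measurable_fun _ _ (g_sigma_algebraType [set H | exists A : 'I_n -> set R,
    (forall i, measurable (A i)) /\
    H = [set w | forall i : 'I_n, (i < m)%N -> A i (Z w 0 i)]]) (measurableTypeR R) setT S ->
  forall A B : set (measurableTypeR R), measurable A -> measurable B ->
  P (S @^-1` A `&` (fun w => Z w 0 (Ordinal mn)) @^-1` B) =
  (P (S @^-1` A) * P ((fun w => Z w 0%R (Ordinal mn)) @^-1` B))%E.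
Proof.
set G1 := (X in g_sigma_algebraType X); set im := Ordinal mn.
pose G2 : set (set T) := [set H | exists B : set R, measurable B /\
  H = [set w | B (Z w 0 im)]].
move=> mS A B mA mB.
have mrect (C : 'I_n -> set R) : (forall i, measurable (C i)) ->
    measurable [set w | forall i, C i (Z w 0 i)].
  move=> mC; rewrite -[X in measurable X]setTI.
  exact: (mZ measurableT (measurable_rect mC)).
have E1 (C : 'I_n -> set R) : [set w | forall i : 'I_n, (i < m)%N -> C i (Z w 0 i)] =
    [set w | forall i : 'I_n, (if (i < m)%N then C i else [set: R]) (Z w 0 i)].
  apply/seteqP; split=> w Cw i; first by case: ifP => // /Cw.
  by move=> im'; have := Cw i; rewrite im'.
apply: (@indep_sigma _ _ _ P G1 G2).
- by move=> _ [C [mC ->]]; rewrite E1;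
    apply: (mrect (fun i : 'I_n => if (i < m)%N then C i else [set: R])) => i; case: ifP.
- move=> _ [C [mC ->]]; rewrite -[X in measurable X]setTI.
  exact: (mZi im measurableT mC).
- move=> _ _ [C [mC ->]] [D [mD ->]]; exists (fun i => C i `&` D i); split.
    by move=> i; exact: measurableI.
  apply/seteqP; split=> w /= => [[Cw Dw] i im'|CDw]; first by split; [exact: Cw|exact: Dw].
  by split=> i im'; have [] := CDw i im'.
- move=> _ _ [C [mC ->]] [D [mD ->]]; exists (C `&` D); split => //.
  exact: measurableI.
- by exists (fun=> setT); split => //; apply/seteqP; split.
- by exists setT; split.
- move=> _ _ [C [mC ->]] [D [mD ->]].
  rewrite E1.
  pose C' (i : 'I_n) := if (i < m)%N then C i else [set: R].
  have mC' i : measurable (C' i) by rewrite /C'; case: ifP.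
  pose F i := if i == im then D else C' i.
  have mF i : measurable (F i) by rewrite /F; case: ifP.
  have := ZE mF; have := ZE mC'.
  rewrite (bigD1 im)//= => e1; rewrite (bigD1 im)//= => e2.
  transitivity (P [set w | forall i, F i (Z w 0 i)]).
    congr (P _); apply/seteqP; split=> w /=.
      by move=> [Cw Dw] i; rewrite /F; case: eqP => [->//|_]; exact: Cw.
    move=> Fw; split; last by have := Fw im; rewrite /F eqxx.
    move=> i; have := Fw i; rewrite /F; case: eqP => [->|_]//.
    by rewrite /im /= ltnn.
  rewrite e2 e1 gaussian_coord_prob// {1}/F eqxx.
  have -> : normal_prob 0 s (C' im) = 1%E.
    by rewrite /C' /im /= ltnn; exact: (@probability_setT _ _ _ (normal_prob 0 s)).
  rewrite mul1e muleC; congr (_ * _)%E; apply: eq_bigr => i ii.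
  by rewrite /F (negbTE ii).
- by have := mS measurableT A mA; rewrite setTI.
- by apply: sub_sigma_algebra; exists B.
Qed.

(** Induction on the number of coordinates in the scalar product. The new coordinate is independent
    of the partial sum, and its mean sine vanishes, so the addition formulas multiply both parts by
    one factor [gcos]. *)
Lemma gaussian_char (z : 'rV[R]_n) :
  \int[P]_w cos (dotv z (Z w)) = \prod_(i < n) gcos s (z 0 i) /\
  \int[P]_w sin (dotv z (Z w)) = 0.
Proof.
pose S m w := \sum_(i < n | (i < m)%N) z 0 i * Z w 0 i.
have key m : (m <= n)%N -> \int[P]_w cos (S m w) = \prod_(i < n | (i < m)%N) gcos s (z 0 i) /\
    \int[P]_w sin (S m w) = 0.
  elim: m => [_|m IH mn].
    rewrite big_pred0//; split.
      under eq_Rintegral do rewrite /S big_pred0// cos0.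
      exact: ex_cst.
    under eq_Rintegral do rewrite /S big_pred0// sin0.
    exact: ex_cst.
  have [IHc IHs] := IH (ltnW mn); set im := Ordinal mn.
  have split_pred (i : 'I_n) : (i < m.+1)%N && (i != im) = (i < m)%N.
    by rewrite ltnS leq_eqVlt -val_eqE /=; case: eqVneq => [->|]; rewrite ?ltnn//= andbT.
  have SE w : S m.+1 w = S m w + z 0 im * Z w 0 im.
    rewrite /S (bigD1 im)/= ?ltnS// addrC; congr (_ + _).
    by apply: eq_bigl => i; rewrite split_pred.
  pose G1 : set (set T) := [set H | exists A : 'I_n -> set R,
    (forall i, measurable (A i)) /\
    H = [set w | forall i : 'I_n, (i < m)%N -> A i (Z w 0 i)]].
  have mS' : @measurable_fun _ _ (g_sigma_algebraType G1) (measurableTypeR R) setT (S m).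
    rewrite /S; under eq_fun do rewrite big_mkcond /=.
    apply: (@measurable_sum _ (g_sigma_algebraType G1) R setT _ (index_enum 'I_n)
      (fun i w => if (i < m)%N then z 0 i * Z w 0 i else 0)) => i.
    case: (boolP (i < m)%N) => im'; last exact: measurable_cst.
    apply: measurable_funM => // _ B mB; rewrite setTI; apply: sub_sigma_algebra.
    exists (fun k => if k == i then B else setT); split.
      by move=> k; case: ifP.
    apply/seteqP; split=> w /=; first by move=> Bw k km; case: eqP => // ->.
    by move=> /(_ i im'); rewrite eqxx.
  have mSm : @measurable_fun _ _ T (measurableTypeR R) setT (S m).
    rewrite /S; under eq_fun do rewrite big_mkcond /=.
    apply: (@measurable_sum _ T R setT _ (index_enum 'I_n)
      (fun i w => if (i < m)%N then z 0 i * Z w 0 i else 0)) => i.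
    case: (boolP (i < m)%N) => im'; last exact: measurable_cst.
    exact: measurable_funM.
  have ind := gaussian_indep mn mS'.
  have ex2 (F : R * R -> R) : @bmeas _ (measurableTypeR R * measurableTypeR R)%type R F ->
      \int[P]_w F (S m w, Z w 0 im) = \int[P]_w \int[P]_w' F (S m w, Z w' 0 im).
    move=> bF.
    exact: (@indep_ex R _ T P _ _ (measurableTypeR R) (measurableTypeR R) _ _ F mSm (mZi im) ind bF).
  pose c := gcos s (z 0 im).
  have bc (k : R) : @bmeas _ (measurableTypeR R) R (fun x => cos (k * x)).
    by apply: bmeas_cosM; exact: measurable_funM.
  have bs (k : R) : @bmeas _ (measurableTypeR R) R (fun x => sin (k * x)).
    by apply: bmeas_sinM; exact: measurable_funM.
  have cE : \int[P]_w cos (z 0 im * Z w 0 im) = c by exact: (gaussian_coord_ex im (bc _)).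
  have sE : \int[P]_w sin (z 0 im * Z w 0 im) = 0.
    by rewrite (gaussian_coord_ex im (bs (z 0 im))) gsin0.
  have bcZ : bmeas (fun w => cos (z 0 im * Z w 0 im)) by apply: bmeas_cosM; exact: measurable_funM.
  have bsZ : bmeas (fun w => sin (z 0 im * Z w 0 im)) by apply: bmeas_sinM; exact: measurable_funM.
  have bcS : bmeas (fun w => cos (S m w)) by exact: bmeas_cosM.
  have bsS : bmeas (fun w => sin (S m w)) by exact: bmeas_sinM.
  have mF : @measurable_fun _ _ (measurableTypeR R * measurableTypeR R)%type (measurableTypeR R) setT
     (fun p : R * R => p.1 + z 0 im * p.2).
    by apply: measurable_funD => //; exact: measurable_funM.
  split.
    transitivity (\int[P]_w cos (S m w + z 0 im * Z w 0 im)).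
      by apply: eq_Rintegral => w _; rewrite SE.
    rewrite (ex2 (fun p => cos (p.1 + z 0 im * p.2))); last exact: bmeas_cosM.
    transitivity (\int[P]_w (c * cos (S m w))).
      apply: eq_Rintegral => w _ /=.
      transitivity (\int[P]_w' (cos (S m w) * cos (z 0 im * Z w' 0 im) -
                                sin (S m w) * sin (z 0 im * Z w' 0 im))).
        by apply: eq_Rintegral => w' _; rewrite cosD.
      rewrite exB; [|exact: bmeasZ|exact: bmeasZ].
      by rewrite exZ// exZ// cE sE mulr0 subr0 mulrC.
    rewrite exZ// IHc [RHS](bigD1 im)/= ?ltnS//; congr (_ * _).
    by apply: eq_bigl => i; rewrite split_pred.
  transitivity (\int[P]_w sin (S m w + z 0 im * Z w 0 im)).
    by apply: eq_Rintegral => w _; rewrite SE.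
  rewrite (ex2 (fun p => sin (p.1 + z 0 im * p.2))); last exact: bmeas_sinM.
  transitivity (\int[P]_w (c * sin (S m w))).
    apply: eq_Rintegral => w _ /=.
    transitivity (\int[P]_w' (sin (S m w) * cos (z 0 im * Z w' 0 im) +
                              cos (S m w) * sin (z 0 im * Z w' 0 im))).
      by apply: eq_Rintegral => w' _; rewrite sinD.
    rewrite exD; [|exact: bmeasZ|exact: bmeasZ].
    by rewrite exZ// exZ// cE sE mulr0 addr0 mulrC.
  by rewrite exZ// IHs mulr0.
have [kc ks] := key n (leqnn n).
have SnE w : S n w = dotv z (Z w) by apply: eq_bigl => i; rewrite ltn_ord.
split.
  under eq_Rintegral do rewrite -SnE; rewrite kc.
  by apply: eq_bigl => i; rewrite ltn_ord.
by under eq_Rintegral do rewrite -SnE.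
Qed.

End gaussian_vector.

(** * Characteristic functions and their slopes at time zero *)

Section characteristic.
Context {R : realType} {d : nat} {dO : measure_display}
  {Omega : measurableType dO} (P : probability Omega R).
Implicit Types (Z W V Y : R -> Omega -> 'rV[R]_d).

Lemma levy_process_like Z : levy_process P Z -> levy_like P Z.
Proof. by case=> mZ _ _ iZ sZ; split. Qed.

Lemma levy_like_double Z : levy_like P Z -> levy_like P (fun t => Z (2 * t)).
Proof.
move=> [mZ iZ sZ]; split.
- by move=> t t0; apply: mZ; rewrite mulr_ge0.
- move=> n tt t0 tS; apply: (iZ n (fun k => 2 * tt k)); first by rewrite mulr_ge0.
  by move=> k kn; rewrite ler_pM2l// tS.
- by move=> s t A s0 t0 mA; rewrite mulrDr sZ// mulr_ge0.
Qed.

Lemma measurable_dotv (z : 'rV[R]_d) dT (T : measurableType dT) (f : T -> 'rV[R]_d) :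
  measurable_fun setT f -> measurable_fun setT (fun t => dotv z (f t)).
Proof.
move=> mf; apply: (@measurable_sum _ T R setT _ (index_enum 'I_d)
  (fun i t => z 0 i * f t 0 i)) => i.
by apply: measurable_funM => //; exact: measurable_fun_coord.
Qed.

Lemma dotvDr (z x y : 'rV[R]_d) : dotv z (x + y) = dotv z x + dotv z y.
Proof. by rewrite -big_split; apply: eq_bigr => i _; rewrite mxE mulrDr. Qed.

Definition ccos Z t z := \int[P]_w cos (dotv z (Z t w)).
Definition csin Z t z := \int[P]_w sin (dotv z (Z t w)).

Lemma exponent_char Y Psi t z : has_exponent P Y Psi -> 0 <= t ->
  ccos Y t z = expR (- (t * complex.Re (Psi z))) * cos (t * complex.Im (Psi z)) /\
  csin Y t z = - (expR (- (t * complex.Re (Psi z))) * sin (t * complex.Im (Psi z))).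
Proof.
move=> eY t0; have := eY t z t0; case: (Psi z) => a b.
rewrite /ccos /csin /cintegral /cexp /expi /= => -[] -> ->.
by rewrite !mul0r !subr0 !addr0 cosN sinN; split; ring.
Qed.

Section brownian.
Variables (W : R -> Omega -> 'rV[R]_d).
Hypothesis (W_brownian : standard_brownian P W).
Local Notation V := (fun t => W (2 * t)).

Lemma brownian_char t z : 0 < t ->
  ccos V t z = \prod_(i < d) gcos (Num.sqrt (2 * t)) (z 0 i) /\ csin V t z = 0.
Proof.
move=> t0; have t20 : 0 < 2 * t by rewrite mulr_gt0.
case: W_brownian => lW _ gW.
apply: gaussian_char; first by rewrite sqrtr_gt0.
  by case: lW => + _ _ _ _; apply; exact: ltW.
by move=> A mA; exact: gW.
Qed.

Let sq (t : R) : 0 < t -> Num.sqrt (2 * t) ^+ 2 = 2 * t.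
Proof. by move=> t0; rewrite sqr_sqrtr// mulr_ge0// ltW. Qed.

Lemma prod_oneB (I : Type) (r : seq I) (F : I -> R) : (forall i, `|F i| <= 1) ->
  1 - \prod_(i <- r) F i <= \sum_(i <- r) (1 - F i) /\ `|\prod_(i <- r) F i| <= 1.
Proof.
move=> F1; elim: r => [|i r [IH1 IH2]]; first by rewrite !big_nil subrr normr1.
rewrite !big_cons; split; last by rewrite normrM mulr_ile1.
have := F1 i; move: IH1 IH2; set p := \prod_(_ <- _) _; set s := \sum_(_ <- _) _.
rewrite !ler_norml => h1 /andP[h2 h3] /andP[h4 h5].
have : 0 <= (1 - F i) * (1 - p) by rewrite mulr_ge0// subr_ge0.
lra.
Qed.

Lemma brownian_char_bound t z : 0 < t -> 0 <= 1 - ccos V t z <= 3 * t * dotv z z.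
Proof.
move=> t0; have [-> _] := brownian_char z t0.
have [h1 h2] := @prod_oneB 'I_d (index_enum _) (fun i => gcos (Num.sqrt (2 * t)) (z 0 i))
  (fun i => gcos_le1 _ _).
apply/andP; split; first by rewrite subr_ge0 (le_trans (ler_norm _)).
apply: le_trans h1 _; rewrite /dotv mulr_sumr; apply: ler_sum => i _.
have s0 : 0 < Num.sqrt (2 * t) by rewrite sqrtr_gt0 mulr_gt0.
apply: le_trans (gcos_bound s0 _) _; rewrite sq//.
by rewrite expr2; lra.
Qed.

Lemma expR_slope (c : R) : (expR (c * t) - 1) / t @[t --> 0^'+] --> c.
Proof.
have dE : is_derive (0 : R) 1 (fun t : R => expR (c * t)) c.
  have -> : (fun t : R => expR (c * t)) = expR \o (fun t => c * t) by [].
  have dM : is_derive (0 : R) 1 (fun t : R => c * t) c.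
    have := is_deriveZ c (is_derive_id (0 : R) 1).
    by rewrite /GRing.scale /= mulr1.
  have := @is_derive1_comp R expR (fun t => c * t) 0 _ _ (is_derive_expR (c * 0)) dM.
  by rewrite mulr0 expR0 mul1r.
have [dv ve] := dE; move: dv; rewrite /derivable => /cvg_ex[l hl].
have lc : l = c by rewrite -ve; apply/esym/cvg_lim.
move: hl; rewrite lc => hl.
have hr : (fun t => (expR (c * t) - 1) / t) @ 0^'+ --> c.
  have -> : (fun t => (expR (c * t) - 1) / t) =
     (fun h : R => h^-1 *: (expR (c * (h *: 1 + 0)) - expR (c * 0))).
    apply/funext => h; rewrite mulr0 expR0 addr0 /GRing.scale /= mulr1.
    by rewrite mulrC.
  apply: cvg_trans hl; apply: cvg_app => A.
  apply: (@filterS _ (nbhs (0 : R)) _ (fun y => y != 0 -> A y)) => y H y0.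
  by apply: H; rewrite gt_eqF.
exact: hr.
Qed.

Lemma cvg_id_at_right : t @[t --> (0 : R)^'+] --> (0 : R).
Proof. by apply: cvg_at_right_filter; exact: cvg_id. Qed.

(** With [a t = c ^+ 2 * t], the bounds [gcos_lower] and [gcos_upper] squeeze the quotient between
    two difference quotients of exponentials, both with slope [c ^+ 2] at 0. *)
Lemma gcos_slope (c : R) : (1 - gcos (Num.sqrt (2 * t)) c) / t @[t --> 0^'+] --> c ^+ 2.
Proof.
pose a (t : R) := c ^+ 2 * t.
have aE t : 0 < t -> a t = c ^+ 2 * Num.sqrt (2 * t) ^+ 2 / 2.
  by move=> t0; rewrite sq// /a; field.
pose U (t : R) := (expR (c ^+ 2 * t) - 1) / t.
pose Lo (t : R) := U t - 4 * ((expR (4 * c ^+ 2 * t) - 1) / t / 2 - 2 * U t).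
have cU : U t @[t --> 0^'+] --> c ^+ 2 by exact: expR_slope.
have cL : Lo t @[t --> 0^'+] --> c ^+ 2.
  have -> : c ^+ 2 = c ^+ 2 - 4 * ((4 * c ^+ 2) / 2 - 2 * c ^+ 2) by field.
  apply: cvgB => //; apply: cvgMr; apply: cvgB; last exact: cvgMr.
  by apply: cvgMl; exact: expR_slope.
apply: (@squeeze_cvgr _ _ _ _ Lo U) => //.
near=> t.
have t0 : 0 < t by near: t; exact: nbhs_right_gt.
have s0 : 0 < Num.sqrt (2 * t) by rewrite sqrtr_gt0 mulr_gt0.
have ti : 0 < t^-1 by rewrite invr_gt0.
apply/andP; split; last first.
  rewrite /U ler_pM2r//; apply: le_trans (gcos_lower s0 c) _.
  by rewrite -aE.
have := gcos_upper s0 (aE t t0); rewrite -(ler_pM2r ti) => H.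
rewrite /Lo /U -/(a t) (_ : 4 * c ^+ 2 * t = 4 * a t); last by rewrite /a; ring.
move: H; set e1 := expR _; set e2 := expR _; set g := gcos _ _; set v := t^-1; lra.
Unshelve. all: by end_near. Qed.

Lemma brownian_char_slope z : (1 - ccos V t z) / t @[t --> 0^'+] --> dotv z z.
Proof.
pose F i (t : R) := gcos (Num.sqrt (2 * t)) (z 0 i).
have F1 i : F i t @[t --> 0^'+] --> (1 : R).
  have -> : (1 : R) = 1 - (z 0 i ^+ 2) * 0 by rewrite mulr0 subr0.
  have h : 1 - (1 - F i t) / t * t @[t --> 0^'+] --> 1 - (z 0 i ^+ 2) * 0.
    apply: cvgB; first exact: cvg_cst.
    by apply: cvgM; [exact: gcos_slope|exact: cvg_id_at_right].
  apply: cvg_trans h; apply: near_eq_cvg; near=> t.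
  have t0 : t != 0 by rewrite gt_eqF//; near: t; exact: nbhs_right_gt.
  by rewrite divfK//; ring.
have key (r : seq 'I_d) :
    (1 - \prod_(i <- r) F i t) / t @[t --> 0^'+] --> \sum_(i <- r) z 0 i ^+ 2.
  elim: r => [|i r IH].
    under eq_cvg do rewrite big_nil subrr mul0r.
    by rewrite big_nil; exact: cvg_cst.
  rewrite big_cons.
  under eq_cvg => t.
    rewrite big_cons.
    rewrite (_ : _ / _ = (1 - F i t) / t + F i t * ((1 - \prod_(i <- r) F i t) / t)).
      over.
    by rewrite mulrA -mulrDl; congr (_ / _); ring.
  apply: cvgD; first exact: gcos_slope.
  rewrite -[X in _ --> X]mul1r; exact: cvgM.
have -> : dotv z z = \sum_(i <- index_enum 'I_d) z 0 i ^+ 2.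
  by apply: eq_bigr => i _; rewrite expr2.
apply: cvg_trans (key _); apply: near_eq_cvg; near=> t.
have t0 : 0 < t by near: t; exact: nbhs_right_gt.
by have [-> _] := brownian_char z t0.
Unshelve. all: by end_near. Qed.

End brownian.
End characteristic.

(** * Integrals against the Levy density *)

Section norms.
Context {R : realType} {d : nat}.
Implicit Types x y z : 'rV[R]_d.

Lemma dotv_ge0 x : 0 <= dotv x x.
Proof. by apply: sumr_ge0 => i _; rewrite -expr2 sqr_ge0. Qed.

Lemma enorm_ge0 x : 0 <= enorm x. Proof. exact: sqrtr_ge0. Qed.

Lemma enorm_sqr x : enorm x ^+ 2 = dotv x x.
Proof. by rewrite sqr_sqrtr// dotv_ge0. Qed.

Lemma coord_le_norm x i : `|x 0 i| <= `|x|.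
Proof.
rewrite [`|x|]mx_normrE.
exact: (le_bigmax (0 : R) (fun ij : 'I_1 * 'I_d => `|x ij.1 ij.2|) (0, i)).
Qed.

Lemma norm_le_coord x (r : R) : 0 <= r -> (forall i, `|x 0 i| <= r) -> `|x| <= r.
Proof.
move=> r0 xr; rewrite [`|x|]mx_normrE; apply: bigmax_le => // -[i k] _ /=.
by rewrite ord1.
Qed.

Lemma coord_le_enorm x i : `|x 0 i| <= enorm x.
Proof.
rewrite -(ler_pXn2r (n := 2)) ?nnegrE ?enorm_ge0// enorm_sqr real_normK ?num_real//.
rewrite /dotv (bigD1 i)//= -expr2 lerDl; apply: sumr_ge0 => k _.
by rewrite -expr2 sqr_ge0.
Qed.

Lemma norm_le_enorm x : `|x| <= enorm x.
Proof. by apply: norm_le_coord => [|i]; [exact: enorm_ge0|exact: coord_le_enorm]. Qed.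

Lemma enorm_sqr_le x : enorm x ^+ 2 <= d%:R * `|x| ^+ 2.
Proof.
rewrite enorm_sqr -[d in d%:R](card_ord d) mulr_natl -sumr_const; apply: ler_sum => i _.
by rewrite -expr2 -real_normK ?num_real// ler_pXn2r ?nnegrE// coord_le_norm.
Qed.

Lemma enorm_le x : enorm x <= d%:R * `|x|.
Proof.
rewrite -(ler_pXn2r (n := 2)) ?nnegrE ?enorm_ge0 ?mulr_ge0//.
apply: le_trans (enorm_sqr_le x) _; rewrite exprMn ler_wpM2r ?sqr_ge0//.
by rewrite -natrX ler_nat; case: (d) => // n; rewrite expnS leq_pmulr.
Qed.

Lemma dotv_le x y : `|dotv x y| <= d%:R * `|x| * `|y|.
Proof.
rewrite (le_trans (ler_norm_sum _ _ _))//.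
rewrite -mulrA -[d in d%:R](card_ord d) mulr_natl -sumr_const; apply: ler_sum => i _.
by rewrite normrM ler_pM// coord_le_norm.
Qed.

Lemma dotv_le_enorm x y : `|dotv x y| <= d%:R * `|x| * enorm y.
Proof. by apply: le_trans (dotv_le x y) _; rewrite ler_wpM2l ?mulr_ge0// norm_le_enorm. Qed.

Lemma enorm0 : enorm (0 : 'rV[R]_d) = 0.
Proof. by rewrite /enorm /dotv big1 ?sqrtr0// => i _; rewrite mxE mul0r. Qed.

Lemma measurable_open (U : set 'rV[R]_d) : open U -> measurable U.
Proof. exact: sub_sigma_algebra. Qed.

Lemma measurable_set1C x : measurable [set~ x].
Proof.
apply: measurable_open; apply: closed_openC.
exact: (accessible_closed_set1 (hausdorff_accessible (@norm_hausdorff R 'rV[R]_d))).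
Qed.

Lemma continuous_measurable_rV (f : 'rV[R]_d -> R) : continuous f -> measurable_fun setT f.
Proof.
move=> cf; apply: (measurability _ (RGenOpens.measurableE R)) => _ [_ [a [b ->] <-]].
rewrite setTI; apply: measurable_open.
by move/continuousP : cf; apply; exact: interval_open.
Qed.

Lemma measurable_dot x : measurable_fun setT (dotv x).
Proof. by apply: (measurable_dotv x (f := id)); exact: measurable_id. Qed.

Lemma measurable_enorm : measurable_fun setT (@enorm R d).
Proof.
have h : measurable_fun setT (fun x : 'rV[R]_d => dotv x x).
  apply: (@measurable_sum _ _ R setT _ (index_enum 'I_d)
    (fun i (x : 'rV[R]_d) => x 0 i * x 0 i)) => i.
  by apply: measurable_funM; exact: measurable_coord.
by apply: measurableT_comp h; exact: (continuous_measurable_fun (@sqrt_continuous R)).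
Qed.

Lemma measurable_unit_ball : measurable (@unit_ball R d).
Proof.
rewrite -[X in measurable X]setTI; apply: (measurable_fun_le measurableT).
  exact: measurable_enorm.
exact: measurable_cst.
Qed.

End norms.

Section jump_kernel.
Context {R : realType} {d : nat}.
Variable j : 'rV[R]_d -> R.
Hypotheses (j_measurable : measurable_fun ([set~ 0] : set 'rV[R]_d) j)
  (j_ge0 : forall y, y != 0 -> 0 <= j y)
  (j_levy : (\int[lebesgue_rV d]_(y in [set~ 0%R])
               (Num.min 1 (enorm y ^+ 2) * j y)%:E < +oo)%E).
Local Notation mu := (lebesgue_rV d).
Local Notation D := ([set~ 0] : set 'rV[R]_d).

Definition qmin (y : 'rV[R]_d) : R := Num.min 1 (enorm y ^+ 2).

Definition jint (F : 'rV[R]_d -> R) : R := \int[mu]_(y in D) (F y * j y).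

(** The integrands dominated by a multiple of min(1, |y|^2). By the Levy condition they are
    integrable against [j], so [jint] is linear, monotone and continuous under domination on this
    class. *)
Definition jadm (F : 'rV[R]_d -> R) :=
  measurable_fun setT F /\ exists2 C : R, 0 <= C & forall y, `|F y| <= C * qmin y.

Lemma qmin_ge0 y : 0 <= qmin y.
Proof. by rewrite /qmin le_min ler01 sqr_ge0. Qed.

Lemma measurable_qmin : measurable_fun setT qmin.
Proof.
apply: measurable_minr => //; apply: measurable_funX; exact: measurable_enorm.
Qed.

Let mD : measurable D. Proof. exact: measurable_set1C. Qed.

Let mM (F : 'rV[R]_d -> R) : measurable_fun setT F -> measurable_fun D (fun y => F y * j y).
Proof. by move=> mF; apply: measurable_funM => //; exact: measurable_funTS. Qed.

Lemma jint_integrable F : jadm F -> mu.-integrable D (EFin \o (fun y => F y * j y)).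
Proof.
move=> [mF [C C0 FC]].
have iq : mu.-integrable D (EFin \o (fun y => qmin y * j y)).
  apply/integrableP; split; first by apply/measurable_EFinP; apply: mM; exact: measurable_qmin.
  rewrite (eq_integral (fun y => (qmin y * j y)%:E)) => [//|y]; rewrite inE => /eqP y0.
  by rewrite /= ger0_norm// mulr_ge0 ?qmin_ge0// j_ge0.
apply: le_integrable (rintegrableZ mD C iq) => //.
  by apply/measurable_EFinP; exact: mM.
move=> y /eqP y0; rewrite /= lee_fin !normrM.
rewrite (ger0_norm (j_ge0 y0)) (ger0_norm (qmin_ge0 y)) (ger0_norm C0) mulrA.
by rewrite ler_wpM2r// j_ge0.
Qed.

Lemma jadmD F G : jadm F -> jadm G -> jadm (fun y => F y + G y).
Proof.
move=> [mF [C C0 FC]] [mG [K K0 GK]]; split; first exact: measurable_funD.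
exists (C + K); first exact: addr_ge0.
by move=> y; rewrite (le_trans (ler_normD _ _))// mulrDl lerD.
Qed.

Lemma jadmZ k F : jadm F -> jadm (fun y => k * F y).
Proof.
move=> [mF [C C0 FC]]; split; first exact: measurable_funM.
exists (`|k| * C); first exact: mulr_ge0.
by move=> y; rewrite normrM -mulrA ler_wpM2l.
Qed.

Lemma jadmN F : jadm F -> jadm (fun y => - F y).
Proof.
by move=> /(jadmZ (-1)); congr jadm; apply/funext => y; rewrite mulN1r.
Qed.

Lemma jadmB F G : jadm F -> jadm G -> jadm (fun y => F y - G y).
Proof. by move=> aF aG; apply: jadmD => //; exact: jadmN. Qed.

Lemma jadm_qmin : jadm qmin.
Proof.
split; first exact: measurable_qmin.
by exists 1 => // y; rewrite mul1r ger0_norm// qmin_ge0.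
Qed.

Lemma jadm_sum I (s : seq I) (F : I -> 'rV[R]_d -> R) :
  (forall i, jadm (F i)) -> jadm (fun y => \sum_(i <- s) F i y).
Proof.
move=> aF; elim: s => [|i s IH].
  under eq_fun do rewrite big_nil; split; first exact: measurable_cst.
  by exists 0 => // y; rewrite normr0 mul0r.
by under eq_fun do rewrite big_cons; exact: jadmD.
Qed.

Lemma eq_jint F G : (forall y, y != 0 -> F y = G y) -> jint F = jint G.
Proof.
by move=> FG; apply: eq_Rintegral => y; rewrite inE => /eqP y0; rewrite FG.
Qed.

Lemma jintD F G : jadm F -> jadm G -> jint (fun y => F y + G y) = jint F + jint G.
Proof.
move=> aF aG; rewrite -RintegralD//; [|exact: jint_integrable|exact: jint_integrable].
by apply: eq_Rintegral => y _; rewrite mulrDl.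
Qed.

Lemma jintB F G : jadm F -> jadm G -> jint (fun y => F y - G y) = jint F - jint G.
Proof.
move=> aF aG; rewrite -RintegralB//; [|exact: jint_integrable|exact: jint_integrable].
by apply: eq_Rintegral => y _; rewrite mulrBl.
Qed.

Lemma jintZ k F : jadm F -> jint (fun y => k * F y) = k * jint F.
Proof.
move=> aF; rewrite -RintegralZl//; last exact: jint_integrable.
by apply: eq_Rintegral => y _; rewrite mulrA.
Qed.

Lemma jintN F : jadm F -> jint (fun y => - F y) = - jint F.
Proof.
move=> aF; rewrite -mulN1r -jintZ//.
by apply: eq_jint => y _; rewrite mulN1r.
Qed.

Lemma jint0 : jint (fun=> 0) = 0.
Proof.
rewrite /jint; under eq_Rintegral do rewrite mul0r.
by rewrite Rintegral_cst ?mul0r.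
Qed.

Lemma jint_sum I (s : seq I) (F : I -> 'rV[R]_d -> R) :
  (forall i, jadm (F i)) -> jint (fun y => \sum_(i <- s) F i y) = \sum_(i <- s) jint (F i).
Proof.
move=> aF; elim: s => [|i s IH].
  by rewrite big_nil -[RHS]jint0; apply: eq_jint => y _; rewrite big_nil.
rewrite big_cons -IH -jintD//; last exact: jadm_sum.
by apply: eq_jint => y _; rewrite big_cons.
Qed.

Lemma le_jint F G : jadm F -> jadm G -> (forall y, y != 0 -> F y <= G y) ->
  jint F <= jint G.
Proof.
move=> aF aG FG; apply: le_Rintegral => //; [exact: jint_integrable|exact: jint_integrable|].
by move=> y /eqP y0; rewrite ler_wpM2r ?FG// j_ge0.
Qed.

Lemma jint_ge0 F : (forall y, 0 <= F y) -> 0 <= jint F.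
Proof. by move=> F0; apply: Rintegral_ge0 => y /eqP y0; rewrite mulr_ge0// j_ge0. Qed.

Lemma jint_norm_le F G : jadm F -> jadm G -> (forall y, y != 0 -> `|F y| <= G y) ->
  `|jint F| <= jint G.
Proof.
move=> aF aG FG; rewrite ler_norml; apply/andP; split; last first.
  by apply: le_jint => // y /FG; rewrite ler_norml => /andP[].
rewrite -jintN//; apply: le_jint => //; first exact: jadmN.
by move=> y /FG; rewrite ler_norml => /andP[].
Qed.

Lemma jint_dct (F_ : nat -> 'rV[R]_d -> R) F (C : R) :
  (forall n, measurable_fun setT (F_ n)) -> 0 <= C ->
  (forall n y, `|F_ n y| <= C * qmin y) ->
  (forall y, y != 0 -> F_ n y @[n --> \oo] --> F y) ->
  jint (F_ n) @[n --> \oo] --> jint F.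
Proof.
move=> mF C0 FC cF.
have aF n : jadm (F_ n) by split; [exact: mF|exists C].
have aq : jadm (fun y => C * qmin y) by apply: jadmZ; exact: jadm_qmin.
have cFj y : D y -> ((F_ n y * j y)%:E @[n --> \oo] --> (F y * j y)%:E)%E.
  move=> /eqP y0; apply: cvg_EFin; first exact: nearW.
  by apply: cvgMl; exact: cF.
have dom n y : D y -> (`|(F_ n y * j y)%:E| <= (C * qmin y * j y)%:E)%E.
  move=> /eqP y0; rewrite /= lee_fin normrM (ger0_norm (j_ge0 y0)).
  by rewrite ler_wpM2r// j_ge0.
have mFj n : measurable_fun D (fun y => (F_ n y * j y)%:E).
  by apply/measurable_EFinP; exact: mM.
have mFlim : measurable_fun D (fun y => (F y * j y)%:E).
  exact: (@emeasurable_fun_cvg _ _ _ D (fun n y => (F_ n y * j y)%:E)).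
have ic : mu.-integrable D (fun y => (C * qmin y * j y)%:E) by exact: jint_integrable aq.
have [iF _ h] := @dominated_convergence _ _ _ mu D mD
  (fun n y => (F_ n y * j y)%:E) (fun y => (F y * j y)%:E) (fun y => (C * qmin y * j y)%:E)
  mFj mFlim (aeW mu cFj) ic (aeW mu (fun y => fun n Dy => dom n y Dy)).
apply: fine_cvg; rewrite fineK//.
exact: (integrable_fin_num mD iF).
Qed.

End jump_kernel.

(** * Bounds on the symbol of the jump part *)

Section symbol.
Context {R : realType} {d : nat}.
Variable j : 'rV[R]_d -> R.
Hypotheses (j_measurable : measurable_fun ([set~ 0] : set 'rV[R]_d) j)
  (j_ge0 : forall y, y != 0 -> 0 <= j y)
  (j_levy : (\int[lebesgue_rV d]_(y in [set~ 0%R])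
               (Num.min 1 (enorm y ^+ 2) * j y)%:E < +oo)%E).
Local Notation jint := (jint j).
Implicit Types (z y : 'rV[R]_d) (K : R).

Definition sre z : R := complex.Re (psi j z).
Definition sim z : R := complex.Im (psi j z).

Definition comp1 z y : R := \1_(@unit_ball R d) y * dotv z y - sin (dotv z y).

Lemma sreE z : sre z = jint (fun y => 1 - cos (dotv z y)).
Proof.
by apply: eq_Rintegral => y _ /=; rewrite /expi /= mulr0 subr0 addr0.
Qed.

Lemma simE z : sim z = jint (comp1 z).
Proof.
apply: eq_Rintegral => y _ /=; rewrite /expi /= /comp1 mulr0 add0r sub0r.
by rewrite [X in X * _]addrC.
Qed.

Lemma unit_ballE y : \1_(@unit_ball R d) y = (if enorm y <= 1 then 1 else 0) :> R.
Proof.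
rewrite indicE; case: ifPn => h; first by rewrite mem_set.
by rewrite memNset//= /unit_ball /=; exact/negP.
Qed.

(** A majorant, increasing in [K], of the integrands of the real and imaginary parts of the symbol
    at frequencies [z] with [d%:R * |z| <= K]. For small jumps, the quadratic bound makes it vanish
    as [K] tends to 0, while the affine bound makes it [o(K^2)] at infinity; for large jumps the
    minimum with 1 does both. *)
Definition envelope K y : R :=
  if enorm y <= 1 then Num.min (3 * K ^+ 2 * enorm y ^+ 2) (2 + 2 * K * enorm y)
  else 3 * Num.min 1 (K * enorm y).

Lemma envelope_ge0 K y : 0 <= K -> 0 <= envelope K y.
Proof.
move=> K0; have e0 := enorm_ge0 y; rewrite /envelope; case: ifP => _.
  by rewrite le_min !mulr_ge0 ?sqr_ge0// addr_ge0// !mulr_ge0.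
by rewrite mulr_ge0// le_min ler01 mulr_ge0.
Qed.

Lemma oneBcos_le_norm (u : R) : 1 - cos u <= 2 * `|u|.
Proof.
have [h|h] := leP `|u| 1.
  apply: le_trans (oneBcos_le u) _; rewrite -real_normK ?num_real//.
  by have := normr_ge0 u; nra.
by have := cos_geN1 u; lra.
Qed.

Lemma subr_sin_le2 (u : R) : `|u - sin u| <= 2 * u ^+ 2.
Proof.
have [h|h] := leP `|u| 1.
  rewrite distrC; apply: le_trans (subr_sin_le u) _.
  rewrite -[in leRHS]real_normK ?num_real// (exprS _ 2).
  by have := sqr_ge0 `|u|; nra.
apply: (@le_trans _ _ (`|u| + `|u|)).
  by rewrite (le_trans (ler_normB _ _))// lerD// normr_sin.
by rewrite -real_normK ?num_real//; nra.
Qed.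

Lemma envelopeP z y K : d%:R * `|z| <= K ->
  (1 - cos (dotv z y)) + `|comp1 z y| <= envelope K y.
Proof.
move=> zK; have K0 : 0 <= K by apply: le_trans zK; rewrite mulr_ge0.
have e0 := enorm_ge0 y.
have uK : `|dotv z y| <= K * enorm y.
  by apply: le_trans (dotv_le_enorm z y) _; rewrite ler_wpM2r.
have u2 : dotv z y ^+ 2 <= K ^+ 2 * enorm y ^+ 2.
  by rewrite -exprMn -real_normK ?num_real// ler_pXn2r ?nnegrE// mulr_ge0.
rewrite /comp1 unit_ballE /envelope; set u := dotv z y in uK u2 *; case: ifPn => h.
  rewrite mul1r le_min; apply/andP; split.
    by have := oneBcos_le u; have := subr_sin_le2 u; have := sqr_ge0 u; lra.
  have := oneBcos_le2 u; have := ler_normB u (sin u); have := normr_sin u; lra.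
rewrite mul0r sub0r normrN; have [a|a] := leP 1 (K * enorm y).
  by have := oneBcos_le2 u; have := sin_max u; lra.
by have := oneBcos_le_norm u; have := normr_sin u; lra.
Qed.

Lemma envelope_le K y : 0 <= K -> envelope K y <= 3 * (K ^+ 2 + 1) * qmin y.
Proof.
move=> K0; have e0 := enorm_ge0 y; have k2 := sqr_ge0 K.
rewrite /envelope /qmin; case: ifPn => h.
  have h2 : enorm y ^+ 2 <= 1 by rewrite exprn_ile1.
  rewrite (min_r h2) ge_min; apply/orP; left.
  by have := sqr_ge0 (enorm y); nra.
have h2 : 1 <= enorm y ^+ 2 by rewrite -ltNge in h; rewrite exprn_ege1// ltW.
rewrite (min_l h2) mulr1; have : Num.min 1 (K * enorm y) <= 1 by rewrite ge_min lexx.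
lra.
Qed.

Lemma envelope_homo K K' y : 0 <= K -> K <= K' -> envelope K y <= envelope K' y.
Proof.
move=> K0 KK; have e0 := enorm_ge0 y; rewrite /envelope; case: ifP => _.
  have k2 : K ^+ 2 <= K' ^+ 2 by rewrite ler_pXn2r ?nnegrE// (le_trans K0).
  rewrite le_min !ge_min; apply/andP; split; apply/orP; [left|right].
    by rewrite ler_wpM2r ?sqr_ge0//; lra.
  by nra.
rewrite ler_pM2l// le_min ge_min lexx/= ge_min; apply/orP; right.
by rewrite ler_wpM2r.
Qed.

Lemma measurable_envelope K : measurable_fun setT (envelope K).
Proof.
have me := @measurable_enorm R d.
apply: measurable_fun_if => //.
- exact: measurable_fun_ler.
- apply: measurable_funTS; apply: measurable_minr.
    by apply: measurable_funM => //; exact: measurable_funX.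
  by apply: measurable_funD => //; exact: measurable_funM.
- apply: measurable_funTS; apply: measurable_funM => //; apply: measurable_minr => //.
  exact: measurable_funM.
Qed.

Lemma jadm_envelope K : 0 <= K -> jadm (envelope K).
Proof.
move=> K0; split; first exact: measurable_envelope.
exists (3 * (K ^+ 2 + 1)); first by have := sqr_ge0 K; lra.
by move=> y; rewrite ger0_norm ?envelope_ge0// envelope_le.
Qed.

Definition Hmod K := jint (envelope K).

Lemma jadm_oneBcos z : jadm (fun y => 1 - cos (dotv z y)).
Proof.
split.
  by have := bmeasB (bmeas_cst 1) (bmeas_cosM (measurable_dot z)); case.
have K0 : 0 <= d%:R * `|z| by rewrite mulr_ge0.
exists (3 * ((d%:R * `|z|) ^+ 2 + 1)); first by have := sqr_ge0 (d%:R * `|z|); lra.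
move=> y; rewrite ger0_norm ?oneBcos_ge0//; apply: le_trans (envelope_le y K0).
by have := envelopeP y (lexx (d%:R * `|z|)); have := normr_ge0 (comp1 z y); lra.
Qed.

Lemma jadm_comp1 z : jadm (comp1 z).
Proof.
split.
  apply: measurable_funB.
    apply: measurable_funM; last exact: measurable_dot.
    by apply: measurable_indic; exact: measurable_unit_ball.
  by have [] := bmeas_sinM (measurable_dot z).
have K0 : 0 <= d%:R * `|z| by rewrite mulr_ge0.
exists (3 * ((d%:R * `|z|) ^+ 2 + 1)); first by have := sqr_ge0 (d%:R * `|z|); lra.
move=> y; apply: le_trans (envelope_le y K0).
by have := envelopeP y (lexx (d%:R * `|z|)); have := oneBcos_ge0 (dotv z y); lra.
Qed.

Lemma sre_ge0 z : 0 <= sre z.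
Proof. by rewrite sreE; apply: jint_ge0 => // y; exact: oneBcos_ge0. Qed.

Lemma symbol_le_Hmod z K : d%:R * `|z| <= K -> sre z + `|sim z| <= Hmod K.
Proof.
move=> zK; have K0 : 0 <= K by apply: le_trans zK; rewrite mulr_ge0.
have a1 := jadm_oneBcos z; have a2 := jadm_comp1 z.
have a3 : jadm (fun y => `|comp1 z y|).
  case: a2 => m [C C0 hC]; split; first exact: measurableT_comp.
  by exists C => // y; rewrite normr_id.
have h : `|sim z| <= jint (fun y => `|comp1 z y|) by rewrite simE; exact: jint_norm_le.
rewrite sreE; apply: (@le_trans _ _ (jint (fun y => 1 - cos (dotv z y)) + jint (fun y => `|comp1 z y|))).
  by rewrite lerD2l.
rewrite -jintD//; apply: le_jint => //; [exact: jadmD|exact: jadm_envelope|].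
by move=> y _; exact: envelopeP.
Qed.

Lemma Hmod_homo K K' : 0 <= K -> K <= K' -> Hmod K <= Hmod K'.
Proof.
move=> K0 KK; have K'0 := le_trans K0 KK.
apply: le_jint => //; [exact: jadm_envelope|exact: jadm_envelope|].
by move=> y _; exact: envelope_homo.
Qed.

Lemma Hmod_ge0 K : 0 <= K -> 0 <= Hmod K.
Proof. by move=> K0; apply: jint_ge0 => // y; exact: envelope_ge0. Qed.

Lemma Hmod_cvg0 (e : R) : 0 < e -> exists2 k : R, 0 < k & forall K, 0 <= K <= k -> Hmod K <= e.
Proof.
move=> e0.
have h : Hmod (n.+1%:R^-1) @[n --> \oo] --> jint (fun=> 0).
  apply: (@jint_dct _ _ _ _ _ _ _ _ (3 * (1 + 1))) => //.
  - by move=> n; exact: measurable_envelope.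
  - move=> n y; rewrite ger0_norm ?envelope_ge0//.
    apply: le_trans (envelope_le y _) _ => //.
    rewrite ler_wpM2r ?qmin_ge0// ler_pM2l// lerD2r exprn_ile1// invf_le1//.
    by rewrite ler1n.
  - move=> y y0; have c0 : (n.+1%:R^-1 : R) @[n --> \oo] --> (0 : R).
      exact: cvg_harmonic.
    have up n : envelope n.+1%:R^-1 y <= n.+1%:R^-1 * (3 * enorm y ^+ 2 + 3 * enorm y).
      have n0 : 0 <= n.+1%:R^-1 :> R by rewrite invr_ge0.
      have n1 : n.+1%:R^-1 <= 1 :> R by rewrite invf_le1// ler1n.
      have e' := enorm_ge0 y; have e2 := sqr_ge0 (enorm y).
      move: n0 n1; set k := n.+1%:R^-1 => n0 n1.
      have k2 : k ^+ 2 <= k by rewrite expr2; nra.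
      rewrite /envelope; case: ifP => _.
        by rewrite ge_min; apply/orP; left; nra.
      have : Num.min 1 (k * enorm y) <= k * enorm y by rewrite ge_min lexx orbT.
      nra.
    apply: (@squeeze_cvgr _ _ _ _ (fun=> 0)
      (fun n => n.+1%:R^-1 * (3 * enorm y ^+ 2 + 3 * enorm y))).
    + by apply: nearW => n; rewrite up andbT envelope_ge0.
    + exact: cvg_cst.
    + by rewrite -[X in _ --> X](mul0r (3 * enorm y ^+ 2 + 3 * enorm y)); exact: cvgMl.
move: h; rewrite jint0 => /cvgrPdist_le /(_ e e0)[N _ hN].
exists N.+1%:R^-1; first by rewrite invr_gt0.
move=> K /andP[K0 KN]; have := hN N (leqnn N); rewrite sub0r normrN => h.
by apply: le_trans (Hmod_homo K0 KN) _; apply: le_trans (ler_norm _) h.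
Qed.

(** Dominated convergence for [envelope K / K^2], which tends to 0 pointwise. At high frequencies
    the jumps weigh less than the Brownian part; this is the reason why [Y_s / sqrt s] tends to 0 in
    probability. *)
Lemma Hmod_little_sqr (e : R) : 0 < e ->
  exists2 k : R, 0 < k & forall K, k <= K -> Hmod K <= e * K ^+ 2.
Proof.
move=> e0; have e4 : 0 < e / 4 by rewrite divr_gt0.
have h : jint (fun y => n.+1%:R ^- 2 * envelope (n.+1%:R) y) @[n --> \oo] --> jint (fun=> 0).
  apply: (@jint_dct _ _ _ _ _ _ _ _ (3 * (1 + 1))) => //.
  - by move=> n; apply: measurable_funM => //; exact: measurable_envelope.
  - move=> n y; have n1 : 1 <= n.+1%:R ^+ 2 :> R by rewrite exprn_ege1// ler1n.
    have n0 : 0 < n.+1%:R ^+ 2 :> R by rewrite exprn_gt0.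
    rewrite ger0_norm; last by rewrite mulr_ge0 ?envelope_ge0// invr_ge0 ltW.
    rewrite mulrC ler_pdivrMr//; apply: le_trans (envelope_le y _) _ => //.
    by have := qmin_ge0 y; nra.
  - move=> y y0; have c0 : (n.+1%:R^-1 : R) @[n --> \oo] --> (0 : R) by exact: cvg_harmonic.
    have up n : n.+1%:R ^- 2 * envelope n.+1%:R y <=
        n.+1%:R^-1 * (5 + 2 * enorm y).
      have n1 : 1 <= n.+1%:R :> R by rewrite ler1n.
      have n0 : 0 < n.+1%:R :> R by [].
      have e' := enorm_ge0 y.
      rewrite -exprVn expr2 -mulrA ler_wpM2l ?invr_ge0// mulrC ler_pdivrMr//.
      rewrite /envelope; case: ifP => _.
        by rewrite ge_min; apply/orP; right; nra.
      have : Num.min 1 (n.+1%:R * enorm y) <= 1 by rewrite ge_min lexx.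
      nra.
    apply: (@squeeze_cvgr _ _ _ _ (fun=> 0) (fun n => n.+1%:R^-1 * (5 + 2 * enorm y))).
    + apply: nearW => n; rewrite up andbT.
      by rewrite mulr_ge0 ?envelope_ge0 ?invr_ge0// exprn_ge0.
    + exact: cvg_cst.
    + by rewrite -[X in _ --> X](mul0r (5 + 2 * enorm y)); exact: cvgMl.
move: h; rewrite jint0 => /cvgrPdist_le /(_ _ e4)[N _ hN].
(* The limit is taken along integers. If [m] is the integer part of [K], then [K < m + 1 <= 2 * K],
   since [K >= 1]; monotonicity in [K] costs the factor 4 built into [e / 4]. *)
exists N.+1%:R => // K NK.
have K0 : 0 <= K by apply: le_trans NK.
have [/= n1 n2] : (Num.trunc K)%:R <= K /\ K < (Num.trunc K).+1%:R.
  by have /andP := truncn_itv K0.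
have Nn : (N <= Num.trunc K)%N.
  by have := le_lt_trans NK n2; rewrite ltr_nat ltnS => /ltnW.
have := hN _ Nn; rewrite sub0r normrN.
rewrite jintZ//; last exact: jadm_envelope.
set m := Num.trunc K in n1 n2 Nn *; rewrite -/(Hmod m.+1%:R) => h.
have m0 : 0 < m.+1%:R ^+ 2 :> R by rewrite exprn_gt0.
have {h} h : Hmod m.+1%:R <= e / 4 * m.+1%:R ^+ 2.
  rewrite -ler_pdivrMr// mulrC; exact: le_trans (ler_norm _) h.
apply: le_trans (Hmod_homo K0 (ltW n2)) _; apply: le_trans h _.
have m2 : m.+1%:R <= 2 * K :> R.
  have : 1 <= K by apply: le_trans NK; rewrite ler1n.
  by rewrite -natr1; lra.
have : m.+1%:R ^+ 2 <= (2 * K) ^+ 2 by rewrite ler_pXn2r ?nnegrE// mulr_ge0.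
by rewrite exprMn; nra.
Qed.

End symbol.

(** * Averaged cosines as truncation functions *)

Section uniform01.
Context {R : realType}.
Local Notation mu := (@lebesgue_measure R).

Definition U01 : probability (measurableTypeR R) R := uniform_prob (@ltr01 R).

Lemma U01_ex (f : measurableTypeR R -> R) : bmeas f ->
  \int[U01]_x f x = \int[mu]_(x in `[0%R, 1%R]) f x.
Proof.
move=> bf; have [M M0 fM] := bmeas_bound bf.
have ge0case (g : measurableTypeR R -> R) : measurable_fun setT g -> (forall x, 0 <= g x) ->
    \int[U01]_x g x = \int[mu]_(x in `[0%R, 1%R]) g x.
  move=> mg g0; rewrite /Rintegral /U01 integral_uniform//.
  - by rewrite subr0 invr1 mul1e.
  - exact/measurable_EFinP.
have bg := bmeasD bf (bmeas_cst M).
have := ge0case _ bg.1; rewrite (exD U01 bf (bmeas_cst M)) ex_cst => H.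
have l1 : mu `[0%R, 1%R]%classic = 1%E.
  by rewrite lebesgue_measure_itv/= lte_fin ltr01 sube0.
have iM (g : measurableTypeR R -> R) : bmeas g -> mu.-integrable `[0%R, 1%R] (EFin \o g).
  move=> [mg [N gN]]; apply: measurable_bounded_integrable => //.
  - by apply: (@le_lt_trans _ _ 1%E); [rewrite -l1|exact: ltry].
  - exact: measurable_funTS.
  - by exists N; split => [|x Nx y _ /=]; rewrite ?num_real// (le_trans (gN y))// ltW.
have {}H : \int[U01]_x f x + M = \int[mu]_(x in `[0%R, 1%R]) (f x + M).
  by apply: H => x; have := fM x; rewrite ler_norml => /andP[]; lra.
move: H; rewrite (RintegralD _ (iM _ bf) (iM _ (bmeas_cst M)))//.
rewrite Rintegral_cst//.
have := congr1 fine l1; rewrite [fine 1]/= => l1'; rewrite [fine _]l1' mulr1; lra.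
Qed.

Lemma U01_le (f : measurableTypeR R -> R) (b : R) : bmeas f ->
  (forall s, 0 <= s <= 1 -> f s <= b) -> \int[U01]_x f x <= b.
Proof.
move=> bf fb; rewrite -[leRHS](ex_cst U01) !U01_ex//; last exact: bmeas_cst.
have l1 : mu `[0%R, 1%R]%classic = 1%E.
  by rewrite lebesgue_measure_itv/= lte_fin ltr01 sube0.
have iM (g : measurableTypeR R -> R) : bmeas g -> mu.-integrable `[0%R, 1%R] (EFin \o g).
  move=> [mg [N gN]]; apply: measurable_bounded_integrable => //.
  - by apply: (@le_lt_trans _ _ 1%E); [rewrite -l1|exact: ltry].
  - exact: measurable_funTS.
  - by exists N; split => [|x Nx y _ /=]; rewrite ?num_real// (le_trans (gN y))// ltW.
apply: (le_Rintegral _ (iM _ bf) (iM _ (bmeas_cst b))) => //.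
Qed.

Lemma U01_norm_le (f : measurableTypeR R -> R) (b : R) : bmeas f ->
  (forall s, 0 <= s <= 1 -> `|f s| <= b) -> `|\int[U01]_x f x| <= b.
Proof.
move=> bf fb; apply: le_trans (ex_norm U01 bf) _; apply: U01_le => //.
exact: bmeas_norm.
Qed.

Lemma U01_cos (v : R) : v != 0 -> \int[U01]_s cos (s * v) = sin v / v.
Proof.
move=> v0.
have dF (s : R) : is_derive s 1 (fun s : R => sin (s * v) / v) (cos (s * v)).
  have d1 : is_derive s 1 (fun s : R => s * v) v.
    have := is_deriveZ v (is_derive_id s (1 : R)); rewrite /GRing.scale /= mulr1.
    by have -> : (v \*: id) = (fun s : R => s * v) by apply/funext => x /=; exact: mulrC.
  have := @is_derive1_comp R sin (fun s => s * v) s _ _ (is_derive_sin (s * v)) d1.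
  move=> /(is_deriveZ (v^-1)); rewrite /GRing.scale /= mulrCA mulVf// mulr1.
  have -> // : (v^-1 \*: (sin \o (fun s : R => s * v))) = (fun s : R => sin (s * v) / v).
  by apply/funext => x /=; exact: mulrC.
have cF (s : R) : (fun s : R => sin (s * v) / v) x @[x --> s] --> sin (s * v) / v.
  have h := dF s.
  have : differentiable (fun s : R => sin (s * v) / v) s.
    by apply/derivable1_diffP; exact: ex_derive.
  by move/differentiable_continuous.
rewrite U01_ex; last by apply: bmeas_cosM; exact: measurable_funM.
rewrite /Rintegral (@continuous_FTC2 _ _ (fun s : R => sin (s * v) / v))//.
- by rewrite mul1r mul0r sin0 mul0r sube0.
- apply: continuous_subspaceT => s; apply: continuous_comp.
    by apply: cvgMl; exact: cvg_id.
  exact: continuous_cos.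
- split.
  + by move=> s _; have := dF s => h; exact: ex_derive.
  + by apply: cvg_at_right_filter; exact: cF.
  + by apply: cvg_at_left_filter; exact: cF.
- by move=> s _; rewrite derive1E; have := dF s => h; exact: derive_val.
Qed.

(** This is [1 - sin u / u], kept as an average of [1 - cos (s * u)]: it is comparable to min(1,
    u^2) and its mean under a random variable is an average of values of the characteristic
    function. *)
Definition th (u : R) : R := \int[U01]_s (1 - cos (s * u)).

Lemma bmeas_th_kernel u : @bmeas _ (measurableTypeR R) R (fun s => 1 - cos (s * u)).
Proof.
by apply: (bmeasB (bmeas_cst 1)); apply: bmeas_cosM; exact: measurable_funM.
Qed.

Lemma th_ge0 u : 0 <= th u.
Proof. by apply: ex_ge0 => s; exact: oneBcos_ge0. Qed.

Lemma th_le2 u : th u <= 2.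
Proof.
rewrite -[leRHS](ex_cst U01); apply: ex_le => [||s]; [exact: bmeas_th_kernel|exact: bmeas_cst|].
exact: oneBcos_le2.
Qed.

Lemma th0 : th 0 = 0.
Proof.
rewrite /th; under eq_Rintegral do rewrite mulr0 cos0 subrr.
exact: ex_cst.
Qed.

Lemma thE u : u != 0 -> th u = 1 - sin u / u.
Proof.
move=> u0; rewrite /th (exB U01 (bmeas_cst 1)) ?ex_cst ?U01_cos//.
by apply: bmeas_cosM; exact: measurable_funM.
Qed.

Lemma thN u : th (- u) = th u.
Proof. by rewrite /th; apply: eq_Rintegral => s _; rewrite mulrN cosN. Qed.

(** From [sin v >= cos 1 * v] on [0, 1] follows [1 - cos v >= (cos 1)^2 / 2 * v^2] on [0, 2];
    integrating once more gives [v - sin v >= (cos 1)^2 / 6 * v^3]. *)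
Definition thc : R := cos 1 ^+ 2 / 6.

Lemma thc_gt0 : 0 < thc.
Proof. by rewrite /thc divr_gt0// exprn_gt0// cos1_gt0. Qed.

Lemma sin_lower (v : R) : 0 <= v <= 1 -> cos 1 * v <= sin v.
Proof.
move=> /andP[v0 v1].
have := @increment_le R (fun x => - sin x) (fun x => - cos x) (- cos 1) v _ v0.
rewrite sin0 oppr0 subr0 mulNr lerN2; apply.
move=> x /andP[x0 xv]; rewrite lerN2.
have x1 : x <= 1 := le_trans xv v1.
have pi1 : (1 : R) <= pi by have := @pi_ge2 R; lra.
move: x1; rewrite le_eqVlt => /predU1P[->//|x1]; apply: ltW.
by rewrite ltr_cos// in_itv/= ?x0 ?ler01//= (le_trans (ltW x1)).
Qed.

Lemma oneBcos_lower (v : R) : 0 <= v <= 2 -> cos 1 ^+ 2 / 2 * v ^+ 2 <= 1 - cos v.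
Proof.
move=> /andP[v0 v2]; rewrite oneBcos.
have h : cos 1 * (v / 2) <= sin (v / 2) by apply: sin_lower; apply/andP; split; lra.
have h0 : 0 <= cos 1 * (v / 2) by rewrite mulr_ge0 ?divr_ge0// ltW// cos1_gt0.
have : (cos 1 * (v / 2)) ^+ 2 <= sin (v / 2) ^+ 2 by rewrite ler_pXn2r ?nnegrE// (le_trans h0).
by rewrite exprMn expr_div_n; lra.
Qed.

Lemma th_lower u : thc * Num.min 1 (u ^+ 2) <= th u.
Proof.
wlog u0 : u / 0 < u => [hw|].
  have [->|u0] := eqVneq u 0.
    by rewrite th0 expr0n/= min_r// mulr0.
  have [p|p] := ltP 0 u; first exact: hw.
  by rewrite -thN -sqrrN; apply: hw; rewrite oppr_gt0 lt_neqAle u0.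
have c0 := @thc_gt0; have cos11 : cos 1 ^+ 2 <= 1 :> R.
  by have := sqr_ge0 (sin (1 : R)); rewrite sin2cos2; lra.
rewrite thE ?gt_eqF//.
have [u2|u2] := leP u 2.
  have H : thc * u ^+ 3 <= u - sin u.
    have := @increment_le R (fun x => thc * x ^+ 3 - (x - sin x))
      (fun x => thc * (3 * x ^+ 2) - (1 - cos x)) 0 u _ (ltW u0).
    rewrite expr0n/= mulr0 sin0 !subr0 mul0r subr_le0; apply.
      move=> x; apply: is_deriveB.
      have dc := is_deriveM (is_derive_id x (1 : R))
        (is_deriveM (is_derive_id x (1 : R)) (is_derive_id x (1 : R))).
      have := is_deriveZ thc dc; rewrite /GRing.scale /= !mulr1.
      by have -> : x * (x + x) + x * x = 3 * x ^+ 2 by ring.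
    move=> x /andP[x0 xu]; have := @oneBcos_lower x.
    rewrite x0 (le_trans xu u2) => /(_ isT); rewrite /thc; lra.
  have m : Num.min 1 (u ^+ 2) <= u ^+ 2 by rewrite ge_min lexx orbT.
  rewrite -(ler_pM2r u0) mulrBl divfK ?gt_eqF// mul1r; apply: le_trans H.
  by rewrite -mulrA (exprSr u 2) ler_pM2l// ler_pM2r.
have m : Num.min 1 (u ^+ 2) <= 1 by rewrite ge_min lexx.
have s1 : sin u / u <= 1 / 2.
  by rewrite ler_pdivrMr//; have := sin_le1 u; lra.
rewrite /thc in c0 *; nra.
Qed.

End uniform01.

Section truncation.
Context {R : realType} {d : nat} dT {T : measurableType dT} (P : probability T R).
Implicit Types (k : R) (p x y : 'rV[R]_d) (i : 'I_d).

(** A bounded bump centred at [p]: it vanishes at [p], is at least [thc] at distance [1 / k] and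
    beyond ([Th_far]), and is at most of order [(k |x - p|)^2]. It plays the role of a localizing
    function whose drift under the semigroup is controlled by the symbol ([Th_drift]). *)
Definition Th k p x : R := \sum_(i < d) th (k * (x 0 i - p 0 i)).

Lemma dotv_ebasis (s : R) i x : dotv (s *: ebasis i) x = s * x 0 i.
Proof.
rewrite /dotv (bigD1 i)//= big1 => [|k ki]; first by rewrite !mxE !eqxx addr0 mulr1.
by rewrite !mxE (negbTE ki) andbF mulr0 mul0r.
Qed.

Lemma measurable_th : measurable_fun setT (@th R).
Proof.
pose F (q : measurableTypeR R * measurableTypeR R) : R := 1 - cos (q.2 * q.1).
have bF : bmeas F.
  apply: (bmeasB (bmeas_cst 1)); apply: bmeas_cosM; exact: measurable_funM.
by case: (bmeas_ex2 U01 U01 bF).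
Qed.

Lemma bmeas_th_comp dT' (T' : measurableType dT') (h : T' -> R) : measurable_fun setT h ->
  bmeas (fun w => th (h w)).
Proof.
move=> mh; split; first exact: measurableT_comp measurable_th mh.
by exists 2 => w; rewrite ger0_norm ?th_ge0// th_le2.
Qed.

Lemma measurable_Th_comp dT' (T' : measurableType dT') (Z : T' -> 'rV[R]_d) k p :
  measurable_fun setT Z -> bmeas (fun w => Th k p (Z w)).
Proof.
move=> mZ; apply: (@bmeas_sum _ T' R _ (index_enum 'I_d)
  (fun i w => th (k * (Z w 0 i - p 0 i)))) => i.
apply: bmeas_th_comp; apply: measurable_funM => //; apply: measurable_funB => //.
exact: measurable_fun_coord.
Qed.

Lemma bmeas_Th k p : bmeas (Th k p).
Proof. by apply: (measurable_Th_comp k p (Z := id)); exact: measurable_id. Qed.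

Lemma Th_ge0 k p x : 0 <= Th k p x.
Proof. by apply: sumr_ge0 => i _; exact: th_ge0. Qed.

Lemma Thpp k p : Th k p p = 0.
Proof. by rewrite /Th big1// => i _; rewrite subrr mulr0 th0. Qed.

Lemma Th_lower k p x : 0 <= k -> thc * Num.min 1 ((k * `|x - p|) ^+ 2) <= Th k p x.
Proof.
move=> k0.
have [->|xp] := eqVneq x p.
  by rewrite subrr normr0 mulr0 expr0n/= min_r// mulr0 Th_ge0.
have [[i0 i] /= xi] : exists i : 'I_1 * 'I_d, `|x - p| = `|(x - p) i.1 i.2|.
  apply: mx_norm_neq0; apply/eqP => e0; move: xp; rewrite -subr_eq0 -normr_eq0.
  by rewrite [`|_|]e0 eqxx.
rewrite xi (ord1 i0) !mxE /Th (bigD1 i)//=.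
apply: (@le_trans _ _ (th (k * (x 0 i - p 0 i)))); last first.
  by rewrite lerDl; apply: sumr_ge0 => *; exact: th_ge0.
apply: le_trans (th_lower _); rewrite exprMn real_normK ?num_real// -exprMn.
exact: lexx.
Qed.

Lemma Th_far k p x : 0 <= k -> 1 <= k * `|x - p| -> thc <= Th k p x.
Proof.
move=> k0 h; apply: le_trans (Th_lower p x k0); rewrite min_l ?mulr1//.
by rewrite exprn_ege1.
Qed.

Lemma ex_Th_le (Z : T -> 'rV[R]_d) k (b : R) : measurable_fun setT Z -> 0 <= k ->
  (forall i s, 0 <= s <= k -> `|1 - \int[P]_w cos (dotv (s *: ebasis i) (Z w))| <= b) ->
  \int[P]_w Th k 0 (Z w) <= d%:R * b.
Proof.
move=> mZ k0 hb; rewrite /Th.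
rewrite (@ex_sum _ T R P _ (index_enum 'I_d) (fun i w => th (k * (Z w 0 i - (0 : 'rV[R]_d) 0 i)))); last first.
  move=> i; apply: bmeas_th_comp; apply: measurable_funM => //; apply: measurable_funB => //.
  exact: measurable_fun_coord.
rewrite -[d in leRHS](card_ord d) mulr_natl -sumr_const; apply: ler_sum => i _.
pose F (q : T * measurableTypeR R) : R := 1 - cos (q.2 * (k * (Z q.1 0 i - (0 : 'rV[R]_d) 0 i))).
have mF : measurable_fun setT (fun q : T * measurableTypeR R => q.2 * (k * (Z q.1 0 i - (0 : 'rV[R]_d) 0 i))).
  apply: measurable_funM => //; apply: measurable_funM => //; apply: measurable_funB => //.
  exact: (measurableT_comp (measurable_fun_coord i mZ) measurable_fst).
have bF : bmeas F by apply: (bmeasB (bmeas_cst 1)); exact: bmeas_cosM.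
(* Exchanging the average over [s] with the expectation leaves a characteristic function at the
   frequency [s * k] on the axis [i]. *)
have -> : \int[P]_w th (k * (Z w 0 i - (0 : 'rV[R]_d) 0 i)) = \int[P]_w \int[U01]_s F (w, s) by [].
rewrite (ex_fubini P U01 bF).
apply: U01_le; first exact: (bmeas_ex1 P U01 bF).
move=> s /andP[s0 s1].
have -> : \int[P]_w F (w, s) = 1 - \int[P]_w cos (dotv ((s * k) *: ebasis i) (Z w)).
  rewrite -[X in X - _](ex_cst P) -(exB P (bmeas_cst 1)); last first.
    by apply: bmeas_cosM; exact: measurable_dotv.
  by apply: eq_Rintegral => w _; rewrite dotv_ebasis /F /= mxE subr0 mulrA.
apply: le_trans (ler_norm _) _; apply: hb.
by rewrite mulr_ge0// ler_piMl.
Qed.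

(* Markov's inequality for [Th], whose expectation is controlled by the characteristic function. *)
Lemma tail_le (Z : T -> 'rV[R]_d) k (b : R) : measurable_fun setT Z -> 0 < k ->
  (forall i s, 0 <= s <= k -> `|1 - \int[P]_w cos (dotv (s *: ebasis i) (Z w))| <= b) ->
  fine (P [set w | k^-1 <= `|Z w|]) <= d%:R * b / thc.
Proof.
move=> mZ k0 hb; have mA : measurable [set w | k^-1 <= `|Z w|].
  rewrite -[X in measurable X]setTI; apply: (measurable_fun_le measurableT) => //.
  apply: (measurableT_comp _ mZ); apply: continuous_measurable_rV.
  exact: norm_continuous.
rewrite -ex_indic// ler_pdivlMr ?thc_gt0//.
apply: le_trans (ex_Th_le mZ (ltW k0) hb).
rewrite mulrC -exZ; last exact: bmeas_indic.
apply: ex_le => [||w]; [by apply: bmeasZ; exact: bmeas_indic|exact: measurable_Th_comp|].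
rewrite indicE; have [h|h] := boolP (k^-1 <= `|Z w|).
  rewrite mem_set// mulr1; apply: Th_far; first exact: ltW.
  by rewrite subr0 mulrC -ler_pdivrMr// mul1r.
by rewrite memNset ?mulr0 ?Th_ge0//=; exact/negP.
Qed.

End truncation.

(** * The characteristic function of the sum process *)

Section levy_sum.
Context {R : realType} {d : nat} {dO : measure_display}
  {Omega : measurableType dO} (P : probability Omega R).
Variable j : 'rV[R]_d -> R.
Hypotheses (j_measurable : measurable_fun ([set~ 0] : set 'rV[R]_d) j)
  (j_ge0 : forall y, y != 0 -> 0 <= j y)
  (j_levy : (\int[lebesgue_rV d]_(y in [set~ 0%R])
               (Num.min 1 (enorm y ^+ 2) * j y)%:E < +oo)%E).
Variables (W Y : R -> Omega -> 'rV[R]_d).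
Hypotheses (W_brownian : standard_brownian P W)
  (Y_levy : levy_process P Y) (Y_exponent : has_exponent P Y (psi j))
  (WY_independent : independent_processes P (fun t => W (2 * t)) Y).
Implicit Types (z x y : 'rV[R]_d) (t s : R).

Local Notation V := (fun t => W (2 * t)).
Definition Xsum : R -> Omega -> 'rV[R]_d := psum V Y.
Local Notation X := Xsum.

Lemma levy_like_V : levy_like P V.
Proof.
by apply: levy_like_double; apply: levy_process_like; case: W_brownian.
Qed.

Lemma levy_like_Y : levy_like P Y. Proof. exact: levy_process_like. Qed.

Lemma measurable_X t : 0 <= t -> measurable_fun setT (X t).
Proof. exact: measurable_psum levy_like_V levy_like_Y t. Qed.

Lemma VY_indep t A B : 0 <= t -> measurable A -> measurable B ->
  P (V t @^-1` A `&` Y t @^-1` B) = (P (V t @^-1` A) * P (Y t @^-1` B))%E.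
Proof.
move=> t0 mA mB; apply: WY_independent; apply: sub_sigma_algebra.
  by exists t => //; exists A.
by exists t => //; exists B.
Qed.

Lemma X_char t z : 0 < t ->
  ccos P X t z = ccos P V t z * ccos P Y t z /\
  csin P X t z = ccos P V t z * csin P Y t z.
Proof.
move=> t0; have t0' := ltW t0.
have mV := ll_meas levy_like_V t0'; have mY := ll_meas levy_like_Y t0'.
have [_ sV] := brownian_char W_brownian z t0.
have mS : measurable_fun setT (fun q : 'rV[R]_d * 'rV[R]_d => dotv z (q.1 + q.2)).
  by apply: measurable_dotv; exact: measurable_rVD.
have bcV := bmeas_cosM (measurable_dotv z mV); have bsV := bmeas_sinM (measurable_dotv z mV).
have bcY := bmeas_cosM (measurable_dotv z mY); have bsY := bmeas_sinM (measurable_dotv z mY).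
split.
  transitivity (\int[P]_w \int[P]_w' cos (dotv z (V t w + Y t w'))).
    exact: (indep_ex mV mY (fun A B => VY_indep t0') (bmeas_cosM mS)).
  transitivity (\int[P]_w (ccos P Y t z * cos (dotv z (V t w)) - csin P Y t z * sin (dotv z (V t w)))).
    apply: eq_Rintegral => w _.
    under eq_Rintegral do rewrite dotvDr cosD.
    rewrite exB; [|exact: bmeasZ|exact: bmeasZ].
    by rewrite exZ// exZ// mulrC [in X in _ - X]mulrC.
  rewrite exB; [|exact: bmeasZ|exact: bmeasZ].
  by rewrite exZ// exZ// -/(ccos P V t z) -/(csin P V t z) sV mulr0 subr0 mulrC.
transitivity (\int[P]_w \int[P]_w' sin (dotv z (V t w + Y t w'))).
  exact: (indep_ex mV mY (fun A B => VY_indep t0') (bmeas_sinM mS)).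
transitivity (\int[P]_w (ccos P Y t z * sin (dotv z (V t w)) + csin P Y t z * cos (dotv z (V t w)))).
  apply: eq_Rintegral => w _.
  under eq_Rintegral do rewrite dotvDr sinD.
  rewrite exD; [|exact: bmeasZ|exact: bmeasZ].
  by rewrite exZ// exZ// mulrC [in X in _ + X]mulrC.
rewrite exD; [|exact: bmeasZ|exact: bmeasZ].
by rewrite exZ// exZ// -/(ccos P V t z) -/(csin P V t z) sV mulr0 add0r mulrC.
Qed.

Local Notation sre := (sre j).
Local Notation sim := (sim j).

Definition Bz z := 3 * dotv z z + sre z + `|sim z|.

Lemma Y_char_bound t z : 0 <= t ->
  `|1 - ccos P Y t z| <= t * (sre z + `|sim z|) /\ `|csin P Y t z| <= t * `|sim z|.
Proof.
move=> t0; have [-> ->] := exponent_char z Y_exponent t0.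
rewrite -/(sre z) -/(sim z); have a0 := sre_ge0 j_ge0 z.
set a := sre z in a0 *; set b := sim z; set e := expR _.
have ta : 0 <= t * a by rewrite mulr_ge0.
have e1 : e <= 1 by rewrite /e -expR0 ler_expR oppr_le0.
have e0 : 0 < e by exact: expR_gt0.
have e2 : 1 - t * a <= e by exact: expR_ge1Dx.
have h1 : `|sin (t * b)| <= t * `|b| by rewrite (le_trans (normr_sin _))// normrM ger0_norm.
have h2 : 1 - cos (t * b) <= t * `|b|.
  have := @oneBcos_le_norm R (t * b); have := oneBcos_le (t * b).
  rewrite normrM (ger0_norm t0) => A B.
  have [c|c] := leP 1 (t * `|b|); last first.
    apply: le_trans A _; rewrite -real_normK ?num_real// normrM (ger0_norm t0).
    have : 0 <= t * `|b| by rewrite mulr_ge0.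
    by move: (t * `|b|) c => v; nra.
  have [c'|c'] := leP 2 (t * `|b|); first by have := oneBcos_le2 (t * b); lra.
  apply: le_trans A _; rewrite -real_normK ?num_real// normrM (ger0_norm t0).
  by move: (t * `|b|) c c' => v; nra.
have c1 := cos_le1 (t * b); have c2 := cos_geN1 (t * b).
split; last first.
  by rewrite normrN normrM gtr0_norm//; apply: le_trans h1; rewrite ler_piMl.
rewrite ler_norml; apply/andP; split; last first.
  rewrite mulrDr; have : e * (1 - cos (t * b)) <= 1 * (1 - cos (t * b)).
    by rewrite ler_wpM2r// oneBcos_ge0.
  lra.
have : e * cos (t * b) <= 1.
  by apply: le_trans e1; rewrite ler_piMr// ltW.
have := mulr_ge0 t0 (addr_ge0 a0 (normr_ge0 b)); lra.
Qed.

Lemma ccos_norm Z t z : (measurable_fun setT (Z t : Omega -> 'rV[R]_d)) -> `|ccos P Z t z| <= 1.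
Proof.
move=> mZ; apply: ex_norm_le => [|w]; last exact: cos_max.
by apply: bmeas_cosM; exact: measurable_dotv.
Qed.

Lemma X_char_bound t z : 0 < t ->
  `|1 - ccos P X t z| <= t * Bz z /\ `|csin P X t z| <= t * Bz z.
Proof.
move=> t0; have t0' := ltW t0; have [-> ->] := X_char z t0.
have [h1 h2] := Y_char_bound z t0'.
have /andP[v0 v1] := brownian_char_bound W_brownian z t0.
have vn : `|ccos P V t z| <= 1 by apply: ccos_norm; exact: (ll_meas levy_like_V t0').
have a0 := sre_ge0 j_ge0 z.
have z0 := dotv_ge0 z.
have tz : 0 <= t * dotv z z by rewrite mulr_ge0.
split.
  rewrite (_ : 1 - _ = (1 - ccos P V t z) + ccos P V t z * (1 - ccos P Y t z)); last by ring.
  apply: le_trans (ler_normD _ _) _; rewrite (ger0_norm v0) normrM.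
  have : `|ccos P V t z| * `|1 - ccos P Y t z| <= `|1 - ccos P Y t z| by rewrite ler_piMl.
  rewrite /Bz; lra.
rewrite normrM; have : `|ccos P V t z| * `|csin P Y t z| <= `|csin P Y t z| by rewrite ler_piMl.
have := mulr_ge0 t0' a0; rewrite /Bz; lra.
Qed.

Lemma Y_char_slope z :
  (ccos P Y t z - 1) / t @[t --> 0^'+] --> - sre z /\
  csin P Y t z / t @[t --> 0^'+] --> - sim z.
Proof.
have t00 := @cvg_id_at_right R.
have tpos : \forall t \near (0 : R)^'+, 0 < t by exact: nbhs_right_gt.
set a := sre z; set b := sim z.
have cexp : expR (- a * t) @[t --> 0^'+] --> (1 : R).
  have -> : 1 = expR (- a * 0) :> R by rewrite mulr0 expR0.
  apply: continuous_cvg; first exact: continuous_expR.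
  exact: cvgMr.
have cc : (1 - cos (t * b)) / t @[t --> 0^'+] --> (0 : R).
  apply: (@squeeze_cvgr _ _ _ _ (fun=> 0) (fun t => t * (b ^+ 2 / 2))).
  - near=> t; have t0 : 0 < t by near: t.
    apply/andP; split; first by rewrite divr_ge0 ?oneBcos_ge0// ltW.
    rewrite ler_pdivrMr//.
    by apply: le_trans (oneBcos_le _) _; rewrite exprMn expr2; lra.
  - exact: cvg_cst.
  - by rewrite -[X in _ --> X](mul0r (b ^+ 2 / 2)); exact: cvgMl.
have cs : sin (t * b) / t @[t --> 0^'+] --> b.
  have h : (sin (t * b) - t * b) / t @[t --> 0^'+] --> (0 : R).
    apply: norm_cvg0.
    apply: (@squeeze_cvgr _ _ _ _ (fun=> 0) (fun t => t * (t * `|b| ^+ 3))).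
    - near=> t; have t0 : 0 < t by near: t.
      rewrite normr_ge0 /= normrM normfV (gtr0_norm t0) ler_pdivrMr//.
      apply: le_trans (subr_sin_le _) _; rewrite normrM (gtr0_norm t0) exprMn.
      by rewrite (exprS t 2) expr2; lra.
    - exact: cvg_cst.
    - have : t * (t * `|b| ^+ 3) @[t --> 0^'+] --> (0 : R) * ((0 : R) * `|b| ^+ 3).
        by apply: cvgM => //; exact: cvgMl.
      by rewrite mul0r.
  have h2 : (sin (t * b) - t * b) / t + b @[t --> 0^'+] --> 0 + b.
    by apply: cvgD => //; exact: cvg_cst.
  rewrite add0r in h2; apply: cvg_trans h2; apply: near_eq_cvg; near=> t.
  have t0 : t != 0 by rewrite gt_eqF//; near: t.
  by rewrite mulrBl mulrAC divff// mul1r subrK.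
have Ye t : 0 < t -> ccos P Y t z = expR (- a * t) * cos (t * b) /\
    csin P Y t z = - (expR (- a * t) * sin (t * b)).
  by move=> t0; have := exponent_char z Y_exponent (ltW t0); rewrite -mulNr mulNr (mulrC t a) -mulNr.
split.
  have h : (expR (- a * t) - 1) / t - expR (- a * t) * ((1 - cos (t * b)) / t) @[t --> 0^'+] -->
      - a - 1 * 0.
    apply: cvgB; first exact: expR_slope.
    exact: cvgM.
  rewrite mulr0 subr0 in h; apply: cvg_trans h; apply: near_eq_cvg; near=> t.
  have t0 : 0 < t by near: t.
  have [-> _] := Ye t t0.
  by rewrite mulrA -mulrBl; congr (_ / _); ring.
have h : - (expR (- a * t) * (sin (t * b) / t)) @[t --> 0^'+] --> - (1 * b).
  by apply: cvgN; exact: cvgM.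
rewrite mul1r in h; apply: cvg_trans h; apply: near_eq_cvg; near=> t.
have t0 : 0 < t by near: t.
have [_ ->] := Ye t t0.
by rewrite mulrA [RHS]mulNr.
Unshelve. all: by end_near. Qed.

(** The link between the process and the operator: the slope at time 0 is minus the symbol of [L],
    split into real and imaginary parts. *)
Lemma X_char_slope z :
  (ccos P X t z - 1) / t @[t --> 0^'+] --> - (dotv z z + sre z) /\
  csin P X t z / t @[t --> 0^'+] --> - sim z.
Proof.
have [c1 c2] := Y_char_slope z; have c3 := @brownian_char_slope _ _ _ _ _ _ W_brownian z.
have cV : ccos P V t z @[t --> 0^'+] --> (1 : R).
  have h : 1 - (1 - ccos P V t z) / t * t @[t --> 0^'+] --> 1 - dotv z z * 0.
    by apply: cvgB; [exact: cvg_cst|apply: cvgM => //; exact: cvg_id_at_right].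
  rewrite mulr0 subr0 in h; apply: cvg_trans h; apply: near_eq_cvg; near=> t.
  have t0 : t != 0 by rewrite gt_eqF//; near: t; exact: nbhs_right_gt.
  by rewrite divfK//; ring.
split.
  have h : - ((1 - ccos P V t z) / t) + ccos P V t z * ((ccos P Y t z - 1) / t) @[t --> 0^'+] -->
      - dotv z z + 1 * - sre z.
    by apply: cvgD; [exact: cvgN|exact: cvgM].
  rewrite mul1r -opprD in h; apply: cvg_trans h; apply: near_eq_cvg; near=> t.
  have t0 : 0 < t by near: t; exact: nbhs_right_gt.
  have [-> _] := X_char z t0.
  by rewrite mulrA -mulNr -mulrDl; congr (_ / _); ring.
have h : ccos P V t z * (csin P Y t z / t) @[t --> 0^'+] --> 1 * - sim z by exact: cvgM.
rewrite mul1r in h; apply: cvg_trans h; apply: near_eq_cvg; near=> t.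
have t0 : 0 < t by near: t; exact: nbhs_right_gt.
have [_ ->] := X_char z t0.
by rewrite mulrA.
Unshelve. all: by end_near. Qed.

End levy_sum.

(** * The semigroup *)

Section setup.
Context {R : realType} {d : nat} {dO : measure_display}
  {Omega : measurableType dO}.

Record setup (P : probability Omega R) (j : 'rV[R]_d -> R)
    (W Y : R -> Omega -> 'rV[R]_d) : Prop := Setup {
  s_jm : measurable_fun ([set~ 0] : set 'rV[R]_d) j ;
  s_j0 : forall y, y != 0 -> 0 <= j y ;
  s_jl : (\int[lebesgue_rV d]_(y in [set~ 0%R])
               (Num.min 1 (enorm y ^+ 2) * j y)%:E < +oo)%E ;
  s_W : standard_brownian P W ;
  s_Y : levy_process P Y ;
  s_Ye : has_exponent P Y (psi j) ;
  s_WY : independent_processes P (fun t => W (2 * t)) Y }.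

Variables (P : probability Omega R) (j : 'rV[R]_d -> R) (W Y : R -> Omega -> 'rV[R]_d).
Hypothesis S : setup P j W Y.
Implicit Types (z x y p : 'rV[R]_d) (t s k : R) (phi : 'rV[R]_d -> R).
Local Notation X := (Xsum W Y).

Definition Pt t phi x : R := \int[P]_w phi (x + X t w).

Lemma mX t : 0 <= t -> measurable_fun setT (X t).
Proof. exact: measurable_X (s_W S) (s_Y S) t. Qed.

Lemma measurable_shiftX t x : 0 <= t -> measurable_fun setT (fun w => x + X t w).
Proof. by move=> t0; apply: measurable_rVD => //; exact: mX. Qed.

Lemma bmeas_shiftX t x phi : 0 <= t -> bmeas phi -> bmeas (fun w => phi (x + X t w)).
Proof. by move=> t0 bp; apply: (bmeas_comp _ bp); exact: measurable_shiftX. Qed.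

Lemma bmeas_Pt t phi : 0 <= t -> bmeas phi -> bmeas (Pt t phi).
Proof.
move=> t0 bp; pose F (q : 'rV[R]_d * Omega) := phi (q.1 + X t q.2).
have bF : bmeas F.
  apply: (bmeas_comp _ bp); apply: measurable_rVD => //.
  exact: (measurableT_comp (mX t0)).
exact: (bmeas_ex2 (distribution P (mfun_of (mX t0))) P bF).
Qed.

Lemma Pt_cst t r x : Pt t (fun=> r) x = r.
Proof. exact: ex_cst. Qed.

Section linear.
Variables (t : R).
Hypothesis t0 : 0 <= t.

Lemma PtD phi psi x : bmeas phi -> bmeas psi ->
  Pt t (fun y => phi y + psi y) x = Pt t phi x + Pt t psi x.
Proof. by move=> b1 b2; apply: exD; exact: bmeas_shiftX. Qed.

Lemma PtB phi psi x : bmeas phi -> bmeas psi ->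
  Pt t (fun y => phi y - psi y) x = Pt t phi x - Pt t psi x.
Proof. by move=> b1 b2; apply: exB; exact: bmeas_shiftX. Qed.

Lemma PtZ k phi x : bmeas phi -> Pt t (fun y => k * phi y) x = k * Pt t phi x.
Proof. by move=> b1; apply: exZ; exact: bmeas_shiftX. Qed.

Lemma PtN phi x : bmeas phi -> Pt t (fun y => - phi y) x = - Pt t phi x.
Proof. by move=> b1; apply: exN; exact: bmeas_shiftX. Qed.

Lemma Pt_sum I (r : seq I) (F : I -> 'rV[R]_d -> R) x : (forall i, bmeas (F i)) ->
  Pt t (fun y => \sum_(i <- r) F i y) x = \sum_(i <- r) Pt t (F i) x.
Proof. by move=> bF; apply: ex_sum => i; exact: bmeas_shiftX. Qed.

Lemma Pt_le phi psi x : bmeas phi -> bmeas psi -> (forall y, phi y <= psi y) ->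
  Pt t phi x <= Pt t psi x.
Proof. by move=> b1 b2 h; apply: ex_le => //; exact: bmeas_shiftX. Qed.

Lemma Pt_ge0 phi x : (forall y, 0 <= phi y) -> 0 <= Pt t phi x.
Proof. by move=> h; exact: ex_ge0. Qed.

Lemma Pt_norm phi x : bmeas phi -> `|Pt t phi x| <= Pt t (fun y => `|phi y|) x.
Proof. by move=> b1; apply: ex_norm; exact: bmeas_shiftX. Qed.

Lemma Pt_dct (f_ : nat -> 'rV[R]_d -> R) phi (M : R) x : (forall n, bmeas (f_ n)) ->
  (forall n y, `|f_ n y| <= M) -> (forall y, f_ n y @[n --> \oo] --> phi y) ->
  Pt t (f_ n) x @[n --> \oo] --> Pt t phi x.
Proof.
by move=> bf fM cf; apply: (ex_dct (M := M)) => // n; exact: bmeas_shiftX.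
Qed.

End linear.

Lemma eq_Pt t phi psi x : (forall y, phi y = psi y) -> Pt t phi x = Pt t psi x.
Proof. by move=> h; apply: eq_Rintegral => w _; rewrite h. Qed.

Lemma Pt_shift t phi z x : Pt t (fun y => phi (y + z)) x = Pt t phi (x + z).
Proof. by apply: eq_Rintegral => w _; rewrite addrAC. Qed.

Lemma X0_ae : {ae P, forall w, X 0 w = 0}.
Proof.
have [[_ W0 _ _ _] _ _] := s_W S; have [_ Y0 _ _ _] := s_Y S.
by apply: filterS2 W0 Y0 => w; rewrite /Xsum /psum mulr0 => -> ->; rewrite addr0.
Qed.

Lemma ex_ae_eq (F G : Omega -> R) : bmeas F -> bmeas G -> {ae P, forall w, F w = G w} ->
  \int[P]_w F w = \int[P]_w G w.
Proof.
move=> bF bG FG; rewrite /Rintegral; congr fine; apply: ae_eq_integral => //.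
- by apply/measurable_EFinP; case: bF.
- by apply/measurable_EFinP; case: bG.
- by apply: filterS FG => w -> _.
Qed.

Let levyV := levy_like_V (s_W S).
Let levyY := levy_like_Y (s_Y S).

(** [markov_step] applied to the position measured from [X (tt 0%N)]; both sides are then corrected
    on the null set where [X 0] is not 0. *)
Lemma markov tt (k : nat) (H : set Omega) phi x : grid tt -> tt 0%N = 0 ->
  past (fun t => W (2 * t)) Y tt k H -> bmeas phi ->
  \int[P]_w (\1_H w * phi (x + X (tt k.+1) w)) =
  \int[P]_w (\1_H w * Pt (tt k.+1 - tt k) phi (x + X (tt k) w)).
Proof.
move=> gt t00 pH bp.
have mH : measurable H by exact: (past_measurable levyV levyY gt pH).
have k0 := grid_ge0 k gt; have k1 := grid_ge0 k.+1 gt.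
pose G := g_sigma_algebraType (past_gen (fun t => W (2 * t)) Y tt k).
pose inc (w : G) : 'rV[R]_d := X (tt k) w - X (tt 0%N) w.
have minc : @measurable_fun _ _ G _ setT inc by exact: (past_meas_incr gt (leqnn k)).
pose F (q : G * 'rV[R]_d) : R := \1_(H : set G) q.1 * phi (x + inc q.1 + q.2).
have bH : @bmeas _ (G * 'rV[R]_d)%type R (fun q => \1_(H : set G) q.1).
  apply: (@bmeas_comp _ _ G (G * 'rV[R]_d)%type R fst (\1_(H : set G))) => //.
  exact: bmeas_indic.
have bF : bmeas F.
  apply: bmeasM => //; apply: (bmeas_comp _ bp); apply: measurable_rVD => //.
  apply: measurable_rVD => //; exact: (measurableT_comp minc).
have X00 := X0_ae.
have ae1 (t : R) : 0 <= t -> {ae P, forall w, X t w - X (tt 0%N) w = X t w}.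
  by move=> _; apply: filterS X00 => w; rewrite t00 => ->; rewrite subr0.
have bi : bmeas (\1_H : Omega -> R) by exact: bmeas_indic.
have mXk := mX k0; have mXk1 := mX k1; have mX0 := mX (grid_ge0 0 gt).
transitivity (\int[P]_w F (w, incr X tt k w)).
  apply: ex_ae_eq.
  - by apply: bmeasM => //; exact: bmeas_shiftX.
  - apply: (@bmeasM _ Omega) => //; apply: (bmeas_comp _ bp).
    apply: measurable_rVD; last exact: measurable_rVB.
    by apply: measurable_rVD => //; exact: measurable_rVB.
  - apply: filterS (ae1 _ k0) => w h; rewrite /F /= /inc h.
    by congr (_ * phi _); rewrite -addrA; congr (_ + _); rewrite /incr addrC subrK.
rewrite (markov_step levyV levyY (s_WY S) gt bF).
apply: ex_ae_eq.
- have tk0 : 0 <= tt k.+1 - tt k by rewrite subr_ge0; exact: gt.2.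
  pose F' (q : Omega * Omega) := \1_H q.1 *
    phi (x + (X (tt k) q.1 - X (tt 0%N) q.1) + X (tt k.+1 - tt k) q.2).
  suff bF' : bmeas F' by exact: (bmeas_ex2 P P bF').
  apply: bmeasM; first exact: (bmeas_comp measurable_fst bi).
  apply: (bmeas_comp _ bp); apply: measurable_rVD; last exact: (measurableT_comp (mX tk0)).
  apply: measurable_rVD => //; apply: measurable_rVB.
    exact: (measurableT_comp mXk measurable_fst).
  exact: (measurableT_comp mX0 measurable_fst).
- apply: bmeasM => //; apply: bmeas_shiftX => //; apply: bmeas_Pt => //.
  by rewrite subr_ge0; exact: gt.2.
- apply: filterS (ae1 _ k0) => w h; rewrite /F /= /inc h.
  rewrite exZ//; apply: bmeas_shiftX => //.
  by rewrite subr_ge0; exact: gt.2.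
Qed.

Lemma Pt_semigroup s t phi x : 0 <= s -> 0 <= t -> bmeas phi ->
  Pt s (Pt t phi) x = Pt (s + t) phi x.
Proof.
move=> s0 t0 bp.
(* A grid with the two steps [s] and [t], constant afterwards, and the sure event as the past
   event. *)
pose tt (n : nat) : R := if n is 0 then 0 else if n is 1 then s else s + t.
have gt : grid tt.
  split => // -[|[|n]] //=; first by rewrite lerDl.
have pT : past (fun t => W (2 * t)) Y tt 1 setT.
  by exact: (@measurableT _ (g_sigma_algebraType (past_gen (fun t => W (2 * t)) Y tt 1))).
have := markov x gt erefl pT bp.
rewrite (_ : tt 2 - tt 1 = t); last by rewrite /= addrC addKr.
under eq_Rintegral do rewrite indicT mul1r.
under [in X in _ = X -> _]eq_Rintegral do rewrite indicT mul1r.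
by rewrite /Pt => ->.
Qed.

Local Notation cc := (ccos P X).
Local Notation cs := (csin P X).

Lemma bmeas_cosz z (a : R) : bmeas (fun y : 'rV[R]_d => cos (dotv z y + a)).
Proof. by apply: bmeas_cosM; apply: measurable_funD => //; exact: measurable_dot. Qed.

Lemma Pt_cos t z (a : R) x : 0 <= t ->
  Pt t (fun y => cos (dotv z y + a)) x =
  cos (dotv z x + a) * cc t z - sin (dotv z x + a) * cs t z.
Proof.
move=> t0; have mXt := measurable_dotv z (mX t0).
have bc := bmeas_cosM mXt; have bs := bmeas_sinM mXt.
rewrite -exZ// -exZ// -exB; [|exact: bmeasZ|exact: bmeasZ].
by rewrite /Pt; apply: eq_Rintegral => w _; rewrite dotvDr addrAC (cosD (_ + _)).
Qed.

(** A bound on the symbol of [X] at frequencies at most [k] on the coordinate axes, where 3 comes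
    from the Gaussian bound. [DD k] bounds the drift of [Th k p] per unit time: each of the [d]
    coordinates contributes a cosine and a sine term. *)
Definition Bk k : R := 3 * k ^+ 2 + Hmod j (d%:R * k).
Definition DD k : R := 2 * d%:R * Bk k.

Lemma Bk_ge0 k : 0 <= k -> 0 <= Bk k.
Proof.
move=> k0; apply: addr_ge0; first by rewrite mulr_ge0// sqr_ge0.
by apply: (Hmod_ge0 (s_j0 S)); rewrite mulr_ge0.
Qed.

Lemma Bz_ebasis i s k : 0 <= s <= k -> Bz j (s *: ebasis i) <= Bk k.
Proof.
move=> /andP[s0 sk]; rewrite /Bz /Bk -addrA lerD//.
  rewrite dotv_ebasis !mxE !eqxx mulr1 -expr2 ler_pM2l// ler_pXn2r// nnegrE//.
  exact: le_trans sk.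
apply: (symbol_le_Hmod (s_jm S) (s_j0 S) (s_jl S)).
rewrite ler_wpM2l// normrZ (ger0_norm s0) -[leRHS]mulr1 ler_pM//.
by apply: norm_le_coord => // l; rewrite !mxE eqxx/=; case: eqP => _; rewrite ?normr1 ?normr0.
Qed.

Lemma X_char_coord t i s k : 0 < t -> 0 <= s <= k ->
  `|1 - cc t (s *: ebasis i)| <= t * Bk k /\ `|cs t (s *: ebasis i)| <= t * Bk k.
Proof.
move=> t0 sk.
have [h1 h2] := X_char_bound (s_j0 S) (s_W S) (s_Y S) (s_Ye S) (s_WY S) (s *: ebasis i) t0.
have h : t * Bz j (s *: ebasis i) <= t * Bk k by rewrite ler_pM2l// Bz_ebasis.
by split; [apply: le_trans h1 h|apply: le_trans h2 h].
Qed.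

Lemma X_tail t k : 0 < t -> 0 < k ->
  fine (P [set w | k^-1 <= `|X t w|]) <= d%:R * (t * Bk k) / thc.
Proof.
move=> t0 k0; apply: tail_le => //; first exact: (mX (ltW t0)).
by move=> i s sk; have [] := X_char_coord i t0 sk.
Qed.

(** [Th] is an average over [s] of cosines of frequency [s * k] along the axes, and the semigroup
    changes each of them by at most [2 * t * Bk k], whatever the point [x]. *)
Lemma Th_drift t k p x : 0 < t -> 0 <= k ->
  `|Pt t (Th k p) x - Th k p x| <= t * DD k.
Proof.
move=> t0 k0; have t0' := ltW t0.
pose G i y : R := th (k * (y 0 i - p 0 i)).
have bG i : bmeas (G i).
  apply: bmeas_th_comp; apply: measurable_funM => //; apply: measurable_funB => //.
  exact: measurable_coord.
have -> : Pt t (Th k p) x = \sum_(i <- index_enum 'I_d) Pt t (G i) x.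
  exact: (Pt_sum t0' (index_enum 'I_d) x bG).
rewrite /Th -sumrB; apply: le_trans (ler_norm_sum _ _ _) _.
rewrite (_ : t * DD k = \sum_(i < d) (2 * (t * Bk k))); last first.
  by rewrite sumr_const card_ord -mulr_natl /DD; ring.
apply: ler_sum => i _.
pose F (q : Omega * measurableTypeR R) : R :=
  1 - cos (q.2 * (k * ((x + X t q.1) 0 i - p 0 i))).
have mF : measurable_fun setT (fun q : Omega * measurableTypeR R =>
    q.2 * (k * ((x + X t q.1) 0 i - p 0 i))).
  apply: measurable_funM => //; apply: measurable_funM => //; apply: measurable_funB => //.
  exact: (measurableT_comp (measurable_fun_coord i (measurable_shiftX x t0')) measurable_fst).
have bF : bmeas F by apply: (bmeasB (bmeas_cst 1)); exact: bmeas_cosM.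
have -> : Pt t (G i) x = \int[U01]_s \int[P]_w F (w, s) by rewrite -(ex_fubini P U01 bF).
rewrite -(exB U01 (bmeas_ex1 P U01 bF) (bmeas_th_kernel _)).
apply: U01_norm_le.
  by apply: bmeasB; [exact: (bmeas_ex1 P U01 bF)|exact: bmeas_th_kernel].
move=> s /andP[s0 s1].
pose z := (s * k) *: ebasis i : 'rV[R]_d; pose a := - (s * k * p 0 i).
have -> : \int[P]_w F (w, s) = 1 - Pt t (fun y => cos (dotv z y + a)) x.
  rewrite -(Pt_cst t 1 x) -(PtB t0' x (bmeas_cst 1) (bmeas_cosz z a)).
  apply: eq_Rintegral => w _; rewrite /F /z /a dotv_ebasis /=; congr (1 - cos _).
  by ring.
rewrite (_ : cos (s * (k * (x 0 i - p 0 i))) = cos (dotv z x + a)); last first.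
  by rewrite /z /a dotv_ebasis; congr cos; ring.
rewrite Pt_cos//.
have sk : 0 <= s * k <= k by rewrite mulr_ge0//= ler_piMl.
have [h1 h2] := X_char_coord i t0 sk.
rewrite (_ : _ - _ = cos (dotv z x + a) * (1 - cc t z) + sin (dotv z x + a) * cs t z); last by ring.
apply: le_trans (ler_normD _ _) _; rewrite !normrM.
have c1 := cos_max (dotv z x + a); have c2 := sin_max (dotv z x + a).
rewrite mulr_natl mulr2n lerD// -[leRHS]mul1r; apply: ler_pM => //.
Qed.

Lemma Bk_cvg0 (e : R) : 0 < e -> exists2 k : R, 0 < k & forall k', 0 <= k' <= k -> Bk k' <= e.
Proof.
move=> e0; have e2 : 0 < e / 2 by rewrite divr_gt0.
have [k1 k10 h1] := Hmod_cvg0 (s_jm S) (s_j0 S) (s_jl S) e2.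
have d1 : 0 < d%:R + 1 :> R by rewrite ltr_wpDl.
have e6 : 0 < Num.min 1 (e / 6) by rewrite lt_min ltr01 divr_gt0.
exists (Num.min (k1 / (d%:R + 1)) (Num.min 1 (e / 6))).
  by rewrite lt_min e6 andbT divr_gt0.
move=> k' /andP[k'0]; rewrite le_min => /andP[a]; rewrite le_min => /andP[b c].
have h2 : Hmod j (d%:R * k') <= e / 2.
  apply: h1; rewrite mulr_ge0//=.
  move: a; rewrite ler_pdivlMr// => a; apply: le_trans a.
  by rewrite mulrC ler_wpM2l// lerDl.
have : k' ^+ 2 <= k' by rewrite expr2 ler_piMl.
rewrite /Bk; lra.
Qed.

(** For [k] of order [1 / sqrt t] the product [t * Bk k] stays bounded for small [t]: at most
    diffusive scaling, as needed for the tail of [X_t] in [exit_small]. *)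
Lemma Bk_quad : exists2 C : R, 0 < C & forall k, 0 <= k -> Bk k <= C * (1 + k ^+ 2).
Proof.
have [k1 k10 h1] := Hmod_little_sqr (s_jm S) (s_j0 S) (s_jl S) (@ltr01 R).
exists (3 + d%:R ^+ 2 + Hmod j k1).
  by rewrite ltr_wpDr ?(Hmod_ge0 (s_j0 S)) ?ltW// ltr_wpDr// sqr_ge0.
move=> k k0; have H0 := Hmod_ge0 (s_j0 S) (ltW k10).
have d2 : 0 <= d%:R ^+ 2 :> R by exact: sqr_ge0.
have k2 : 0 <= k ^+ 2 by exact: sqr_ge0.
have hk : Hmod j (d%:R * k) <= d%:R ^+ 2 * k ^+ 2 + Hmod j k1.
  have [c|c] := leP k1 (d%:R * k).
    by apply: le_trans (h1 _ c) _; rewrite mul1r exprMn lerDl.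
  apply: (@le_trans _ _ (Hmod j k1)); last by rewrite lerDr mulr_ge0.
  apply: (Hmod_homo (s_jm S) (s_j0 S) (s_jl S)) => //; last exact: ltW.
  by rewrite mulr_ge0.
by rewrite /Bk; nra.
Qed.

End setup.

(** * Trigonometric polynomials and the barrier *)

Lemma cvgn_le (R : realType) (u : nat -> R) (l a : R) :
  u n @[n --> \oo] --> l -> (forall n, u n <= a) -> l <= a.
Proof.
move=> c h; rewrite -(cvg_lim (@norm_hausdorff _ _) c).
by apply: limr_le; [exact: cvgP c|exact: nearW].
Qed.

Lemma cvgn_norm_le (R : realType) (u : nat -> R) (l a : R) :
  u n @[n --> \oo] --> l -> (forall n, `|u n| <= a) -> `|l| <= a.
Proof. by move=> /cvg_norm c h; exact: (cvgn_le c). Qed.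

Section trig.
Context {R : realType} {d : nat} {dO : measure_display}
  {Omega : measurableType dO}.
Variables (P : probability Omega R) (j : 'rV[R]_d -> R) (W Y : R -> Omega -> 'rV[R]_d).
Hypothesis S : setup P j W Y.
Implicit Types (z x y p : 'rV[R]_d) (t s k r : R) (phi : 'rV[R]_d -> R).
Implicit Types l : seq (R * 'rV[R]_d * R).
Local Notation X := (Xsum W Y).
Local Notation Pt := (Pt P W Y).
Local Notation sre := (sre j).
Local Notation sim := (sim j).

Definition tp l x : R := \sum_(q <- l) q.1.1 * cos (dotv q.1.2 x + q.2).

(** The value of [L_op] on [tp l] ([L_op_tp]), and also the generator of the semigroup there
    ([tp_generator]). In both lists the triples are coefficient, frequency and phase. *)
Definition Lt l x : R := \sum_(q <- l) q.1.1 *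
  (- (dotv q.1.2 q.1.2 + sre q.1.2) * cos (dotv q.1.2 x + q.2) +
   sim q.1.2 * sin (dotv q.1.2 x + q.2)).

Lemma bmeas_tp l : bmeas (tp l).
Proof.
apply: (@bmeas_sum _ _ R _ l (fun q x => q.1.1 * cos (dotv q.1.2 x + q.2))) => q.
by apply: bmeasZ; exact: bmeas_cosz.
Qed.

Lemma tp_cons q l x : tp (q :: l) x = q.1.1 * cos (dotv q.1.2 x + q.2) + tp l x.
Proof. by rewrite /tp big_cons. Qed.

(** Uniformity in [x] is automatic: [x] enters only through a bounded cosine and sine, while the
    time dependence sits in the characteristic function. *)
Lemma tp_generator l (e : R) : 0 < e ->
  \forall t \near 0^'+, forall x, `|Pt t (tp l) x - tp l x - t * Lt l x| <= t * e.
Proof.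
elim: l e => [|[[c z] a] l IH] e e0.
  near=> t => x; have t0 : 0 < t by near: t; exact: nbhs_right_gt.
  rewrite (_ : Pt t (tp [::]) x = 0); last first.
    by rewrite -(Pt_cst P W Y t 0 x); apply: eq_Pt => y; rewrite /tp big_nil.
  by rewrite /tp /Lt !big_nil mulr0 !subr0 normr0 mulr_ge0// ltW.
have e2 : 0 < e / 2 by rewrite divr_gt0.
pose c' := `|c| + 1; have c'0 : 0 < c' by rewrite ltr_wpDl.
have e4 : 0 < e / 4 / c' by rewrite !divr_gt0.
have [h1 h2] := X_char_slope (s_W S) (s_Y S) (s_Ye S) (s_WY S) z.
move/cvgrPdist_le: h1 => /(_ _ e4) h1; move/cvgrPdist_le: h2 => /(_ _ e4) h2.
have {}IH := IH _ e2.
near=> t => x.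
have t0 : 0 < t by near: t; exact: nbhs_right_gt.
have t0' := ltW t0.
have A1 : `|- (dotv z z + sre z) - (ccos P X t z - 1) / t| <= e / 4 / c' by near: t.
have A2 : `|- sim z - csin P X t z / t| <= e / 4 / c' by near: t.
have A3 : forall x, `|Pt t (tp l) x - tp l x - t * Lt l x| <= t * (e / 2) by near: t.
rewrite (_ : Pt t (tp ((c, z, a) :: l)) x =
    c * Pt t (fun y => cos (dotv z y + a)) x + Pt t (tp l) x); last first.
  rewrite -(PtZ S t0' c x (bmeas_cosz z a)) -(PtD S t0' x (bmeasZ c (bmeas_cosz z a)) (bmeas_tp l)).
  by apply: eq_Pt => y; rewrite tp_cons.
rewrite (Pt_cos S)// tp_cons /Lt big_cons -/(Lt l x) /=.
set u := dotv z x + a; set A := ccos P X t z in A1 *; set B := csin P X t z in A2 *.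
set G := - _ in A1 *.
rewrite (_ : _ - t * _ = t * (c * (sin u * (- sim z - B / t) * -1 * -1 - cos u * (G - (A - 1) / t))) +
   (Pt t (tp l) x - tp l x - t * Lt l x)); last first.
  by field; rewrite gt_eqF.
apply: le_trans (ler_normD _ _) _.
rewrite (splitr e) [leRHS]mulrDr; apply: lerD => //.
rewrite normrM gtr0_norm// ler_pM2l// normrM.
have s1 := sin_max u; have c1 := cos_max u.
have B1 : `|sin u * (- sim z - B / t) * -1 * -1 - cos u * (G - (A - 1) / t)| <= e / 4 / c' + e / 4 / c'.
  apply: le_trans (ler_normB _ _) _; rewrite !normrM normrN1 !mulr1; apply: lerD.
    by rewrite -[leRHS]mul1r; apply: ler_pM.
  by rewrite -[leRHS]mul1r; apply: ler_pM.
apply: (@le_trans _ _ (c' * (e / 4 / c' + e / 4 / c'))).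
  by apply: ler_pM => //; rewrite /c' lerDl.
rewrite le_eqVlt; apply/orP; left; apply/eqP; field; by rewrite gt_eqF.
Unshelve. all: by end_near. Qed.

Lemma dot0v x : dotv 0 x = 0.
Proof. by rewrite /dotv big1// => i _; rewrite mxE mul0r. Qed.

Lemma sre0 : sre 0 = 0.
Proof.
by rewrite sreE -[RHS](jint0 j); apply: eq_Rintegral => y _; rewrite dot0v cos0 subrr.
Qed.

Lemma sim0 : sim 0 = 0.
Proof.
rewrite simE -[RHS](jint0 j); apply: eq_Rintegral => y _.
by rewrite /comp1 dot0v mulr0 sin0 subrr.
Qed.

(* [A cos s + B sin s] is the phase shift of [cos s] for which the generator
   produces [- (A^2 + B^2) cos s], where [A + iB] is the symbol at the frequency. *)
Lemma barrier_exists (i : 'I_d) r : 0 < r -> exists l (M : R),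
  (forall x, 1 <= tp l x <= M) /\ forall x, `|x| <= r -> Lt l x <= - 2.
Proof.
move=> r0; pose zeta := (r + 1)^-1; have z0 : 0 < zeta by rewrite invr_gt0 addr_gt0.
pose z := zeta *: ebasis i : 'rV[R]_d.
pose A := dotv z z + sre z; pose B := sim z.
have A0 : 0 < A.
  rewrite /A ltr_pwDl ?(sre_ge0 (s_j0 S))// dotv_ebasis !mxE !eqxx mulr1.
  by rewrite mulr_gt0.
pose T := A + `|B|; have T0 : 0 < T by rewrite ltr_pwDl.
pose N2 := A ^+ 2 + B ^+ 2; have N20 : 0 < N2 by rewrite ltr_pwDl ?sqr_ge0// exprn_gt0.
(* With the frequency 1 / (r + 1) the argument of the cosine stays in [-1, 1] on the ball, so the
   cosine is at least 1/2. Dividing by [K] gives [tp >= 1] because [K <= 2 * T], and [Lt <= - 2]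
   because [K <= N2 / 4]. *)
pose K := Num.min (2 * T) (N2 / 4); have K0 : 0 < K by rewrite lt_min mulr_gt0// divr_gt0.
have [K1 K2] : K <= 2 * T /\ K <= N2 / 4 by split; rewrite ge_min lexx ?orbT.
exists [:: (3 * T / K, 0, 0); (A / K, z, 0); (B / K, z, - (pi / 2))], (4 * T / K).
have tpE x : tp [:: (3 * T / K, 0, 0); (A / K, z, 0); (B / K, z, - (pi / 2))] x =
    (3 * T + (A * cos (dotv z x) + B * sin (dotv z x))) / K.
  rewrite /tp !big_cons big_nil /= !addr0 cosBpihalf.
  by rewrite dot0v cos0; field; rewrite gt_eqF.
split=> x.
  have h : `|A * cos (dotv z x) + B * sin (dotv z x)| <= T.
    apply: le_trans (ler_normD _ _) _; rewrite !normrM (gtr0_norm A0); apply: lerD.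
      by rewrite ler_piMr// ?cos_max// ltW.
    by rewrite ler_piMr// sin_max.
  move: h; rewrite ler_norml => /andP[h1 h2].
  rewrite tpE ler_pdivlMr// mul1r ler_pM2r ?invr_gt0//; apply/andP; split; lra.
move=> xr; rewrite /Lt !big_cons big_nil /= !addr0 sre0 sim0 cosBpihalf sinBpihalf.
rewrite !dot0v -/A -/B.
set s := dotv z x.
rewrite addr0 oppr0 !mul0r addr0 mulr0 add0r.
have -> : A / K * (- A * cos s + B * sin s) + B / K * (- A * sin s + B * - cos s) =
    - (N2 * cos s) / K by rewrite /N2; ring.
have cs : 1 / 2 <= cos s.
  have s1 : `|s| <= 1.
    rewrite /s dotv_ebasis normrM gtr0_norm// /zeta -ler_pdivlMl ?invr_gt0 ?addr_gt0// invrK mulr1.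
    by apply: le_trans (coord_le_norm x i) _; apply: le_trans xr _; rewrite lerDl.
  have := oneBcos_le s; rewrite -real_normK ?num_real//.
  have : `|s| ^+ 2 <= 1 by rewrite expr_le1.
  by lra.
rewrite mulNr lerN2 ler_pdivlMr//.
have : N2 * (1 / 2) <= N2 * cos s by rewrite ler_pM2l.
lra.
Qed.

(* [b_drift] is what makes the discrete exit times from the ball integrable. *)
Record barrier r (beta : 'rV[R]_d -> R) (M t0 : R) : Prop := Barrier {
  b_bm : bmeas beta ;
  b_ge1 : forall x, 1 <= beta x ;
  b_leM : forall x, beta x <= M ;
  b_t0 : 0 < t0 <= 1 ;
  b_drift : forall t x, 0 < t <= t0 -> `|x| <= r -> Pt t beta x <= beta x - t }.

Lemma tp_barrier r l (M : R) : (forall x, 1 <= tp l x <= M) ->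
  (forall x, `|x| <= r -> Lt l x <= - 2) -> exists t0, barrier r (tp l) M t0.
Proof.
move=> h1 h2; have [e /= e0 he] := tp_generator l (@ltr01 R).
exists (Num.min 1 (e / 2)); split.
- exact: bmeas_tp.
- by move=> x; have /andP[] := h1 x.
- by move=> x; have /andP[] := h1 x.
- by rewrite lt_min ltr01 divr_gt0//= ge_min lexx.
- move=> t x /andP[t0]; rewrite le_min => /andP[_ te] xr.
  have := he t _ t0 x; rewrite /= sub0r normrN gtr0_norm// => /(_ _)/wrap[].
    by apply: le_lt_trans te _; rewrite ltr_pdivrMr// ltr_pMr// ltrDl.
  rewrite ler_norml => /andP[_]; have := h2 x xr.
  by rewrite -(ler_pM2l t0); lra.
Qed.

(** * Discrete maximum principle and Dirichlet problem *)

Section discrete.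
Variables (r M t0 h : R) (beta : 'rV[R]_d -> R).
Hypothesis bb : barrier r beta M t0.
Hypothesis h0 : 0 < h <= t0.

Let hp : 0 < h. Proof. by case/andP: h0. Qed.
Let h1 : h <= 1.
Proof. by case/andP: h0 => _ /le_trans; apply; case/andP: (b_t0 bb). Qed.
Let M1 : 1 <= M. Proof. exact: le_trans (b_ge1 bb 0) (b_leM bb 0). Qed.
Let bpos x : 0 < beta x. Proof. exact: lt_le_trans ltr01 (b_ge1 bb x). Qed.

(** The barrier contracts: [Pt h beta <= beta - h <= (1 - h / M) * beta] in the ball. Iterating the
    hypothesis bounds [w] by [K * (1 - h / M) ^+ n * beta] for every [n]. *)
Lemma max_principle (A : set 'rV[R]_d) w : (forall x, A x -> `|x| <= r) -> bmeas w ->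
  (forall x, ~ A x -> w x <= 0) -> (forall x, A x -> w x <= Pt h w x) ->
  forall x, w x <= 0.
Proof.
move=> Ar bw w0 wP; have [K K0 wK] := bmeas_bound bw.
have bm := b_bm bb.
have M0 : 0 < M by exact: lt_le_trans ltr01 M1.
pose q := 1 - h / M.
have hM : 0 < h / M <= 1.
  by rewrite divr_gt0//= ler_pdivrMr// mul1r; exact: le_trans h1 M1.
have q0 : 0 <= q by rewrite /q; lra.
have step n x : w x <= K * q ^+ n * beta x.
  elim: n x => [|n IH] x.
    rewrite expr0 mulr1; apply: le_trans (le_trans (ler_norm _) (wK x)) _.
    by rewrite -[leLHS]mulr1 ler_wpM2l// (b_ge1 bb).
  have Kq : 0 <= K * q ^+ n by rewrite mulr_ge0// exprn_ge0.
  have [Ax|nAx] := pselect (A x); last first.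
    by apply: le_trans (w0 x nAx) _; rewrite mulr_ge0// ?mulr_ge0// ?exprn_ge0// ltW.
  apply: le_trans (wP x Ax) _.
  apply: (@le_trans _ _ (K * q ^+ n * Pt h beta x)).
    rewrite -(PtZ S (ltW hp))//; apply: (Pt_le S (ltW hp)) => //; exact: bmeasZ.
  rewrite exprSr -!mulrA ler_wpM2l//; rewrite mulrA -mulrA; first by rewrite ler_wpM2l ?exprn_ge0//; apply: le_trans (b_drift bb h0 (Ar _ Ax)) _;
    rewrite /q mulrBl mul1r lerB// mulrAC ler_pdivrMr// ler_pM2l// (b_leM bb).
move=> x; apply/ler_addgt0Pl => e e0; rewrite addr0.
have c : K * q ^+ n * beta x @[n --> \oo] --> K * 0 * beta x.
  apply: cvgMl; apply: cvgMr; apply: cvg_expr.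
  by rewrite ger0_norm// /q; lra.
rewrite mulr0 mul0r in c.
have /cvgrPdist_le/(_ _ e0)[n _ /(_ n (leqnn n))] := c.
rewrite /= sub0r normrN => /(le_trans (ler_norm _)); exact: le_trans (step n x).
Qed.

Section dirichlet.
Variables (D : set 'rV[R]_d) (f g : 'rV[R]_d -> R).
Hypotheses (mD : measurable D) (Dr : forall x, D x -> `|x| <= r).
Hypotheses (bf : bmeas f) (bg : bmeas g).

(** Monotone iteration of the one-step operator from the subsolution [- K * beta]; the iterates
    increase and stay below the supersolution [K * beta], and dominated convergence lets the
    semigroup pass to the limit. *)
Lemma discrete_dirichlet (K : R) : (forall x, `|f x| <= K) -> (forall x, `|g x| <= K) ->
  exists V, [/\ bmeas V, forall x, D x -> V x = h * f x + Pt h V x,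
    forall x, ~ D x -> V x = g x & forall x, `|V x| <= K * M].
Proof.
move=> fK gK; have K0 : 0 <= K by exact: le_trans (normr_ge0 _) (fK 0).
have bm := b_bm bb; have hp' := ltW hp.
pose T V x := \1_D x * (h * f x + Pt h V x) + \1_(~` D) x * g x.
have TD V x : D x -> T V x = h * f x + Pt h V x.
  by move=> Dx; rewrite /T !indicE mem_set// memNset ?mul1r ?mul0r ?addr0//=; exact.
have TN V x : ~ D x -> T V x = g x.
  by move=> Dx; rewrite /T !indicE memNset// mem_set// ?mul1r ?mul0r ?add0r.
have bT V : bmeas V -> bmeas (T V).
  move=> bV; apply: bmeasD; apply: bmeasM => //.
  - exact: bmeas_indic.
  - by apply: bmeasD; [exact: bmeasZ|exact: (bmeas_Pt S)].
  - by apply: bmeas_indic; exact: measurableC.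
have Tle V V' : bmeas V -> bmeas V' -> (forall x, V x <= V' x) -> forall x, T V x <= T V' x.
  move=> b1 b2 le x; have [Dx|Dx] := pselect (D x); last by rewrite !TN.
  by rewrite !TD// lerD2l; exact: (Pt_le S).
pose V0 x := - (K * beta x); have bV0 : bmeas V0 by apply: bmeasN; exact: bmeasZ.
pose V_ n := iter n T V0.
have bV n : bmeas (V_ n) by elim: n => // n; exact: bT.
have fx x := fK x; have Kb x : K <= K * beta x.
  by rewrite -[leLHS]mulr1 ler_wpM2l// (b_ge1 bb).
have V01 x : V0 x <= T V0 x.
  have := fK x; have := gK x; rewrite !ler_norml => /andP[g1 g2] /andP[f1 f2].
  have [Dx|Dx] := pselect (D x); last by rewrite TN// /V0; have := Kb x; lra.
  rewrite TD// /V0 (PtN S)//; last exact: bmeasZ.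
  rewrite (PtZ S)//; have := b_drift bb h0 (Dr Dx).
  move/(ler_wpM2l K0); have : h * - K <= h * f x by rewrite ler_pM2l.
  lra.
have Vinc n x : V_ n x <= V_ n.+1 x.
  by elim: n x => [|n IH] x; [exact: V01|exact: (Tle _ _ (bV n) (bV n.+1))].
have Vub n x : V_ n x <= K * beta x.
  elim: n x => [|n IH] x /=.
    by rewrite /V0; have := Kb x; lra.
  have := fK x; have := gK x; rewrite !ler_norml => /andP[g1 g2] /andP[f1 f2].
  have [Dx|Dx] := pselect (D x); last by rewrite TN//; have := Kb x; lra.
  rewrite TD//; have b2 : bmeas (fun x => K * beta x) by exact: bmeasZ.
  have := Pt_le S hp' x (bV n) b2 IH; rewrite (PtZ S)//.
  have := b_drift bb h0 (Dr Dx); move/(ler_wpM2l K0).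
  have : h * f x <= h * K by rewrite ler_pM2l.
  lra.
have Vlb n x : - (K * beta x) <= V_ n x.
  by elim: n => [|n IH]; [exact: lexx|exact: le_trans IH (Vinc n x)].
have Vnorm n x : `|V_ n x| <= K * M.
  apply: (@le_trans _ _ (K * beta x)); first by rewrite ler_norml Vlb Vub.
  by rewrite ler_wpM2l// (b_leM bb).
have cV x : cvgn (V_ ^~ x).
  apply: nondecreasing_is_cvgn.
    by apply/nondecreasing_seqP => n; exact: Vinc.
  by exists (K * beta x) => _ [n _ <-]; exact: Vub.
pose V x : R := limn (V_ ^~ x).
have cV' x : V_ n x @[n --> \oo] --> V x by exact: cV.
have bVV : bmeas V by exact: (bmeas_cvg bV Vnorm cV').
have cS x : V_ n.+1 x @[n --> \oo] --> V x by rewrite (cvg_shiftS (V_ ^~ x)).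
exists V; split => //.
- move=> x Dx; rewrite -(cvg_lim (@norm_hausdorff _ _) (cS x)); apply: cvg_lim.
    exact: norm_hausdorff.
  have c : Pt h (V_ n) x @[n --> \oo] --> Pt h V x by apply: (Pt_dct S hp' (M := K * M)).
  under eq_fun do rewrite [V_ _ _]TD//.
  by apply: cvgD; [exact: cvg_cst|exact: c].
- move=> x Dx; rewrite -(cvg_lim (@norm_hausdorff _ _) (cS x)); apply: cvg_lim.
    exact: norm_hausdorff.
  by under eq_fun do rewrite [V_ _ _]TN//; exact: cvg_cst.
- by move=> x; exact: (cvgn_norm_le (cV' x) (Vnorm^~ x)).
Qed.

End dirichlet.
End discrete.
End trig.

(** * The exit time near the boundary *)

Section gaussian_lower.
Context {R : realType}.
Implicit Types (s a L : R).

(** On an interval of length [2 * s] the density is at least its peak, of order [1 / s], times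
    [expR (- L^2 / 2)]; the product does not depend on [s], as Brownian scaling predicts. *)
Lemma normal_interval_lower s a L : 0 < s -> `|a| + 1 <= L ->
  ((expR (- (L ^+ 2 / 2)) / Num.sqrt (pi * 2))%:E <=
   normal_prob 0 s `[(s * (a - 1))%R, (s * (a + 1))%R])%E.
Proof.
move=> s0 aL; have sN0 : s != 0 by rewrite gt_eqF.
set I := `[_, _]%classic; set c := expR _.
have L1 : 1 <= L by apply: le_trans aL; rewrite lerDr.
pose k := normal_peak s * c.
have k0 : 0 <= k by rewrite mulr_ge0 ?expR_ge0// normal_peak_ge0.
have mpdf : measurable_fun I (EFin \o normal_pdf 0 s).
  by apply: measurable_funTS; apply/measurable_EFinP; exact: measurable_normal_pdf.
apply: (@le_trans _ _ (\int[lebesgue_measure]_(x in I) k%:E)%E); last first.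
  apply: ge0_le_integral => //.
  - exact: measurable_itv.
  - move=> x; rewrite /I /= in_itv/= => /andP[x1 x2]; rewrite lee_fin.
    rewrite /normal_pdf (negbTE sN0) /k; apply: ler_wpM2l; first exact: normal_peak_ge0.
    rewrite ler_expR subr0 mulNr lerN2.
    have xs : `|x| <= s * L.
      have := ler_norm a; have := ler_norm (- a); rewrite normrN => h1 h2.
      have hL : s * (`|a| + 1) <= s * L by rewrite ler_pM2l.
      have hu : s * (a + 1) <= s * (`|a| + 1) by rewrite ler_pM2l// lerD2r.
      have hl : s * (- `|a| - 1) <= s * (a - 1) by rewrite ler_pM2l//; lra.
      by rewrite ler_norml; apply/andP; split; lra.
    rewrite ler_pdivrMr; last by rewrite -mulr_natr mulr_gt0// exprn_gt0.
    rewrite -real_normK ?num_real//.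
    have : `|x| ^+ 2 <= (s * L) ^+ 2.
      by rewrite ler_pXn2r ?nnegrE// mulr_ge0 ?(ltW s0)//; lra.
    rewrite exprMn -mulr_natr; lra.
rewrite integral_cst; last exact: measurable_itv.
have lI : (lebesgue_measure I = (2 * s)%:E)%E.
  rewrite /I lebesgue_measure_itv/= lte_fin ltr_pM2l// ltrD2l.
  by rewrite (_ : -1 < 1); [rewrite -EFinB; congr EFin; ring|lra].
apply: (@le_trans _ _ (k%:E * (2 * s)%:E)%E); last by rewrite -lI.
rewrite -EFinM lee_fin /k /normal_peak.
have -> : Num.sqrt (s ^+ 2 * pi *+ 2) = s * Num.sqrt (pi * 2).
  by rewrite -mulr_natr -mulrA sqrtrM ?sqr_ge0// sqrtr_sqr gtr0_norm.
set q := Num.sqrt _.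
have q0 : 0 < q by rewrite sqrtr_gt0 mulr_gt0// pi_gt0.
rewrite (_ : (s * q)^-1 * c * (2 * s) = 2 * (c / q)); last by field; rewrite sN0 gt_eqF.
by rewrite ler_peMl// ?ler1n// divr_ge0 ?expR_ge0// ltW.
Qed.

End gaussian_lower.

Section cone.
Context {R : realType} {d : nat} {dO : measure_display}
  {Omega : measurableType dO}.
Variables (P : probability Omega R) (j : 'rV[R]_d -> R) (W Y : R -> Omega -> 'rV[R]_d).
Hypothesis S : setup P j W Y.
Implicit Types (z x y p e : 'rV[R]_d) (t s k r : R) (phi : 'rV[R]_d -> R).
Local Notation X := (Xsum W Y).
Local Notation V := (fun t => W (2 * t)).

Let levyV := levy_like_V (s_W S).
Let levyY := levy_like_Y (s_Y S).

Definition cube s x : set 'rV[R]_d := [set v | forall i, (s * (x 0 i - 1) <= v 0 i <= s * (x 0 i + 1))%R].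

Lemma measurable_cube s x : measurable (cube s x).
Proof.
have -> : cube s x = [set v | forall i : 'I_d, `[s * (x 0 i - 1), s * (x 0 i + 1)]%classic (v 0 i)].
  by apply/seteqP; split=> v vc i; have := vc i; rewrite /= in_itv.
by apply: (@measurable_rect R d (fun i => `[s * (x 0 i - 1), s * (x 0 i + 1)]%classic)) => i;
  exact: measurable_itv.
Qed.

Lemma brownian_cube L : exists2 c, 0 < c & forall t x, 0 < t -> (forall i, `|x 0 i| + 1 <= L) ->
  c <= fine (P (V t @^-1` cube (Num.sqrt (2 * t)) x)).
Proof.
pose c1 := expR (- (L ^+ 2 / 2)) / Num.sqrt (pi * 2).
have c10 : 0 < c1 by rewrite divr_gt0 ?expR_gt0// sqrtr_gt0 mulr_gt0// pi_gt0.
exists (c1 ^+ d); first exact: exprn_gt0.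
move=> t x t0 xL; set s := Num.sqrt _.
have t20 : 0 < 2 * t by rewrite mulr_gt0.
have s0 : 0 < s by rewrite sqrtr_gt0.
have [_ _ Wn] := s_W S.
have mA (i : 'I_d) : measurable `[s * (x 0 i - 1), s * (x 0 i + 1)]%classic by exact: measurable_itv.
have := Wn (2 * t) _ t20 mA; rewrite -/s.
have -> : [set w | forall i : 'I_d, `[s * (x 0 i - 1), s * (x 0 i + 1)]%classic (W (2 * t) w 0 i)] =
    V t @^-1` cube s x.
  by apply/seteqP; split=> v vc i; have := vc i; rewrite /= in_itv.
move=> PE; have mVc : measurable (V t @^-1` cube s x).
  rewrite -[X in measurable X]setTI.
  exact: (ll_meas levyV (ltW t0) measurableT (measurable_cube s x)).
rewrite -lee_fin fineK ?fin_num_measure// PE.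
have -> : c1 ^+ d = \prod_(i < d) c1 by rewrite prodr_const card_ord.
have [] // : 0 <= \prod_(i < d) c1 /\ ((\prod_(i < d) c1)%:E <=
   \prod_(i < d) normal_prob 0 s `[(s * (x 0%R i - 1))%R, (s * (x 0%R i + 1))%R]%classic)%E.
apply: (big_ind2 (fun (a : R) (b : \bar R) => 0 <= a /\ (a%:E <= b)%E)) => [|a b a' b' [a0 ab] [a'0 ab']|i _].
- by [].
- by rewrite mulr_ge0//; split=> //; rewrite EFinM lee_pmul// lee_fin.
- by split; [exact: ltW|exact: normal_interval_lower].
Qed.

(** [tail_le] at [k = 1 / s] with [t = s^2 / 2], and [Hmod_little_sqr] for the symbol at that
    frequency. The constant [thc / D1 ^+ 3] is the one for which the bound becomes 1/2. *)
Lemma Y_small : exists2 t0, 0 < t0 & forall t, 0 < t <= t0 ->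
  1 / 2 <= fine (P (Y t @^-1` [set y | `|y| < Num.sqrt (2 * t)])).
Proof.
pose D1 : R := d%:R + 1; have D10 : 0 < D1 by rewrite ltr_wpDl.
have th0 : 0 < thc :> R := thc_gt0.
have e0 : 0 < thc / D1 ^+ 3 by rewrite divr_gt0// exprn_gt0.
have [k1 k10 hk] := Hmod_little_sqr (s_jm S) (s_j0 S) (s_jl S) e0.
exists ((D1 / k1) ^+ 2 / 2); first by rewrite divr_gt0// exprn_gt0// divr_gt0.
move=> t /andP[t0 tt0]; set s := Num.sqrt _.
have t20 : 0 < 2 * t by rewrite mulr_gt0.
have s0 : 0 < s by rewrite sqrtr_gt0.
have s2 : s ^+ 2 = 2 * t by rewrite sqr_sqrtr// ltW.
have sk : s <= D1 / k1.
  rewrite -(ler_pXn2r (n := 2)) ?nnegrE ?(ltW s0)//; last by rewrite divr_ge0// ltW.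
  by rewrite s2; lra.
have mYt := ll_meas levyY (ltW t0).
have si0 : 0 < s^-1 by rewrite invr_gt0.
have := @tail_le _ _ _ _ P (Y t) s^-1 (t * Hmod j (D1 * s^-1)) mYt si0.
rewrite invrK => /(_ _)/wrap[].
  move=> i q /andP[q0 qs].
  have [h _] := Y_char_bound (s_j0 S) (s_Ye S) (q *: ebasis i) (ltW t0).
  apply: le_trans h _; rewrite ler_pM2l//.
  apply: (symbol_le_Hmod (s_jm S) (s_j0 S) (s_jl S)).
  apply: ler_pM => //; first by rewrite lerDl.
  rewrite normrZ (ger0_norm q0) -[leRHS]mulr1 ler_pM//.
  by apply: norm_le_coord => // l; rewrite !mxE eqxx/=; case: eqP => _; rewrite ?normr1 ?normr0.
have Hb : Hmod j (D1 * s^-1) <= thc / D1 ^+ 3 * (D1 * s^-1) ^+ 2.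
  by apply: hk; rewrite ler_pdivlMr// mulrC -ler_pdivlMr.
set Q := fine _ => hQ.
have Q2 : Q <= 1 / 2.
  apply: le_trans hQ _; rewrite ler_pdivrMr//.
  apply: (@le_trans _ _ (D1 * (t * (thc / D1 ^+ 3 * (D1 * s^-1) ^+ 2)))).
    apply: ler_pM => //; last by rewrite ler_pM2l.
      by rewrite mulr_ge0 ?(ltW t0)// (Hmod_ge0 (s_j0 S))// mulr_ge0// ltW.
    by rewrite lerDl.
  rewrite exprMn exprVn s2 (_ : _ * _ = thc / 2); first by lra.
  by field; rewrite !gt_eqF.
have mC : measurable [set w | s <= `|Y t w|].
  rewrite -[X in measurable X]setTI; apply: (measurable_fun_le measurableT) => //.
  apply: (measurableT_comp _ mYt); apply: continuous_measurable_rV; exact: norm_continuous.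
have -> : Y t @^-1` [set y | `|y| < s] = ~` [set w | s <= `|Y t w|].
  by apply/seteqP; split=> w /=; rewrite ltNge => /negP.
rewrite probability_setC// fineB// ?fin_num_measure//.
by move: Q2; rewrite /Q /=; lra.
Qed.

Lemma dotvZr z k x : dotv z (k *: x) = k * dotv z x.
Proof. by rewrite /dotv mulr_sumr; apply: eq_bigr => i _; rewrite mxE mulrCA. Qed.

Lemma dotvBr z x y : dotv z (x - y) = dotv z x - dotv z y.
Proof. by rewrite dotvDr -scaleN1r dotvZr mulN1r. Qed.

(** With probability at least [c] the Brownian part moves the point to distance of order [sqrt t] in
    the direction [- e], below the graph, while [Y] moves by less than [sqrt (2 * t)]. Scaling makes
    [c] independent of [t] and of the starting point. *)
Lemma exterior_cone D p : lipschitz_domain D -> (closure D `\` D) p ->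
  exists c t0, [/\ 0 < c, 0 < t0 & forall t x, 0 < t <= t0 -> `|x - p| <= Num.sqrt (2 * t) ->
    Pt P W Y t \1_D x <= 1 - c].
Proof.
move=> [oD /(_ p)] H pD; have [r [e [gamma [r0 e1 lip Dr]]]] := H pD.
have mD := measurable_open oD.
have [Lam Lam0 gL] : exists2 Lam : R, 0 < Lam & forall x y, dotv e x = 0 -> dotv e y = 0 ->
    `|gamma x - gamma y| <= Lam * `|x - y|.
  have [L0 [_ hL]] := lip; exists (`|L0| + 1); first by rewrite ltr_wpDl.
  move=> x y x0 y0; apply: (hL (`|L0| + 1) _ (x, y)) => //=.
  by apply: le_lt_trans (ler_norm _) _; rewrite ltrDl.
have ee : dotv e e = 1 by rewrite -enorm_sqr e1 expr1n.
have en : `|e| <= 1 by rewrite -e1 norm_le_enorm.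
have proj0 x : dotv e (x - dotv e x *: e) = 0 by rewrite dotvBr dotvZr ee mulr1 subrr.
(* [K * s] is the descent along [e] that beats the other displacements: an error [3 * d * s] in
   height and a rise of at most [Lam * 3 * (1 + d) * s] of the graph. *)
pose K : R := 3 * d%:R + 3 * Lam * (1 + d%:R).
have d0 : 0 <= d%:R :> R by [].
have K0 : 0 <= K.
  by rewrite /K addr_ge0 ?mulr_ge0 ?addr_ge0// ltW.
have [c0 c00 hc] := brownian_cube (K + 1); have [t1 t10 hY] := Y_small.
(* The bound [D3 * s <= r] keeps the endpoint in the Euclidean ball around [p] where [D] is given by
   the graph; [d] converts the sup norm. *)
pose D3 : R := (d%:R + 1) * (K + 4).
have D30 : 0 < D3 by rewrite mulr_gt0// ltr_wpDl.
exists (c0 / 2), (Num.min t1 ((r / D3) ^+ 2 / 2)); split.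
- by rewrite divr_gt0.
- by rewrite lt_min t10 divr_gt0// exprn_gt0// divr_gt0.
move=> t x /andP[t0]; rewrite le_min => /andP[tt1 tr] xp.
set s := Num.sqrt _ in xp *.
have t20 : 0 < 2 * t by rewrite mulr_gt0.
have s0 : 0 < s by rewrite sqrtr_gt0.
have s2 : s ^+ 2 = 2 * t by rewrite sqr_sqrtr// ltW.
have sr : s <= r / D3.
  rewrite -(ler_pXn2r (n := 2)) ?nnegrE ?(ltW s0)//; last by rewrite divr_ge0// ltW.
  by rewrite s2; lra.
pose A := V t @^-1` cube s (- K *: e); pose B := Y t @^-1` [set y | `|y| < s].
have mYt := ll_meas levyY (ltW t0); have mVt := ll_meas levyV (ltW t0).
have mS : measurable [set y : 'rV[R]_d | `|y| < s].
  apply: measurable_open; apply: (open_comp _ (@open_lt R s)) => y _; exact: norm_continuous.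
have mA : measurable A by rewrite -[X in measurable X]setTI; exact: (mVt measurableT _ (measurable_cube _ _)).
have mB : measurable B by rewrite -[X in measurable X]setTI; exact: (mYt measurableT _ mS).
have PA : c0 <= fine (P A).
  apply: hc => // i; rewrite mxE normrM normrN (ger0_norm K0) lerD2r.
  by rewrite -[leRHS]mulr1 ler_wpM2l//; apply: le_trans (coord_le_norm e i) en.
have PB : 1 / 2 <= fine (P B) by apply: hY; rewrite t0.
have PAB : c0 / 2 <= \int[P]_w \1_(A `&` B) w.
  rewrite ex_indic; last exact: measurableI.
  rewrite (VY_indep (s_WY S) (ltW t0) (measurable_cube s (- K *: e)) mS).
  rewrite fineM ?fin_num_measure// -[X in c0 * X]div1r.
  by apply: ler_pM => //; exact: ltW.
suff out w : (A `&` B) w -> ~ D (x + X t w).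
  apply: (@le_trans _ _ (\int[P]_w (1 - \1_(A `&` B) w))); last first.
    rewrite exB; [|exact: bmeas_cst|by apply: bmeas_indic; exact: measurableI].
    by rewrite ex_cst lerB.
  apply: ex_le => [||w].
  - by apply: (bmeas_shiftX S x (ltW t0)); exact: bmeas_indic.
  - by apply: bmeasB; [exact: bmeas_cst|apply: bmeas_indic; exact: measurableI].
  - rewrite !indicE; have [ABw|nAB] := pselect ((A `&` B) w).
      by rewrite (mem_set ABw) (memNset (out w ABw)) subrr.
    by rewrite (memNset nAB) subr0; case: (_ \in _).
(* The endpoint is [p - (K * s) *: e + u], where [u] collects the initial offset, the error of the
   Brownian part and the jump part, each at most [s]. *)
move=> [Aw Bw]; pose u := (x - p) + (V t w + (K * s) *: e) + Y t w.
have u3 : `|u| <= 3 * s.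
  have h1 : `|V t w + (K * s) *: e| <= s.
    apply: norm_le_coord => [|i]; first exact: ltW.
    have := Aw i; rewrite !mxE ler_norml => /andP[a1 a2]; apply/andP; split; lra.
  have h2 : `|Y t w| <= s by exact: ltW.
  apply: le_trans (ler_normD _ _) _.
  have := ler_normD (x - p) (V t w + (K * s) *: e); lra.
have yE : x + X t w = p - (K * s) *: e + u.
  by rewrite /u /Xsum /psum; apply/rowP => i; rewrite !mxE; ring.
set y := x + X t w in yE *.
have yp : enorm (y - p) < r.
  apply: le_lt_trans (enorm_le _) _.
  have : `|y - p| <= (K + 3) * s.
    have -> : y - p = u - (K * s) *: e by rewrite yE; apply/rowP => i; rewrite !mxE; ring.
    apply: le_trans (ler_normB _ _) _; rewrite normrZ ger0_norm ?mulr_ge0 ?(ltW s0)//.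
    have : K * s * `|e| <= K * s by rewrite ler_piMr// mulr_ge0// ltW.
    lra.
  move=> h; apply: (@le_lt_trans _ _ (d%:R * ((K + 3) * s))); first by rewrite ler_wpM2l.
  have : D3 * s <= r by rewrite mulrC -ler_pdivlMr.
  apply: lt_le_trans; rewrite mulrA ltr_pM2r// /D3.
  have := mulr_ge0 d0 K0; nra.
have pp : ~ D p by case: pD.
have gp : dotv e p <= gamma (p - dotv e p *: e).
  rewrite leNgt; apply/negP => h; apply: pp; apply/(Dr p) => //.
  by rewrite subrr enorm0.
move=> /(Dr y yp); apply/negP; rewrite -leNgt.
have eu : `|dotv e u| <= 3 * d%:R * s.
  apply: le_trans (dotv_le _ _) _.
  apply: (@le_trans _ _ (d%:R * 1 * (3 * s))); last by lra.
  by apply: ler_pM => //; rewrite ler_wpM2l.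
have ey : dotv e y = dotv e p - K * s + dotv e u.
  by rewrite yE dotvDr dotvBr dotvZr ee mulr1.
have hy : `|(y - dotv e y *: e) - (p - dotv e p *: e)| <= 3 * (1 + d%:R) * s.
  rewrite (_ : _ - _ = u - dotv e u *: e); last first.
    by rewrite ey yE; apply/rowP => i; rewrite !mxE; ring.
  apply: le_trans (ler_normB _ _) _; rewrite normrZ.
  have : `|dotv e u| * `|e| <= `|dotv e u| by rewrite ler_piMr.
  lra.
have := gL _ _ (proj0 y) (proj0 p); rewrite ler_norml => /andP[g1 _].
have g2 : Lam * `|(y - dotv e y *: e) - (p - dotv e p *: e)| <= Lam * (3 * (1 + d%:R) * s).
  by rewrite ler_pM2l.
move: eu; rewrite ler_norml => /andP[_ eu]; rewrite ey; rewrite /K.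
move: g1 g2 gp; rewrite ey /K; set G1 := gamma _; set G2 := gamma _; lra.
Qed.

End cone.

Section norm_sets.
Context {R : realType} {d : nat} dT {T : measurableType dT}.
Implicit Types (p : 'rV[R]_d) (Z : T -> 'rV[R]_d) (s : R).

Lemma continuous_dist p : continuous (fun y : 'rV[R]_d => `|y - p|).
Proof.
have c : continuous (fun y : 'rV[R]_d => y - p).
  by move=> y; have := @cvgB _ _ _ _ _ id (cst p) y p (@cvg_id _ (nbhs y)) (cvg_cst _); apply.
by move=> y; exact: (continuous_comp (c y) (@norm_continuous _ _ _)).
Qed.

Lemma measurable_dist_gt Z p s : measurable_fun setT Z -> measurable [set w | s < `|Z w - p|].
Proof.
move=> mZ; have mS : measurable [set y : 'rV[R]_d | s < `|y - p|].
  apply: measurable_open; apply: (open_comp _ (@open_gt R s)) => y _; exact: continuous_dist.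
by rewrite -[X in measurable X]setTI; exact: (mZ measurableT _ mS).
Qed.

Lemma measurable_norm_ge Z s : measurable_fun setT Z -> measurable [set w | s <= `|Z w|].
Proof.
move=> mZ; rewrite -[X in measurable X]setTI; apply: (measurable_fun_le measurableT) => //.
apply: (measurableT_comp _ mZ); apply: continuous_measurable_rV; exact: norm_continuous.
Qed.

End norm_sets.

(** * Survival in the domain along a time grid *)

Section stay.
Context {R : realType} {d : nat} {dO : measure_display}
  {Omega : measurableType dO}.
Variables (P : probability Omega R) (j : 'rV[R]_d -> R) (W Y : R -> Omega -> 'rV[R]_d).
Hypothesis S : setup P j W Y.
Implicit Types (z x y p : 'rV[R]_d) (t s k r : R) (phi e : 'rV[R]_d -> R) (tt : nat -> R).
Local Notation X := (Xsum W Y).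
Local Notation Pt := (Pt P W Y).

Section one_grid.
Variables (D : set 'rV[R]_d) (tt : nat -> R) (x : 'rV[R]_d).
Hypotheses (mD : measurable D) (gt : grid tt) (tt0 : tt 0%N = 0).

Definition stay i : set Omega :=
  [set w | forall k : nat, (k < i)%N -> D (x + (X (tt k.+1) w - X (tt 0%N) w))].

Lemma stay_past i : past (fun t => W (2 * t)) Y tt i (stay i).
Proof.
pose G := g_sigma_algebraType (past_gen (fun t => W (2 * t)) Y tt i).
have -> : stay i = \bigcap_(k < i)
    [set w | D (x + (X (tt k.+1) w - X (tt 0%N) w))].
  by apply/seteqP; split.
apply: (@fin_bigcap_measurable _ G _ _ (fun k : nat => [set w : G | D (x + (X (tt k.+1) w - X (tt 0%N) w))])).
  exact: finite_II.
move=> k /= ki; rewrite -[X in measurable X]setTI.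
have mk : @measurable_fun _ _ G _ setT (fun w => X (tt k.+1) w - X (tt 0%N) w).
  exact: (past_meas_incr gt ki).
have : @measurable_fun _ _ G _ setT (fun w => x + (X (tt k.+1) w - X (tt 0%N) w)).
  by apply: measurable_rVD.
by move=> /(_ measurableT _ mD).
Qed.

Lemma measurable_stay i : measurable (stay i).
Proof. exact: (past_measurable (levy_like_V (s_W S)) (levy_like_Y (s_Y S)) gt (@stay_past i)). Qed.

Let bst i : bmeas (\1_(stay i) : Omega -> R).
Proof. exact/bmeas_indic/measurable_stay. Qed.

Let bsh i phi : bmeas phi -> bmeas (fun w => phi (x + X (tt i) w)).
Proof. by move=> bp; apply: (bmeas_shiftX S _ (grid_ge0 i gt)). Qed.

Lemma stay_step i phi : bmeas phi ->
  \int[P]_w (\1_(stay i.+1) w * phi (x + X (tt i.+1) w)) =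
  \int[P]_w (\1_(stay i) w * Pt (tt i.+1 - tt i) (fun y => \1_D y * phi y) (x + X (tt i) w)).
Proof.
move=> bp; have bD : bmeas (fun y => \1_D y * phi y) by apply: bmeasM => //; exact: bmeas_indic.
rewrite -(markov S x gt tt0 (@stay_past i) bD).
apply: ex_ae_eq.
- by apply: bmeasM => //; exact: bsh.
- by apply: bmeasM => //; exact: (bsh i.+1 bD).
apply: filterS (X0_ae S) => w; rewrite -tt0 => X0.
rewrite mulrA; congr (_ * _); rewrite !indicE -natrM mulnb; congr (nat_of_bool _)%:R.
apply/idP/andP => [/set_mem h|[/set_mem h1 /set_mem h2]].
  split; first by apply/mem_set => k ki; exact/h/(ltn_trans ki).
  by apply/mem_set; have := h i (ltnSn i); rewrite X0 subr0.
apply/mem_set => k; rewrite ltnS leq_eqVlt => /orP[/eqP ->|]; last exact: h1.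
by rewrite X0 subr0.
Qed.

Lemma stay0E phi : bmeas phi -> \int[P]_w (\1_(stay 0) w * phi (x + X (tt 0%N) w)) = phi x.
Proof.
move=> bp; rewrite -[RHS](ex_cst P (phi x)); apply: ex_ae_eq.
- by apply: bmeasM => //; exact: bsh.
- exact: bmeas_cst.
apply: filterS (X0_ae S) => w; rewrite -tt0 => ->.
by rewrite addr0 indicE mem_set ?mul1r.
Qed.

Lemma stay_ub i : \int[P]_w \1_(stay i) w <= 1.
Proof.
rewrite -[leRHS](ex_cst P 1); by apply: ex_le => //; exact: bmeas_cst.
Qed.

(** At time [tt i] the path is either within [s] of [p], and then leaves during the next step with
    probability at least [c], or farther away, which has probability at most [e]. *)
Lemma stay_decay i p (c e s : R) : 0 <= c <= 1 ->
  (forall y, `|y - p| <= s -> Pt (tt i.+1 - tt i) \1_D y <= 1 - c) ->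
  fine (P [set w | s < `|x + X (tt i) w - p|]) <= e ->
  \int[P]_w \1_(stay i.+1) w <= (1 - c) * \int[P]_w \1_(stay i) w + e.
Proof.
move=> /andP[c0 c1] hD he.
have dt0 : 0 <= tt i.+1 - tt i by rewrite subr_ge0; exact: gt.2.
have mA : measurable [set w | s < `|x + X (tt i) w - p|].
  by apply: measurable_dist_gt; exact: (measurable_shiftX S x (grid_ge0 i gt)).
have -> : \int[P]_w \1_(stay i.+1) w = \int[P]_w (\1_(stay i.+1) w * (fun=> 1) (x + X (tt i.+1) w)).
  by apply: eq_Rintegral => w _; rewrite mulr1.
rewrite (stay_step i (bmeas_cst 1)).
have eD y : Pt (tt i.+1 - tt i) (fun y => \1_D y * (fun=> 1) y) y = Pt (tt i.+1 - tt i) \1_D y.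
  by apply: eq_Pt => z; rewrite mulr1.
under eq_Rintegral do rewrite eD.
have bi : bmeas (\1_D : 'rV[R]_d -> R) by exact: bmeas_indic.
have bp : bmeas (Pt (tt i.+1 - tt i) \1_D) by exact: (bmeas_Pt S).
have bA : bmeas (\1_[set w | s < `|x + X (tt i) w - p|] : Omega -> R) by exact: bmeas_indic.
rewrite -exZ//; apply: (@le_trans _ _ (\int[P]_w ((1 - c) * \1_(stay i) w) +
    \int[P]_w \1_[set w | s < `|x + X (tt i) w - p|] w)).
  rewrite -exD//; last exact: bmeasZ.
  apply: ex_le => [||w].
  - by apply: bmeasM => //; exact: bsh.
  - by apply: bmeasD => //; exact: bmeasZ.
  set q := x + X (tt i) w.
  have Pt1 : Pt (tt i.+1 - tt i) \1_D q <= 1.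
    rewrite -[leRHS](Pt_cst P W Y (tt i.+1 - tt i) 1 q); by apply: (Pt_le S) => //; exact: bmeas_cst.
  have Pt0 : 0 <= Pt (tt i.+1 - tt i) \1_D q by apply: Pt_ge0 => y; rewrite indicE ler0n.
  have [h|h] := leP `|q - p| s.
    have -> : \1_[set w | s < `|x + X (tt i) w - p|] w = 0 :> R.
      by rewrite indicE memNset//= -/q; apply/negP; rewrite -leNgt.
    rewrite addr0.
    rewrite mulrC ler_wpM2r ?indicE ?ler0n//; exact: hD.
  have -> : \1_[set w | s < `|x + X (tt i) w - p|] w = 1 :> R by rewrite indicE mem_set.
  have : 0 <= (1 - c) * \1_(stay i) w by rewrite mulr_ge0 ?subr_ge0 ?indicE ?ler0n.
  have : \1_(stay i) w * Pt (tt i.+1 - tt i) \1_D q <= 1 * 1 :> R.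
    by apply: ler_pM => //; rewrite indicE ?ler0n// lern1 leq_b1.
  by rewrite /= mulr1; lra.
by rewrite lerD2l ex_indic.
Qed.

(** Here [e] is an expected exit time: it vanishes off [D], so the expectation after the step may be
    restricted to the paths still in [D]. *)
Lemma stay_telescope i e : bmeas e -> (forall y, ~ D y -> e y = 0) ->
  (forall y, e y <= (tt i.+1 - tt i) + Pt (tt i.+1 - tt i) e y) ->
  \int[P]_w (\1_(stay i) w * e (x + X (tt i) w)) <=
  (tt i.+1 - tt i) + \int[P]_w (\1_(stay i.+1) w * e (x + X (tt i.+1) w)).
Proof.
move=> be e0 he.
have dt0 : 0 <= tt i.+1 - tt i by rewrite subr_ge0; exact: gt.2.
have bp : bmeas (Pt (tt i.+1 - tt i) e) by exact: (bmeas_Pt S).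
rewrite stay_step//.
have eD y : Pt (tt i.+1 - tt i) (fun y => \1_D y * e y) y = Pt (tt i.+1 - tt i) e y.
  apply: eq_Pt => z; rewrite indicE; have [Dz|Dz] := pselect (D z).
    by rewrite mem_set// mul1r.
  by rewrite memNset// mul0r e0.
under [in leRHS]eq_Rintegral do rewrite eD.
have bs1 : bmeas (fun w => \1_(stay i) w * Pt (tt i.+1 - tt i) e (x + X (tt i) w)).
  by apply: bmeasM => //; exact: (bsh i bp).
rewrite -[X in X + _](ex_cst P) -exD//; last exact: bmeas_cst.
apply: ex_le => [||w].
- by apply: bmeasM => //; exact: bsh.
- by apply: bmeasD => //; exact: bmeas_cst.
rewrite indicE; case: (_ \in _); rewrite ?mul1r ?mul0r ?addr0//; exact: he.
Qed.

End one_grid.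

Lemma sub_iterate h e : 0 < h -> bmeas e -> (forall y, e y <= h + Pt h e y) ->
  forall (k : nat) y, e y <= k.+1%:R * h + Pt (k.+1%:R * h) e y.
Proof.
move=> h0 be he; have h0' := ltW h0; elim=> [|k IH] y; first by rewrite mul1r.
have kh0 : 0 <= k.+1%:R * h by rewrite mulr_ge0.
have bp : bmeas (Pt h e) by exact: (bmeas_Pt S).
have h2 := Pt_le S kh0 y be (bmeasD (bmeas_cst h) bp) he.
rewrite (PtD S kh0 y (bmeas_cst h) bp) Pt_cst (Pt_semigroup S) // in h2.
apply: le_trans (IH y) _; rewrite -[k.+2]addn1 natrD mulrDl mul1r; lra.
Qed.

(** Survival is tested on the geometric grid [b ^+ i * rho]. If [b] is large, the displacement up to
    one grid time is small compared with the diffusive scale of the next step, so every step starts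
    at a distance from [p] where the cone estimate applies and costs a factor [1 - c]. The mesh [h]
    enters only through the requirement that [rho] be a multiple of it, whence the uniformity. *)
Lemma exit_small D p (eps M : R) : lipschitz_domain D -> (closure D `\` D) p ->
  0 < eps -> 0 < M -> exists2 eta, 0 < eta & forall (rho : R) (q : nat) h e x,
    0 < rho <= eta -> 0 < h -> rho = q%:R * h -> bmeas e -> (forall y, 0 <= e y <= M) ->
    (forall y, ~ D y -> e y = 0) -> (forall y, e y <= h + Pt h e y) ->
    `|x - p| <= Num.sqrt rho / 2 -> e x <= eps.
Proof.
move=> lD pD eps0 M0; have mD : measurable D by apply: measurable_open; case: lD.
have [c [t0 [c0 t00 hc]]] := exterior_cone S lD pD.
have c1 : c <= 1.
  have : 0 <= 1 - c.
    apply: le_trans (hc t0 p _ _); last by rewrite subrr normr0 sqrtr_ge0.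
      by apply: Pt_ge0 => y; rewrite indicE ler0n.
    by rewrite t00 lexx.
  by rewrite subr_ge0.
have th0 : 0 < thc :> R := thc_gt0.
(* The errors of the steps form a geometric series of sum at most [e' / c], which contributes
   [M * (e' / c) = eps / 3]. *)
pose e' := c * eps / (3 * M); have e'0 : 0 < e' by rewrite divr_gt0 ?mulr_gt0.
have [m hm] : exists m : nat, M * (1 - c) ^+ m <= eps / 3.
  have eM : 0 < eps / 3 / M by rewrite !divr_gt0.
  have cv : (1 - c) ^+ n @[n --> \oo] --> (0 : R) by apply: cvg_expr; rewrite ger0_norm; lra.
  have /cvgrPdist_le/(_ _ eM)[m _ /(_ m (leqnn m))] := cv.
  rewrite /= sub0r normrN => /(le_trans (ler_norm _)) h; exists m.
  by rewrite mulrC -ler_pdivlMr.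
have [C C0 hC] := Bk_quad S.
(* The inequality [Q <= b - 1] is what makes the tail of the displacement at time [tt i.+1] smaller
   than [e'], the next step having length [(b - 1) * tt i.+1]. *)
pose Q := d%:R * (3 * C) / (thc * e').
have Q0 : 0 <= Q.
  rewrite /Q divr_ge0//; first by rewrite mulr_ge0// mulr_ge0// ltW.
  by rewrite mulr_ge0// ltW.
pose b := (Num.bound Q).+2.
have bQ : Q <= b%:R - 1.
  have := archi_boundP Q0; rewrite /b -[_.+2]addn2 natrD; lra.
have b2 : 2 <= b%:R :> R by rewrite ler_nat.
have bpos n : 0 < b%:R ^+ n :> R by rewrite exprn_gt0//; lra.
(* The grid times up to index [m.+1] are thereby at most [t0], for the cone estimate, at most 1, to
   absorb the constant in [Bk_quad], and at most [eps / 3], for the elapsed time. *)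
exists (Num.min (Num.min t0 1) (eps / 3) / b%:R ^+ m.+1).
  by rewrite divr_gt0// !lt_min t00 ltr01 divr_gt0.
move=> rho q h e x /andP[rho0]; rewrite ler_pdivlMr// !le_min => /andP[/andP[rt r1] re].
move=> h0 rE be he e0 hsub xp.
pose tt (i : nat) : R := if i is 0 then 0 else b%:R ^+ i * rho.
have ttS i : tt i.+1 = b%:R ^+ i.+1 * rho by [].
have tt0 : tt 0%N = 0 by [].
have gt : grid tt.
  split=> [|[|i]]; rewrite ?tt0// ?ttS; first by rewrite mulr_ge0// ltW.
  by rewrite ler_pM2r// [leRHS]exprS ler_peMl ?(ltW (bpos _))//; lra.
have q0 : (0 < q)%N.
  by rewrite lt0n; apply: contraTneq rho0 => q0; rewrite rE q0 mul0r ltxx.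
have he1 y : 0 <= e y by have /andP[] := he y.
have he2 y : e y <= M by have /andP[] := he y.
(* every step of the grid is a multiple of [h] *)
have hstep i y : e y <= (tt i.+1 - tt i) + Pt (tt i.+1 - tt i) e y.
  have [k kE] : exists k : nat, tt i.+1 - tt i = k.+1%:R * h.
    case: i => [|i].
      exists (b * q).-1; rewrite prednK ?muln_gt0 ?q0//.
      by rewrite tt0 subr0 ttS expr1 natrM rE mulrA.
    exists (b ^ i.+1 * (b - 1) * q).-1.
    rewrite prednK ?muln_gt0 ?q0 ?expn_gt0//.
    by rewrite !ttS !natrM natrX natrB// rE (exprS b%:R i.+1); ring.
  by rewrite kE; exact: sub_iterate.
pose a i := \int[P]_w \1_(stay D tt x i) w.
have tel i : e x <= tt i + \int[P]_w (\1_(stay D tt x i) w * e (x + X (tt i) w)).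
  elim: i => [|i IH]; first by rewrite tt0 add0r stay0E.
  apply: le_trans IH _.
  have := stay_telescope x mD gt tt0 be e0 (hstep i); lra.
have aM i : \int[P]_w (\1_(stay D tt x i) w * e (x + X (tt i) w)) <= M * a i.
  have bs : bmeas (\1_(stay D tt x i) : Omega -> R) by exact/bmeas_indic/measurable_stay.
  rewrite -exZ//; apply: ex_le => [||w].
  - by apply: bmeasM => //; apply: (bmeas_shiftX S) => //; exact: grid_ge0.
  - exact: bmeasZ.
  - by rewrite mulrC ler_wpM2r// indicE ler0n.
have dec i : (i < m)%N -> a i.+2 <= (1 - c) * a i.+1 + e'.
  move=> im; set De := tt i.+2 - tt i.+1; pose s := Num.sqrt (2 * De).
  have DeE : De = (b%:R - 1) * tt i.+1 by rewrite /De !ttS (exprS b%:R i.+1); ring.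
  have ti0 : 0 < tt i.+1 by rewrite ttS mulr_gt0.
  have De0 : 0 < De by rewrite DeE mulr_gt0//; lra.
  have tim : tt i.+2 <= rho * b%:R ^+ m.+1.
    rewrite ttS mulrC ler_pM2l// ler_weXn2l//; lra.
  have Det : De <= tt i.+2 by rewrite /De lerBlDr lerDl ltW.
  have s0 : 0 < s by rewrite sqrtr_gt0 mulr_gt0.
  have s2 : s ^+ 2 = 2 * De by rewrite sqr_sqrtr// mulr_ge0// ltW.
  apply: (@stay_decay D tt x mD gt tt0 i.+1 p c e' s).
  - by rewrite (ltW c0).
  - by move=> y ys; apply: hc => //; rewrite -/De De0/=; lra.
  (* Since the start is within [s / 2] of [p], being farther than [s] from [p] forces a displacement
     of at least [s / 2]; hence the tail at [2 / s]. *)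
  have rs : Num.sqrt rho <= s.
    apply: ler_wsqrtr; apply: (@le_trans _ _ (tt i.+1)).
      by rewrite ttS ler_peMl ?(ltW rho0)// exprn_ege1//; lra.
    by rewrite DeE; nra.
  have k0 : 0 < 2 / s by rewrite divr_gt0.
  have tl := X_tail S ti0 k0.
  apply: (@le_trans _ _ (fine (P [set w | (2 / s)^-1 <= `|X (tt i.+1) w|]))).
    have mX1 := mX S (ltW ti0).
    rewrite fine_le ?fin_num_measure//.
    - by apply: measurable_dist_gt; exact: (measurable_shiftX S x (ltW ti0)).
    - exact: measurable_norm_ge.
    apply: le_measure; rewrite ?inE.
    - by apply: measurable_dist_gt; exact: (measurable_shiftX S x (ltW ti0)).
    - exact: measurable_norm_ge.
    move=> w /= hw; rewrite invf_div.
    have : `|x + X (tt i.+1) w - p| <= `|x - p| + `|X (tt i.+1) w|.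
      by rewrite addrAC; exact: ler_normD.
    lra.
  apply: le_trans tl _; rewrite ler_pdivrMr//.
  have hB : Bk j (2 / s) <= 3 * C / De.
    apply: le_trans (hC _ (ltW k0)) _; rewrite exprMn exprVn s2.
    have De1 : De <= 1 by lra.
    rewrite (_ : C * _ = C * (De + 2) / De); last by field; rewrite gt_eqF.
    by rewrite ler_pM2r ?invr_gt0//; nra.
  apply: (@le_trans _ _ (d%:R * (tt i.+1 * (3 * C / De)))).
    by rewrite ler_wpM2l// ler_pM2l.
  have b1 : 0 < b%:R - 1 :> R by lra.
  rewrite DeE (_ : _ * _ = d%:R * (3 * C) / (b%:R - 1)); last by field; rewrite !gt_eqF.
  have bQ' : d%:R * (3 * C) <= (b%:R - 1) * (thc * e') by rewrite -ler_pdivrMr// mulr_gt0.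
  by rewrite ler_pdivrMr// [leRHS]mulrC (mulrC e').
have am i : (i <= m)%N -> a i.+1 <= (1 - c) ^+ i + e' / c.
  elim: i => [_|i IH im].
    by apply: le_trans (stay_ub _ mD gt 1) _; rewrite expr0 lerDl divr_ge0// ltW.
  apply: le_trans (dec i im) _.
  have := ler_wpM2l (_ : 0 <= 1 - c) (IH (ltnW im)) => /(_ _)/wrap[]; first by rewrite subr_ge0.
  rewrite exprS mulrDr (_ : (1 - c) * (e' / c) = e' / c - e'); first by lra.
  by field; rewrite gt_eqF.
apply: le_trans (tel m.+1) _.
have h1 : tt m.+1 <= eps / 3 by rewrite ttS mulrC.
have h2 := aM m.+1.
have h3 : M * a m.+1 <= M * ((1 - c) ^+ m + e' / c) by rewrite ler_pM2l// am.
have h4 : M * (e' / c) = eps / 3 by rewrite /e'; field; rewrite !gt_eqF.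
lra.
Qed.

End stay.

(** * The discrete Dirichlet problem and its limit *)

Section compact_balls.
Context {R : realType} {d : nat}.
Implicit Types (x y q : 'rV[R]_d) (r : R).

Lemma ball_normP q (e : R) x : ball q e x <-> `|x - q| < e.
Proof. by rewrite -ball_normE /= distrC. Qed.

Lemma continuous_rVP (u : 'rV[R]_d -> R) : continuous u <->
  (forall x (e : R), 0 < e -> exists2 delta : R, 0 < delta &
     forall y, `|y - x| < delta -> `|u y - u x| <= e).
Proof.
split=> [cu x e e0|h x].
  have /(_ _ e e0)/nbhs_ballP[delta /= d0 hd] := (@cvgrPdist_le _ _ _ (nbhs x) _ _ _).1 (cu x).
  by exists delta => // y yx; rewrite distrC; apply: hd; exact/ball_normP.
apply/(@cvgrPdist_le _ _ _ (nbhs x)) => e e0; have [delta d0 hd] := h x e e0.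
apply/nbhs_ballP; exists delta => //= y /ball_normP yx.
by rewrite distrC; exact: hd.
Qed.

Lemma compact_norm_le r : compact [set x : 'rV[R]_d | `|x| <= r].
Proof.
apply: bounded_closed_compact.
  exists r; split; first exact: num_real.
  by move=> M rM x /= xr; apply: le_trans xr (ltW rM).
apply: (@preimage_closed _ _ (fun x : 'rV[R]_d => `|x|) [set t | t <= r]).
  by move=> x _; exact: norm_continuous.
exact: closed_le.
Qed.

(** Compactness in its near-covering form, for properties that hold eventually in [n] and locally in
    [x]. *)
Lemma compact_uniform (K : set 'rV[R]_d) (Q : nat -> 'rV[R]_d -> Prop) : compact K ->
  (forall q, K q -> exists delta : R, exists N : nat, 0 < delta /\
     forall n x, (N <= n)%N -> `|x - q| < delta -> Q n x) ->
  exists N, forall n x, (N <= n)%N -> K x -> Q n x.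
Proof.
move=> /compact_near_coveringP/(_ nat \oo Q _) h hQ.
have [|N _ hN] := h.
  move=> q /hQ [delta [N [d0 hd]]].
  exists (ball q delta, [set n | (N <= n)%N]) => /=.
    by split; [exact: nbhsx_ballx|exists N].
  by move=> [x n] [/= /ball_normP xq Nn]; exact: hd.
by exists N => n x Nn Kx; exact: hN.
Qed.

Lemma th_le_sqr (u : R) : th u <= u ^+ 2 / 2.
Proof.
apply: U01_le; first exact: bmeas_th_kernel.
move=> s /andP[s0 s1]; apply: le_trans (oneBcos_le _) _.
rewrite ler_pM2r// exprMn ler_piMl ?sqr_ge0// expr_le1//.
Qed.

Lemma Th_upper (k : R) p x : Th k p x <= d%:R * (k * `|x - p|) ^+ 2.
Proof.
have -> : d%:R * (k * `|x - p|) ^+ 2 = \sum_(i < d) (k * `|x - p|) ^+ 2.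
  by rewrite sumr_const card_ord mulr_natl.
apply: ler_sum => i _; apply: le_trans (th_le_sqr _) _.
have h : (k * (x 0 i - p 0 i)) ^+ 2 <= (k * `|x - p|) ^+ 2.
  rewrite !exprMn ler_wpM2l ?sqr_ge0// -real_normK ?num_real// ler_pXn2r ?nnegrE//.
  by have := coord_le_norm (x - p) i; rewrite !mxE.
have := sqr_ge0 (k * `|x - p|); lra.
Qed.

End compact_balls.

(** * Boundary behaviour and asymptotic equicontinuity *)

Section approximation.
Context {R : realType} {d : nat} {dO : measure_display}
  {Omega : measurableType dO}.
Variables (P : probability Omega R) (j : 'rV[R]_d -> R) (W Y : R -> Omega -> 'rV[R]_d).
Hypothesis S : setup P j W Y.
Implicit Types (z x y p q : 'rV[R]_d) (t s k : R) (phi : 'rV[R]_d -> R).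
Local Notation X := (Xsum W Y).
Local Notation Pt := (Pt P W Y).

(* The data of the Dirichlet problem, [f] and [g] being cut off to [D] and to
   its complement. *)
Record data (D : set 'rV[R]_d) (f g : 'rV[R]_d -> R) (K : R) : Prop := Data {
  p_lip : lipschitz_domain D ;
  p_bf : bmeas f ;
  p_bg : bmeas g ;
  p_fK : forall x, `|f x| <= K ;
  p_gK : forall x, `|g x| <= K ;
  p_fc : forall e : R, 0 < e -> exists2 delta : R, 0 < delta &
    forall x y, D x -> D y -> `|x - y| < delta -> `|f x - f y| <= e ;
  p_gc : forall q (e : R), ~ D q -> 0 < e -> exists2 delta : R, 0 < delta &
    forall x, ~ D x -> `|x - q| < delta -> `|g x - g q| <= e }.

Record discrete_solution (h : R) (D : set 'rV[R]_d) (f g V : 'rV[R]_d -> R) (K : R) : Prop :=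
  DiscreteSolution {
  d_b : bmeas V ;
  d_in : forall x, D x -> V x = h * f x + Pt h V x ;
  d_out : forall x, ~ D x -> V x = g x ;
  d_K : forall x, `|V x| <= K }.

Variables (r M t0 : R) (beta : 'rV[R]_d -> R).
Hypothesis bb : barrier P W Y r beta M t0.
(** Dyadic, so that each grid contains the coarser ones ([mesh_mul]). *)
Definition mesh n : R := t0 / 2 ^+ n.

Let t00 : 0 < t0. Proof. by case/andP: (b_t0 bb). Qed.
Let M1 : 1 <= M. Proof. exact: le_trans (b_ge1 bb 0) (b_leM bb 0). Qed.
Let M0 : 0 < M. Proof. exact: lt_le_trans ltr01 M1. Qed.

Lemma mesh_gt0 n : 0 < mesh n.
Proof. by rewrite divr_gt0// exprn_gt0. Qed.

Lemma mesh_le n : 0 < mesh n <= t0.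
Proof. by rewrite mesh_gt0 ler_pdivrMr ?exprn_gt0// ler_peMr ?(ltW t00)// exprn_ege1// ler1n. Qed.

Lemma mesh_cvg0 (e : R) : 0 < e -> exists n, mesh n <= e.
Proof.
move=> e0; have c : t0 * (2^-1) ^+ n @[n --> \oo] --> t0 * (0 : R).
  by apply: cvgMr; apply: cvg_expr; rewrite ger0_norm//; lra.
rewrite mulr0 in c.
have /cvgrPdist_le/(_ _ e0)[n _ /(_ n (leqnn n))] := c.
rewrite /= sub0r normrN => /(le_trans (ler_norm _)) h; exists n.
by rewrite /mesh -exprVn.
Qed.

Lemma mesh_mul n N : (N <= n)%N -> mesh N = (2 ^ (n - N))%N%:R * mesh n.
Proof.
move=> Nn; rewrite /mesh natrX -{2}(subnK Nn) exprD; field.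
by rewrite !expf_neq0.
Qed.

Variables (D : set 'rV[R]_d) (f g : 'rV[R]_d -> R) (K : R).
Hypotheses (pb : data D f g K) (Dr : forall x, D x -> `|x| <= r).

Let oD : open D. Proof. by case: (p_lip pb). Qed.
Let mD : measurable D. Proof. exact: measurable_open. Qed.
Let K0 : 0 <= K. Proof. exact: le_trans (normr_ge0 _) (p_fK pb 0). Qed.

Lemma discrete_solution_exists n : exists V, discrete_solution (mesh n) D f g V (K * M).
Proof.
have [V [bV V1 V2 V3]] := discrete_dirichlet S bb (mesh_le n) mD Dr (p_bf pb) (p_bg pb) (p_fK pb) (p_gK pb).
by exists V.
Qed.

(* The expected discrete exit time. *)
Lemma discrete_exit_time n : exists e,
  [/\ discrete_solution (mesh n) D (fun=> 1) (fun=> 0) e M, forall x, 0 <= e x <= M &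
      forall x, e x <= mesh n + Pt (mesh n) e x].
Proof.
have hn := mesh_le n; have h0 := mesh_gt0 n.
have one x : `|(fun=> 1 : R) x| <= 1 by rewrite normr1.
have zero (x : 'rV[R]_d) : `|(fun=> 0 : R) x| <= 1 by rewrite normr0.
have [e [be e1 e2 e3]] := discrete_dirichlet S bb hn mD Dr
  (bmeas_cst (1 : R)) (bmeas_cst (0 : R)) one zero.
rewrite mul1r in e3.
clear one zero; have e0 x : 0 <= e x.
  rewrite -oppr_le0; apply: (max_principle S bb hn Dr (w := fun x => - e x)).
  - exact: bmeasN.
  - by move=> y Dy; rewrite e2// oppr0.
  - by move=> y Dy; rewrite e1// (PtN S) ?(ltW h0)//; lra.
exists e; split; first by split.
  by move=> x; rewrite e0; have := e3 x; rewrite ger0_norm.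
move=> x; have [Dx|Dx] := pselect (D x); first by rewrite e1// mulr1.
by rewrite e2// addr_ge0 ?(ltW h0)//; apply: Pt_ge0.
Qed.

Variables (V e_ : nat -> 'rV[R]_d -> R).
Hypotheses (hV : forall n, discrete_solution (mesh n) D f g (V n) (K * M))
  (he : forall n, discrete_solution (mesh n) D (fun=> 1) (fun=> 0) (e_ n) M)
  (he0 : forall n x, 0 <= e_ n x <= M)
  (hes : forall n x, e_ n x <= mesh n + Pt (mesh n) (e_ n) x).

Lemma exit_layer q (eps : R) : ~ D q -> 0 < eps -> exists delta : R, exists N : nat,
  0 < delta /\ forall n x, (N <= n)%N -> `|x - q| < delta -> e_ n x <= eps.
Proof.
move=> Dq e0; have [cq|cq] := pselect (closure D q).
  have [eta eta0 H] := exit_small S (p_lip pb) (conj cq Dq) e0 M0.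
  have [N hN] := mesh_cvg0 eta0.
  exists (Num.sqrt (mesh N) / 2), N; split; first by rewrite divr_gt0// sqrtr_gt0 mesh_gt0.
  move=> n x Nn xq.
  apply: (H (mesh N) (2 ^ (n - N))%N (mesh n)) => //.
  - by rewrite mesh_gt0.
  - exact: mesh_gt0.
  - exact: mesh_mul.
  - exact: d_b (he n).
  - exact: d_out (he n).
  - exact: ltW.
have : nbhs q (~` closure D).
  by apply: open_nbhs_nbhs; split => //; apply: closed_openC; exact: closed_closure.
move=> /nbhs_ballP[delta /= d0 hd]; exists delta, 0%N; split => // n x _ xq.
rewrite (d_out (he n)) ?(ltW e0)// => Dx.
by have := hd x; move/(_ _)/wrap => []; [exact/ball_normP|apply; exact: subset_closure].
Qed.

(** [V n - g q] and its opposite are compared with [eps / 3 + C * Th k q + L * e_ n] by the maximum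
    principle. The constant [C] makes the bump exceed the oscillation [2 * K] of [g] at distance
    [dg] and beyond. The expected exit time loses exactly [h] per step, so [L = K + C * DD j k]
    absorbs both [f] and the drift of the bump; it is small near [q] by [exit_layer]. *)
Lemma solution_layer q (eps : R) : ~ D q -> 0 < eps -> exists delta : R, exists N : nat,
  0 < delta /\ forall n x, (N <= n)%N -> `|x - q| < delta -> `|V n x - g q| <= eps.
Proof.
move=> Dq e0; have e3 : 0 < eps / 3 by rewrite divr_gt0.
have [dg dg0 hg] := p_gc pb Dq e3.
have th0 : 0 < thc :> R := thc_gt0.
pose k := dg^-1; have k0 : 0 < k by rewrite invr_gt0.
pose C := 2 * K / thc; have C0 : 0 <= C by rewrite divr_ge0 ?(ltW th0) ?mulr_ge0 ?(ltW M0).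
have DD0 : 0 <= DD j k by rewrite mulr_ge0 ?mulr_ge0// (Bk_ge0 S) ?ltW.
pose L := K + C * DD j k; have L0 : 0 <= L by rewrite addr_ge0// mulr_ge0.
have L10 : 0 < L + 1 by rewrite ltr_wpDl.
have eL : 0 < eps / 3 / (L + 1) by rewrite divr_gt0.
have [d1 [N [d10 hN]]] := exit_layer Dq eL.
pose G : R := C * d%:R * k ^+ 2 + 1.
have G0 : 0 < G by rewrite ltr_wpDl// mulr_ge0 ?sqr_ge0// mulr_ge0.
pose d2 := Num.min 1 (eps / 3 / G).
have d20 : 0 < d2 by rewrite lt_min ltr01 divr_gt0.
exists (Num.min d1 d2), N; split; first by rewrite lt_min d10.
move=> n x Nn; rewrite lt_min => /andP[x1 x2].
have hn := mesh_le n; have h0 := mesh_gt0 n; have h0' := ltW h0.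
have bV := d_b (hV n); have be := d_b (he n).
have main s : `|s| = 1 -> forall x, s * (V n x - g q) - eps / 3 - C * Th k q x - L * e_ n x <= 0.
  move=> s1 {x1 x2} x; pose w y := s * V n y - (s * g q + eps / 3) - C * Th k q y - L * e_ n y.
  suff : w x <= 0 by rewrite /w; lra.
  have b1 : bmeas (fun y => s * V n y) by exact: bmeasZ.
  have b2 : bmeas (fun y => s * V n y - (s * g q + eps / 3)) by apply: bmeasB => //; exact: bmeas_cst.
  have b3 : bmeas (fun y => C * Th k q y) by apply: bmeasZ; exact: bmeas_Th.
  have b4 := bmeasB b2 b3; have b5 := bmeasZ L be.
  apply: (max_principle S bb hn Dr (w := w)) => [|y Dy|y Dy].
  - exact: bmeasB.
  - rewrite /w (d_out (hV n) Dy) (d_out (he n) Dy) mulr0 subr0.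
    have T0 := Th_ge0 k q y.
    suff : `|s * (g y - g q)| <= eps / 3 + C * Th k q y.
      by rewrite ler_norml => /andP[_]; lra.
    rewrite normrM s1 mul1r; have [h|h] := ltP `|y - q| dg.
      by apply: le_trans (hg y Dy h) _; rewrite lerDl mulr_ge0.
    have : C * thc <= C * Th k q y.
      rewrite ler_wpM2l//; apply: Th_far; first exact: ltW.
      by rewrite /k mulrC ler_pdivlMr// mul1r.
    rewrite /C divfK ?gt_eqF// => hC.
    have := ler_normB (g y) (g q); have := p_gK pb y; have := p_gK pb q; lra.
  rewrite (PtB S h0' y b4 b5) (PtB S h0' y b2 b3) (PtB S h0' y b1 (bmeas_cst _)) Pt_cst.
  rewrite !(PtZ S h0')//; last exact: bmeas_Th.
  rewrite /w (d_in (hV n) Dy) (d_in (he n) Dy).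
  have := Th_drift S q y h0 (ltW k0); rewrite ler_norml => /andP[T1 T2].
  have f1 : `|s * f y| <= K by rewrite normrM s1 mul1r (p_fK pb).
  move: f1; rewrite ler_norml => /andP[_ f1].
  have := ler_wpM2l C0 T2; have := ler_wpM2l h0' f1; rewrite /L.
  move: (Pt (mesh n) (V n) y) (Pt (mesh n) (e_ n) y) (Pt (mesh n) (Th k q) y) => v1 v2 v3; lra.
have Tx : C * Th k q x <= eps / 3.
  apply: (@le_trans _ _ (C * (d%:R * (k * `|x - q|) ^+ 2))).
    by rewrite ler_wpM2l// Th_upper.
  have xq0 := normr_ge0 (x - q).
  move: x2; rewrite /d2 lt_min ltr_pdivlMr// => /andP[x2 x3].
  have : `|x - q| ^+ 2 <= `|x - q| by rewrite expr2 ler_piMr// ltW.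
  move=> h4; rewrite exprMn; have GG : C * d%:R * k ^+ 2 <= G by rewrite lerDl.
  have P0 : 0 <= C * d%:R * k ^+ 2 by rewrite mulr_ge0 ?sqr_ge0// mulr_ge0.
  have := ler_pM P0 (sqr_ge0 `|x - q|) GG h4.
  rewrite !mulrA; lra.
have Ex : L * e_ n x <= eps / 3.
  have := hN n x Nn x1; rewrite ler_pdivlMr//; have /andP[e00 _] := he0 n x.
  by lra.
have s1 : `|1 : R| = 1 by rewrite normr1.
have s2 : `|-1 : R| = 1 by rewrite normrN1.
have := main _ s1 x; have := main _ s2 x; rewrite ler_norml => m1 m2.
by apply/andP; split; lra.
Qed.

Lemma layer_uniform (rr eps : R) : 0 < eps -> exists N : nat, forall n x y, (N <= n)%N ->
  `|x| <= rr -> `|x - y| < N.+1%:R^-1 -> ~ D x \/ ~ D y -> `|V n x - V n y| <= eps.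
Proof.
move=> e0; have e2 : 0 < eps / 2 by rewrite divr_gt0.
pose Q (n : nat) x := forall m y, (n <= m)%N -> `|x - y| < n.+1%:R^-1 ->
  ~ D x \/ ~ D y -> `|V m x - V m y| <= eps.
have [|N hN] := @compact_uniform R d _ Q (@compact_norm_le R d rr).
  move=> q _.
  have small (delta : R) : 0 < delta -> exists N0 : nat, forall n, (N0 <= n)%N -> n.+1%:R^-1 < delta.
    by move=> d0; have [N0 _ h] := near_infty_natSinv_lt (PosNum d0); exists N0 => n; exact: h.
  have [Dq|Dq] := pselect (D q).
    have /nbhs_ballP[delta /= d0 hd] : nbhs q D by exact: open_nbhs_nbhs.
    have d2 : 0 < delta / 2 by rewrite divr_gt0.
    have [N0 hN0] := small _ d2.
    exists (delta / 2), N0; split => // n x Nn xq m y nm xy; case=> [Dx|Dy]; exfalso.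
      by apply: Dx; apply: hd; apply/ball_normP; lra.
    apply: Dy; apply: hd; apply/ball_normP.
    have := ler_normB (x - q) (x - y); rewrite (_ : _ - _ - _ = y - q); last by rewrite opprB addrC subrKA.
    have := lt_trans xy (hN0 n Nn); lra.
  have [delta [N1 [d0 hd]]] := solution_layer Dq e2.
  have d2 : 0 < delta / 2 by rewrite divr_gt0.
  have [N0 hN0] := small _ d2.
  exists (delta / 2), (maxn N0 N1); split => // n x; rewrite geq_max => /andP[n0 n1] xq m y nm xy _.
  have h1 : `|V m x - g q| <= eps / 2 by apply: hd; [exact: leq_trans nm|lra].
  have h2 : `|V m y - g q| <= eps / 2.
    apply: hd; first exact: leq_trans nm.
    have := ler_normB (x - q) (x - y); rewrite (_ : _ - _ - _ = y - q); last by rewrite opprB addrC subrKA.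
    have := lt_trans xy (hN0 n n0); lra.
  have := ler_normB (V m x - g q) (V m y - g q).
  rewrite (_ : _ - _ - _ = V m x - V m y); [lra|by rewrite opprB subrKA].
by exists N => n x y Nn xr xy; exact: (hN N x (leqnn N) xr n y Nn xy).
Qed.

(** Comparison of [V n] with its translate by [z] on the points [y] of [D] with [y + z] in [D].
    Elsewhere one of the two points is outside [D], and [layer_uniform] applies, but on bounded sets
    only, as [g] need not be uniformly continuous. A very flat bump [Th k 0] takes over beyond
    distance [1 / k], and the barrier pays for its drift and for the modulus of continuity of
    [f]. *)
Lemma equicontinuity (rr eps : R) : 0 < rr -> 0 < eps -> exists delta : R, exists N : nat, 0 < delta /\
  forall n x z, (N <= n)%N -> `|x| <= rr -> `|z| < delta -> `|V n (x + z) - V n x| <= eps.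
Proof.
move=> rr0 e0; have e5 : 0 < eps / 5 by rewrite divr_gt0.
have th0 : 0 < thc :> R := thc_gt0.
pose C := 2 * (K * M) / thc.
have C0 : 0 <= C by rewrite divr_ge0 ?(ltW th0) ?mulr_ge0 ?(ltW M0).
(* [E1] bounds [k^2], which makes the bump small on the ball of radius [rr]; [E2] bounds the symbol
   at frequency [k], which makes its drift small. *)
pose E1 := eps / 5 / (C * d%:R * rr ^+ 2 + 1); pose E2 := eps / 5 / (C * (2 * d%:R) * M + 1).
have q1 : 0 < C * d%:R * rr ^+ 2 + 1 by rewrite ltr_wpDl// mulr_ge0 ?sqr_ge0// mulr_ge0.
have q2 : 0 < C * (2 * d%:R) * M + 1 by rewrite ltr_wpDl// mulr_ge0 ?(ltW M0)// mulr_ge0// mulr_ge0.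
have E10 : 0 < E1 by rewrite divr_gt0.
have E20 : 0 < E2 by rewrite divr_gt0.
have [k1 k10 hk1] := Bk_cvg0 S E20.
pose k := Num.min k1 (Num.min 1 E1).
have k0 : 0 < k by rewrite !lt_min k10 ltr01.
have kk : Bk j k <= E2 by apply: hk1; rewrite (ltW k0) ge_min lexx.
have k2 : k ^+ 2 <= E1.
  have a : k <= E1 by rewrite /k !ge_min lexx !orbT.
  have b : k <= 1 by rewrite /k !ge_min lexx !orbT.
  by apply: le_trans a; rewrite expr2 ler_piMr// ltW.
have [N1 hN1] := layer_uniform k^-1 e5.
have e5M : 0 < eps / 5 / M by rewrite divr_gt0.
have [d2 d20 hd2] := p_fc pb e5M.
exists (Num.min N1.+1%:R^-1 d2), N1; split; first by rewrite lt_min d20 invr_gt0 ltr0n.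
move=> n x z Nn xr; rewrite lt_min => /andP[z1 z2].
have hn := mesh_le n; have h0 := mesh_gt0 n; have h0' := ltW h0.
have bV := d_b (hV n); have bbm := b_bm bb.
have bVz : bmeas (fun y => V n (y + z)).
  by apply: (bmeas_comp _ bV); apply: measurable_rVD => //; exact: measurable_cst.
pose L := eps / 5 / M + C * DD j k.
have DD0 : 0 <= DD j k by rewrite mulr_ge0 ?mulr_ge0// (Bk_ge0 S) ?ltW.
have L0 : 0 <= L by rewrite addr_ge0 ?(ltW e5M)// mulr_ge0.
have main s : `|s| = 1 -> forall x, s * (V n (x + z) - V n x) - eps / 5 - C * Th k 0 x - L * beta x <= 0.
  move=> s1 {xr} x; pose w y := s * V n (y + z) - s * V n y - eps / 5 - C * Th k 0 y - L * beta y.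
  suff : w x <= 0 by rewrite /w; lra.
  have b1 : bmeas (fun y => s * V n (y + z)) by exact: bmeasZ.
  have b1' : bmeas (fun y => s * V n y) by exact: bmeasZ.
  have b1'' := bmeasB b1 b1'.
  have b2 := bmeasB b1'' (bmeas_cst (eps / 5)).
  have b3 : bmeas (fun y => C * Th k 0 y) by apply: bmeasZ; exact: bmeas_Th.
  have b4 := bmeasB b2 b3; have b5 := bmeasZ L bbm.
  have Ar y : (D `&` [set y | D (y + z)]) y -> `|y| <= r by move=> [Dy _]; exact: Dr.
  apply: (max_principle S bb hn Ar (w := w)) => [|y Dy|y [Dy Dyz]].
  - exact: bmeasB.
  - have T0 := Th_ge0 k 0 y.
    have B0 : 0 <= L * beta y by rewrite mulr_ge0// (le_trans ler01)// (b_ge1 bb).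
    suff : `|s * (V n (y + z) - V n y)| <= eps / 5 + C * Th k 0 y.
      by rewrite /w ler_norml => /andP[_]; lra.
    rewrite normrM s1 mul1r; have [h|h] := leP `|y| k^-1.
      apply: le_trans (_ : _ <= eps / 5) _; last by rewrite lerDl mulr_ge0.
      rewrite distrC; apply: hN1 => //; first by rewrite opprD addrA subrr add0r normrN.
      by apply/not_andP.
    have : C * thc <= C * Th k 0 y.
      rewrite ler_wpM2l//; apply: Th_far; first exact: ltW.
      by rewrite subr0 mulrC -ler_pdivrMr// mul1r ltW.
    rewrite /C divfK ?gt_eqF// => hC.
    have := ler_normB (V n (y + z)) (V n y).
    have := d_K (hV n) y; have := d_K (hV n) (y + z); lra.
  rewrite (PtB S h0' y b4 b5) (PtB S h0' y b2 b3) (PtB S h0' y b1'' (bmeas_cst _)) Pt_cst.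
  rewrite (PtB S h0' y b1 b1') !(PtZ S h0')//; last exact: bmeas_Th.
  rewrite Pt_shift /w (d_in (hV n) Dy) (d_in (hV n) Dyz).
  have := Th_drift S 0 y h0 (ltW k0); rewrite ler_norml => /andP[T1 T2].
  have := b_drift bb hn (Ar y (conj Dy Dyz)).
  have f1 : `|s * (f (y + z) - f y)| <= eps / 5 / M.
    by rewrite normrM s1 mul1r; apply: hd2 => //; rewrite addrAC subrr add0r.
  move: f1; rewrite ler_norml => /andP[_ f1] B1.
  have := ler_wpM2l C0 T2; have := ler_wpM2l h0' f1; have := ler_wpM2l L0 B1; rewrite /L.
  move: (Pt (mesh n) (V n) y) (Pt (mesh n) (V n) (y + z)) (Pt (mesh n) (Th k 0) y) (Pt (mesh n) beta y).
  move=> v1 v2 v3 v4; lra.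
have Tx : C * Th k 0 x <= eps / 5.
  apply: (@le_trans _ _ (C * (d%:R * (k * `|x|) ^+ 2))).
    by rewrite ler_wpM2l//; have := Th_upper k 0 x; rewrite subr0.
  apply: (@le_trans _ _ (C * (d%:R * (E1 * rr ^+ 2)))).
    rewrite ler_wpM2l// ler_wpM2l// exprMn ler_pM ?sqr_ge0// ler_pXn2r ?nnegrE ?(ltW rr0)//.
  have : E1 * (C * d%:R * rr ^+ 2 + 1) = eps / 5 by rewrite divfK// gt_eqF.
  lra.
have Bx : L * beta x <= eps / 5 + eps / 5.
  apply: (@le_trans _ _ (L * M)); first by rewrite ler_wpM2l// (b_leM bb).
  rewrite mulrDl divfK ?gt_eqF// lerD2l /DD.
  have : C * (2 * d%:R * Bk j k) * M <= C * (2 * d%:R * E2) * M.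
    by rewrite ler_wpM2r ?(ltW M0)// ler_wpM2l// ler_wpM2l// mulr_ge0.
  have : E2 * (C * (2 * d%:R) * M + 1) = eps / 5 by rewrite divfK// gt_eqF.
  lra.
have s1 : `|1 : R| = 1 by rewrite normr1.
have s2 : `|-1 : R| = 1 by rewrite normrN1.
have := main _ s1 x; have := main _ s2 x; rewrite ler_norml => m1 m2.
by apply/andP; split; lra.
Qed.

Section limit.
Variable u : 'rV[R]_d -> R.
Hypothesis Vu : forall x, V n x @[n --> \oo] --> u x.

(** The [V n] need not be continuous: their modulus is controlled only up to [eps] and for large
    [n]. This is enough for the limit. *)
Lemma limit_continuous : continuous u.
Proof.
apply/continuous_rVP => x e e0.
have [delta [N [d0 h]]] := equicontinuity (ltr_wpDl (normr_ge0 x) ltr01) e0.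
exists delta => // y yx.
apply: (cvgn_norm_le (u := fun n => V (n + N)%N y - V (n + N)%N x)).
  by apply: cvgB; [rewrite (cvg_shiftn N (fun n => V n y))|rewrite (cvg_shiftn N (fun n => V n x))].
move=> n; rewrite -(subrK x y) (addrC (y - x)); apply: h => //; first exact: leq_addl.
by rewrite lerDl.
Qed.

Lemma limit_uniform (rr eps : R) : 0 < eps -> exists N : nat, forall n x, (N <= n)%N ->
  `|x| <= rr -> `|V n x - u x| <= eps.
Proof.
move=> e0; have e3 : 0 < eps / 3 by rewrite divr_gt0.
apply: (@compact_uniform R d _ (fun n x => `|V n x - u x| <= eps) (@compact_norm_le R d rr)) => q _.
have [delta [N1 [d0 h]]] := equicontinuity (ltr_wpDl (normr_ge0 q) ltr01) e3.
have /cvgrPdist_le/(_ _ e3)[N2 _ h2] := @Vu q.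
have [d1 d10 h1] := (continuous_rVP u).1 limit_continuous q _ e3.
exists (Num.min delta d1), (maxn N1 N2); split; first by rewrite lt_min d0.
move=> n x; rewrite geq_max lt_min => /andP[n1 n2] /andP[x1 x2].
have a1 : `|V n x - V n q| <= eps / 3.
  by rewrite -[in V n x](subrK q x) (addrC (x - q)); apply: h => //; rewrite lerDl.
have a2 : `|u q - V n q| <= eps / 3 by exact: (h2 n n2).
have a3 : `|u x - u q| <= eps / 3 by exact: h1.
move: a1 a2 a3; rewrite !ler_norml => /andP[? ?] /andP[? ?] /andP[? ?].
by apply/andP; split; lra.
Qed.

End limit.
End approximation.

(** * The stochastic representation *)

Section positions.
Context {R : realType} {d : nat} {dO : measure_display}
  {Omega : measurableType dO}.
Variables (P : probability Omega R) (j : 'rV[R]_d -> R) (W Y : R -> Omega -> 'rV[R]_d).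
Hypothesis S : setup P j W Y.
Implicit Types (y p : 'rV[R]_d) (t s : R) (phi : 'rV[R]_d -> R).
Local Notation X := (Xsum W Y).
Local Notation Pt := (Pt P W Y).
Variables (D : set 'rV[R]_d) (x : 'rV[R]_d) (h : R).
Hypotheses (mD : measurable D) (Dx : D x) (h0 : 0 < h).

Definition gr (k : nat) : R := k%:R * h.

Lemma grid_gr : grid gr.
Proof.
split=> [|k]; rewrite /gr ?mul0r//.
by rewrite ler_pM2r// ler_nat.
Qed.

Let gr0 : gr 0 = 0. Proof. by rewrite /gr mul0r. Qed.

Lemma gr_diff k : gr k.+1 - gr k = h.
Proof. by rewrite /gr -mulrBl -natr1 addrAC subrr add0r mul1r. Qed.

(** Positions relative to time 0, so that they are measurable with respect to the past; [pos] agrees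
    with [x + X] off a null set. *)
Definition pos k w := x + (X (gr k) w - X (gr 0) w).
Local Notation st := (stay W Y D gr x).

Lemma pos0 w : pos 0 w = x. Proof. by rewrite /pos subrr addr0. Qed.

Lemma measurable_pos k : measurable_fun setT (pos k).
Proof.
apply: measurable_rVD => //; apply: measurable_rVB; apply: (mX S); exact: (grid_ge0 _ grid_gr).
Qed.

Lemma bmeas_pos k phi : bmeas phi -> bmeas (fun w => phi (pos k w)).
Proof. by move=> bp; apply: (bmeas_comp _ bp); exact: measurable_pos. Qed.

Lemma bmeas_stay k : bmeas (\1_(st k) : Omega -> R).
Proof. apply: bmeas_indic; exact: (measurable_stay S x mD grid_gr). Qed.

Lemma markov_pos k (H : set Omega) phi : past (fun t => W (2 * t)) Y gr k H -> bmeas phi ->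
  \int[P]_w (\1_H w * phi (pos k.+1 w)) = \int[P]_w (\1_H w * Pt h phi (pos k w)).
Proof.
move=> pH bp; have h0' := ltW h0; have bPp : bmeas (Pt h phi) by exact: (bmeas_Pt S).
have mH : measurable H.
  exact: (@past_measurable _ _ _ _ _ _ _ (levy_like_V (s_W S)) (levy_like_Y (s_Y S)) _ k grid_gr _ pH).
have bH : bmeas (\1_H : Omega -> R) by exact: bmeas_indic.
have ae (i : nat) psi : bmeas psi -> \int[P]_w (\1_H w * psi (pos i w)) = \int[P]_w (\1_H w * psi (x + X (gr i) w)).
  move=> bs; apply: ex_ae_eq.
  - by apply: bmeasM => //; exact: bmeas_pos.
  - by apply: bmeasM => //; apply: (bmeas_shiftX S) => //; exact: (grid_ge0 _ grid_gr).
  by apply: filterS (X0_ae S) => w; rewrite /pos gr0 => ->; rewrite subr0.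
by rewrite !ae// (markov S x grid_gr gr0 pH bp) gr_diff.
Qed.

Lemma stay_pos k w : st k w -> D (pos k w).
Proof. by case: k => [_|k h1]; [rewrite pos0|exact: h1]. Qed.

Lemma stayS k w : st k.+1 w <-> st k w /\ D (pos k.+1 w).
Proof.
split=> [hw|[h1 h2] i]; first by split=> [i ik|]; [exact/hw/ltnW|exact: hw].
by rewrite ltnS leq_eqVlt => /orP[/eqP ->|]; [exact: h2|exact: h1].
Qed.

Lemma stay_le k l w : (k <= l)%N -> st l w -> st k w.
Proof. by move=> kl hw i ik; apply: hw; exact: leq_trans kl. Qed.

Lemma indic_stayS k w : (\1_(st k.+1) w : R) = \1_(st k) w * \1_D (pos k.+1 w).
Proof.
rewrite !indicE -natrM mulnb; congr (nat_of_bool _)%:R; apply/idP/andP.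
  by move=> /set_mem/stayS[a b]; split; exact/mem_set.
by move=> [/set_mem a /set_mem b]; apply/mem_set/stayS.
Qed.

Section solution.
Variables (V f g : 'rV[R]_d -> R) (K : R).
Hypotheses (dV : discrete_solution P W Y h D f g V K) (bf : bmeas f) (bg : bmeas g).

Definition gain m w : R := \sum_(0 <= i < m) \1_(st i) w * (h * f (pos i w)).
(** The difference of indicators selects the step at which the path is outside [D] for the first
    time after time 0; at most one summand is nonzero. *)
Definition payoff m w : R := \sum_(0 <= i < m) (\1_(st i) w - \1_(st i.+1) w) * g (pos i.+1 w).

Lemma bmeas_gain m : bmeas (gain m).
Proof.
apply: (@bmeas_sum _ Omega R _ (index_iota 0 m) (fun i w => \1_(st i) w * (h * f (pos i w)))) => i.
apply: bmeasM; first exact: bmeas_stay.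
by apply: bmeasZ; exact: bmeas_pos.
Qed.

Lemma bmeas_payoff m : bmeas (payoff m).
Proof.
apply: (@bmeas_sum _ Omega R _ (index_iota 0 m) (fun i w => (\1_(st i) w - \1_(st i.+1) w) * g (pos i.+1 w))) => i.
by apply: bmeasM; [apply: bmeasB; exact: bmeas_stay|exact: bmeas_pos].
Qed.

(** Passing from [m] to [m.+1] changes the integrand by [V] at the new position minus its one-step
    mean, on the paths still in [D]; this has expectation 0 by the Markov property. *)
Lemma dynkin m : V x = \int[P]_w (gain m w + payoff m w + \1_(st m) w * V (pos m w)).
Proof.
have bV := d_b dV; have h0' := ltW h0; have bPV : bmeas (Pt h V) by exact: (bmeas_Pt S).
elim: m => [|m ->].
  rewrite -[LHS](ex_cst P); apply: eq_Rintegral => w _.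
  by rewrite /gain /payoff !big_geq// !add0r pos0 indicE mem_set ?mul1r.
have bF m' : bmeas (fun w => gain m' w + payoff m' w + \1_(st m') w * V (pos m' w)).
  apply: bmeasD; first by apply: bmeasD; [exact: bmeas_gain|exact: bmeas_payoff].
  by apply: bmeasM; [exact: bmeas_stay|exact: bmeas_pos].
have b1 : bmeas (fun w => \1_(st m) w * V (pos m.+1 w)).
  by apply: bmeasM; [exact: bmeas_stay|exact: bmeas_pos].
have b2 : bmeas (fun w => \1_(st m) w * Pt h V (pos m w)).
  by apply: bmeasM; [exact: bmeas_stay|exact: bmeas_pos].
have E w : gain m.+1 w + payoff m.+1 w + \1_(st m.+1) w * V (pos m.+1 w) =
    (gain m w + payoff m w + \1_(st m) w * V (pos m w)) +
    (\1_(st m) w * V (pos m.+1 w) - \1_(st m) w * Pt h V (pos m w)).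
  rewrite /gain /payoff !big_nat_recr//= -/(gain m w) -/(payoff m w).
  have [sw|sw] := pselect (st m w); last first.
    rewrite indic_stayS (_ : \1_(st m) w = 0); first by ring.
    by rewrite indicE memNset.
  rewrite indic_stayS (_ : \1_(st m) w = 1); last by rewrite indicE mem_set.
  rewrite (d_in dV (stay_pos sw)).
  have [Dm|Dm] := pselect (D (pos m.+1 w)).
    by rewrite (_ : \1_D _ = 1); [ring|rewrite indicE mem_set].
  by rewrite (d_out dV Dm) (_ : \1_D _ = 0); [ring|rewrite indicE memNset].
under [RHS]eq_Rintegral do rewrite E.
rewrite [RHS]exD//; last exact: bmeasB.
rewrite [X in _ + X]exB// (markov_pos (@stay_past _ _ _ _ W Y D gr x mD grid_gr m) bV).
by rewrite subrr addr0.
Qed.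

End solution.

Section exit_time.
Variables (e : 'rV[R]_d -> R) (M : R).
Hypotheses (de : discrete_solution P W Y h D (fun=> 1) (fun=> 0) e M) (e0 : forall y, 0 <= e y <= M).

Lemma exit_sum m : \int[P]_w (\sum_(0 <= i < m) h * \1_(st i) w) <= M.
Proof.
have /andP[_ eM] := e0 x; apply: le_trans eM.
have be := d_b de.
rewrite (dynkin de (bmeas_cst 1) (bmeas_cst 0) m); apply: ex_le => [||w].
- apply: (@bmeas_sum _ Omega R _ (index_iota 0 m) (fun i w => h * \1_(st i) w)) => i.
  by apply: bmeasZ; exact: bmeas_stay.
- apply: bmeasD; last by apply: bmeasM; [exact: bmeas_stay|exact: bmeas_pos].
  by apply: bmeasD; [apply: bmeas_gain; exact: bmeas_cst|apply: bmeas_payoff; exact: bmeas_cst].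
- rewrite /gain /payoff [X in _ + X + _]big1 => [|i _]; last by rewrite mulr0.
  rewrite addr0; have /andP[ep _] := e0 (pos m w).
  have -> : \sum_(0 <= i < m) \1_(st i) w * (h * 1) = \sum_(0 <= i < m) h * \1_(st i) w.
    by apply: eq_bigr => i _; rewrite mulr1 mulrC.
  by rewrite lerDl mulr_ge0// indicE ler0n.
Qed.

Lemma stay_prob m : m%:R * h * \int[P]_w \1_(st m) w <= M.
Proof.
apply: le_trans (exit_sum m); rewrite -exZ; last exact: bmeas_stay.
apply: ex_le => [||w].
- by apply: bmeasZ; exact: bmeas_stay.
- apply: (@bmeas_sum _ Omega R _ (index_iota 0 m) (fun i w => h * \1_(st i) w)) => i.
  by apply: bmeasZ; exact: bmeas_stay.
- apply: (@le_trans _ _ (\sum_(0 <= i < m) h * \1_(st m) w)).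
    by rewrite sumr_const_nat subn0 -[leRHS]mulr_natl mulrA.
  rewrite !big_nat; apply: ler_sum => i /andP[_ im]; rewrite ler_pM2l// !indicE.
  have [sw|sw] := pselect (st m w); last by rewrite (memNset sw) ler0n.
  by rewrite (mem_set sw) mem_set//; exact: stay_le (ltnW im) sw.
Qed.

Variables (L : set 'rV[R]_d) (eps : R).
Hypotheses (mL : measurable L) (eL : forall y, L y -> e y <= eps) (eps0 : 0 <= eps).

Definition visited m : set Omega := [set w | exists2 k, (k <= m)%N & L (pos k w)].

Let Hv m := st m `&` visited m.

Let visited_past m : past (fun t => W (2 * t)) Y gr m (visited m).
Proof.
pose G := g_sigma_algebraType (past_gen (fun t => W (2 * t)) Y gr m).
have -> : visited m = \bigcup_(k < m.+1) [set w | L (pos k w)].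
  by apply/seteqP; split=> w; [move=> [k km Lk]; exists k|move=> [k /= km Lk]; exists k].
apply: (@bigcup_measurable _ G (fun k : nat => [set w : G | L (pos k w)]) (fun k => (k < m.+1)%N)).
move=> k /=; rewrite ltnS => km; rewrite -[X in measurable X]setTI.
have mk : @measurable_fun _ _ G _ setT (fun w => X (gr k) w - X (gr 0) w).
  exact: (past_meas_incr grid_gr km).
have mp : @measurable_fun _ _ G _ setT (pos k) by apply: measurable_rVD.
by have := mp measurableT _ mL.
Qed.

Let Hv_past m : past (fun t => W (2 * t)) Y gr m (Hv m).
Proof.
pose G := g_sigma_algebraType (past_gen (fun t => W (2 * t)) Y gr m).
apply: (@measurableI _ G).
  exact: (@stay_past _ _ _ _ W Y D gr x mD grid_gr m).
exact: visited_past.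
Qed.

Let past_m m H : past (fun t => W (2 * t)) Y gr m H -> measurable H.
Proof. move=> pH; exact: (@past_measurable _ _ _ _ _ _ _ (levy_like_V (s_W S)) (levy_like_Y (s_Y S)) _ m grid_gr _ pH). Qed.

Lemma measurable_visited m : measurable (visited m).
Proof. exact: (@past_m m _ (@visited_past m)). Qed.

Let bHv m : bmeas (\1_(Hv m) : Omega -> R).
Proof. by apply: bmeas_indic; exact: (@past_m m _ (@Hv_past m)). Qed.

Let bvis m : bmeas (\1_(visited m) : Omega -> R).
Proof. by apply: bmeas_indic; exact: measurable_visited. Qed.

(* Once the layer [L] is visited, the remaining time in [D] has mean at most [eps]. *)
Lemma visited_time m : \int[P]_w (\sum_(0 <= i < m) h * \1_(Hv i) w) <= eps.
Proof.
have be := d_b de; have h0' := ltW h0; have bPe : bmeas (Pt h e) by exact: (bmeas_Pt S).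
have ege y : 0 <= e y by case/andP: (e0 y).
(* A supermartingale: the first term is the time spent in [D] since the visit, the second the
   expected remaining time. The third term compensates the appearance of the second at the first
   visit, where it is at most [eps]. *)
pose Phi m w := \sum_(0 <= i < m) h * \1_(Hv i) w + \1_(Hv m) w * e (pos m w) - eps * \1_(visited m) w.
have bsum m' : bmeas (fun w => \sum_(0 <= i < m') h * \1_(Hv i) w).
  apply: (@bmeas_sum _ Omega R _ (index_iota 0 m') (fun i w => h * \1_(Hv i) w)) => i.
  exact: bmeasZ.
have bHe m' k : bmeas (fun w => \1_(Hv m') w * e (pos k w)).
  by apply: bmeasM => //; exact: bmeas_pos.
have bHp m' : bmeas (fun w => \1_(Hv m') w * Pt h e (pos m' w)).
  by apply: bmeasM => //; exact: bmeas_pos.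
have bPhi m' : bmeas (Phi m') by apply: bmeasB; [exact: bmeasD|exact: bmeasZ].
have PhiE m' : \int[P]_w Phi m' w <= 0.
  elim: m' => [|k IH].
    rewrite -[leRHS](ex_cst P 0); apply: ex_le => // [|w]; first exact: bmeas_cst.
    rewrite /Phi big_geq// add0r pos0 !indicE.
    have [Lx|Lx] := pselect (visited 0 w); last first.
      by rewrite (memNset Lx) memNset ?mul0r ?mulr0 ?subr0// => -[].
    rewrite (mem_set Lx) mem_set; last by split.
    rewrite mul1r mulr1 subr_le0; apply: eL; case: Lx => i; rewrite leqn0 => /eqP ->.
    by rewrite pos0.
  apply: le_trans IH; rewrite -subr_le0 -exB//.
  apply: (@le_trans _ _ (\int[P]_w (\1_(Hv k) w * e (pos k.+1 w) - \1_(Hv k) w * Pt h e (pos k w)))); last first.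
    by rewrite exB// (markov_pos (@Hv_past k) be) subrr.
  apply: ex_le => [||w]; [exact: bmeasB|exact: bmeasB|].
  rewrite /Phi big_nat_recr//=.
  have hk : h * \1_(Hv k) w - \1_(Hv k) w * e (pos k w) = - (\1_(Hv k) w * Pt h e (pos k w)).
    rewrite !indicE; have [Hw|Hw] := pselect (Hv k w); last by rewrite (memNset Hw) mulr0 !mul0r subrr oppr0.
    by rewrite (mem_set Hw) (d_in de (stay_pos Hw.1)) mulr1 !mul1r opprD addNKr.
  suff : \1_(Hv k.+1) w * e (pos k.+1 w) <=
      \1_(Hv k) w * e (pos k.+1 w) + eps * (\1_(visited k.+1) w - \1_(visited k) w).
    lra.
  have ee := ege (pos k.+1 w).
  have [sw|sw] := pselect (visited k w).
    have sw1 : visited k.+1 w by case: sw => i ik Li; exists i => //; exact: leqW.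
    rewrite [X in _ * (X - _)]indicE (mem_set sw1) [X in _ * (_ - X)]indicE (mem_set sw).
    rewrite subrr mulr0 addr0 ler_wpM2r// !indicE ler_nat.
    have [Hw|Hw] := pselect (Hv k.+1 w); last by rewrite (memNset Hw).
    rewrite (mem_set Hw) mem_set//; split => //.
    by case: Hw => /stayS[].
  have nH : \1_(Hv k) w = 0 :> R by rewrite indicE memNset// => -[].
  rewrite nH mul0r add0r [X in _ * (_ - X)]indicE (memNset sw) subr0.
  have [sw1|sw1] := pselect (visited k.+1 w); last first.
    rewrite (_ : \1_(Hv k.+1) w = 0); first by rewrite mul0r mulr_ge0// indicE ler0n.
    by rewrite indicE memNset// => -[].
  rewrite [X in eps * X]indicE (mem_set sw1) mulr1.
  apply: (@le_trans _ _ (e (pos k.+1 w))).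
    by rewrite ler_piMl// indicE lern1 leq_b1.
  apply: eL; case: sw1 => i; rewrite leq_eqVlt => /orP[/eqP -> //|]; rewrite ltnS => ik Li.
  by exfalso; apply: sw; exists i.
have := PhiE m; rewrite /Phi exB//; [|exact: bmeasD|exact: bmeasZ].
rewrite exD// exZ//.
have : 0 <= \int[P]_w (\1_(Hv m) w * e (pos m w)).
  by apply: ex_ge0 => w; rewrite mulr_ge0// indicE ler0n.
have : \int[P]_w \1_(visited m) w <= 1.
  by rewrite -[leRHS](ex_cst P 1); apply: ex_le => //; exact: bmeas_cst.
move/(ler_wpM2l eps0); lra.
Qed.

Definition lingers kmax l : set Omega :=
  [set w | exists2 k, (k <= kmax)%N & L (pos k w) /\ st (k + l)%N w].

Lemma measurable_lingers kmax l : measurable (lingers kmax l).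
Proof.
have -> : lingers kmax l = \bigcup_(k < kmax.+1) ((pos k @^-1` L) `&` st (k + l)%N).
  by apply/seteqP; split=> w; [move=> [k km Lk]; exists k|move=> [k /= km Lk]; exists k].
apply: bigcup_measurable => k _; apply: measurableI; last exact: (measurable_stay S x mD grid_gr).
by rewrite -[X in measurable X]setTI; exact: (measurable_pos k measurableT mL).
Qed.

(** On this event at least [l] summands of [visited_time] are equal to [h], namely those from the
    visit on: Markov's inequality. *)
Lemma lingers_prob kmax l : l%:R * h * \int[P]_w \1_(lingers kmax l) w <= eps.
Proof.
apply: le_trans (visited_time (kmax + l)); rewrite -exZ; last first.
  by apply: bmeas_indic; exact: measurable_lingers.
have bs : bmeas (fun w => \sum_(0 <= i < kmax + l) h * \1_(Hv i) w).
  apply: (@bmeas_sum _ Omega R _ (index_iota 0 (kmax + l)) (fun i w => h * \1_(Hv i) w)) => i.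
  exact: bmeasZ.
apply: ex_le => // [|w].
  by apply: bmeasZ; apply: bmeas_indic; exact: measurable_lingers.
have pos_sum a b : 0 <= \sum_(a <= i < b) h * \1_(Hv i) w.
  by apply: sumr_ge0 => i _; rewrite mulr_ge0 ?(ltW h0)// indicE ler0n.
rewrite indicE; have [Ew|Ew] := pselect (lingers kmax l w); last first.
  by rewrite (memNset Ew) mulr0; exact: pos_sum.
rewrite (mem_set Ew) mulr1; case: Ew => k kk [Lk sk].
rewrite (big_cat_nat (n := k))//=; last by rewrite (leq_trans kk)// leq_addr.
rewrite (big_cat_nat (n := (k + l)%N) (m := k))//=; [|exact: leq_addr|by rewrite leq_add2r].
have -> : \sum_(k <= i < k + l) h * \1_(Hv i) w = l%:R * h.
  rewrite -[in RHS](addKn k l) mulr_natl -sumr_const_nat !big_nat; apply: eq_bigr => i /andP[ki il].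
  rewrite indicE mem_set ?mulr1//; split; first exact: stay_le (ltnW il) sk.
  by exists k.
have := pos_sum 0%N k; have := pos_sum (k + l)%N (kmax + l)%N; lra.
Qed.

End exit_time.
End positions.

(** * Integrals of step functions *)

Section step_integral.
Context {R : realType}.
Implicit Types (a b c h K : R) (s : measurableTypeR R -> R).
Local Notation mu := (@lebesgue_measure R).

Lemma co_lt_oo a b : (mu `[a, b[%classic < +oo)%E.
Proof.
rewrite lebesgue_measure_itv/=; case: ifP => _; last by rewrite ltry.
by rewrite -EFinB ltry.
Qed.

Lemma co_integrable s a b : bmeas s -> mu.-integrable `[a, b[ (EFin \o s).
Proof.
move=> [ms [N sN]]; apply: measurable_bounded_integrable => //.
- exact: co_lt_oo.
- exact: measurable_funTS.
- by exists N; split; [exact: num_real|move=> M NM x _; exact: le_trans (sN x) (ltW NM)].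
Qed.

Lemma co_cat s a b c : bmeas s -> a <= b -> b <= c ->
  \int[mu]_(t in `[a, c[) s t = \int[mu]_(t in `[a, b[) s t + \int[mu]_(t in `[b, c[) s t.
Proof.
move=> bs ab bc.
have E : `[a, c[%classic = `[a, b[%classic `|` `[b, c[%classic.
  apply/seteqP; split=> t /=; rewrite !in_itv/=.
    by move=> /andP[at_ tc]; have [tb|bt] := ltP t b; [left; rewrite at_|right].
  move=> [/andP[at_ tb]|/andP[bt tc]]; first by rewrite at_ (lt_le_trans tb bc).
  by rewrite tc (le_trans ab bt).
rewrite E Rintegral_setU//; first by rewrite -E; exact: co_integrable.
apply/disj_set2P; apply/seteqP; split=> t //= [].
by rewrite !in_itv/= => /andP[_ tb] /andP[bt _]; rewrite ltNge bt in tb.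
Qed.

Lemma co_length a b : a <= b -> fine (mu `[a, b[%classic) = b - a.
Proof.
move=> ab; rewrite lebesgue_measure_itv/= lte_fin.
move: ab; rewrite le_eqVlt => /predU1P[->|ab]; first by rewrite ltxx subrr.
by rewrite ab -EFinB.
Qed.

Lemma co_bound s a b K : bmeas s -> a <= b -> (forall t, `|s t| <= K) ->
  `|\int[mu]_(t in `[a, b[) s t| <= K * (b - a).
Proof.
move=> bs ab sK; apply: le_trans (le_normr_Rintegral _ _) _ => //.
  exact: co_integrable.
rewrite -(co_length ab) -Rintegral_cst//.
apply: le_Rintegral => //.
- by apply: (co_integrable (s := fun t => `|s t|)); exact: bmeas_norm.
- by apply: (co_integrable (s := cst K)); exact: bmeas_cst.
Qed.

Lemma co_diff s a b c K : bmeas s -> a <= b -> a <= c -> (forall t, `|s t| <= K) ->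
  `|\int[mu]_(t in `[a, b[) s t - \int[mu]_(t in `[a, c[) s t| <= K * `|b - c|.
Proof.
move=> bs ab ac sK; have [bc|cb] := leP b c.
  rewrite (co_cat bs ab bc) opprD addrA subrr sub0r normrN (distrC b c) (ger0_norm (_ : 0 <= c - b)) ?subr_ge0//.
  exact: co_bound.
rewrite (co_cat bs ac (ltW cb)) addrAC subrr add0r (ger0_norm (_ : 0 <= b - c)) ?subr_ge0 ?(ltW cb)//.
by apply: co_bound => //; exact: ltW.
Qed.

Lemma bmeas_step (q : nat -> R) h K : 0 < h -> (forall i, `|q i| <= K) ->
  @bmeas _ (measurableTypeR R) R (fun t => q (Num.truncn (t / h))).
Proof.
move=> h0 qK; split; last by exists K => t; exact: qK.
have mle k : measurable [set t : measurableTypeR R | (Num.truncn (t / h) <= k)%N].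
  have -> : [set t : measurableTypeR R | (Num.truncn (t / h) <= k)%N] = `]-oo, (k.+1%:R * h)[%classic.
    by apply/seteqP; split=> t /=; rewrite in_itv/= truncn_le_nat ltr_pdivrMr.
  exact: measurable_itv.
have meq k : measurable [set t : measurableTypeR R | Num.truncn (t / h) = k].
  case: k => [|k].
    rewrite (_ : mkset _ = [set t : measurableTypeR R | (Num.truncn (t / h) <= 0)%N])//.
    by apply/seteqP; split=> t /=; rewrite leqn0; [move=> ->|move=> /eqP].
  rewrite (_ : mkset _ = [set t : measurableTypeR R | (Num.truncn (t / h) <= k.+1)%N] `\`
     [set t : measurableTypeR R | (Num.truncn (t / h) <= k)%N]); first exact: measurableD.
  apply/seteqP; split=> t /=; first by move=> ->; rewrite leqnn ltnn.
  by move=> [a /negP]; rewrite -ltnNge => b; apply/eqP; rewrite eqn_leq a b.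
move=> _ B mB; rewrite setTI.
have -> : (fun t : measurableTypeR R => q (Num.truncn (t / h))) @^-1` B =
    \bigcup_(k in [set k | B (q k)]) [set t : measurableTypeR R | Num.truncn (t / h) = k].
  apply/seteqP; split=> t /=; first by move=> Bq; exists (Num.truncn (t / h)).
  by move=> [k /= Bk ->].
by apply: bigcup_measurable => k _; exact: meq.
Qed.

Lemma step_integral (q : nat -> R) h K k : 0 < h -> (forall i, `|q i| <= K) ->
  \int[mu]_(t in `[0, (k%:R * h)[) q (Num.truncn (t / h)) = \sum_(0 <= i < k) h * q i.
Proof.
move=> h0 qK; have bs := bmeas_step h0 qK.
elim: k => [|k IH].
  by rewrite mul0r set_itvco0 Rintegral_set0 big_geq.
have k0 : 0 <= k%:R * h by rewrite mulr_ge0// ltW.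
have kk : k%:R * h <= k.+1%:R * h by rewrite ler_pM2r// ler_nat.
rewrite (co_cat bs k0 kk) IH big_nat_recr//=; congr (_ + _).
transitivity (\int[mu]_(t in `[(k%:R * h), (k.+1%:R * h)[) q k).
  apply: eq_Rintegral => t; rewrite inE/= in_itv/= => /andP[t1 t2]; congr q.
  by apply: truncn_def; rewrite ler_pdivlMr// ltr_pdivrMr// t1.
rewrite Rintegral_cst//.
by rewrite co_length// mulrC; congr (_ * _); rewrite -mulrBl -natr1 addrAC subrr add0r mul1r.
Qed.

End step_integral.

(** * Convergence of grid sums along a fixed path *)

Section path.
Context {R : realType} {d : nat}.
Local Notation mu := (@lebesgue_measure R).
Implicit Types (y : 'rV[R]_d) (t : R).
Variables (t0 : R) (D : set 'rV[R]_d) (f g : 'rV[R]_d -> R) (K : R) (xi : R -> 'rV[R]_d) (T : R).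
Local Notation h := (mesh t0).
Hypotheses (t00 : 0 < t0) (oD : open D).
Hypotheses (fK : forall y, `|f y| <= K).
Hypotheses (fc : forall y (e : R), D y -> 0 < e -> exists2 delta : R, 0 < delta &
    forall z, `|z - y| < delta -> `|f z - f y| <= e).
Hypotheses (gc : forall y (e : R), ~ D y -> 0 < e -> exists2 delta : R, 0 < delta &
    forall z, ~ D z -> `|z - y| < delta -> `|g z - g y| <= e).
Hypotheses (xic : forall t (e : R), 0 <= t -> 0 < e -> exists2 delta : R, 0 < delta &
    forall s, t <= s < t + delta -> `|xi s - xi t| < e).
Hypotheses (T0 : 0 < T) (xiT : ~ D (xi T)) (xi_in : forall t, 0 <= t < T -> D (xi t)).
(* the exit at time [T] is seen on fine enough grids *)
Hypothesis xi_out : forall e : R, 0 < e -> exists n : nat, exists k : nat,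
  [/\ (0 < k)%N, k%:R * h n < T + e & ~ D (xi (k%:R * h n))].
Variable m : nat -> nat.
Hypothesis m_large : forall B : R, exists N, forall n, (N <= n)%N -> B <= (m n)%:R * h n.

Definition in_D n i := forall k : nat, (k < i)%N -> D (xi (k.+1%:R * h n)).

Let h0 n : 0 < h n. Proof. by rewrite divr_gt0// exprn_gt0. Qed.

Let hmul n N : (N <= n)%N -> h N = (2 ^ (n - N))%N%:R * h n.
Proof.
move=> Nn; rewrite /mesh natrX -{2}(subnK Nn) exprD; field.
by rewrite !expf_neq0.
Qed.

Lemma hcvg : h n @[n --> \oo] --> (0 : R).
Proof.
have c : t0 * (2^-1) ^+ n @[n --> \oo] --> t0 * (0 : R).
  by apply: cvgMr; apply: cvg_expr; rewrite ger0_norm//; lra.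
rewrite mulr0 in c; apply: cvg_trans c; apply: near_eq_cvg; near=> n.
by rewrite /mesh exprVn.
Unshelve. all: by end_near. Qed.

Let hsmall (e : R) : 0 < e -> exists N, forall n, (N <= n)%N -> h n < e.
Proof.
move=> e0; have e2 : 0 < e / 2 by rewrite divr_gt0.
have /cvgrPdist_le/(_ _ e2)[N _ hN] := hcvg; exists N => n Nn.
have := hN n Nn; rewrite /= sub0r normrN gtr0_norm//; lra.
Qed.

(** [xi_out] supplies an exit on one grid shortly after [T]. By nestedness it is a point of every
    finer grid, so the first exit on such a grid comes no later; it comes no earlier than [T]
    because the path is in [D] before [T]. *)
Lemma exit_index (e : R) : 0 < e -> exists N, forall n, (N <= n)%N -> exists k : nat,
  [/\ forall i, in_D n i <-> (i <= k)%N, ~ D (xi (k.+1%:R * h n)),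
      T <= k.+1%:R * h n < T + e & (k.+1 < m n)%N].
Proof.
move=> e0; have [n0 [k0 [k00 ke kD]]] := xi_out e0.
have [N1 hN1] := m_large (T + e).
exists (maxn n0 N1) => n; rewrite geq_max => /andP[n0n N1n].
pose Q (k : nat) := `[< ~ D (xi (k.+1%:R * h n)) >].
pose k1 := (k0 * 2 ^ (n - n0)).-1.
have k1E : k1.+1%:R * h n = k0%:R * h n0.
  by rewrite prednK ?muln_gt0 ?k00 ?expn_gt0// natrM (hmul n0n) mulrA.
have exQ : exists k, Q k by exists k1; apply/asboolP; rewrite k1E.
have [k /asboolP Qk kmin] := ex_minnP exQ.
have kk1 : (k <= k1)%N by apply: kmin; apply/asboolP; rewrite k1E.
have kT : k.+1%:R * h n < T + e.
  by apply: le_lt_trans ke; rewrite -k1E ler_pM2r// ler_nat.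
have kDin i : in_D n i <-> (i <= k)%N.
  split=> [hi|ik i' ii]; first by rewrite leqNgt; apply/negP => ki; exact: Qk (hi k ki).
  apply: contrapT => nD; have : Q i' by exact/asboolP.
  by move=> /kmin; rewrite leqNgt (leq_trans ii ik).
exists k; split => //.
  rewrite kT andbT leNgt; apply/negP => kT'; apply: Qk; apply: xi_in.
  by rewrite kT' andbT mulr_ge0// ltW.
have := hN1 n N1n; move=> /(lt_le_trans kT).
by rewrite ltr_pM2r// ltr_nat.
Qed.

Lemma path_payoff : \sum_(0 <= i < m n) (`[< in_D n i >]%:R - `[< in_D n i.+1 >]%:R) * g (xi (i.+1%:R * h n))
  @[n --> \oo] --> g (xi T).
Proof.
apply/cvgrPdist_le => e e0.
have [dg dg0 hg] := gc xiT e0.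
have [dx dx0 hx] := xic (ltW T0) dg0.
have [N hN] := exit_index dx0; exists N => //= n Nn.
have [k [hk kD kT km]] := hN n Nn.
have b i : `[< in_D n i >] = (i <= k)%N.
  by apply/idP/idP => [/asboolP/hk//|ik]; apply/asboolP/hk.
have kmn : (k <= m n)%N by apply: leq_trans (ltnW km).
rewrite (big_cat_nat (n := k))//= big_nat big1 => [|i /andP[_ ik]]; last first.
  by rewrite !b (ltnW ik) ik subrr mul0r.
rewrite add0r big_ltn; last exact: leq_trans km.
rewrite !b leqnn ltnn subr0 mul1r big_nat big1 => [|i /andP[ki _]]; last first.
  by rewrite !b leqNgt ki/= [(i < k)%N]ltnNge (ltnW ki) subrr mul0r.
by rewrite addr0 distrC; apply: hg => //; apply: hx.
Qed.

Let K0 : 0 <= K. Proof. exact: le_trans (normr_ge0 _) (fK 0). Qed.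

(** The path is read at the next grid time, strictly after [t]: continuity is available from the
    right only. *)
Definition sampled n (t : measurableTypeR R) : R := f (xi ((Num.truncn (t / h n)).+1%:R * h n)).

Let bsampled n : bmeas (sampled n).
Proof. exact: (bmeas_step (q := fun i => f (xi (i.+1%:R * h n))) (h0 n) (fun i => fK _)). Qed.

Lemma sampled_cvg t : 0 <= t < T -> sampled n t @[n --> \oo] --> f (xi t).
Proof.
move=> tT; have /andP[t00' _] := tT.
apply/cvgrPdist_le => e e0; have [df df0 hf] := fc (xi_in tT) e0.
have [dx dx0 hx] := xic t00' df0; have [N hN] := hsmall dx0.
exists N => //= n Nn; rewrite distrC; apply: hf; apply: hx.
have th : 0 <= t / h n by rewrite divr_ge0// ltW.
have /andP[a b] := truncn_itv th.
apply/andP; split; first by move: b; rewrite ltr_pdivrMr// => /ltW.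
rewrite -natr1 mulrDl mul1r; apply: ler_ltD; last exact: hN.
by move: a; rewrite ler_pdivlMr.
Qed.

Lemma path_integral_cvg : \int[mu]_(t in `[0, T[) sampled n t @[n --> \oo] -->
  \int[mu]_(t in `]0, T[) f (xi t).
Proof.
have mI : measurable `[0, T[%classic by exact: (@measurable_itv R).
have mF : @measurable_fun _ _ (measurableTypeR R) _ `[0, T[ (fun t => f (xi t)).
  apply: (@measurable_fun_cvg _ _ _ `[0, T[%classic sampled) => [n|t /=].
    by apply: measurable_funTS; case: (bsampled n).
  by rewrite in_itv/=; exact: sampled_cvg.
have iK : mu.-integrable `[0, T[ (EFin \o cst K) by apply: (co_integrable (s := cst K)); exact: bmeas_cst.
have dct := @dominated_convergence _ (measurableTypeR R) R mu `[0, T[%classic mI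
  (fun n => EFin \o sampled n) (EFin \o (fun t => f (xi t))) (EFin \o cst K) _ _ _ iK.
have [||||iF _ c] := dct.
- by move=> n; apply/measurable_EFinP; apply: measurable_funTS; case: (bsampled n).
- exact/measurable_EFinP.
- apply: aeW => t /=; rewrite in_itv/= => tT; apply: cvg_EFin; first exact: nearW.
  exact: sampled_cvg.
- by apply: aeW => t n _ /=; rewrite lee_fin fK.
rewrite [X in _ --> X]Rintegral_itv_obnd_cbnd; last first.
  apply: integrableS iF => // t /=; rewrite !in_itv/= => /andP[/ltW-> ->] //.
apply: fine_cvg; rewrite fineK//.
exact: integrable_fin_num.
Qed.

Lemma path_gain : \sum_(0 <= i < m n) `[< in_D n i >]%:R * (h n * f (xi (i%:R * h n)))
  @[n --> \oo] --> \int[mu]_(t in `]0, T[) f (xi t).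
Proof.
have c0 : (\sum_(0 <= i < m n) `[< in_D n i >]%:R * (h n * f (xi (i%:R * h n))) -
    \int[mu]_(t in `[0, T[) sampled n t) @[n --> \oo] --> (0 : R).
  apply/cvgrPdist_le => e e0.
  have e3 : 0 < e / 3 / (K + 1) by rewrite !divr_gt0// ltr_wpDl.
  have [N1 hN1] := exit_index e3; have [N2 hN2] := hsmall e3.
  exists (maxn N1 N2) => // n nn; have /andP[n1 n2] : (N1 <= n)%N && (N2 <= n)%N by rewrite -geq_max.
  have [k [hk kD /andP[kT1 kT2] km]] := hN1 n n1; have hn := hN2 n n2.
  have b i : `[< in_D n i >] = (i <= k)%N.
    by apply/idP/idP => [/asboolP/hk//|ik]; apply/asboolP/hk.
  rewrite (big_cat_nat (n := k.+1))//=; last exact: ltnW.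
  have -> : \sum_(k.+1 <= i < m n) `[< in_D n i >]%:R * (h n * f (xi (i%:R * h n))) = 0.
    by rewrite big_nat big1// => i /andP[ki _]; rewrite !b leqNgt ki/= mul0r.
  rewrite addr0.
  (* The sum reads the path at left endpoints and [sampled] at right endpoints; shifting the index
     leaves the term at time 0 apart, of size at most [h n * K]. *)
  have -> : \sum_(0 <= i < k.+1) `[< in_D n i >]%:R * (h n * f (xi (i%:R * h n))) =
      h n * f (xi (0%:R * h n)) + \int[mu]_(t in `[0, (k%:R * h n)[) sampled n t.
    rewrite (step_integral (q := fun i => f (xi (i.+1%:R * h n))) k (h0 n) (fun i => fK _)).
    rewrite big_nat_recl//= b leq0n mul1r; congr (_ + _).
    by rewrite !big_nat; apply: eq_bigr => i /andP[_ ik]; rewrite b ik mul1r.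
  rewrite sub0r normrN.
  have k0 : 0 <= k%:R * h n by rewrite mulr_ge0// ltW.
  have := co_diff (bsampled n) k0 (ltW T0) (fun t => fK _).
  set I1 := Rintegral _ _ _; set I2 := Rintegral _ _ _ => h12.
  have hf : `|h n * f (xi (0%:R * h n))| <= h n * (K + 1).
    rewrite normrM gtr0_norm// ler_pM2l//; have := fK (xi (0%:R * h n)); lra.
  have kh : `|k%:R * h n - T| <= e / 3 / (K + 1) + h n.
    have hn0 := h0 n.
    by move: kT1 kT2; rewrite -natr1 mulrDl mul1r => kT1 kT2; rewrite ler_norml; apply/andP; split; lra.
  have KK : K * `|k%:R * h n - T| <= (K + 1) * (e / 3 / (K + 1) + h n).
    by apply: ler_pM => //; rewrite lerDl.
  have E : (K + 1) * (e / 3 / (K + 1)) = e / 3 by rewrite mulrC divfK// gt_eqF// ltr_wpDl.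
  have hK : (K + 1) * h n <= e / 3 by rewrite -E ler_wpM2l ?addr_ge0// ltW.
  have := ler_normD (h n * f (xi (0%:R * h n))) (I1 - I2); rewrite addrA.
  lra.
pose A n : R := \sum_(0 <= i < m n) `[< in_D n i >]%:R * (h n * f (xi (i%:R * h n))).
pose B n : R := \int[mu]_(t in `[0, T[) sampled n t.
have c : A n - B n + B n @[n --> \oo] --> 0 + \int[mu]_(t in `]0, T[) f (xi t).
  by apply: cvgD; [exact: c0|exact: path_integral_cvg].
rewrite add0r in c; have E : (fun n => A n - B n + B n) = A by apply/funext => n; rewrite subrK.
by rewrite E in c.
Qed.

End path.

(** * Null sets and almost sure limits *)

Section negligible.
Context {R : realType} dT {T : measurableType dT} (P : probability T R).

(** The limit becomes measurable after being set to 0 on a measurable null set, and completeness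
    removes this change. In this way functionals of the exit time are measurable without a study of
    the exit time itself. *)
Lemma ae_limit_measurable (f_ : nat -> T -> R) (F : T -> R) : measure_is_complete P ->
  (forall n, bmeas (f_ n)) -> {ae P, forall w, f_ n w @[n --> \oo] --> F w} ->
  measurable_fun setT (EFin \o F).
Proof.
move=> cP bf [N [mN N0 hN]].
pose G w : R := \1_(~` N) w * F w.
have mG : measurable_fun setT (EFin \o G).
  apply/measurable_EFinP; apply: (@measurable_fun_cvg _ _ _ setT (fun n w => \1_(~` N) w * f_ n w)).
    move=> n; apply: measurable_funM; last by case: (bf n).
    by apply: measurable_indic; exact: measurableC.
  move=> w _; rewrite /G indicE; have [Nw|Nw] := pselect (N w).
    rewrite memNset; last by apply.
    by rewrite mul0r; under eq_fun do rewrite mul0r; exact: cvg_cst.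
  rewrite mem_set// mul1r; under eq_fun do rewrite mul1r.
  by apply: contrapT => h; apply: Nw; apply: hN.
apply: (ae_measurable_fun cP _ mG); exists N; split => // w /= h.
apply: contrapT => Nw; apply: h => _; congr EFin.
by rewrite /G indicE mem_set// mul1r.
Qed.

Lemma null_of_small (A : set T) : (forall e : R, 0 < e -> exists B, [/\ measurable B, A `<=` B & (P B <= e%:E)%E]) ->
  P.-negligible A.
Proof.
move=> h; have /choice[B hB] : forall n : nat, exists B, [/\ measurable B, A `<=` B & (P B <= (n.+1%:R^-1)%:E)%E].
  by move=> n; apply: h; rewrite invr_gt0.
exists (\bigcap_n B n); split.
- by apply: bigcap_measurable => // n _; case: (hB n).
- apply/eqP; rewrite eq_le measure_ge0 andbT; apply/lee_addgt0Pr => e e0; rewrite add0e.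
  have [n _ /(_ n (leqnn n)) hn] := near_infty_natSinv_lt (PosNum e0).
  have [mB _ Be] := hB n.
  apply: le_trans (_ : (_ <= P (B n))%E) (le_trans Be _); last by rewrite lee_fin ltW.
  apply: le_measure; rewrite ?inE//; last by move=> w /(_ n I).
  by apply: bigcap_measurable => // k _; case: (hB k).
- by move=> w Aw n _; case: (hB n) => _ /(_ w Aw).
Qed.

Lemma liminf_prob (A : nat -> set T) (c : R) (N : nat) : (forall n, measurable (A n)) ->
  (forall n, (N <= n)%N -> (P (A n) <= c%:E)%E) ->
  (P (\bigcup_m \bigcap_(n >= m) A n) <= c%:E)%E.
Proof.
move=> mA hA.
have mI m : measurable (\bigcap_(n >= m) A n).
  by apply: bigcap_measurableType => // n _.
have c1 := @nondecreasing_cvg_mu _ _ _ P (fun m => \bigcap_(n >= m) A n) mI.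
have mU : measurable (\bigcup_m \bigcap_(n >= m) A n) by exact: bigcupT_measurable.
have hom : {homo (fun m => \bigcap_(n >= m) A n) : n m / (n <= m)%N >-> (n <= m)%O}.
  by move=> n m nm; apply/subsetPset => w h k /= mk; apply: h; exact: leq_trans mk.
have {}c1 := c1 mU hom.
rewrite -(cvg_lim (@ereal_hausdorff R) c1); apply: lime_le; first exact: cvgP c1.
exists N => // m /= Nm; apply: le_trans (hA m Nm).
by apply: le_measure; rewrite ?inE// => w /(_ m (leqnn m)).
Qed.

End negligible.

(** * From the discrete problem to the expectation *)

Section scheme.
Context {R : realType} {d : nat} {dO : measure_display}
  {Omega : measurableType dO}.
Variables (P : probability Omega R) (j : 'rV[R]_d -> R) (W Y : R -> Omega -> 'rV[R]_d).
Hypothesis S : setup P j W Y.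
Implicit Types (y p q : 'rV[R]_d) (t s : R).
Local Notation X := (Xsum W Y).
Local Notation Pt := (Pt P W Y).
Local Notation leb := (@lebesgue_measure R).

Record scheme (D : set 'rV[R]_d) (f g : 'rV[R]_d -> R) (K r M t0 : R)
    (beta : 'rV[R]_d -> R) (V e_ : nat -> 'rV[R]_d -> R) : Prop := Scheme {
  c_bar : barrier P W Y r beta M t0 ;
  c_data : data D f g K ;
  c_r : forall x, D x -> `|x| <= r ;
  c_V : forall n, discrete_solution P W Y (mesh t0 n) D f g (V n) (K * M) ;
  c_e : forall n, discrete_solution P W Y (mesh t0 n) D (fun=> 1) (fun=> 0) (e_ n) M ;
  c_e0 : forall n x, 0 <= e_ n x <= M ;
  c_es : forall n x, e_ n x <= mesh t0 n + Pt (mesh t0 n) (e_ n) x }.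

Lemma scheme_exists D f g (K r M t0 : R) beta : barrier P W Y r beta M t0 -> data D f g K ->
  (forall x, D x -> `|x| <= r) -> exists V e_, scheme D f g K r M t0 beta V e_.
Proof.
move=> bb pb Dr.
have /choice[V hV] := discrete_solution_exists S bb pb Dr.
have /choice[e_ he] := discrete_exit_time S bb pb Dr.
by exists V, e_; split => // n; case: (he n).
Qed.

Variables (D : set 'rV[R]_d) (f g : 'rV[R]_d -> R) (K r M t0 : R)
    (beta : 'rV[R]_d -> R) (V e_ : nat -> 'rV[R]_d -> R).
Hypothesis C : scheme D f g K r M t0 beta V e_.
Hypothesis cP : measure_is_complete P.

Let bb := c_bar C.
Let pb := c_data C.
Let t00 : 0 < t0. Proof. by case/andP: (b_t0 bb). Qed.
Let M0 : 0 < M.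
Proof. exact: lt_le_trans ltr01 (le_trans (b_ge1 bb 0) (b_leM bb 0)). Qed.
Let oD : open D. Proof. by case: (p_lip pb). Qed.
Let mD : measurable D. Proof. exact: measurable_open. Qed.
Let K0 : 0 <= K. Proof. exact: le_trans (normr_ge0 _) (p_fK pb 0). Qed.
Let h0 n : 0 < mesh t0 n. Proof. exact: mesh_gt0 bb n. Qed.

Let data1 : data D (fun=> 1) (fun=> 0) 1.
Proof.
split.
- exact: p_lip pb.
- exact: bmeas_cst.
- exact: bmeas_cst.
- by move=> x; rewrite normr1.
- by move=> x; rewrite normr0.
- by move=> e e0; exists 1 => // x y _ _ _; rewrite subrr normr0 ltW.
- by move=> q e _ e0; exists 1 => // x _ _; rewrite subrr normr0 ltW.
Qed.

Definition layer (N : nat) : set 'rV[R]_d := \bigcup_(q in ~` D) ball q N.+1%:R^-1.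

Lemma measurable_layer N : measurable (layer N).
Proof.
apply: measurable_open; apply: bigcup_open => q _; apply: ball_open.
Qed.

Lemma exit_layer_uniform (eps : R) : 0 < eps -> exists N, forall n y, (N <= n)%N -> layer N y ->
  e_ n y <= eps.
Proof.
move=> e0.
have he1 n : discrete_solution P W Y (mesh t0 n) D (fun=> 1) (fun=> 0) (e_ n) (1 * M).
  by rewrite mul1r; exact: c_e C n.
have [N hN] := layer_uniform S bb data1 (c_r C) he1 (c_e C) (c_e0 C) (c_es C) r e0.
exists N => n y Nn [q Dq /ball_normP yq].
have [Dy|Dy] := pselect (D y); last by rewrite (d_out (c_e C n) Dy) ltW.
have := hN n y q Nn (c_r C Dy) yq (or_intror Dq).
rewrite (d_out (c_e C n) Dq) subr0; exact: le_trans (ler_norm _).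
Qed.

Variable x : 'rV[R]_d.
Hypothesis Dx : D x.
Local Notation h := (mesh t0).
Local Notation st n := (stay W Y D (gr (h n)) x).
Local Notation ps n := (pos W Y x (h n)).
(** The number of steps for which the time horizon is [n.+1 * t0]: it tends to infinity while the
    mesh tends to 0. *)
Definition steps (n : nat) : nat := (n.+1 * 2 ^ n)%N.

Lemma steps_mesh n : (steps n)%:R * h n = n.+1%:R * t0.
Proof.
rewrite /steps /mesh natrM natrX; field.
by rewrite expf_neq0.
Qed.

Lemma steps_large (B : R) : exists N, forall n, (N <= n)%N -> B <= (steps n)%:R * h n.
Proof.
exists (Num.bound (`|B| / t0)) => n Nn; rewrite steps_mesh -ler_pdivrMr//.
have := archi_boundP (divr_ge0 (normr_ge0 B) (ltW t00)) => /ltW b.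
apply: le_trans (_ : `|B| / t0 <= _); first by rewrite ler_pM2r ?invr_gt0// ler_norm.
by apply: le_trans b _; rewrite ler_nat leqW.
Qed.

Definition never_exit : set Omega := \bigcap_k st 0 k.

Lemma never_exit_null : P.-negligible never_exit.
Proof.
apply: null_of_small => e e0.
pose k := (Num.bound (M / e / t0)).+1.
have ms : measurable (st 0 k) by apply: (measurable_stay S x mD); exact: grid_gr.
exists (st 0 k); split => //; first by move=> w; exact.
rewrite -(@fineK _ (P _)) ?fin_num_measure// lee_fin -ex_indic//.
have := stay_prob S mD Dx (h0 0) (c_e C 0) (c_e0 C 0) k.
have hk : M / e <= k%:R * h 0.
  rewrite /mesh expr0 divr1 -ler_pdivrMr//.
  have q0 : 0 <= M / e / t0 by rewrite !divr_ge0 ?(ltW M0) ?(ltW e0) ?(ltW t00).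
  by apply: le_trans (ltW (archi_boundP q0)) _; rewrite ler_nat leqW.
have kh0 : 0 < k%:R * h 0 by rewrite mulr_gt0.
rewrite mulrC -ler_pdivlMr// => h1; apply: le_trans h1 _.
by rewrite ler_pdivrMr// mulrC -ler_pdivrMr.
Qed.

(* paths that touch the complement of [D] and stay in [D] afterwards on all grids *)
Definition late_exit (delta : R) : set Omega :=
  [set w | forall N, exists n0, forall n, (n0 <= n)%N ->
     lingers W Y D x (h n) (layer N) (steps n) (Num.truncn (delta / h n)) w].

(** Once the path is in a thin layer around the complement of [D], the expected remaining time is
    small uniformly in the mesh, so remaining in [D] for time [delta] has small probability. The
    event asks for this on all sufficiently fine grids, hence its probability is bounded by that for
    a single fine grid ([liminf_prob]). *)
Lemma late_exit_null (delta : R) : 0 < delta -> P.-negligible (late_exit delta).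
Proof.
move=> d0; apply: null_of_small => e e0.
have e1 : 0 < e * (delta / 2) by rewrite mulr_gt0// divr_gt0.
have [N hN] := exit_layer_uniform e1.
pose A n := lingers W Y D x (h n) (layer N) (steps n) (Num.truncn (delta / h n)).
have mA n : measurable (A n).
  by apply: (measurable_lingers S x mD (h0 n)); exact: measurable_layer.
have [N1 hN1] : exists N1, forall n, (N1 <= n)%N -> h n <= delta / 2.
  have d2 : 0 < delta / 2 by rewrite divr_gt0.
  have /cvgrPdist_le/(_ _ d2)[N1 _ hN1] := @hcvg R t0; exists N1 => n nn.
  by have := hN1 n nn; rewrite /= sub0r normrN gtr0_norm.
exists (\bigcup_m \bigcap_(n >= m) A n); split.
- apply: bigcupT_measurable => m; apply: bigcap_measurableType => // n _.
- by move=> w /(_ N)[n0 hw]; exists n0 => // n /= n0n; exact: hw.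
apply: (@liminf_prob _ _ _ P A e (maxn N N1)) => // n; rewrite geq_max => /andP[nN n1].
rewrite -(@fineK _ (P _)) ?fin_num_measure// lee_fin -ex_indic//.
have := lingers_prob S mD Dx (h0 n) (c_e C n) (c_e0 C n) (measurable_layer N) (hN n ^~ nN) (ltW e1)
   (steps n) (Num.truncn (delta / h n)).
rewrite -/(A n); set I := Rintegral _ _ _ => hI.
have I0 : 0 <= I by apply: ex_ge0 => w; rewrite indicE ler0n.
have dh : 0 <= delta / h n by rewrite divr_ge0 ?(ltW d0) ?(ltW (h0 n)).
have /andP[_ tr] := truncn_itv dh.
have l2 : delta / 2 <= (Num.truncn (delta / h n))%:R * h n.
  move: tr; rewrite ltr_pdivrMr// -natr1 mulrDl mul1r; have := hN1 n n1; lra.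
have := ler_wpM2r I0 l2 => h3; have := le_trans h3 hI.
by rewrite [leRHS]mulrC ler_pM2l// divr_gt0.
Qed.

Definition xi (w : Omega) t := x + X t w.

Lemma xi_right w t (e : R) : 0 <= t -> 0 < e -> exists2 delta : R, 0 < delta &
  forall s, t <= s < t + delta -> `|xi w s - xi w t| < e.
Proof.
move=> t0' e0; have e2 : 0 < e / 2 by rewrite divr_gt0.
have [_ Wc _] := s_W S; have [_ _ Yc _ _] := s_Y S.
have t20 : 0 <= 2 * t by rewrite mulr_ge0.
have [d1 d10 h1] : exists2 d1 : R, 0 < d1 & forall s, 0 <= s -> `|s - 2 * t| < d1 ->
    `|W s w - W (2 * t) w| < e / 2.
  have /subspace_continuousP/(_ (2 * t) t20) c := Wc w.
  have : nbhs (W (2 * t) w) (ball (W (2 * t) w) (e / 2)) by exact: nbhsx_ballx.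
  move=> /c; rewrite /= /within /= => /nbhs_ballP[d1 /= d10 hd]; exists d1 => // s s0 sd.
  apply/ball_normP; apply: hd => //.
  by rewrite -ball_normE /= distrC.
have [d2 d20 h2] : exists2 d2 : R, 0 < d2 & forall s, t < s < t + d2 -> `|Y s w - Y t w| < e / 2.
  have [c _] := Yc w.
  have : nbhs (Y t w) (ball (Y t w) (e / 2)) by exact: nbhsx_ballx.
  move=> /(c t t0'); rewrite /= /within /= => /nbhs_ballP[d2 /= d20 hd]; exists d2 => // s /andP[ts sd].
  apply/ball_normP; apply: hd => //.
  by rewrite -ball_normE /= distrC ger0_norm; lra.
exists (Num.min (d1 / 2) d2); first by rewrite lt_min d20 divr_gt0.
move=> s /andP[ts]; rewrite -ltrBlDl lt_min => /andP[s1 s2].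
have [<-|nts] := eqVneq t s; first by rewrite subrr normr0.
have {}ts : t < s by rewrite lt_neqAle nts.
have a1 : `|W (2 * s) w - W (2 * t) w| < e / 2.
  apply: h1; first by rewrite mulr_ge0//; lra.
  by rewrite -mulrBr normrM !ger0_norm//; lra.
have a2 : `|Y s w - Y t w| < e / 2 by apply: h2; rewrite ts -ltrBlDl.
rewrite (_ : _ - _ = (W (2 * s) w - W (2 * t) w) + (Y s w - Y t w)).
  by apply: le_lt_trans (ler_normD _ _) _; lra.
by rewrite /xi /Xsum /psum; apply/rowP => i; rewrite !mxE; ring.
Qed.

Definition tau w := exit_time D (xi w).

Definition good w := [/\ X 0 w = 0, ~ never_exit w & forall i : nat, ~ late_exit i.+1%:R^-1 w].

Lemma good_ae : {ae P, forall w, good w}.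
Proof.
have h1 := X0_ae S.
have h2 : {ae P, forall w, ~ never_exit w}.
  by apply: negligibleS never_exit_null => w /contrapT.
have h3 : {ae P, forall w, forall i : nat, ~ late_exit i.+1%:R^-1 w}.
  have hn : P.-negligible (\bigcup_i late_exit i.+1%:R^-1).
    by apply: negligible_bigcup => i; apply: late_exit_null; rewrite invr_gt0.
  apply: negligibleS hn => w /= /existsNP[i /contrapT hi]; exists i => //.
by apply: filterS3 h1 h2 h3 => w ? ? ?; split.
Qed.

Section good_path.
Variable w : Omega.
Hypothesis gw : good w.

Let X0 : X 0 w = 0. Proof. by case: gw. Qed.

Lemma pos_xi n k : ps n k w = xi w (k%:R * h n).
Proof. by rewrite /pos /gr mul0r X0 subr0. Qed.

Lemma stay_in_D n i : `[< in_D t0 D (xi w) n i >]%:R = \1_(st n i) w :> R.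
Proof.
rewrite indicE; congr (nat_of_bool _)%:R; apply/asboolP/idP.
  by move=> hi; apply/mem_set => k ki; have := pos_xi n k.+1; rewrite /pos => ->; exact: hi.
by move=> /set_mem hi k ki; rewrite -pos_xi; exact: hi.
Qed.

Lemma coarse_exit : exists k, ~ st 0 k w.
Proof. by have [_ nw _] := gw; apply/existsNP => h1; apply: nw => k _; exact: h1. Qed.

Definition T := fine (tau w).

Let xi0 : xi w 0 = x. Proof. by rewrite /xi X0 addr0. Qed.

Lemma tau_fin : tau w = T%:E.
Proof.
rewrite /T fineK// fin_numElt; apply/andP; split.
  apply: (@lt_le_trans _ _ 0%E); first exact: ltNy0.
  by apply: le_ereal_inf_tmp => _ [t [tp _] <-]; rewrite lee_fin ltW.
have [k hk] := coarse_exit.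
have [i hi] : exists i : nat, ~ D (xi w (i.+1%:R * h 0)).
  apply: contrapT => hn; apply: hk => i ik.
  have := pos_xi 0 i.+1; rewrite /pos => ->; apply: contrapT => hD; apply: hn; exists i.
  exact: hD.
apply: (@le_lt_trans _ _ (i.+1%:R * h 0)%:E); last exact: ltry.
by apply: ereal_inf_lbound; exists (i.+1%:R * h 0) => //; split => //; rewrite mulr_gt0.
Qed.

Lemma before_tau t : 0 < t -> (t%:E < tau w)%E -> D (xi w t).
Proof.
move=> tp; rewrite ltNge => /negP h1; apply: contrapT => nD; apply: h1.
by apply: ereal_inf_lbound; exists t.
Qed.

Let T_ge0 : 0 <= T.
Proof.
by rewrite -lee_fin -tau_fin; apply: le_ereal_inf_tmp => _ [t [tp _] <-]; rewrite lee_fin ltW.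
Qed.

(** If the path were in the open set [D] at time [T], right continuity would keep it there for a
    while, and the infimum defining the exit time would be larger than [T]. *)
Lemma xi_T : ~ D (xi w T).
Proof.
move=> DT; have /nbhs_ballP[e /= e0 he] : nbhs (xi w T) D by exact: open_nbhs_nbhs.
have [delta d0 hd] := xi_right w T_ge0 e0.
have : ((T + delta)%:E <= tau w)%E.
  apply: le_ereal_inf_tmp => _ [t [tp nD] <-]; rewrite lee_fin leNgt; apply/negP => tT.
  apply: nD; have [tT'|Tt] := ltP t T.
    by apply: before_tau => //; rewrite tau_fin lte_fin.
  by apply: he; apply/ball_normP; apply: hd; rewrite Tt.
by rewrite tau_fin lee_fin; lra.
Qed.

Lemma T_gt0 : 0 < T.
Proof.
rewrite lt_neqAle T_ge0 andbT; apply/eqP => T0.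
by apply: xi_T; rewrite -T0 xi0.
Qed.

Lemma xi_before t : 0 <= t < T -> D (xi w t).
Proof.
move=> /andP[]; rewrite le_eqVlt => /predU1P[<- _|tp tT]; first by rewrite xi0.
by apply: before_tau => //; rewrite tau_fin lte_fin.
Qed.

(** Otherwise the path would be in [D] at all positive grid times before [T + e]. At the first grid
    time after [T] it is close to [xi w T], a point outside [D], and from there on it stays in [D]
    on the grid for a time bounded below: a late exit, excluded for good paths. *)
Lemma xi_after (e : R) : 0 < e -> exists n : nat, exists k : nat,
  [/\ (0 < k)%N, k%:R * h n < T + e & ~ D (xi w (k%:R * h n))].
Proof.
move=> e0; apply: contrapT => hn.
have inD n k : (0 < k)%N -> k%:R * h n < T + e -> D (xi w (k%:R * h n)).
  by move=> k0 kT; apply: contrapT => nD; apply: hn; exists n, k.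
have [_ _ gl] := gw.
have e2 : 0 < e / 2 by rewrite divr_gt0.
have [J _ /(_ J (leqnn J)) hJ] := near_infty_natSinv_lt (PosNum e2).
apply: (gl J) => N; rewrite /= in hJ.
have N0 : 0 < N.+1%:R^-1 :> R by rewrite invr_gt0.
have [dx dx0 hx] := xi_right w T_ge0 N0.
have m0 : 0 < Num.min dx (e / 2) by rewrite lt_min dx0.
have m2 : 0 < Num.min dx (e / 2) / 2 by rewrite divr_gt0.
have /cvgrPdist_le/(_ _ m2)[N1 _ hN1] := @hcvg R t0.
have [N2 hN2] := steps_large (T + e).
exists (maxn N1 N2) => n; rewrite geq_max => /andP[n1 n2].
have hn' : h n < Num.min dx (e / 2).
  by have := hN1 n n1; rewrite /= sub0r normrN gtr0_norm//; lra.
move: hn'; rewrite lt_min => /andP[hdx he2].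
have Th : 0 <= T / h n by rewrite divr_ge0 ?T_ge0 ?(ltW (h0 n)).
have /andP[] := truncn_itv Th; set k := Num.truncn _.
rewrite ler_pdivlMr// ltr_pdivrMr// => k1 k2.
have k3 : k.+1%:R * h n <= T + h n by rewrite -natr1 mulrDl mul1r lerD2r.
exists k.+1.
  rewrite -ltnS -(ltr_nat R) -(ltr_pM2r (h0 n)).
  apply: (@le_lt_trans _ _ ((steps n)%:R * h n)); last by rewrite ltr_pM2r// ltr_nat.
  by have := hN2 n n2; lra.
split.
  exists (xi w T); first exact: xi_T.
  by apply/ball_normP; rewrite pos_xi; apply: hx; rewrite ltW//=; lra.
move=> i ik; have := pos_xi n i.+1; rewrite /pos => ->; apply: inD => //.
have dh : 0 <= J.+1%:R^-1 / h n by rewrite divr_ge0 ?(ltW (h0 n)).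
have /andP[tr _] := truncn_itv dh; move: tr; rewrite ler_pdivlMr// => tr.
apply: (@le_lt_trans _ _ ((k.+1 + Num.truncn (J.+1%:R^-1 / h n))%:R * h n)).
  by rewrite ler_pM2r// ler_nat.
apply: (@le_lt_trans _ _ ((T + h n) + J.+1%:R^-1)); first by rewrite natrD mulrDl lerD.
have : J.+1%:R^-1 < e / 2 := hJ.
by move: (J.+1%:R^-1) => v; lra.
Qed.

Let fc y (e : R) : D y -> 0 < e -> exists2 delta : R, 0 < delta &
    forall z, `|z - y| < delta -> `|f z - f y| <= e.
Proof.
move=> Dy e0; have [d1 d10 h1] := p_fc pb e0.
have /nbhs_ballP[d2 /= d20 h2] : nbhs y D by exact: open_nbhs_nbhs.
exists (Num.min d1 d2); first by rewrite lt_min d10.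
move=> z; rewrite lt_min => /andP[z1 z2]; apply: h1 => //.
by apply: h2; exact/ball_normP.
Qed.

Lemma gain_cvg : gain W Y D x (h n) f (steps n) w @[n --> \oo] -->
  \int[leb]_(t in [set t | 0 < t /\ (t%:E < tau w)%E]) f (xi w t).
Proof.
have c := @path_gain R d t0 D f K (xi w) T t00 (p_fK pb) fc (@xi_right w) T_gt0 xi_before xi_after steps steps_large.
have -> : [set t | 0 < t /\ (t%:E < tau w)%E] = `]0, T[%classic.
  apply/seteqP; split=> t /=; rewrite tau_fin lte_fin in_itv/=; first by move=> [-> ->].
  by move=> /andP.
rewrite (_ : (fun n => gain W Y D x (h n) f (steps n) w) = (fun n =>
  \sum_(0 <= i < steps n) `[< in_D t0 D (xi w) n i >]%:R * (h n * f (xi w (i%:R * h n))))) //.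
by apply/funext => n; apply: eq_bigr => i _; rewrite stay_in_D pos_xi.
Qed.

Lemma payoff_cvg : payoff W Y D x (h n) g (steps n) w @[n --> \oo] --> g (xi w (fine (tau w))).
Proof.
have c := @path_payoff R d t0 D g (xi w) T t00 (p_gc pb) (@xi_right w) T_gt0 xi_T xi_before xi_after steps steps_large.
rewrite (_ : (fun n => payoff W Y D x (h n) g (steps n) w) = (fun n =>
  \sum_(0 <= i < steps n) (`[< in_D t0 D (xi w) n i >]%:R - `[< in_D t0 D (xi w) n i.+1 >]%:R) *
     g (xi w (i.+1%:R * h n)))) //.
by apply/funext => n; apply: eq_bigr => i _; rewrite !stay_in_D pos_xi.
Qed.

(** The right-hand side is [K] times the exit time on the coarsest grid. By nestedness a path that
    is outside [D] at a coarse grid time is so on every finer grid, which gives a dominating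
    function independent of [n], integrable by [exit_sum]. *)
Lemma gain_bound n m : (`|(gain W Y D x (h n) f m w)%:E| <=
  K%:E * \sum_(0 <= i <oo) (h 0 * \1_(st 0 i) w)%:E)%E.
Proof.
pose Q k := `[< ~ st 0 k w >].
have exQ : exists k, Q k by have [k hk] := coarse_exit; exists k; apply/asboolP.
have [k /asboolP Qk kmin] := ex_minnP exQ.
have kin i : (i < k)%N -> st 0 i w.
  by move=> ik; apply: contrapT => h1; have := kmin i (asboolT h1); rewrite leqNgt ik.
have km i : (k * 2 ^ n <= i)%N -> ~ st n i w.
  move=> ki hi; apply: Qk => l lk.
  have := hi (l.+1 * 2 ^ n).-1; rewrite prednK ?muln_gt0 ?expn_gt0// => /(_ _)/wrap[].
    by apply: leq_trans ki; rewrite leq_mul2r lk orbT.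
  have := pos_xi n (l.+1 * 2 ^ n); rewrite /pos => ->.
  have := pos_xi 0 l.+1; rewrite /pos => ->.
  by rewrite natrM -mulrA -{1}(subn0 n) -mesh_mul.
apply: (@le_trans _ _ (K%:E * (k%:R * h 0)%:E)%E); last first.
  rewrite lee_wpmul2l ?lee_fin//.
  apply: (@le_trans _ _ (\sum_(0 <= i < k) (h 0 * \1_(st 0 i) w)%:E)%E); last first.
    by apply: nneseries_lim_ge => i _ _; rewrite lee_fin mulr_ge0 ?(ltW (h0 0))// indicE ler0n.
  rewrite sumEFin lee_fin -[in leLHS](subn0 k) mulr_natl -sumr_const_nat !big_nat; apply: ler_sum => i /andP[_ ik].
  by rewrite indicE (mem_set (kin i ik)) mulr1.
rewrite -EFinM abse_EFin lee_fin /gain; apply: le_trans (ler_norm_sum _ _ _) _.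
apply: (@le_trans _ _ (\sum_(0 <= i < m) (K * h n) * (i < k * 2 ^ n)%N%:R)).
  apply: ler_sum => i _; rewrite normrM normrM (gtr0_norm (h0 n)) ger0_norm ?indicE ?ler0n//.
  have [ki|ik] := leqP (k * 2 ^ n) i; first by rewrite memNset ?mul0r ?mulr0//; exact: km.
  rewrite mulr1; apply: (@le_trans _ _ (1 * (h n * `|f (ps n i w)|))).
    have q0 : 0 <= h n * `|f (ps n i w)| by rewrite mulr_ge0 ?(ltW (h0 n)).
    by rewrite ler_wpM2r// lern1 leq_b1.
  by rewrite mul1r mulrC ler_wpM2r ?(ltW (h0 n))// (p_fK pb).
rewrite -mulr_sumr -mulrA ler_wpM2l//.
have -> : k%:R * h 0 = h n * (k * 2 ^ n)%:R.
  by rewrite (@mesh_mul _ t0 n 0 (leq0n n)) subn0 natrM; ring.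
rewrite ler_wpM2l ?(ltW (h0 n))// -natr_sum ler_nat.
rewrite -big_mkcond /= sum1_count.
have -> : count (fun i => (i < k * 2 ^ n)%N) (index_iota 0 m) = minn m (k * 2 ^ n).
  rewrite /index_iota subn0; elim: m => [|m IH]; first by rewrite min0n.
  rewrite -(addn1 m) iotaD count_cat IH /= add0n addn0; case: ltnP => a /=.
    by rewrite (minn_idPl _)// addn1.
  by rewrite addn0 (minn_idPr _)// (leq_trans a)// leq_addr.
exact: geq_minr.
Qed.

End good_path.

Lemma payoff_bound n m w : `|payoff W Y D x (h n) g m w| <= K.
Proof.
apply: le_trans (ler_norm_sum _ _ _) _.
apply: (@le_trans _ _ (\sum_(0 <= i < m) K * (\1_(st n i) w - \1_(st n i.+1) w))).
  apply: ler_sum => i _.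
  have dif : 0 <= \1_(st n i) w - \1_(st n i.+1) w :> R.
    rewrite subr_ge0 !indicE ler_nat; case: (pselect (st n i.+1 w)) => hi; last by rewrite (memNset hi).
    by rewrite (mem_set hi) mem_set//; exact: stay_le (leqnSn i) hi.
  by rewrite normrM (ger0_norm dif) mulrC ler_wpM2r// (p_gK pb).
rewrite -mulr_sumr -[leRHS]mulr1 ler_wpM2l//.
have -> : \sum_(0 <= i < m) (\1_(st n i) w - \1_(st n i.+1) w) = \1_(st n 0) w - \1_(st n m) w :> R.
  rewrite -[LHS]opprK -sumrN; under eq_bigr do rewrite opprB.
  by rewrite (telescope_sumr (fun i => \1_(st n i) w))// opprB.
have : \1_(st n 0) w <= 1 :> R by rewrite indicE lern1 leq_b1.
have : 0 <= \1_(st n m) w :> R by rewrite indicE ler0n.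
lra.
Qed.

(** Expectations of the pathwise limits of [gain] and [payoff], by dominated convergence in the
    formula [dynkin]. The functions [f'] and [g'] are free off the sets where they are read, which
    permits to return to the uncut data. *)
Lemma representation (f' g' : 'rV[R]_d -> R) : (forall y, D y -> f' y = f y) ->
  (forall y, ~ D y -> g' y = g y) -> exists2 u : R, V n x @[n --> \oo] --> u &
  (u%:E = 'E_P[fun w => (\int[leb]_(t in [set t | (0 < t)%R /\ (t%:E < tau w)%E]) f' (xi w t))%R] +
          'E_P[fun w => g' (xi w (fine (tau w)))])%E.
Proof.
move=> ff' gg'.
pose I w := \int[leb]_(t in [set t | 0 < t /\ (t%:E < tau w)%E]) f' (xi w t).
pose G w := g' (xi w (fine (tau w))).
have bg n : bmeas (gain W Y D x (h n) f (steps n)) := bmeas_gain S x mD (h0 n) (p_bf pb) (steps n).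
have bp n : bmeas (payoff W Y D x (h n) g (steps n)) := bmeas_payoff S x mD (h0 n) (p_bg pb) (steps n).
have aI : {ae P, forall w, gain W Y D x (h n) f (steps n) w @[n --> \oo] --> I w}.
  apply: filterS good_ae => w gw.
  rewrite (_ : I w = \int[leb]_(t in [set t | 0 < t /\ (t%:E < tau w)%E]) f (xi w t)); first exact: gain_cvg.
  by apply: eq_Rintegral => t; rewrite inE => -[t1 t2]; apply: ff'; exact: before_tau.
have aG : {ae P, forall w, payoff W Y D x (h n) g (steps n) w @[n --> \oo] --> G w}.
  apply: filterS good_ae => w gw.
  by rewrite /G gg'; [exact: payoff_cvg|exact: xi_T].
have mI := ae_limit_measurable cP bg aI; have mG := ae_limit_measurable cP bp aG.
pose D0 w : \bar R := (K%:E * \sum_(0 <= i <oo) (h 0 * \1_(st 0 i) w)%:E)%E.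
have b0 i : bmeas (fun w => h 0 * \1_(st 0 i) w).
  by apply: bmeasZ; exact: (bmeas_stay S x mD (h0 0)).
have p0 i w : (0 <= (h 0 * \1_(st 0 i) w)%:E)%E.
  by rewrite lee_fin mulr_ge0 ?(ltW (h0 0))// indicE ler0n.
have iD0 : P.-integrable setT D0.
  apply: integrableZl => //; apply/integrableP; split.
    apply: ge0_emeasurable_sum => [i w _ _|i _]; first exact: p0.
    by apply/measurable_EFinP; case: (b0 i).
  apply: (@le_lt_trans _ _ M%:E); last exact: ltry.
  under eq_integral => w _.
    rewrite gee0_abs; last by apply: nneseries_ge0 => i _ _; exact: p0.
    over.
  rewrite integral_nneseries//; last by move=> i; apply/measurable_EFinP; case: (b0 i).
  apply: lime_le; first by apply: is_cvg_nneseries => i _ _; exact: integral_ge0.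
  apply: nearW => m.
  rewrite (eq_bigr (fun i => (\int[P]_w (h 0 * \1_(st 0 i) w))%:E)); last first.
    by move=> i _; rewrite ex_EFin.
  rewrite sumEFin lee_fin.
  apply: le_trans (exit_sum S mD Dx (h0 0) (c_e C 0) (c_e0 C 0) m).
  by rewrite (@ex_sum _ Omega R P _ (index_iota 0 m) (fun i w => h 0 * \1_(st 0 i) w)).
have [|||iI _ cI] := @dominated_convergence _ Omega R P setT measurableT
  (fun n => EFin \o gain W Y D x (h n) f (steps n)) (EFin \o I) D0 _ mI _ iD0.
- by move=> n; apply/measurable_EFinP; case: (bg n).
- by apply: filterS aI => w c _; apply: cvg_EFin; [exact: nearW|exact: c].
- by apply: filterS good_ae => w gw n _; exact: gain_bound.
have iK : P.-integrable setT (EFin \o cst K) by apply: bmeas_integrable; exact: bmeas_cst.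
have [|||iG _ cG] := @dominated_convergence _ Omega R P setT measurableT
  (fun n => EFin \o payoff W Y D x (h n) g (steps n)) (EFin \o G) (EFin \o cst K) _ mG _ iK.
- by move=> n; apply/measurable_EFinP; case: (bp n).
- by apply: filterS aG => w c _; apply: cvg_EFin; [exact: nearW|exact: c].
- by apply: aeW => w n _ /=; rewrite lee_fin payoff_bound.
have fI : (\int[P]_w (I w)%:E)%E \is a fin_num by exact: integrable_fin_num.
have fG : (\int[P]_w (G w)%:E)%E \is a fin_num by exact: integrable_fin_num.
exists (fine (\int[P]_w (I w)%:E)%E + fine (\int[P]_w (G w)%:E)%E); last first.
  by rewrite EFinD !fineK// unlock.
(* The contribution of the paths still in [D] at the horizon. It is of order [1 / n.+1], since the
   expected exit time is at most [M]. *)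
pose Q n : R := \int[P]_w (\1_(st n (steps n)) w * V n (ps n (steps n) w)).
have VE n : V n x = \int[P]_w gain W Y D x (h n) f (steps n) w +
    \int[P]_w payoff W Y D x (h n) g (steps n) w + Q n.
  rewrite (dynkin S mD Dx (h0 n) (c_V C n) (p_bf pb) (p_bg pb) (steps n)).
  rewrite exD; [|exact: bmeasD|]; last first.
    apply: bmeasM; first exact: (bmeas_stay S x mD (h0 n)).
    by apply: (bmeas_pos S x (h0 n)); exact: d_b (c_V C n).
  by rewrite exD.
have Q0 : Q n @[n --> \oo] --> (0 : R).
  apply: norm_cvg0.
  apply: (@squeeze_cvgr _ _ _ _ (fun=> 0) (fun n => (K * M * M / t0) * n.+1%:R^-1)).
  - near=> n; rewrite normr_ge0 /=.
    have bs : bmeas (\1_(st n (steps n)) : Omega -> R) := bmeas_stay S x mD (h0 n) (steps n).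
    apply: (@le_trans _ _ (K * M * \int[P]_w \1_(st n (steps n)) w)).
      rewrite -exZ//; apply: le_trans (ex_norm _ _) _.
        by apply: bmeasM => //; apply: (bmeas_pos S x (h0 n)); exact: d_b (c_V C n).
      apply: ex_le => [||w]; [|exact: bmeasZ|].
        apply: bmeas_norm; apply: bmeasM => //; apply: (bmeas_pos S x (h0 n)); exact: d_b (c_V C n).
      have i0 : 0 <= \1_(st n (steps n)) w :> R by rewrite indicE ler0n.
      rewrite normrM (ger0_norm i0) mulrC ler_wpM2r//.
      exact: d_K (c_V C n) _.
    have := stay_prob S mD Dx (h0 n) (c_e C n) (c_e0 C n) (steps n); rewrite steps_mesh.
    have n0 : 0 < n.+1%:R * t0 by rewrite mulr_gt0.
    rewrite mulrC -ler_pdivlMr// => hs.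
    apply: le_trans (ler_wpM2l _ hs) _; first by rewrite mulr_ge0// ltW.
    by rewrite invfM !mulrA (mulrAC _ n.+1%:R^-1).
  - exact: cvg_cst.
  - rewrite -[X in _ --> X](mulr0 (K * M * M / t0)); apply: cvgMr.
    exact: cvg_harmonic.
have c1 : \int[P]_w gain W Y D x (h n) f (steps n) w @[n --> \oo] --> fine (\int[P]_w (I w)%:E)%E.
  by apply: fine_cvg; rewrite fineK//; exact: cI.
have c2 : \int[P]_w payoff W Y D x (h n) g (steps n) w @[n --> \oo] --> fine (\int[P]_w (G w)%:E)%E.
  by apply: fine_cvg; rewrite fineK//; exact: cG.
rewrite (_ : (fun n => V n x) = (fun n => \int[P]_w gain W Y D x (h n) f (steps n) w +
    \int[P]_w payoff W Y D x (h n) g (steps n) w + Q n)); last by apply/funext.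
rewrite -[X in _ --> X]addr0; apply: cvgD => //; exact: cvgD.
Unshelve. all: by end_near. Qed.

End scheme.

(** * Approximation by trigonometric polynomials *)

Section trig_calculus.
Context {R : realType} {d : nat}.
Implicit Types (z x y v w : 'rV[R]_d) (i k : 'I_d) (l : seq (R * 'rV[R]_d * R)).

Lemma is_derive_line (f : 'rV[R]_d -> R) x v (D : R) :
  is_derive (0 : R) 1 (fun t : R => f (t *: v + x)) D -> is_derive x v f D.
Proof.
have E : (fun h : R => h^-1 *: ((f \o shift x) (h *: v) - f x)) =
    (fun h : R => h^-1 *: (((fun t : R => f (t *: v + x)) \o shift 0) (h *: 1) - f (0 *: v + x))).
  apply/funext => h; rewrite /= scale0r add0r.
  by have -> : h *: (1 : R) + 0 = h by rewrite addr0 [LHS]mulr1.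
move=> [dv dE]; split; first by rewrite /derivable E.
by rewrite -dE /derive E.
Qed.

(** Differentiation of a cosine is a phase shift by [pi / 2] and a factor, so derivatives of [tp]
    are again of this form. *)
Definition dl i l : seq (R * 'rV[R]_d * R) :=
  [seq (q.1.1 * q.1.2 0 i, q.1.2, q.2 + pi / 2) | q : R * 'rV[R]_d * R <- l].

Lemma dotv_ebasisr z i : dotv z (ebasis i) = z 0 i.
Proof.
rewrite /dotv (bigD1 i)//= big1 => [|k ki]; rewrite !mxE ?eqxx ?mulr1 ?addr0//.
by rewrite (negbTE ki) mulr0.
Qed.

Lemma is_derive_tp i l x : is_derive x (ebasis i) (tp l) (tp (dl i l) x).
Proof.
apply: is_derive_line; elim: l => [|[[c z] a] l IH].
  rewrite (_ : (fun t => _) = cst 0); last by apply/funext => t; rewrite /tp big_nil.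
  by rewrite /tp big_nil; exact: is_derive_cst.
rewrite (_ : (fun t => _) =
    (fun t : R => c *: cos (t * z 0 i + (dotv z x + a))) + (fun t : R => tp l (t *: ebasis i + x))); last first.
  apply/funext => t; by rewrite fctE tp_cons /= dotvDr dotvZr dotv_ebasisr -addrA.
rewrite /= tp_cons /= addrA cosDpihalf; apply: is_deriveD.
have h : is_derive (0 : R) 1 (fun t : R => t * z 0 i + (dotv z x + a)) (z 0 i).
  by apply: is_derive_eq; rewrite /GRing.scale /= mulr0 mulr1 add0r addr0.
have := @is_derive1_comp R cos _ _ _ _ (is_derive_cos _) h.
rewrite mul0r add0r => h'.
have := is_deriveZ c h'.
rewrite (_ : c *: _ = c * z 0 i * - sin (dotv z x + a)) //.
by rewrite /GRing.scale /=; ring.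
Qed.

Lemma partial_tp i l : partial i (tp l) = tp (dl i l).
Proof. by apply/funext => x; have /@derive_val := is_derive_tp i l x. Qed.

Lemma derivable_tp i l x : derivable (tp l) x (ebasis i).
Proof. by have [] := is_derive_tp i l x. Qed.

Lemma tp_dl i l x : tp (dl i l) x = \sum_(q <- l) q.1.1 * (- (q.1.2 0 i * sin (dotv q.1.2 x + q.2))).
Proof.
by rewrite /tp /dl big_map; apply: eq_bigr => q _ /=; rewrite addrA cosDpihalf; ring.
Qed.

Lemma laplacian_tp l x :
  laplacian (tp l) x = \sum_(q <- l) q.1.1 * (- (dotv q.1.2 q.1.2) * cos (dotv q.1.2 x + q.2)).
Proof.
rewrite /laplacian.
under eq_bigr => i _ do rewrite !partial_tp tp_dl /dl big_map.
rewrite exchange_big /=; apply: eq_bigr => q _.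
rewrite /dotv mulNr mulr_suml -sumrN mulr_sumr; apply: eq_bigr => i _.
by rewrite addrA sinDpihalf; ring.
Qed.

Lemma dotv_grad_tp l x y :
  dotv y (grad (tp l) x) = \sum_(q <- l) q.1.1 * (- (dotv q.1.2 y * sin (dotv q.1.2 x + q.2))).
Proof.
rewrite /dotv.
under eq_bigr => i _ do rewrite mxE partial_tp tp_dl mulr_sumr.
rewrite exchange_big /=; apply: eq_bigr => q _.
rewrite mulr_suml -sumrN mulr_sumr; apply: eq_bigr => i _.
by ring.
Qed.

Lemma jump_tp l x y :
  tp l (x + y) - tp l x - \1_unit_ball y * dotv y (grad (tp l) x) =
  \sum_(q <- l) (- (q.1.1 * cos (dotv q.1.2 x + q.2)) * (1 - cos (dotv q.1.2 y)) +
                 q.1.1 * sin (dotv q.1.2 x + q.2) * comp1 q.1.2 y).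
Proof.
rewrite dotv_grad_tp /tp mulr_sumr -!sumrB; apply: eq_bigr => q _.
have -> : dotv q.1.2 (x + y) + q.2 = (dotv q.1.2 x + q.2) + dotv q.1.2 y by rewrite dotvDr; ring.
rewrite cosD /comp1; ring.
Qed.

Lemma jadm_jump_tp l x :
  jadm (fun y => tp l (x + y) - tp l x - \1_unit_ball y * dotv y (grad (tp l) x)).
Proof.
rewrite (_ : (fun y => _) = (fun y => \sum_(q <- l) (- (q.1.1 * cos (dotv q.1.2 x + q.2)) * (1 - cos (dotv q.1.2 y)) +
                 q.1.1 * sin (dotv q.1.2 x + q.2) * comp1 q.1.2 y))); last first.
  by apply/funext => y; exact: jump_tp.
apply: jadm_sum => q; apply: jadmD; apply: jadmZ.
  exact: jadm_oneBcos.
exact: jadm_comp1.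
Qed.

Lemma L_op_tp (j : 'rV[R]_d -> R) (jm : measurable_fun ([set~ 0] : set 'rV[R]_d) j)
    (j0 : forall y : 'rV[R]_d, y != 0 -> 0 <= j y)
    (jl : (\int[lebesgue_rV d]_(y in [set~ 0%R]) (Num.min 1 (enorm y ^+ 2) * j y)%:E < +oo)%E)
    l x : L_op j (tp l) x = Lt j l x.
Proof.
rewrite /L_op laplacian_tp.
rewrite -/(jint j (fun y => tp l (x + y) - tp l x - \1_unit_ball y * dotv y (grad (tp l) x))).
rewrite (@eq_jint _ _ j _ (fun y => \sum_(q <- l) (- (q.1.1 * cos (dotv q.1.2 x + q.2)) * (1 - cos (dotv q.1.2 y)) +
    q.1.1 * sin (dotv q.1.2 x + q.2) * comp1 q.1.2 y))); last by move=> y _; exact: jump_tp.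
rewrite (jint_sum jm j0 jl); last first.
  move=> q; apply: jadmD; apply: jadmZ; first exact: jadm_oneBcos.
  exact: jadm_comp1.
rewrite /Lt -big_split /=; apply: eq_bigr => q _.
rewrite (jintD jm j0 jl (jadmZ _ (jadm_oneBcos _)) (jadmZ _ (jadm_comp1 _))).
rewrite (jintZ jm j0 jl _ (jadm_oneBcos _)) (jintZ jm j0 jl _ (jadm_comp1 _)) -sreE -simE; ring.
Qed.

Definition trig (f : 'rV[R]_d -> R) := exists l, f = tp l.

Lemma trig_cosz z (a : R) : trig (fun x => cos (dotv z x + a)).
Proof.
by exists [:: (1, z, a)]; apply/funext => x; rewrite tp_cons /tp big_nil mul1r addr0.
Qed.

Lemma trig_cst (c : R) : trig (fun=> c).
Proof.
exists [:: (c, 0, 0)]; apply/funext => x.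
by rewrite tp_cons /tp big_nil /= dot0v !addr0 cos0 mulr1.
Qed.

Lemma trigD f g : trig f -> trig g -> trig (fun x => f x + g x).
Proof. by move=> [l ->] [m ->]; exists (l ++ m); apply/funext => x; rewrite /tp big_cat. Qed.

Lemma trigZ (c : R) f : trig f -> trig (fun x => c * f x).
Proof.
move=> [l ->]; exists [seq (c * q.1.1, q.1.2, q.2) | q : R * 'rV[R]_d * R <- l]; apply/funext => x.
by rewrite /tp big_map mulr_sumr; apply: eq_bigr => q _; rewrite mulrA.
Qed.

Lemma trigB f g : trig f -> trig g -> trig (fun x => f x - g x).
Proof.
move=> tf /(trigZ (-1)) tg; have := trigD tf tg.
by congr trig; apply/funext => x; rewrite mulN1r.
Qed.

Lemma trigM f g : trig f -> trig g -> trig (fun x => f x * g x).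
Proof.
move=> [l ->] [m ->]; elim: l => [|[[c z] a] l IH].
  have := trig_cst 0; congr trig; apply/funext => x.
  by rewrite [tp [::] x]big_nil mul0r.
suff h : trig (fun x => c * (cos (dotv z x + a) * tp m x)).
  have := trigD h IH; congr trig; apply/funext => x; rewrite tp_cons /=; ring.
apply: trigZ; elim: m {IH} => [|[[c' z'] a'] m IH].
  have := trig_cst 0; congr trig; apply/funext => x.
  by rewrite [tp [::] x]big_nil mulr0.
have := trigD (trigZ (c' / 2) (trigD (trig_cosz (z + z') (a + a')) (trig_cosz (z - z') (a - a')))) IH.
congr trig; apply/funext => x; rewrite tp_cons /=.
have e1 : dotv (z + z') x = dotv z x + dotv z' x.
  by rewrite /dotv -big_split; apply: eq_bigr => i _; rewrite mxE mulrDl.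
have e2 : dotv (z - z') x = dotv z x - dotv z' x.
  by rewrite /dotv -sumrB; apply: eq_bigr => i _; rewrite !mxE mulrBl.
rewrite e1 e2.
have -> : dotv z x + dotv z' x + (a + a') = (dotv z x + a) + (dotv z' x + a') by ring.
have -> : dotv z x - dotv z' x + (a - a') = (dotv z x + a) - (dotv z' x + a') by ring.
rewrite cosD cosB; by field.
Qed.

Lemma trig_sin_coord i (c : R) : trig (fun x => sin (c * x 0 i)).
Proof.
have := trig_cosz (c *: ebasis i) (- (pi / 2)); congr trig; apply/funext => x.
by rewrite dotv_ebasis cosBpihalf.
Qed.

Lemma uniform_on_compact (U : 'rV[R]_d -> R) (K : set 'rV[R]_d) (e : R) : continuous U ->
  compact K -> 0 < e -> exists2 delta : R, 0 < delta &
    forall w w', K w -> `|w' - w| < delta -> `|U w' - U w| <= e.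
Proof.
move=> cU cK e0.
have [|N hN] := @compact_uniform _ _ K
  (fun n w => forall w', `|w' - w| < n.+1%:R^-1 -> `|U w' - U w| <= e) cK; last first.
  by exists N.+1%:R^-1; [rewrite invr_gt0|move=> w w' Kw; exact: hN].
move=> q _; have e2 : 0 < e / 2 by rewrite divr_gt0.
have [delta d0 hd] := (continuous_rVP U).1 cU q (e / 2) e2.
have d2 : 0 < delta / 2 by rewrite divr_gt0.
have [N _ hN] := near_infty_natSinv_lt (PosNum d2).
exists (delta / 2), N; split=> // n x Nn xq w' w'x.
have w'q : `|w' - q| < delta.
  have -> : w' - q = (w' - x) + (x - q) by rewrite addrA subrK.
  apply: le_lt_trans (ler_normD _ _) _; rewrite (splitr delta) ltrD//.
  by apply: lt_trans w'x _; exact: hN.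
have xq' : `|x - q| < delta by apply: lt_trans xq _; rewrite ltr_pdivrMr// ltr_pMr// ltr1n.
have -> : U w' - U x = (U w' - U q) - (U x - U q) by ring.
by apply: le_trans (ler_normB _ _) _; rewrite (splitr e) lerD// hd.
Qed.

(* Expectation of [U] at the end of a walk from [w] which at each step, along the
   coordinate [i] prescribed by [s], moves by [delta] with probability [p i]:
   for a walk with [n] steps in every direction this is a Bernstein polynomial. *)
Fixpoint bern (delta : R) (U : 'rV[R]_d -> R) (p : 'I_d -> R) (s : seq 'I_d) w : R :=
  if s is i :: s' then
    (1 - p i) * bern delta U p s' w + p i * bern delta U p s' (w + delta *: ebasis i)
  else U w.

(** Chebyshev's argument for Bernstein polynomials: a function within [e] plus a quadratic of [c]
    has mean within [e] plus the second moment of the walk, which is the squared bias plus the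
    variance, coordinate by coordinate. *)
Lemma bern_bound (delta : R) (U : 'rV[R]_d -> R) (p : 'I_d -> R) (c e K : R) (a : 'rV[R]_d) s w : (forall i, 0 <= p i <= 1) -> 
  (forall w', `|U w' - c| <= e + K * \sum_k (w' 0 k - a 0 k) ^+ 2) ->
  `|bern delta U p s w - c| <= e + K * \sum_k
     ((w 0 k + (count_mem k s)%:R * p k * delta - a 0 k) ^+ 2 +
      (count_mem k s)%:R * (p k * (1 - p k) * delta ^+ 2)).
Proof.
move=> p01 hU; elim: s w => [|i s IH] w /=.
  rewrite [X in _ <= _ + K * X](eq_bigr (fun k => (w 0 k - a 0 k) ^+ 2))//.
  by move=> k _; rewrite !mul0r !addr0.
have /andP[p0 p1] := p01 i; have q0 : 0 <= 1 - p i by rewrite subr_ge0.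
have -> : (1 - p i) * bern delta U p s w + p i * bern delta U p s (w + delta *: ebasis i) - c =
   (1 - p i) * (bern delta U p s w - c) + p i * (bern delta U p s (w + delta *: ebasis i) - c) by ring.
apply: le_trans (ler_normD _ _) _; rewrite !normrM (ger0_norm p0) (ger0_norm q0).
apply: le_trans (lerD (ler_wpM2l q0 (IH w)) (ler_wpM2l p0 (IH _))) _.
rewrite !mulrDr !(mulrCA _ K) addrACA -mulrDl subrK mul1r -mulrDr !mulr_sumr -big_split /=.
rewrite le_eqVlt; apply/orP; left; apply/eqP; congr (_ + _); rewrite mulr_sumr; apply: eq_bigr => k _.
rewrite !mxE /= [k == i]eq_sym; case: eqVneq => [->|ik] /=; last by rewrite mulr0 addr0 add0n; ring.
rewrite natrD; ring.
Qed.

Lemma trig_bern (delta : R) (U : 'rV[R]_d -> R) (p : 'rV[R]_d -> 'I_d -> R) s w :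
  (forall i, trig (fun x => p x i)) -> trig (fun x => bern delta U (p x) s w).
Proof.
move=> tp_; elim: s w => [|i s IH] w /=; first exact: trig_cst.
apply: trigD; apply: trigM => //.
by apply: trigB => //; exact: trig_cst.
Qed.

(** The change of variables [x_i = r * asin s_i] turns polynomials in [s] into trigonometric
    polynomials in [x]. A Bernstein polynomial is a mean of values of the function, so the bound [C]
    is kept on the whole space; this global bound is what controls large jumps later. *)
Lemma trig_approx (u : 'rV[R]_d -> R) (C r e : R) : continuous u -> (forall x, `|u x| <= C) ->
  0 < r -> 0 < e -> exists l,
  (forall x, `|tp l x| <= C) /\ forall x, `|x| <= r -> `|tp l x - u x| <= e.
Proof.
move=> cu uC r0 e0.
have C0 : 0 <= C by apply: le_trans (uC 0).
pose sn : R := sin 1.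
have pi2 : (1 : R) < pi / 2.
  have := @pi_ge2 R; have := @cos1_gt0 R => c1 p2.
  rewrite lt_neqAle pihalf_ge1 andbT; apply/eqP => h.
  by move: c1; rewrite h cos_pihalf ltxx.
have sn0 : 0 < sn by apply: sin_gt0_pihalf; rewrite ltr01.
have sn1 : sn < 1.
  by rewrite -(@sin_pihalf R) ltr_sin ?in_itv //= ?lexx ?andbT; lra.
(* For [|x_i| <= r] the sine of [x_i / r] lies between [- sin 1] and [sin 1], strictly inside the
   interval where [asin] is continuous; clipping there makes [U] continuous everywhere without
   changing these values. *)
pose clip (s : R) := Num.max (- sn) (Num.min sn s).
have clip_le s : - sn <= clip s <= sn.
  by rewrite /clip le_max lexx /= ge_max ge_min lexx; lra.
have clip_lip s s' : `|clip s - clip s'| <= `|s - s'|.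
  have C3 q : clip q = q \/ (clip q = sn /\ sn <= q) \/ (clip q = - sn /\ q <= - sn).
    rewrite /clip; case: (leP sn q) => h1.
      by right; left; split=> //; apply/max_idPr; lra.
    case: (leP q (- sn)) => h2; last by left.
    by right; right.
  have n1 := ler_norm (s - s'); have n2 := ler_norm (s' - s); rewrite distrC in n2.
  rewrite ler_norml; have := clip_le s; have := clip_le s'.
  by case: (C3 s) => [->|[[-> h1]|[-> h1]]]; case: (C3 s') => [->|[[-> h2]|[-> h2]]];
    move=> /andP[? ?] /andP[? ?]; apply/andP; split; lra.
pose U (w : 'rV[R]_d) := u (\row_i (r * asin (clip (w 0 i)))).
have cU : continuous U.
  apply/continuous_rVP => w e' e'0.
  have [d1 d10 h1] := (continuous_rVP u).1 cu (\row_i (r * asin (clip (w 0 i)))) e' e'0.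
  have hi (i : 'I_d) : nbhs w [set y : 'rV[R]_d |
      `|r * asin (clip (y 0 i)) - r * asin (clip (w 0 i))| < d1].
    have /andP[l1 l2] := clip_le (w 0 i).
    have ci : - 1 < clip (w 0 i) < 1 by apply/andP; split; lra.
    have d1r : 0 < d1 / r by rewrite divr_gt0.
    have /cvgrPdist_lt/(_ _ d1r)/nbhs_ballP[d2 /= d20 hd] := @continuous_asin _ _ ci.
    apply/nbhs_ballP; exists d2 => //= y /ball_normP yw /=.
    rewrite -mulrBr normrM gtr0_norm// mulrC -ltr_pdivlMr// distrC; apply: hd.
    rewrite /ball /=; apply: le_lt_trans (clip_lip _ _) _; rewrite distrC.
    apply: le_lt_trans yw; have := coord_le_norm (y - w) i; by rewrite !mxE.
  have /nbhs_ballP[d2 /= d20 hd2] := @filter_forall _ _ _ _ (nbhs_filter w) hi.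
  exists d2 => // y yw; apply: h1; apply/ball_normP; split=> // i k.
  rewrite (ord1 i) !mxE /ball /= distrC; apply: hd2; exact/ball_normP.
have e2 : 0 < e / 2 by rewrite divr_gt0.
have [delta d0 hd] := uniform_on_compact cU (@compact_norm_le R d 1) e2.
pose K := 2 * C / delta ^+ 2.
have K0 : 0 <= K by apply: divr_ge0; [exact: mulr_ge0|exact: sqr_ge0].
have hK a w : `|a| <= 1 -> `|U w - U a| <= e / 2 + K * \sum_k (w 0 k - a 0 k) ^+ 2.
  move=> a1; have S0 : 0 <= \sum_k (w 0 k - a 0 k) ^+ 2 by apply: sumr_ge0 => k _; exact: sqr_ge0.
  have [wa|wa] := ltP `|w - a| delta.
    by apply: le_trans (hd _ _ a1 wa) _; rewrite lerDl mulr_ge0.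
  have [k wk] : exists k, delta <= `|w 0 k - a 0 k|.
    apply: contrapT => /forallNP h.
    have : `|w - a| < delta.
      apply/ball_normP; split=> // i k; rewrite (ord1 i) /ball /= distrC ltNge.
      by apply/negP => hk; exact: (h k).
    by rewrite ltNge wa.
  apply: (@le_trans _ _ (2 * C)).
    by apply: le_trans (ler_normB _ _) _; rewrite mulr2n mulrDl mul1r lerD// uC.
  apply: (@le_trans _ _ (K * \sum_k (w 0 k - a 0 k) ^+ 2)); last by rewrite lerDr ltW.
  rewrite /K mulrAC ler_pdivlMr ?exprn_gt0// ler_wpM2l ?mulr_ge0//.
  rewrite (bigD1 k)//=; apply: (@le_trans _ _ ((w 0 k - a 0 k) ^+ 2)); last first.
    by rewrite lerDl; apply: sumr_ge0 => i _; exact: sqr_ge0.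
  by rewrite -[leRHS]real_normK ?num_real// lerXn2r// ?nnegrE// ltW.
have [n Kn] : exists n : nat, K * d%:R <= e / 2 * n.+1%:R.
  exists (Num.truncn (K * d%:R / (e / 2))); rewrite [e / 2 * _]mulrC -ler_pdivrMr//.
  by apply/ltW; exact: truncnS_gt.
(* The walk starts at -1 in every coordinate and makes [n.+1] steps of this length per direction,
   with probability [(1 + sin (x_i / r)) / 2] each: the mean of its endpoint is [sin (x_i / r)] and
   the variance is at most [1 / n.+1]. *)
pose del : R := 2 / n.+1%:R.
pose s := flatten (nseq n.+1 (enum 'I_d)).
have cs (k : 'I_d) : count_mem k s = n.+1.
  rewrite /s count_flatten; elim: (n.+1) => [//|m IH] /=.
  by rewrite IH count_uniq_mem ?enum_uniq// mem_enum.
pose p (x : 'rV[R]_d) (i : 'I_d) := 1 / 2 + 1 / 2 * sin (r^-1 * x 0 i).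
have [l lE] : trig (fun x => bern del U (p x) s (const_mx (-1))).
  apply: trig_bern => i; apply: trigD; first exact: trig_cst.
  by apply: trigZ; exact: trig_sin_coord.
have p01 x i : 0 <= p x i <= 1.
  have := sin_max (r^-1 * x 0 i); rewrite ler_norml /p => /andP[h1 h2]; apply/andP; split; lra.
exists l; rewrite -lE; split=> x.
  have h w : `|U w - 0| <= C + 0 * \sum_k (w 0 k - (0 : 'rV[R]_d) 0 k) ^+ 2.
    by rewrite subr0 mul0r addr0; exact: uC.
  have := bern_bound del s (const_mx (-1)) (p01 x) h.
  by rewrite subr0 mul0r addr0.
move=> xr.
pose a : 'rV[R]_d := \row_i sin (r^-1 * x 0 i).
have xi (i : 'I_d) : `|r^-1 * x 0 i| <= 1.
  rewrite normrM gtr0_norm ?invr_gt0// mulrC ler_pdivrMr// mul1r.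
  exact: le_trans (coord_le_norm x i) xr.
have a1 : `|a| <= 1.
  by apply: norm_le_coord => // i; rewrite mxE; exact: sin_max.
have Ua : U a = u x.
  congr u; apply/rowP => i; rewrite !mxE.
  have := xi i; rewrite ler_norml => /andP[x1 x2].
  have s1 : sin (r^-1 * x 0 i) <= sn.
    by rewrite /sn leNgt ltr_sin ?in_itv /= -?leNgt//; apply/andP; split; lra.
  have s2 : - sn <= sin (r^-1 * x 0 i).
    by rewrite /sn -sinN leNgt ltr_sin ?in_itv /= -?leNgt//; apply/andP; split; lra.
  have -> : clip (sin (r^-1 * x 0 i)) = sin (r^-1 * x 0 i).
    by rewrite /clip (min_idPr _)// (max_idPr _).
  rewrite sinK; last by rewrite in_itv /=; apply/andP; split; lra.
  by rewrite mulrA divff ?mul1r// gt_eqF.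
rewrite -Ua; apply: le_trans (bern_bound del s (const_mx (-1)) (p01 x) (fun w => hK a w a1)) _.
rewrite [leRHS](splitr e) lerD2l.
apply: (@le_trans _ _ (K * \sum_(k < d) n.+1%:R^-1)).
  apply: ler_wpM2l => //; apply: ler_sum => k _; rewrite !mxE cs /del /p.
  set q := sin _.
  have -> : - 1 + n.+1%:R * (1 / 2 + 1 / 2 * q) * (2 / n.+1%:R) - q = 0 :> R.
    by field; rewrite gt_eqF.
  have -> : n.+1%:R * ((1 / 2 + 1 / 2 * q) * (1 - (1 / 2 + 1 / 2 * q)) * (2 / n.+1%:R) ^+ 2) =
     (1 - q ^+ 2) / n.+1%:R :> R by field; rewrite gt_eqF.
  rewrite expr0n /= add0r ler_pdivrMr// mulVf ?gt_eqF//.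
  by rewrite gerBl sqr_ge0.
rewrite sumr_const card_ord -[n.+1%:R^-1 *+ d]mulr_natl mulrA ler_pdivrMr//.
Qed.

End trig_calculus.

(** * Averages over segments *)

Section affine.
Context {R : realType}.
Local Notation mu := (@lebesgue_measure R).
Implicit Types (g : measurableTypeR R -> R) (a c : R).

Definition affine a c (s : measurableTypeR R) : measurableTypeR R := a + c * s.

Lemma measurable_affine a c : measurable_fun setT (affine a c).
Proof. by apply: measurable_funD => //; apply: measurable_funM. Qed.

Definition affine_law a c (c0 : 0 < c) : {measure set (measurableTypeR R) -> \bar R} :=
  mscale (NngNum (ltW c0))
    (measure_function_pushforward__canonical__measure_function_Measure mu (measurable_affine a c)).

Lemma lebesgue_affine a c A (c0 : 0 < c) : measurable A ->
  mu A = affine_law a c0 A.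
Proof.
move=> mA; apply: (lebesgue_measure_unique (mu := affine_law a c0)) => // _ [[x y]] _ <-.
have -> : affine_law a c0 `]x, y]%classic = (c%:E * mu (affine a c @^-1` `]x, y]%classic))%E by [].
have -> : affine a c @^-1` `]x, y] = `](x - a) / c, (y - a) / c]%classic.
  apply/seteqP; split=> t /=; rewrite /affine !in_itv/= ltr_pdivrMr// ler_pdivlMr// [t * c]mulrC ltrBlDl lerBrDl //.
rewrite !lebesgue_measure_itv /= !lte_fin ltr_pM2r ?invr_gt0// ltrD2r.
case: ifP => _; last by rewrite mule0.
rewrite -!EFinB -EFinM; congr (_%:E); field; by rewrite gt_eqF.
Qed.

Lemma U01_affine g a c : bmeas g -> 0 < c ->
  c * \int[U01]_s g (a + c * s) = \int[mu]_(t in `[a, a + c[) g t.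
Proof.
move=> bg c0; have [M M0 gM] := bmeas_bound bg.
have ma := measurable_affine a c.
have bga (h : measurableTypeR R -> R) : bmeas h -> bmeas (h \o affine a c).
  by move=> bh; exact: bmeas_comp.
have ac : a <= a + c by rewrite lerDl ltW.
have ge0case (h : measurableTypeR R -> R) : bmeas h -> (forall x, 0 <= h x) ->
    c * \int[U01]_s h (a + c * s) = \int[mu]_(t in `[a, a + c[) h t.
  move=> bh h0.
  rewrite (U01_ex (bga h bh)) -/(\int[mu]_(x in `[0%R, 1%R]) (h \o affine a c) x).
  have -> : \int[mu]_(t in `[a, a + c[) h t = \int[mu]_(t in `[a, a + c]) h t.
    by apply: Rintegral_itv_bndo_bndc; exact: co_integrable.
  rewrite /Rintegral.
  have -> : (\int[mu]_(x in `[a, (a + c)%R]) (h x)%:E =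
      \int[affine_law a c0]_(x in `[a, (a + c)%R]) (h x)%:E)%E.
    by apply: eq_measure_integral => A mA' _; exact: lebesgue_affine.
  rewrite ge0_integral_mscale//; last 2 first.
  - by apply/measurable_EFinP; apply: measurable_funTS; exact: bh.1.
  - by move=> x _; rewrite lee_fin.
  rewrite ge0_integral_pushforward//; last 2 first.
  - by apply/measurable_EFinP; apply: measurable_funTS; exact: bh.1.
  - by move=> x _; rewrite lee_fin.
  have -> : affine a c @^-1` `[a, (a + c)] = `[0%R, 1%R]%classic.
    apply/seteqP; split=> t /=; rewrite /affine !in_itv/= lerDl lerD2l (pmulr_rge0 _ c0);
      by have := ler_pM2l c0 t 1; rewrite mulr1 => ->.
  have l1 : mu `[0%R, 1%R]%classic = 1%E.
    by rewrite lebesgue_measure_itv/= lte_fin ltr01 sube0.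
  rewrite fineM//; apply: integrable_fin_num => //.
  apply: measurable_bounded_integrable => //.
  - by apply: (@le_lt_trans _ _ 1%E); [rewrite -l1|exact: ltry].
  - by apply: measurable_funTS; exact: (bga h bh).1.
  - by case: bh => _ [N hN]; exists N; split => [|x Nx y _ /=]; rewrite ?num_real// (le_trans (hN _))// ltW.
have bgM := bmeasD bg (bmeas_cst M).
have := ge0case _ bgM; rewrite (exD U01 (bga g bg) (bmeas_cst M)) ex_cst.
rewrite (RintegralD _ (co_integrable _ _ bg) (co_integrable _ _ (bmeas_cst M)))//.
rewrite Rintegral_cst// co_length// mulrDr => H; apply: (addIr (c * M)); rewrite H.
  by congr (_ + _); ring.
by move=> x; have := gM x; rewrite ler_norml => /andP[]; lra.
Qed.

(** Both sides are the integral over [[0, delta + eta[] minus those over [[0, delta[] and [[0,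
    eta[]. *)
Lemma U01_exchange g (delta eta : R) : bmeas g -> 0 < delta -> 0 < eta ->
  eta * (\int[U01]_s g (delta + eta * s) - \int[U01]_s g (0 + eta * s)) =
  delta * (\int[U01]_s g (eta + delta * s) - \int[U01]_s g (0 + delta * s)).
Proof.
move=> bg d0 e0; rewrite !mulrBr !U01_affine// !add0r.
have h1 := co_cat bg (ltW d0) (_ : delta <= delta + eta).
have h2 := co_cat bg (ltW e0) (_ : eta <= eta + delta).
rewrite lerDl (ltW e0) in h1; rewrite lerDl (ltW d0) in h2.
have := h1 isT; rewrite (addrC delta eta) (h2 isT).
move: (\int[mu]_(t in `[0, eta[) _) (\int[mu]_(t in `[0, delta[) _) => I1 I2; lra.
Qed.

End affine.

Section mollifier.
Context {R : realType} {d : nat}.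
Implicit Types (x y z w : 'rV[R]_d) (i k : 'I_d) (q : 'rV[R]_d -> R) (s : seq 'I_d).
Variable eta : R.

Definition avg i q x : R := \int[U01]_u q (x + (eta * u) *: ebasis i).

Lemma measurable_line d' (T : measurableType d') (Z : T -> 'rV[R]_d) (a : T -> R) i :
  measurable_fun setT Z -> measurable_fun setT a ->
  measurable_fun setT (fun t => Z t + a t *: ebasis i).
Proof.
move=> mZ ma; apply: measurable_rVD => //; apply: measurable_fun_rV => k.
rewrite (_ : (fun t => _) = (fun t => a t * (ebasis i : 'rV[R]_d) 0 k)); last first.
  by apply/funext => t; rewrite mxE.
exact: measurable_funM.
Qed.

Lemma bmeas_line q x i : bmeas q -> @bmeas _ (measurableTypeR R) R (fun u => q (x + (eta * u) *: ebasis i)).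
Proof.
move=> bq; apply: (bmeas_comp _ bq); exact: measurable_line.
Qed.

Lemma bmeas_avg i q : bmeas q -> bmeas (avg i q).
Proof.
move=> bq; pose F (p : 'rV[R]_d * measurableTypeR R) := q (p.1 + (eta * p.2) *: ebasis i).
apply: (@bmeas_ex2 _ _ _ _ _ (\d_(0 : 'rV[R]_d)) U01 F).
apply: (bmeas_comp _ bq); apply: measurable_line => //.
exact: measurable_funM.
Qed.

Lemma avg_comm i k q : bmeas q -> avg i (avg k q) = avg k (avg i q).
Proof.
move=> bq; apply/funext => x.
pose F (p : measurableTypeR R * measurableTypeR R) :=
  q (x + (eta * p.1) *: ebasis i + (eta * p.2) *: ebasis k).
have bF : bmeas F.
  apply: (bmeas_comp _ bq); apply: measurable_line; last exact: measurable_funM.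
  apply: measurable_line => //; exact: measurable_funM.
rewrite [LHS](ex_fubini U01 U01 bF); apply: eq_Rintegral => u _; apply: eq_Rintegral => v _.
by rewrite /F /= addrAC.
Qed.

Lemma avgB i q1 q2 x : bmeas q1 -> bmeas q2 ->
  avg i (fun z => q1 z - q2 z) x = avg i q1 x - avg i q2 x.
Proof. by move=> b1 b2; rewrite /avg -exB//; exact: bmeas_line. Qed.

Lemma avgD i q1 q2 x : bmeas q1 -> bmeas q2 ->
  avg i (fun z => q1 z + q2 z) x = avg i q1 x + avg i q2 x.
Proof. by move=> b1 b2; rewrite /avg -exD//; exact: bmeas_line. Qed.

Lemma avgZ i (c : R) q x : bmeas q -> avg i (fun z => c * q z) x = c * avg i q x.
Proof. by move=> b1; rewrite /avg -exZ//; exact: bmeas_line. Qed.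

Lemma trig_avg i q : trig q -> trig (avg i q).
Proof.
move=> [l ->]; elim: l => [|[[c z] a] l IH].
  have := trig_cst (d := d) (0 : R); congr trig; apply/funext => x.
  by rewrite /avg -[LHS](ex_cst U01); apply: eq_Rintegral => u _; rewrite /tp big_nil.
pose v := eta * z 0 i.
have mv : measurable_fun setT (fun u : measurableTypeR R => u * v) by apply: measurable_funM.
pose c1 := \int[U01]_u cos (u * v); pose c2 := \int[U01]_u sin (u * v).
have h := trigD (trigZ c (trigB (trigZ c1 (trig_cosz z a)) (trigZ c2 (trig_cosz z (a - pi / 2))))) IH.
move: h; congr trig; apply/funext => x.
rewrite (_ : tp ((c, z, a) :: l) = fun y => c * cos (dotv z y + a) + tp l y); last first.
  by apply/funext => y; rewrite tp_cons.
rewrite avgD; [|by apply: bmeasZ; exact: bmeas_cosz|exact: bmeas_tp].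
rewrite avgZ; last exact: bmeas_cosz.
congr (c * _ + _); rewrite addrA cosBpihalf mulrC [c2 * _]mulrC /c1 /c2 /avg.
have b1 := bmeas_cosM mv; have b2 := bmeas_sinM mv.
rewrite -!exZ// -exB; [|exact: bmeasZ|exact: bmeasZ].
apply: eq_Rintegral => u _; rewrite -cosD dotvDr dotvZr dotv_ebasisr; congr cos.
by rewrite /v; ring.
Qed.

Hypothesis e0 : 0 < eta.

Lemma normZ_ebasis (a : R) i : `|a *: ebasis i : 'rV[R]_d| <= `|a|.
Proof.
by apply: norm_le_coord => // k; rewrite !mxE eqxx; case: eqP => _; rewrite ?mulr1 ?mulr0 ?normr0.
Qed.

Lemma avg_local i q x (rho c e : R) : bmeas q ->
  (forall z, `|z - x| <= rho + eta -> `|q z - c| <= e) ->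
  forall z, `|z - x| <= rho -> `|avg i q z - c| <= e.
Proof.
move=> bq hq z zx; rewrite /avg -[c](ex_cst U01) -exB; [|exact: bmeas_line|exact: bmeas_cst].
apply: U01_norm_le; first by apply: bmeasB; [exact: bmeas_line|exact: bmeas_cst].
move=> u /andP[u0 u1]; apply: hq; rewrite addrAC.
apply: le_trans (ler_normD _ _) _; apply: lerD => //; apply: le_trans (normZ_ebasis _ _) _.
by rewrite normrM gtr0_norm// ger0_norm// ler_piMr// ltW.
Qed.

(* The average over a segment of length [eta] turns increments of length [delta]
   into averages, over segments of length [delta], of increments of length [eta]. *)
Lemma avg_diff i q x (delta c K : R) : bmeas q ->
  (forall u, 0 <= u <= 1 -> `|q (x + (u * delta) *: ebasis i + eta *: ebasis i) -
     q (x + (u * delta) *: ebasis i) - c| <= K) ->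
  `|avg i q (x + delta *: ebasis i) - avg i q x - delta / eta * c| <= `|delta| / eta * K.
Proof.
move=> bq; wlog d0 : x delta c / 0 < delta => [wl hq|hq].
  have [d0|d0|->] := ltgtP delta 0; last 2 first.
  - exact: wl.
  - by rewrite scale0r addr0 subrr !mul0r subr0 normr0 !mul0r.
  have nd : 0 < - delta by rewrite oppr_gt0.
  have := wl (x + delta *: ebasis i) (- delta) c nd.
  rewrite -[x + delta *: ebasis i + - delta *: ebasis i]addrA -scalerDl subrr scale0r addr0 normrN => h.
  have -> : avg i q (x + delta *: ebasis i) - avg i q x - delta / eta * c =
    - (avg i q x - avg i q (x + delta *: ebasis i) - - delta / eta * c) by ring.
  rewrite normrN.
  apply: h => u /andP[u0 u1]; rewrite -[x + _ + _ *: _]addrA -scalerDl.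
  have -> : delta + u * - delta = (1 - u) * delta by ring.
  by apply: hq; apply/andP; split; lra.
pose g (t : measurableTypeR R) : R := q (x + t *: ebasis i).
have bg : bmeas g by apply: (bmeas_comp _ bq); exact: measurable_line.
have := U01_exchange bg d0 e0.
have -> : \int[U01]_u g (delta + eta * u) = avg i q (x + delta *: ebasis i).
  by apply: eq_Rintegral => u _; rewrite /g scalerDl addrA.
have -> : \int[U01]_u g (0 + eta * u) = avg i q x.
  by apply: eq_Rintegral => u _; rewrite /g add0r.
have baf (a b : R) : @bmeas _ (measurableTypeR R) R (fun u => g (a + b * u)).
  apply: (bmeas_comp (f := g) _ bg); exact: measurable_affine.
rewrite -exB// => E.
have b3 := bmeasB (baf eta delta) (baf 0 delta).
have -> : avg i q (x + delta *: ebasis i) - avg i q x - delta / eta * c =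
    delta / eta * (\int[U01]_u (g (eta + delta * u) - g (0 + delta * u)) - c).
  have -> : avg i q (x + delta *: ebasis i) - avg i q x =
    eta^-1 * (eta * (avg i q (x + delta *: ebasis i) - avg i q x)) by rewrite mulrA mulVf ?mul1r// gt_eqF.
  by rewrite E; field; rewrite gt_eqF.
rewrite normrM; have -> : `|delta / eta| = `|delta| / eta by rewrite normrM (gtr0_norm (x := eta^-1))// invr_gt0.
apply: ler_wpM2l; first by rewrite divr_ge0// ltW.
rewrite -[c](ex_cst U01) -exB//; last exact: bmeas_cst.
apply: U01_norm_le; first by apply: bmeasB => //; exact: bmeas_cst.
move=> u u01; rewrite /g add0r scalerDl addrA [delta * u]mulrC addrAC; exact: hq.
Qed.

Definition mol s q := foldr avg q s.

Lemma bmeas_mol s q : bmeas q -> bmeas (mol s q).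
Proof. by move=> bq; elim: s => //= i s IH; exact: bmeas_avg. Qed.

Lemma molB s q1 q2 x : bmeas q1 -> bmeas q2 ->
  mol s (fun z => q1 z - q2 z) x = mol s q1 x - mol s q2 x.
Proof.
move=> b1 b2; elim: s x => [//|i s IH] x /=; rewrite -avgB; [|exact: bmeas_mol|exact: bmeas_mol].
by congr avg; apply/funext => z; exact: IH.
Qed.

Lemma trig_mol s q : trig q -> trig (mol s q).
Proof. by move=> tq; elim: s => //= i s IH; exact: trig_avg. Qed.

Lemma mol_local s q x (rho c e : R) : bmeas q ->
  (forall z, `|z - x| <= rho + (size s)%:R * eta -> `|q z - c| <= e) ->
  forall z, `|z - x| <= rho -> `|mol s q z - c| <= e.
Proof.
move=> bq; elim: s rho => [|i s IH] rho hq /=; first by move: hq; rewrite mul0r addr0.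
apply: avg_local; first exact: bmeas_mol.
apply: IH => z; rewrite -addrA => h; apply: hq; apply: le_trans h _.
by rewrite /= -natr1 mulrDl mul1r [eta + _]addrC.
Qed.

Lemma mol_norm_le s q (M : R) : bmeas q -> (forall z, `|q z| <= M) -> forall z, `|mol s q z| <= M.
Proof.
move=> bq qM z; rewrite -[mol s q z]subr0.
by apply: (mol_local (x := z) (rho := 0)) => // [y _|]; rewrite ?subr0 ?subrr ?normr0.
Qed.

(** Averages in different directions commute, so one occurrence of [i] can be brought outermost,
    where [avg_diff] applies. *)
Lemma mol_rem s i q : bmeas q -> i \in s -> mol s q = avg i (mol (rem i s) q).
Proof.
move=> bq; elim: s => [//|k s IH]; rewrite inE /= eq_sym.
case: eqVneq => [->//|ki] /= /IH ->.
by rewrite /= avg_comm//; exact: bmeas_mol.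
Qed.

(** The corners of a path from [x] to [x + y] along the coordinate axes; directional estimates are
    summed along it. *)
Definition stairs x y (m : nat) : 'rV[R]_d := x + \row_i (if (i < m)%N then y 0 i else 0).

Lemma stairsS x y k : stairs x y k.+1 = stairs x y k + y 0 k *: ebasis k.
Proof.
rewrite /stairs -addrA; congr (_ + _); apply/rowP => i; rewrite !mxE /= ltnS leq_eqVlt.
have [->|ik] := eqVneq i k; first by rewrite eqxx ltnn mulr1 add0r.
have -> : ((i : nat) == k) = false by exact: negbTE ik.
by rewrite mulr0 addr0.
Qed.

Lemma stairs_telescope q x y :
  q (x + y) - q x = \sum_(k < d) (q (stairs x y k + y 0 k *: ebasis k) - q (stairs x y k)).
Proof.
have -> : x + y = stairs x y d.
  by congr (_ + _); apply/rowP => i; rewrite mxE ltn_ord.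
have {2}-> : x = stairs x y 0.
  by rewrite -[LHS]addr0; congr (_ + _); apply/rowP => i; rewrite !mxE.
rewrite -(telescope_sumr (fun m => q (stairs x y m)) (leq0n d)) big_mkord.
by apply: eq_bigr => k _; rewrite stairsS.
Qed.

Lemma stairs_close x y k (u : R) : 0 <= u <= 1 ->
  `|stairs x y k + (u * y 0 k) *: ebasis k - x| <= `|y|.
Proof.
move=> /andP[u0 u1]; apply: norm_le_coord => // i; 
have -> : (stairs x y k + (u * y 0 k) *: ebasis k - x) 0 i =
    (if (i < k)%N then y 0 i else 0) + u * y 0 k * (i == k)%:R by rewrite !mxE /=; ring.
have yi := coord_le_norm y i.
case: eqVneq => [->|_] /=; rewrite ?ltnn ?mulr1 ?add0r ?mulr0 ?addr0.
  rewrite normrM ger0_norm//; apply: le_trans (coord_le_norm y k).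
  by rewrite ler_piMl.
by case: ifP => _ //; rewrite normr0.
Qed.

End mollifier.

(** * Drift of smoothed functions *)

Section mollified_drift.
Context {R : realType} {d : nat} {dO : measure_display}
  {Omega : measurableType dO}.
Variables (P : probability Omega R) (j : 'rV[R]_d -> R) (W Y : R -> Omega -> 'rV[R]_d).
Hypothesis S : setup P j W Y.
Implicit Types (x y z w : 'rV[R]_d) (i k : 'I_d) (q : 'rV[R]_d -> R) (s : seq 'I_d).
Local Notation X := (Xsum W Y).
Local Notation Pt := (Pt P W Y).
Variable eta : R.
Hypothesis e01 : 0 < eta <= 1.
Let e0 : 0 < eta. Proof. by case/andP: e01. Qed.
Let e1 : eta <= 1. Proof. by case/andP: e01. Qed.
Local Notation avg := (avg eta).
Local Notation mol := (mol eta).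

Lemma avg_Pt t i q : 0 <= t -> bmeas q -> Pt t (avg i q) = avg i (Pt t q).
Proof.
move=> t0 bq; apply/funext => x.
pose F (p : Omega * measurableTypeR R) := q (x + X t p.1 + (eta * p.2) *: ebasis i).
have bF : bmeas F.
  apply: (bmeas_comp _ bq); apply: measurable_line; last exact: measurable_funM.
  exact: (measurableT_comp (measurable_shiftX S x t0) measurable_fst).
rewrite [LHS](ex_fubini P U01 bF); apply: eq_Rintegral => u _; apply: eq_Rintegral => v _.
by rewrite /F /= addrAC.
Qed.

Lemma mol_Pt t s q : 0 <= t -> bmeas q -> Pt t (mol s q) = mol s (Pt t q).
Proof.
move=> t0 bq; elim: s => [//|i s IH]; rewrite [LHS]avg_Pt//; last exact: bmeas_mol.
by rewrite IH.
Qed.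

(** One average per direction gives a Lipschitz bound, a second one a first-order expansion with
    quadratic remainder. After the removal of one occurrence every direction is still present
    ([mem_rem_twice]). *)
Definition twice : seq 'I_d := enum 'I_d ++ enum 'I_d.
Definition smooth q := mol twice q.

Lemma size_twice : size twice = d.*2.
Proof. by rewrite size_cat size_enum_ord addnn. Qed.

Lemma mem_twice k : k \in twice.
Proof. by rewrite mem_cat mem_enum. Qed.

Lemma mem_rem_twice i k : i \in rem k twice.
Proof.
rewrite -has_pred1 has_count count_rem mem_twice /= count_cat count_uniq_mem ?enum_uniq// mem_enum /=.
by case: (k == i).
Qed.

Section local.
Variables (q : 'rV[R]_d -> R) (x0 : 'rV[R]_d) (e : R).
Hypotheses (bq : bmeas q) (hq : forall z, `|z - x0| <= 4 + (d.*2)%:R -> `|q z| <= e).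

Let e_ge0 : 0 <= e.
Proof. by apply: le_trans (hq (z := x0) _); rewrite ?subrr ?normr0 ?addr_ge0. Qed.

Lemma mol_local0 s z : (size s <= d.*2)%N -> `|z - x0| <= 4 -> `|mol s q z| <= e.
Proof.
move=> ss zx; rewrite -[mol s q z]subr0.
apply: (mol_local e0 (x := x0) (rho := 4)) => // w wx; rewrite subr0; apply: hq.
apply: le_trans wx _; rewrite lerD2l; apply: (@le_trans _ _ (size s)%:R).
  by rewrite ler_piMr.
by rewrite ler_nat.
Qed.

Lemma mol_lipschitz k z w : `|w - x0| <= 2 -> `|z - x0| <= 2 -> `|z - w| <= 1 ->
  `|mol (rem k twice) q z - mol (rem k twice) q w| <= 2 * d%:R * e / eta * `|z - w|.
Proof.
move=> wx zx zw; have {1}-> : z = w + (z - w) by rewrite addrC subrK.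
rewrite stairs_telescope; apply: le_trans (ler_norm_sum _ _ _) _.
apply: (@le_trans _ _ (\sum_(i < d) `|z - w| / eta * (2 * e))); last first.
  rewrite sumr_const card_ord -[_ *+ d]mulr_natl; rewrite le_eqVlt; apply/orP; left; apply/eqP.
  by field; rewrite gt_eqF.
apply: ler_sum => i _.
rewrite (mol_rem eta bq (mem_rem_twice i k)).
set q' := mol _ q; have bq' : bmeas q' by exact: bmeas_mol.
have q'e v : `|v - x0| <= 4 -> `|q' v| <= e.
  apply: mol_local0; rewrite (leq_trans (size_subseq (rem_subseq _ _)))//.
  by rewrite (leq_trans (size_subseq (rem_subseq _ _)))// size_twice.
have := avg_diff e0 (i := i) (x := stairs w (z - w) i) (delta := (z - w) 0 i) (c := 0) (K := 2 * e) bq'.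
rewrite mulr0 subr0 => h; apply: le_trans (h _) _ => {h}.
  move=> u u01; rewrite subr0; apply: le_trans (ler_normB _ _) _.
  have c1 := stairs_close w (z - w) i u01.
  rewrite mulr2n mulrDl mul1r; apply: lerD; apply: q'e.
  - rewrite (_ : _ - x0 = (stairs w (z - w) i + (u * (z - w) 0 i) *: ebasis i - w) + (w - x0) + eta *: ebasis i); last first.
      by rewrite addrA subrK addrAC.
    apply: le_trans (ler_normD _ _) _.
    apply: le_trans (lerD (ler_normD _ _) (normZ_ebasis _ _)) _.
    rewrite (gtr0_norm e0); apply: le_trans (lerD (lerD (le_trans c1 zw) wx) e1) _; lra.
  - rewrite (_ : _ - x0 = (stairs w (z - w) i + (u * (z - w) 0 i) *: ebasis i - w) + (w - x0)); last first.
      by rewrite addrA subrK.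
    apply: le_trans (ler_normD _ _) _; apply: le_trans (lerD (le_trans c1 zw) wx) _; lra.
rewrite ler_wpM2r ?mulr_ge0// ler_pM2r ?invr_gt0//.
by have := coord_le_norm (z - w) i.
Qed.

(** The slope [c k] is the difference quotient of length [eta] at [x0] of the function with one
    average in direction [k] removed. By [avg_diff] the remainder is governed by the variation of
    such differences, hence by [mol_lipschitz]. The bounds are linear in [e], the size of [q] near
    [x0]. *)
Lemma smooth_taylor : exists c : 'I_d -> R, (forall k, `|c k| <= 2 * e / eta) /\
  forall y, `|y| <= 1 ->
    `|smooth q (x0 + y) - smooth q x0 - \sum_k c k * y 0 k| <= 4 * d%:R ^+ 2 * e / eta ^+ 2 * `|y| ^+ 2.
Proof.
pose D k := mol (rem k twice) q (x0 + eta *: ebasis k) - mol (rem k twice) q x0.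
have nek k : `|eta *: ebasis k : 'rV[R]_d| <= eta.
  by apply: le_trans (normZ_ebasis _ _) _; rewrite gtr0_norm.
have srem k : (size (rem k twice) <= d.*2)%N.
  by rewrite -size_twice; apply: size_subseq; exact: rem_subseq.
exists (fun k => D k / eta); split=> [k|y y1].
  rewrite normrM [`|eta^-1|]gtr0_norm ?invr_gt0// ler_wpM2r ?invr_ge0 ?(ltW e0)//.
  apply: le_trans (ler_normB _ _) _; rewrite mulr2n mulrDl mul1r; apply: lerD; apply: mol_local0 => //.
    rewrite addrC addKr; apply: le_trans (nek k) _.
    by apply: le_trans e1 _; rewrite ler1n.
  by rewrite subrr normr0.
rewrite stairs_telescope -sumrB; apply: le_trans (ler_norm_sum _ _ _) _.
apply: (@le_trans _ _ (\sum_(i < d) `|y| / eta * (2 * (2 * d%:R * e / eta * `|y|)))); last first.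
  rewrite sumr_const card_ord -[_ *+ d]mulr_natl; rewrite le_eqVlt; apply/orP; left; apply/eqP.
  by field; rewrite gt_eqF.
apply: ler_sum => k _; rewrite /smooth (mol_rem eta bq (mem_twice k)).
rewrite (_ : D k / eta * y 0 k = y 0 k / eta * D k); last by ring.
apply: le_trans (avg_diff e0 (c := D k) (K := 2 * (2 * d%:R * e / eta * `|y|)) (bmeas_mol _ _ bq) _) _; last first.
  rewrite ler_wpM2r ?mulr_ge0 ?invr_ge0 ?(ltW e0)// ler_pM2r ?invr_gt0//; exact: coord_le_norm.
move=> u u01; set v := stairs x0 y k + (u * y 0 k) *: ebasis k.
have vy : `|v - x0| <= `|y| by exact: stairs_close.
have K0 : 0 <= 2 * d%:R * e / eta by rewrite divr_ge0 ?mulr_ge0 ?(ltW e0).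
have ve : v + eta *: ebasis k - (x0 + eta *: ebasis k) = v - x0 by rewrite opprD addrACA subrr addr0.
rewrite /D (_ : _ - _ - (_ - _) =
   (mol (rem k twice) q (v + eta *: ebasis k) - mol (rem k twice) q (x0 + eta *: ebasis k)) -
   (mol (rem k twice) q v - mol (rem k twice) q x0)); last by ring.
have nk := nek k.
apply: le_trans (ler_normB _ _) _; rewrite [leRHS]mulr_natl mulr2n; apply: lerD.
  apply: le_trans (mol_lipschitz k _ _ _) _; rewrite ?ve//.
  - by rewrite addrC addKr; apply: le_trans nk _; apply: le_trans e1 _; rewrite ler1n.
  - rewrite addrAC; apply: le_trans (ler_normD _ _) _.
    by rewrite (_ : 2 = 1 + 1)//; apply: lerD; [exact: le_trans vy y1|exact: le_trans nk e1].
  - exact: le_trans vy y1.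
  - exact: ler_wpM2l.
apply: le_trans (mol_lipschitz k _ _ _) _ => //.
- by rewrite subrr normr0.
- by apply: le_trans vy _; apply: le_trans y1 _; rewrite ler1n.
- exact: le_trans vy y1.
- exact: ler_wpM2l.
Qed.

End local.

(** In order: the quadratic remainder in [smooth_taylor], the replacement of coordinates by their
    sines, the bound of the remainder at distance more than 1, all three weighted by the drift of
    [Th 1 x]; then the drift of the sines. *)
Definition smoothing_rate : R :=
  (4 * d%:R ^+ 2 / eta ^+ 2 + 4 * d%:R / eta * d%:R + 2 + 2 * d%:R / eta) / thc * DD j 1 +
  2 * d%:R / eta * Bk j 1.

(** The function [q] is merely bounded and measurable, but smoothing makes the semigroup act on it
    at rate proportional to its size on a large ball. The linear part of the expansion is replaced
    by bounded sines, whose drift is explicit; the remainder [G] is dominated by bumps vanishing at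
    [x]. *)
Lemma smooth_drift q x (M e rho t : R) : bmeas q -> (forall z, `|q z| <= M) -> 1 <= rho ->
  (forall z, `|z - x| <= rho + 4 + (d.*2)%:R -> `|q z| <= e) -> 0 < t ->
  `|Pt t (smooth q) x - smooth q x| <= t * (smoothing_rate * e + 2 * M / thc * DD j rho^-1).
Proof.
move=> bq qM rho1 hq t0; have t0' := ltW t0.
have rho0 : 0 < rho by apply: lt_le_trans rho1.
have hq' z : `|z - x| <= 4 + (d.*2)%:R -> `|q z| <= e.
  by move=> zx; apply: hq; apply: le_trans zx _; rewrite -[rho + 4 + _]addrA lerDr ltW.
have eg : 0 <= e by apply: le_trans (hq' x _); rewrite ?subrr ?normr0 ?addr_ge0.
have M0 : 0 <= M by apply: le_trans (qM 0).
have [c [c_le hc]] := smooth_taylor bq hq'.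
have bsm : bmeas (smooth q) by exact: bmeas_mol.
pose sn k z : R := cos (dotv (ebasis k) z + (- x 0 k - pi / 2)).
have snE k z : sn k z = sin (z 0 k - x 0 k).
  rewrite /sn addrA cosBpihalf; congr (sin (_ + _)).
  by have := dotv_ebasis 1 k z; rewrite scale1r mul1r.
have bsn k : bmeas (sn k) by exact: bmeas_cosz.
have bcs k : bmeas (fun z => c k * sn k z) by exact: bmeasZ.
have bS : bmeas (fun z => \sum_(k <- index_enum 'I_d) c k * sn k z) by exact: bmeas_sum.
pose G z := smooth q z - smooth q x - \sum_(k <- index_enum 'I_d) c k * sn k z.
have bG : bmeas G by apply: bmeasB => //; apply: bmeasB => //; exact: bmeas_cst.
pose CA := (4 * d%:R ^+ 2 / eta ^+ 2 + 4 * d%:R / eta * d%:R + 2 + 2 * d%:R / eta : R).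
have th0 := @thc_gt0 R.
have CA0 : 0 <= CA by rewrite /CA !addr_ge0// ?divr_ge0 ?mulr_ge0 ?sqr_ge0 ?invr_ge0 ?(ltW e0).
(* The first bump handles the quadratic remainder near [x] and distances between 1 and [rho]; the
   second one, flat up to the scale [rho], handles larger distances, where only the global bound [M]
   is available. *)
pose H z := CA * e / thc * Th 1 x z + 2 * M / thc * Th rho^-1 x z.
have bH : bmeas H by apply: bmeasD; apply: bmeasZ; exact: bmeas_Th.
have sum_le z : `|\sum_(k <- index_enum 'I_d) c k * sn k z| <= 2 * d%:R / eta * e.
  apply: le_trans (ler_norm_sum _ _ _) _.
  apply: (@le_trans _ _ (\sum_(k < d) 2 * e / eta)).
    apply: ler_sum => k _; rewrite normrM -[leRHS]mulr1; apply: ler_pM => //.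
    exact: cos_max.
  by rewrite sumr_const card_ord -[_ *+ d]mulr_natl le_eqVlt; apply/orP; left; apply/eqP; ring.
have GH z : `|G z| <= H z.
  have TB : 0 <= 2 * M / thc * Th rho^-1 x z.
    apply: mulr_ge0; last exact: Th_ge0.
    by apply: divr_ge0; [exact: mulr_ge0|exact: ltW].
  have [z1|z1] := leP `|z - x| 1.
    apply: (@le_trans _ _ (CA * e * `|z - x| ^+ 2)).
      have := hc (z - x) z1; rewrite [x + _]addrC subrK => h1.
      rewrite (_ : G z = (smooth q z - smooth q x - \sum_k c k * (z - x) 0 k) +
          \sum_k c k * ((z - x) 0 k - sin ((z - x) 0 k))); last first.
        rewrite /G -[RHS]addrA; congr (_ + _).
        rewrite -sumrN -[in RHS]sumrN -big_split /=; apply: eq_bigr => k _.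
        by rewrite snE !mxE; ring.
      apply: le_trans (ler_normD _ _) _.
      apply: (@le_trans _ _ (4 * d%:R ^+ 2 * e / eta ^+ 2 * `|z - x| ^+ 2 +
          4 * d%:R / eta * e * `|z - x| ^+ 2)).
        apply: lerD => //; apply: le_trans (ler_norm_sum _ _ _) _.
        apply: (@le_trans _ _ (\sum_(k < d) 2 * e / eta * (2 * `|z - x| ^+ 2))).
          apply: ler_sum => k _; rewrite normrM; apply: ler_pM => //.
          apply: le_trans (subr_sin_le2 _) _; rewrite ler_pM2l//.
          by rewrite -real_normK ?num_real// lerXn2r ?nnegrE//; exact: coord_le_norm.
        by rewrite sumr_const card_ord -[_ *+ d]mulr_natl le_eqVlt; apply/orP; left; apply/eqP; ring.
      rewrite -mulrDl ler_wpM2r ?sqr_ge0// /CA.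
      have d1 : 4 * d%:R / eta * e <= 4 * d%:R / eta * d%:R * e + 2 * d%:R / eta * e.
        case: (d) => [|n]; first by rewrite !mulr0 !mul0r addr0.
        rewrite -[leLHS]addr0; apply: lerD; last by rewrite mulr_ge0// divr_ge0// ltW.
        rewrite ler_wpM2r// -[leLHS]mulr1 ler_wpM2l ?ler1n//.
        by rewrite divr_ge0 ?mulr_ge0 ?(ltW e0).
      have e2 : 4 * d%:R ^+ 2 * e / eta ^+ 2 = 4 * d%:R ^+ 2 / eta ^+ 2 * e by ring.
      rewrite e2; move: d1 eg; set A1 := 4 * _ / eta; set A2 := 4 * _ / eta ^+ 2; set A3 := 2 * _ / eta.
      by move=> d1 eg'; rewrite !mulrDl; lra.
    have := Th_lower x z (@ler01 R); rewrite mul1r (min_idPr _); last by rewrite expr_le1.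
    move=> h; apply: (@le_trans _ _ (CA * e / thc * Th 1 x z)).
      rewrite -[CA * e / thc * _]mulrA ler_wpM2l ?mulr_ge0// ler_pdivlMl//.
    by rewrite /H lerDl.
  have T1 : thc <= Th 1 x z by apply: Th_far => //; rewrite mul1r ltW.
  have near_le : CA * e <= CA * e / thc * Th 1 x z.
    by rewrite -[leRHS]mulrA ler_peMr ?mulr_ge0// ler_pdivlMl ?mulr1.
  have CAe : 2 * e + 2 * d%:R / eta * e <= CA * e.
    have a1 : 0 <= 4 * d%:R ^+ 2 / eta ^+ 2.
      by apply: divr_ge0; [apply: mulr_ge0 => //; exact: sqr_ge0|exact: sqr_ge0].
    have a2 : 0 <= 4 * d%:R / eta * d%:R by rewrite mulr_ge0// divr_ge0 ?mulr_ge0 ?(ltW e0).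
    rewrite -mulrDl ler_wpM2r// /CA.
    move: (4 * d%:R ^+ 2 / eta ^+ 2) (4 * d%:R / eta * d%:R) (2 * d%:R / eta) a1 a2 => b1 b2 b3 a1 a2.
    lra.
  have sx : `|smooth q x| <= e.
    by apply: (mol_local0 bq hq'); rewrite ?size_twice// subrr normr0.
  have G1 : `|G z| <= `|smooth q z| + e + 2 * d%:R / eta * e.
    apply: le_trans (ler_normB _ _) _; apply: lerD => //.
    by apply: le_trans (ler_normB _ _) _; exact: lerD.
  apply: le_trans G1 _; rewrite /H.
  have [z2|z2] := leP `|z - x| rho.
    have sz : `|smooth q z| <= e.
      rewrite -[smooth q z]subr0.
      apply: (mol_local e0 (x := x) (rho := rho)) => // w wx; rewrite subr0; apply: hq.
      apply: le_trans wx _; rewrite size_twice -[rho + 4 + _]addrA lerD2l ler_wpDl// ler_piMr//.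
    lra.
  have sz : `|smooth q z| <= M by exact: mol_norm_le.
  have T2 : M <= 2 * M / thc * Th rho^-1 x z.
    have : thc <= Th rho^-1 x z.
      apply: Th_far; first by rewrite invr_ge0 ltW.
      by rewrite ler_pdivlMl// mulr1 ltW.
    move=> h; apply: (@le_trans _ _ (2 * M / thc * thc)); first by rewrite divfK ?gt_eqF//; lra.
    by apply: ler_wpM2l => //; apply: divr_ge0; [exact: mulr_ge0|exact: ltW].
  lra.
have PG : `|Pt t G x| <= t * (CA * e / thc * DD j 1 + 2 * M / thc * DD j rho^-1).
  apply: le_trans (Pt_norm S t0' x bG) _.
  apply: le_trans (Pt_le S t0' x (bmeas_norm bG) bH GH) _.
  have b1 := bmeas_Th 1 x; have b2 := bmeas_Th rho^-1 x.
  rewrite /H (PtD S t0' x (bmeasZ _ b1) (bmeasZ _ b2)) (PtZ S t0' _ x b1) (PtZ S t0' _ x b2).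
  have := Th_drift S x x t0 (@ler01 R); rewrite Thpp subr0 => h1.
  have := Th_drift S x x t0 (_ : 0 <= rho^-1); rewrite Thpp subr0 => h2.
  have {}h1 := le_trans (ler_norm _) h1.
  have {}h2 : Pt t (Th rho^-1 x) x <= t * DD j rho^-1.
    by apply: le_trans (ler_norm _) (h2 _); rewrite invr_ge0 ltW.
  have M2 : 0 <= 2 * M by exact: mulr_ge0.
  apply: le_trans (lerD (ler_wpM2l (divr_ge0 (mulr_ge0 CA0 eg) (ltW th0)) h1)
    (ler_wpM2l (divr_ge0 M2 (ltW th0)) h2)) _.
  by rewrite le_eqVlt; apply/orP; left; apply/eqP; ring.
have PE : Pt t (smooth q) x - smooth q x = Pt t G x + \sum_(k <- index_enum 'I_d) c k * Pt t (sn k) x.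
  have -> : Pt t G x = Pt t (smooth q) x - smooth q x - \sum_(k <- index_enum 'I_d) c k * Pt t (sn k) x.
    rewrite /G (PtB S t0' x (bmeasB bsm (bmeas_cst _)) bS) (PtB S t0' x bsm (bmeas_cst _)) Pt_cst.
    rewrite (Pt_sum S t0' _ x bcs); congr (_ - _); apply: eq_bigr => k _.
    exact: (PtZ S t0' _ x (bsn k)).
  by rewrite subrK.
rewrite PE; apply: le_trans (ler_normD _ _) _.
have -> : t * (smoothing_rate * e + 2 * M / thc * DD j rho^-1) =
    t * (CA * e / thc * DD j 1 + 2 * M / thc * DD j rho^-1) + t * (2 * d%:R / eta * Bk j 1 * e).
  by rewrite /smoothing_rate -/CA; ring.
apply: lerD => //; apply: le_trans (ler_norm_sum _ _ _) _.
apply: (@le_trans _ _ (\sum_(k < d) 2 * e / eta * (t * Bk j 1))); last first.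
  by rewrite sumr_const card_ord -[_ *+ d]mulr_natl le_eqVlt; apply/orP; left; apply/eqP; ring.
apply: ler_sum => k _; rewrite normrM; apply: ler_pM => //.
rewrite (Pt_cos S)// (_ : dotv _ _ + _ = - (pi / 2)); last first.
  by have := dotv_ebasis 1 k x; rewrite scale1r mul1r => ->; ring.
rewrite cosN sinN cos_pihalf sin_pihalf mul0r sub0r mulN1r opprK.
have h01 : 0 <= (1 : R) <= 1 by rewrite ler01 lexx.
by have [] := X_char_coord S k t0 h01; rewrite scale1r.
Qed.

End mollified_drift.

(** * Trigonometric almost-solutions *)

Section trig_solutions.
Context {R : realType} {d : nat} {dO : measure_display}
  {Omega : measurableType dO}.
Variables (P : probability Omega R) (j : 'rV[R]_d -> R) (W Y : R -> Omega -> 'rV[R]_d).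
Hypothesis S : setup P j W Y.
Variables (D : set 'rV[R]_d) (f g : 'rV[R]_d -> R) (K r M t0 : R)
  (beta : 'rV[R]_d -> R) (V e_ : nat -> 'rV[R]_d -> R).
Hypothesis C : scheme P W Y D f g K r M t0 beta V e_.
Variable u : 'rV[R]_d -> R.
Hypothesis Vu : forall x, V n x @[n --> \oo] --> u x.
Implicit Types (x y z w : 'rV[R]_d) (q : 'rV[R]_d -> R).
Local Notation Pt := (Pt P W Y).
Local Notation mesh := (mesh t0).

Lemma solution_continuous : continuous u.
Proof. by apply: (limit_continuous S (c_bar C) (c_data C) (c_r C) (c_V C) (c_e C) (c_e0 C) (c_es C)) => x; exact: (@Vu x). Qed.

Lemma solution_norm x : `|u x| <= K * M.
Proof. exact: (cvgn_norm_le (@Vu x) (fun n => d_K (c_V C n) x)). Qed.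

Lemma solution_uniform (rr eps : R) : 0 < eps -> exists N : nat, forall n x, (N <= n)%N ->
  `|x| <= rr -> `|V n x - u x| <= eps.
Proof. by apply: (limit_uniform S (c_bar C) (c_data C) (c_r C) (c_V C) (c_e C) (c_e0 C) (c_es C)) => x; exact: (@Vu x). Qed.

Lemma bmeas_solution : bmeas u.
Proof.
split; last by exists (K * M); exact: solution_norm.
by apply: continuous_measurable_rV; exact: solution_continuous.
Qed.

Lemma DD_cvg0 (e : R) : 0 < e -> exists2 rho : R, 1 <= rho & DD j rho^-1 <= e.
Proof.
move=> e0; have d1 : 0 < 2 * d%:R + 1 :> R by rewrite ltr_wpDl ?mulr_ge0.
have [k k0 hk] := Bk_cvg0 S (divr_gt0 e0 d1).
exists (Num.max 1 k^-1); first by rewrite le_max lexx.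
set rho := Num.max _ _; have rho0 : 0 < rho by rewrite lt_max ltr01.
have rk : 0 <= rho^-1 <= k.
  rewrite invr_ge0 ltW//= invf_ple ?posrE//; by rewrite le_max lexx orbT.
have := hk _ rk; rewrite ler_pdivlMr// => h; apply: le_trans h.
rewrite /DD mulrC ler_wpM2l ?lerDl//; apply: (Bk_ge0 S); by case/andP: rk.
Qed.

(** Take [tp l] to be the smoothing of an approximation [tp l0] of [u]. Smoothing commutes with the
    semigroup, so the smoothed [V n] still has one-step change close to [- h * f]. The difference
    [V n - tp l0] is small on a large ball, hence by [smooth_drift] its smoothing has small drift;
    therefore [tp l] has one-step change close to [- h * f] too, and [tp_generator] reads off
    [Lt j l]. *)
Lemma trig_solution (e rho delta : R) : 0 < e -> 0 < rho -> 0 < delta -> exists l,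
  [/\ forall x, `|tp l x| <= K * M, forall x, `|x| <= rho -> `|tp l x - u x| <= e &
      forall x, (forall y, `|y - x| <= delta -> D y) -> `|Lt j l x + f x| <= e].
Proof.
move=> e0 rho0 delta0.
have cu := solution_continuous; have bu := bmeas_solution.
have [t00 _] := andP (b_t0 (c_bar C)).
have e2 : 0 < e / 2 by rewrite divr_gt0.
have e8 : 0 < e / 8 by rewrite divr_gt0.
have [d1 d10 hd1] := uniform_on_compact cu (@compact_norm_le R d rho) e2.
have [d2 d20 hd2] := p_fc (c_data C) e8.
pose m := Num.min delta (Num.min d1 d2); have m0 : 0 < m by rewrite !lt_min delta0 d10.
have dd : 0 < (d.*2)%:R + 1 :> R by rewrite ltr_wpDl.
pose eta := Num.min 1 (m / 2 / ((d.*2)%:R + 1)).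
have eta01 : 0 < eta <= 1 by rewrite lt_min ltr01 !divr_gt0//= ge_min lexx.
have [eta0 eta1] := andP eta01.
have etam : (d.*2)%:R * eta < m.
  apply: (@le_lt_trans _ _ (m / 2)); last by rewrite ltr_pdivrMr// ltr_pMr// ltr1n.
  apply: (@le_trans _ _ (((d.*2)%:R + 1) * eta)); first by rewrite ler_wpM2r ?lerDl// ltW.
  by rewrite mulrC -ler_pdivlMr// ge_min lexx orbT.
have ms : m <= delta /\ (m <= d1 /\ m <= d2).
  by rewrite /m; split; [|split]; rewrite !ge_min lexx ?orbT.
have {ms}[md [md1 md2]] := ms.
have KM0 : 0 <= K * M by apply: le_trans (solution_norm 0).
have th0 := @thc_gt0 R.
pose B := 2 * (2 * (K * M)) / thc; have B0 : 0 <= B by apply: divr_ge0 (ltW th0); rewrite mulr_ge0// mulr_ge0.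
have B1 : 0 < B + 1 by rewrite ltr_wpDl.
have [rho1 rho11 hrho1] := DD_cvg0 (divr_gt0 e8 B1).
have hB : B * DD j rho1^-1 <= e / 8.
  move: hrho1; rewrite ler_pdivlMr// => h; apply: le_trans h.
  rewrite mulrC ler_wpM2l ?lerDl// /DD !mulr_ge0// (Bk_ge0 S)// invr_ge0.
  exact: le_trans rho11.
pose CA := smoothing_rate j eta.
pose e1 := Num.min (e / 2) (e / 8 / (`|CA| + 1)).
have CA1 : 0 < `|CA| + 1 by rewrite ltr_wpDl.
have e10 : 0 < e1 by rewrite lt_min e2 divr_gt0.
have hCA : CA * e1 <= e / 8.
  apply: (@le_trans _ _ ((`|CA| + 1) * e1)).
    by rewrite ler_wpM2r ?(ltW e10)//; apply: le_trans (ler_norm _) _; rewrite lerDl.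
  by rewrite mulrC -ler_pdivlMr// ge_min lexx orbT.
have e1e : e1 <= e / 2 by rewrite ge_min lexx.
(* Closeness to [u] is needed on the ball required by [smooth_drift] around every point of [D], and
   on the ball of radius [rho] enlarged by the reach of the smoothing. *)
pose R2 := Num.max rho `|r| + rho1 + 4 + (d.*2)%:R.
have R2x (a : R) : a <= Num.max rho `|r| -> a + (rho1 + 4 + (d.*2)%:R) <= R2.
  by move=> h; rewrite /R2; lra.
have dd0 : 0 <= (d.*2)%:R :> R by [].
have R20 : 0 < R2.
  have h : rho <= Num.max rho `|r| by rewrite le_max lexx.
  by have := R2x _ h; lra.
have e12 : 0 < e1 / 2 by rewrite divr_gt0.
have [l0 [l0K l0u]] := trig_approx cu solution_norm R20 e12.
have b0 : bmeas (tp l0) := bmeas_tp l0.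
have [l lE] : trig (smooth eta (tp l0)) by apply: trig_mol; exists l0.
have bl : bmeas (tp l) := bmeas_tp l.
have etale : (d.*2)%:R * eta <= (d.*2)%:R by rewrite ler_piMr.
exists l; rewrite -lE; split.
- by apply: mol_norm_le.
- move=> x xrho; apply: (mol_local eta0 (x := x) (rho := 0)) => //; last by rewrite subrr normr0.
  move=> z; rewrite size_twice add0r => zx.
  have zR2 : `|z| <= R2.
    rewrite -[z](subrK x); apply: le_trans (ler_normD _ _) _.
    apply: le_trans _ (R2x `|x| _); last by rewrite le_max xrho.
    rewrite addrC lerD2l; lra.
  have h1 := l0u z zR2.
  have h2 : `|u z - u x| <= e / 2.
    apply: hd1 => //; apply: le_lt_trans zx _; exact: lt_le_trans etam md1.
  rewrite (_ : _ - _ = (tp l0 z - u z) + (u z - u x)); last by ring.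
  apply: le_trans (ler_normD _ _) _; lra.
move=> x xD.
have Dx : D x by apply: xD; rewrite subrr normr0 ltW.
have xr : `|x| <= Num.max rho `|r|.
  by apply: le_trans (c_r C Dx) _; apply: le_trans (ler_norm _) _; rewrite le_max lexx orbT.
have [N hN] := solution_uniform R2 e12.
have [del /= del0 hdel] := tp_generator S l e8.
(* The mesh is chosen last: small for the generator estimate, which depends on [l], and with [n]
   large enough for the uniform convergence of [V n]. *)
have [n1 hn1] := mesh_cvg0 t0 (divr_gt0 del0 (ltr0Sn R 1)).
pose n := (n1 + N)%N; pose h := mesh n.
have h0 : 0 < h by exact: (mesh_gt0 (c_bar C)).
have h0' := ltW h0.
have hd : h < del.
  apply: (@le_lt_trans _ _ (del / 2)); last by rewrite ltr_pdivrMr// ltr_pMr// ltr1n.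
  apply: le_trans hn1; rewrite /h /mesh /n exprD invfM mulrA.
  by rewrite ler_pdivrMr ?exprn_gt0// ler_peMr ?exprn_ege1 ?ler1n// divr_ge0 ?exprn_ge0// ltW.
have G : `|Pt h (tp l) x - tp l x - h * Lt j l x| <= h * (e / 8).
  by apply: hdel => //; rewrite /= sub0r normrN (gtr0_norm h0).
have bV := d_b (c_V C n); have bP := bmeas_Pt S h0' bV.
have bq := bmeasB bV b0.
have qM z : `|V n z - tp l0 z| <= 2 * (K * M).
  apply: le_trans (ler_normB _ _) _; rewrite mulr2n mulrDl mul1r lerD//.
  exact: (d_K (c_V C n)).
have hq z : `|z - x| <= rho1 + 4 + (d.*2)%:R -> `|V n z - tp l0 z| <= e1.
  move=> zx; have zR2 : `|z| <= R2.
    rewrite -[z](subrK x); apply: le_trans (ler_normD _ _) _.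
    by apply: le_trans _ (R2x `|x| xr); rewrite addrC lerD2l.
  rewrite (_ : _ - _ = (V n z - u z) - (tp l0 z - u z)); last by ring.
  apply: le_trans (ler_normB _ _) _; rewrite (splitr e1); apply: lerD; last exact: l0u.
  by apply: hN => //; exact: leq_addl.
have := smooth_drift S eta01 bq qM rho11 hq h0; rewrite -/CA -/B.
have sB : smooth eta (fun z => V n z - tp l0 z) = fun z => smooth eta (V n) z - tp l z.
  by apply/funext => z; rewrite /smooth molB// -lE.
have bsV : bmeas (smooth eta (V n)) by exact: bmeas_mol.
rewrite sB (PtB S h0' x bsV bl) => G1.
have G2 : `|Pt h (smooth eta (V n)) x - smooth eta (V n) x - - (h * f x)| <= h * (e / 8).
  rewrite /smooth (mol_Pt S eta _ h0' bV) -molB//.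
  apply: (mol_local eta0 (x := x) (rho := 0)); first exact: bmeasB.
    move=> z; rewrite size_twice add0r => zx.
    have zm : `|z - x| < m by exact: le_lt_trans zx etam.
    have Dz : D z by apply: xD; apply: le_trans (ltW zm) md.
    rewrite (d_in (c_V C n) Dz) (_ : _ - _ = - (h * (f z - f x))); last by rewrite -/h; ring.
    rewrite normrN normrM gtr0_norm// ler_pM2l//; apply: hd2 => //.
    exact: lt_le_trans zm md2.
  by rewrite subrr normr0.
rewrite -lE in G *; rewrite -(ler_pM2l h0) -[h in leLHS](gtr0_norm h0) -normrM.
have G1' : `|Pt h (smooth eta (V n)) x - Pt h (tp l) x - (smooth eta (V n) x - tp l x)| <= h * (e / 4).
  by apply: le_trans G1 _; rewrite ler_pM2l//; lra.
rewrite -lE in G1'.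
have key (a b c p L F : R) : `|a - b - - (h * F)| <= h * (e / 8) ->
    `|a - c - (b - p)| <= h * (e / 4) -> `|c - p - h * L| <= h * (e / 8) -> `|h * (L + F)| <= h * e.
  move=> k1 k2 k3.
  rewrite (_ : h * (L + F) = (a - b - - (h * F)) - (a - c - (b - p)) - (c - p - h * L)); last by ring.
  apply: le_trans (ler_normB _ _) _.
  apply: le_trans (lerD (le_trans (ler_normB _ _) (lerD k1 k2)) k3) _.
  by rewrite -!mulrDr ler_pM2l//; lra.
exact: (key _ _ _ _ _ _ G2 G1' G).
Qed.

End trig_solutions.

(** * Second-order conditions at a minimum *)

Section second_order.
Context {R : realType} {d : nat}.
Implicit Types (x y z v w : 'rV[R]_d) (i k : 'I_d) (q phi : 'rV[R]_d -> R).

Lemma is_derive_along q x v (t : R) (D : R) : is_derive (x + t *: v) v q D ->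
  is_derive t 1 (fun s : R => q (x + s *: v)) D.
Proof.
have E : (fun h : R => h^-1 *: ((q \o shift (x + t *: v)) (h *: v) - q (x + t *: v))) =
    (fun h : R => h^-1 *: (((fun s : R => q (x + s *: v)) \o shift t) (h *: 1) - q (x + t *: v))).
  apply/funext => h; rewrite /=; have -> : h *: (1 : R) + t = h + t by rewrite [h *: 1]mulr1.
  by rewrite scalerDl addrCA addrC.
move=> [dv dE]; split; first by rewrite /derivable -E.
by rewrite -dE /derive -E.
Qed.

Lemma line_mvt q (a : 'rV[R]_d -> R) x i (delta : R) :
  (forall s : R, 0 <= s <= 1 ->
    is_derive (x + (s * delta) *: ebasis i) (ebasis i) q (a (x + (s * delta) *: ebasis i))) ->
  exists2 s : R, 0 < s < 1 & q (x + delta *: ebasis i) - q x = delta * a (x + (s * delta) *: ebasis i).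
Proof.
move=> h; pose g (s : R) : R := q (x + (s * delta) *: ebasis i).
have hd (s : R) : 0 <= s <= 1 -> is_derive s 1 g (a (x + (s * delta) *: ebasis i) * delta).
  move=> /h /is_derive_along h1.
  have h2 : is_derive s 1 (fun s : R => s * delta) delta.
    by apply: is_derive_eq; rewrite /GRing.scale /= mulr0 mulr1 add0r.
  exact: (@is_derive1_comp R (fun s : R => q (x + s *: ebasis i)) (fun s => s * delta) s _ _ h1 h2).
have [||s s01 E] := @MVT R g (fun s => a (x + (s * delta) *: ebasis i) * delta) 0 1 ltr01.
- by move=> s; rewrite in_itv /= => /andP[s0 s1]; apply: hd; rewrite !ltW.
- apply: derivable_within_continuous => s; rewrite in_itv /= => /hd; by case.
exists s; first by move: s01; rewrite in_itv.
by move: E; rewrite /g mul1r mul0r scale0r addr0 subr0 mulr1 => ->; exact: mulrC.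
Qed.

(** The second derivative is given at [x] only. If it were negative, the first derivative would be
    negative just after [x], and by the mean value theorem [q] would drop below its minimum. *)
Lemma min_test q (a : 'rV[R]_d -> R) (b rho : R) x i : 0 < rho ->
  (forall y, `|y - x| <= rho -> is_derive y (ebasis i) q (a y)) ->
  is_derive x (ebasis i) a b -> (forall y, `|y - x| <= rho -> q x <= q y) -> a x = 0 /\ 0 <= b.
Proof.
move=> rho0 hq ha hmin.
have close (t : R) : `|t| <= rho -> `|x + t *: ebasis i - x| <= rho.
  by move=> t1; rewrite addrC addKr; apply: le_trans (normZ_ebasis _ _) _.
have ax : a x = 0.
  pose g (t : R) : R := q (x + t *: ebasis i).
  have dg (t : R) : `|t| <= rho -> is_derive t 1 g (a (x + t *: ebasis i)).
    by move=> t1; apply: is_derive_along; apply: hq; exact: close.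
  have itv (t : R) : t \in `](- rho), rho[ -> `|t| <= rho.
    by rewrite in_itv /= => /andP[t1 t2]; rewrite ler_norml !ltW.
  have [_] : is_derive (0 : R) 1 g 0.
    apply: (@derive1_at_min _ _ (- rho) rho); first by lra.
    - by move=> t /itv /dg[].
    - by rewrite in_itv /= oppr_lt0 rho0.
    - by move=> t /itv t1; rewrite /g scale0r addr0; apply: hmin; exact: close.
  have [|_] := dg 0; first by rewrite normr0 ltW.
  by rewrite scale0r addr0 => -> ->.
split=> //; rewrite leNgt; apply/negP => b0.
have [hdv hE] := ha.
have nb : 0 < - b by rewrite oppr_gt0.
have /cvgrPdist_lt/(_ _ nb) : (fun h : R => h^-1 *: ((a \o shift x) (h *: ebasis i) - a x)) @ 0^' --> b.
  by rewrite -hE.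
move=> [e /= e00 he].
pose t := Num.min (e / 2) rho; have t0 : 0 < t by rewrite lt_min rho0 divr_gt0.
have te : t < e.
  apply: (@le_lt_trans _ _ (e / 2)); first by rewrite ge_min lexx.
  by rewrite ltr_pdivrMr// ltr_pMr// ltr1n.
have tr : t <= rho by rewrite ge_min lexx orbT.
have [s s01|s /andP[s0 s1] E] := @line_mvt q a x i t.
  have /andP[s0 s1] := s01; apply: hq; apply: close; rewrite normrM (ger0_norm s0) (gtr0_norm t0).
  by apply: le_trans tr; rewrite ler_piMl// ltW.
have st0 : 0 < s * t by rewrite mulr_gt0.
have ste : s * t < e by apply: le_lt_trans te; rewrite ler_piMl// ltW.
have neg : a (x + (s * t) *: ebasis i) < 0.
  have := he (s * t); rewrite /= sub0r normrN (gtr0_norm st0) => /(_ ste).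
  rewrite gt_eqF// => /(_ isT); rewrite ax subr0 [(s * t) *: ebasis i + x]addrC.
  set z := x + _; have -> : (s * t)^-1 *: a z = (s * t)^-1 * a z by [].
  rewrite ltr_norml => /andP[h1 _].
  have : (s * t)^-1 * a z < 0 by move: h1; move: ((s * t)^-1 * a z) => Q; lra.
  by rewrite pmulr_rlt0 ?invr_gt0.
have := hmin (x + t *: ebasis i) (close t _); rewrite gtr0_norm// => /(_ tr).
rewrite -subr_ge0 E leNgt pmulr_rlt0// neg.
by [].
Qed.

(* [a] and [b] are the gradient and the Hessian of [phi] on [N]. *)
Record C2_data (N : set 'rV[R]_d) phi (a : 'I_d -> 'rV[R]_d -> R)
    (b : 'I_d -> 'I_d -> 'rV[R]_d -> R) : Prop := C2Data {
  q_d : forall i y, N y -> is_derive y (ebasis i) phi (a i y) ;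
  q_dd : forall i k y, N y -> is_derive y (ebasis k) (a i) (b i k y) ;
  q_c : forall y, N y -> {for y, continuous phi} ;
  q_bc : forall i k y, N y -> {for y, continuous (b i k)} ;
  q_bd : exists B : R, forall y, N y -> `|phi y| <= B }.

Lemma C2_dataN N phi a b : C2_data N phi a b ->
  C2_data N (fun y => - phi y) (fun i y => - a i y) (fun i k y => - b i k y).
Proof.
move=> [h1 h2 h3 h4 [B h5]]; split.
- by move=> i y Ny; apply: is_deriveN; exact: h1.
- by move=> i k y Ny; apply: is_deriveN; exact: h2.
- by move=> y Ny; apply: continuousN; exact: h3.
- by move=> i k y Ny; apply: continuousN; exact: h4.
- by exists B => y Ny; rewrite normrN; exact: h5.
Qed.

Lemma within_open_for (N : set 'rV[R]_d) phi y : open N -> N y ->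
  {within closure N, continuous phi} -> {for y, continuous phi}.
Proof.
move=> oN Ny /(continuous_subspaceW (@subset_closure _ N)).
by rewrite (continuous_open_subspace _ oN) => /(_ y); apply; rewrite inE.
Qed.

Lemma compact_closure (N : set 'rV[R]_d) (rr : R) : (forall y, N y -> `|y| <= rr) -> compact (closure N).
Proof.
move=> hr; have cb := @compact_norm_le R d rr.
apply: (subclosed_compact _ cb); first exact: closed_closure.
have := compact_closed (@norm_hausdorff _ _) cb.
by rewrite closure_id => ->; exact: closure_subset.
Qed.

Lemma C2_closure_data N phi (rr : R) : open N -> (forall y, N y -> `|y| <= rr) -> C2_closure N phi ->
  C2_data N phi (fun i => partial i phi) (fun i k => partial k (partial i phi)).
Proof.
move=> oN hr [h1 h2 h3 h4 h5]; split.
- by move=> i y Ny; split => //; exact: h2.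
- by move=> i k y Ny; split => //; exact: h3.
- by move=> y Ny; exact: within_open_for h1.
- move=> i k y Ny; have [h [hc hE]] := h5 i k.
  have cy := within_open_for oN Ny hc.
  rewrite /prop_for /continuous_at (hE y); last by rewrite inE.
  apply: cvg_trans cy; apply: (@near_eq_cvg _ _ (nbhs y)).
  have nN : nbhs y N by exact: open_nbhs_nbhs.
  by apply: (@filterS _ _ (nbhs_filter y) N) => // z Nz; rewrite hE// inE.
- have cK := @compact_closure N rr hr.
  have [M [Mr hM]] := compact_bounded (continuous_compact h1 cK).
  exists (M + 1) => y Ny; apply: (hM (M + 1)); first by rewrite ltrDl.
  by exists y => //; exact: subset_closure.
Qed.

Section taylor.
Variables (N : set 'rV[R]_d) (phi : 'rV[R]_d -> R).
Variables (a : 'I_d -> 'rV[R]_d -> R) (b : 'I_d -> 'I_d -> 'rV[R]_d -> R).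
Hypothesis H : C2_data N phi a b.
Variables (x0 : 'rV[R]_d) (rho B : R).
Hypothesis hN : forall y, `|y - x0| <= 2 * rho -> N y.
Hypothesis hB : forall i k y, `|y - x0| <= 2 * rho -> `|b i k y| <= B.

Let in2 x y w : `|x - x0| <= rho -> `|y| <= rho -> `|w - x| <= `|y| -> `|w - x0| <= 2 * rho.
Proof.
move=> xr yr wy; rewrite -(subrK x w) -addrA; apply: le_trans (ler_normD _ _) _.
by rewrite mulr_natl mulr2n; apply: lerD => //; exact: le_trans wy yr.
Qed.

Lemma grad_lipschitz i x y : `|x - x0| <= rho -> `|y| <= rho ->
  `|a i (x + y) - a i x| <= d%:R * B * `|y|.
Proof.
move=> xr yr; rewrite stairs_telescope; apply: le_trans (ler_norm_sum _ _ _) _.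
apply: (@le_trans _ _ (\sum_(k < d) `|y| * B)); last first.
  by rewrite sumr_const card_ord -[_ *+ d]mulr_natl le_eqVlt; apply/orP; left; apply/eqP; ring.
apply: ler_sum => k _.
have [s s01|s /andP[s0 s1] ->] := @line_mvt (a i) (b i k) (stairs x y k) k (y 0 k).
  apply: (q_dd H); apply: hN; exact: (in2 xr yr (stairs_close x y k s01)).
rewrite normrM; apply: ler_pM => //; first exact: coord_le_norm.
have s01 : 0 <= s <= 1 by rewrite !ltW.
exact: (hB _ _ (in2 xr yr (stairs_close x y k s01))).
Qed.

Lemma taylor x y : `|x - x0| <= rho -> `|y| <= rho ->
  `|phi (x + y) - phi x - \sum_k y 0 k * a k x| <= d%:R ^+ 2 * B * `|y| ^+ 2.
Proof.
move=> xr yr; rewrite stairs_telescope -sumrB; apply: le_trans (ler_norm_sum _ _ _) _.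
apply: (@le_trans _ _ (\sum_(k < d) `|y| * (d%:R * B * `|y|))); last first.
  by rewrite sumr_const card_ord -[_ *+ d]mulr_natl le_eqVlt; apply/orP; left; apply/eqP; ring.
apply: ler_sum => k _.
have [s s01|s /andP[s0 s1] ->] := @line_mvt phi (a k) (stairs x y k) k (y 0 k).
  apply: (q_d H); apply: hN; exact: (in2 xr yr (stairs_close x y k s01)).
rewrite -mulrBr normrM; apply: ler_pM => //; first exact: coord_le_norm.
have s01 : 0 <= s <= 1 by rewrite !ltW.
have wy := stairs_close x y k s01; set w := stairs _ _ _ + _ in wy *.
have -> : a k w = a k (x + (w - x)) by rewrite addrC subrK.
apply: le_trans (grad_lipschitz _ _ _) _ => //; first exact: le_trans wy yr.
apply: ler_wpM2l => //; rewrite mulr_ge0//.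
by apply: le_trans (hB k k (in2 xr yr wy)).
Qed.

End taylor.

End second_order.

(** * Glued functions under the operator *)

Section glued.
Context {R : realType} {d : nat}.
Implicit Types (x y z : 'rV[R]_d) (i k : 'I_d) (phi u v : 'rV[R]_d -> R) (N : set 'rV[R]_d).
Implicit Types l : seq (R * 'rV[R]_d * R).

Lemma glue_in N phi u y : N y -> glue N phi u y = phi y.
Proof. by move=> Ny; rewrite /glue mem_set. Qed.

Lemma glue_out N phi u y : ~ N y -> glue N phi u y = u y.
Proof. by move=> Ny; rewrite /glue memNset. Qed.

Lemma partial_near N (q1 q2 : 'rV[R]_d -> R) i : open N -> (forall y, N y -> q1 y = q2 y) ->
  forall y, N y -> partial i q1 y = partial i q2 y.
Proof.
move=> oN E y Ny; apply: near_eq_derive.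
have nN : nbhs y N by exact: open_nbhs_nbhs.
by apply: (@filterS _ _ (nbhs_filter y) N) => // z; exact: E.
Qed.

Variable j : 'rV[R]_d -> R.

Lemma L_op_glue N phi u x : open N -> N x ->
  L_op j (glue N phi u) x = laplacian phi x +
    jint j (fun y => glue N phi u (x + y) - phi x - \1_unit_ball y * dotv y (grad phi x)).
Proof.
move=> oN Nx; have E y : N y -> glue N phi u y = phi y by exact: glue_in.
have E1 i y : N y -> partial i (glue N phi u) y = partial i phi y by exact: partial_near.
have E2 i y : N y -> partial i (partial i (glue N phi u)) y = partial i (partial i phi) y.
  by apply: partial_near => //; exact: E1.
have gE : grad (glue N phi u) x = grad phi x by apply/rowP => i; rewrite !mxE E1.
rewrite /L_op gE (E x Nx); apply: (congr1 (fun s => s + _)).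
by apply: eq_bigr => i _; exact: E2.
Qed.

Definition scale_tp (c : R) l : seq (R * 'rV[R]_d * R) :=
  [seq (c * q.1.1, q.1.2, q.2) | q : R * 'rV[R]_d * R <- l].

Lemma tp_scale (c : R) l x : tp (scale_tp c l) x = c * tp l x.
Proof. by rewrite /tp big_map mulr_sumr; apply: eq_bigr => q _; rewrite mulrA. Qed.

Lemma Lt_scale (c : R) l x : Lt j (scale_tp c l) x = c * Lt j l x.
Proof. by rewrite /Lt big_map mulr_sumr; apply: eq_bigr => q _; rewrite mulrA. Qed.

Lemma tp_cat l m x : tp (l ++ m) x = tp l x + tp m x.
Proof. exact: big_cat. Qed.

Lemma Lt_cat l m x : Lt j (l ++ m) x = Lt j l x + Lt j m x.
Proof. exact: big_cat. Qed.

Definition cst_tp (c : R) : seq (R * 'rV[R]_d * R) := [:: (c, 0, 0)].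

Lemma tp_cst (c : R) x : tp (cst_tp c) x = c.
Proof. by rewrite tp_cons /tp big_nil /= dot0v !addr0 cos0 mulr1. Qed.

Lemma Lt_cst (c : R) x : Lt j (cst_tp c) x = 0.
Proof. by rewrite /Lt big_cons big_nil /= sre0 sim0 !dot0v !(addr0, oppr0, mul0r, mulr0). Qed.

Lemma dl_scale (c : R) i l : dl i (scale_tp c l) = scale_tp c (dl i l).
Proof.
by rewrite /dl /scale_tp -!map_comp; apply: eq_map => q /=; rewrite mulrA.
Qed.

Lemma dl_cat i l m : dl i (l ++ m) = dl i l ++ dl i m.
Proof. exact: map_cat. Qed.

Lemma cos_lipschitz (a b : R) : `|cos a - cos b| <= `|a - b|.
Proof.
have -> : cos a - cos b = - (2 * sin ((a + b) / 2) * sin ((a - b) / 2)).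
  transitivity (cos ((a + b) / 2 + (a - b) / 2) - cos ((a + b) / 2 - (a - b) / 2)).
    by congr (cos _ - cos _); field.
  by rewrite cosD cosB; ring.
rewrite normrN !normrM ger0_norm//.
have h1 := sin_max ((a + b) / 2); have h2 := normr_sin ((a - b) / 2).
have -> : `|a - b| = 2 * 1 * `|(a - b) / 2|.
  by rewrite normrM [`|2^-1|]ger0_norm ?invr_ge0//; field.
by apply: ler_pM => //; rewrite ler_pM2l.
Qed.

Lemma continuous_tp l : continuous (tp l).
Proof.
have [C C0 hC] : exists2 C : R, 0 <= C & forall x y, `|tp l y - tp l x| <= C * `|y - x|.
  elim: l => [|[[c z] a] l [C C0 hC]].
    by exists 0 => // x y; rewrite /tp !big_nil subrr normr0 mul0r.
  exists (`|c| * (d%:R * `|z|) + C); first by rewrite addr_ge0// !mulr_ge0.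
  move=> x y; rewrite !tp_cons /=.
  have -> : c * cos (dotv z y + a) + tp l y - (c * cos (dotv z x + a) + tp l x) =
    c * (cos (dotv z y + a) - cos (dotv z x + a)) + (tp l y - tp l x) by ring.
  apply: le_trans (ler_normD _ _) _; rewrite mulrDl; apply: lerD => //.
  rewrite normrM -mulrA; apply: ler_wpM2l => //.
  apply: le_trans _ (dotv_le z (y - x)); rewrite dotvBr.
  have -> : dotv z y - dotv z x = (dotv z y + a) - (dotv z x + a) by ring.
  exact: cos_lipschitz.
apply/continuous_rVP => x e e0; exists (e / (C + 1)); first by rewrite divr_gt0// ltr_wpDl.
move=> y yx; apply: le_trans (hC x y) _; apply: (@le_trans _ _ ((C + 1) * `|y - x|)).
  by rewrite ler_wpM2r// lerDl.
by rewrite mulrC -ler_pdivlMr ?ltW// ltr_wpDl.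
Qed.

Lemma C2_closure_tp N l : C2_closure N (tp l).
Proof.
have cw m : {within closure N, continuous (tp m)}.
  by apply: continuous_subspaceT; exact: continuous_tp.
split=> //.
- by move=> i x _; exact: derivable_tp.
- by move=> i k x _; rewrite partial_tp; exact: derivable_tp.
- by move=> i; exists (tp (dl i l)); split=> // x _; rewrite partial_tp.
- by move=> i k; exists (tp (dl k (dl i l))); split=> // x _; rewrite !partial_tp.
Qed.

Hypotheses (jm : measurable_fun ([set~ 0] : set 'rV[R]_d) j)
  (j0 : forall y : 'rV[R]_d, y != 0 -> 0 <= j y)
  (jl : (\int[lebesgue_rV d]_(y in [set~ 0%R]) (Num.min 1 (enorm y ^+ 2) * j y)%:E < +oo)%E).

Lemma qmin_far y (delta : R) : 0 < delta -> delta <= `|y| -> Num.min 1 (delta ^+ 2) <= qmin y.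
Proof.
move=> d0 dy; rewrite /qmin le_min ge_min lexx /= ge_min.
apply/orP; right; rewrite ler_pXn2r// ?nnegrE ?enorm_ge0 ?(ltW d0)//.
exact: le_trans dy (norm_le_enorm y).
Qed.

Lemma qmin_near y : `|y| <= 1 -> `|y| ^+ 2 <= qmin y.
Proof.
move=> y1; rewrite /qmin le_min expr_le1// y1 /=.
by rewrite ler_pXn2r// ?nnegrE ?enorm_ge0// norm_le_enorm.
Qed.

Lemma jadm_local (F : 'rV[R]_d -> R) (C B delta : R) : measurable_fun setT F -> 0 <= C -> 0 < delta ->
  (forall y, `|y| < delta -> `|F y| <= C * qmin y) -> (forall y, `|F y| <= B) ->
  jadm F /\ forall y, `|F y| <= (C + B / Num.min 1 (delta ^+ 2)) * qmin y.
Proof.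
move=> mF C0 d0 h1 h2.
have B0 : 0 <= B by apply: le_trans (h2 0).
have m0 : 0 < Num.min 1 (delta ^+ 2) by rewrite lt_min ltr01 exprn_gt0.
have K0 : 0 <= B / Num.min 1 (delta ^+ 2) by rewrite divr_ge0// ltW.
have hF y : `|F y| <= (C + B / Num.min 1 (delta ^+ 2)) * qmin y.
  have [yd|dy] := ltP `|y| delta.
    by apply: le_trans (h1 y yd) _; rewrite ler_wpM2r ?qmin_ge0// lerDl.
  apply: (@le_trans _ _ (B / Num.min 1 (delta ^+ 2) * qmin y)).
    apply: le_trans (h2 y) _; rewrite mulrAC ler_pdivlMr//.
    by apply: ler_wpM2l => //; exact: qmin_far.
  by rewrite ler_wpM2r ?qmin_ge0// lerDr.
split=> //; split=> //; exists (C + B / Num.min 1 (delta ^+ 2)) => //.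
exact: addr_ge0.
Qed.

(** Far away from the origin polynomials and solutions are compared only through their bounds; the
    mass of such jumps is made small here. *)
Lemma jint_tail (e : R) : 0 < e -> exists2 rho : R, 1 <= rho &
  jadm (\1_[set y : 'rV[R]_d | rho < `|y|] : 'rV[R]_d -> R) /\
  jint j (\1_[set y : 'rV[R]_d | rho < `|y|]) <= e.
Proof.
move=> e0; pose F n : 'rV[R]_d -> R := \1_[set y : 'rV[R]_d | n.+1%:R < `|y|].
have mF n : measurable_fun setT (F n).
  apply: measurable_indic; have := measurable_dist_gt 0 n.+1%:R (@measurable_id _ 'rV[R]_d setT).
  by congr measurable; apply/seteqP; split=> y /=; rewrite subr0.
have F0 n y : `|y| <= n.+1%:R -> F n y = 0.
  by move=> h; rewrite /F indicE memNset//= ltNge h.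
have F1 n y : `|F n y| <= 1 * qmin y.
  rewrite mul1r; have [h|h] := leP `|y| n.+1%:R; first by rewrite F0// normr0 qmin_ge0.
  rewrite /F indicE mem_set// normr1.
  have := @qmin_far y 1 ltr01; rewrite expr1n minxx; apply.
  by apply: le_trans (ltW h); rewrite ler1n.
have cF y : y != 0 -> F n y @[n --> \oo] --> (0 : R).
  move=> _; apply/cvgrPdist_le => e' e'0; exists (Num.truncn `|y|) => // n /= Nn.
  rewrite F0 ?subrr ?normr0 ?(ltW e'0)//; apply/ltW; apply: lt_le_trans (truncnS_gt _) _.
  by rewrite ler_nat ltnS.
have c := @jint_dct R d j jm j0 jl F (fun=> 0) 1 mF ler01 F1 cF.
rewrite jint0 in c.
have /cvgrPdist_le/(_ _ e0)[n _ /(_ n (leqnn n))] := c.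
rewrite /= sub0r normrN => h; exists n.+1%:R; first by rewrite ler1n.
split; last exact: le_trans (ler_norm _) h.
by split; [exact: mF|exists 1 => // y; exact: F1].
Qed.

End glued.

(** * Uniqueness *)

Section comparison.
Context {R : realType} {d : nat}.
Implicit Types (x y z : 'rV[R]_d) (i k : 'I_d) (phi u v : 'rV[R]_d -> R) (N : set 'rV[R]_d).
Implicit Types l : seq (R * 'rV[R]_d * R).
Variable j : 'rV[R]_d -> R.
Hypotheses (jm : measurable_fun ([set~ 0] : set 'rV[R]_d) j)
  (j0 : forall y : 'rV[R]_d, y != 0 -> 0 <= j y)
  (jl : (\int[lebesgue_rV d]_(y in [set~ 0%R]) (Num.min 1 (enorm y ^+ 2) * j y)%:E < +oo)%E).

Lemma dotvC x y : dotv x y = dotv y x.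
Proof. by apply: eq_bigr => i _; rewrite mulrC. Qed.

(** The integrand of the jump part of [L], with the value [c] and the gradient [g] at the centre as
    free parameters: the glued function and the test function share them. *)
Definition jump (G : 'rV[R]_d -> R) (c : R) (g x y : 'rV[R]_d) : R :=
  G (x + y) - c - \1_unit_ball y * dotv y g.

Lemma measurable_jump (G : 'rV[R]_d -> R) (c : R) (g x : 'rV[R]_d) : measurable_fun setT G -> measurable_fun setT (jump G c g x).
Proof.
move=> mG; apply: measurable_funB; last first.
  apply: measurable_funM; first by apply: measurable_indic; exact: measurable_unit_ball.
  by under eq_fun do rewrite dotvC; exact: measurable_dot.
apply: measurable_funB => //; apply: (measurableT_comp mG).
exact: measurable_rVD.
Qed.

Lemma compensator_le (g y : 'rV[R]_d) : `|\1_unit_ball y * dotv y g| <= d%:R * `|g|.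
Proof.
rewrite unit_ballE; case: ifP => h; last by rewrite mul0r normr0 mulr_ge0.
rewrite mul1r dotvC; apply: le_trans (dotv_le _ _) _; rewrite ler_piMr ?mulr_ge0//.
exact: le_trans (norm_le_enorm y) h.
Qed.

Lemma jump_le (G : 'rV[R]_d -> R) (c B : R) (g x y : 'rV[R]_d) : (forall z, `|G z| <= B) ->
  `|jump G c g x y| <= B + `|c| + d%:R * `|g|.
Proof.
move=> GB; apply: le_trans (ler_normB _ _) _; apply: lerD; last exact: compensator_le.
by apply: le_trans (ler_normB _ _) _; rewrite lerD.
Qed.

Lemma jadm_jump (G : 'rV[R]_d -> R) (c C B delta : R) (g x : 'rV[R]_d) : measurable_fun setT G -> (forall y, `|G y| <= B) ->
  0 <= C -> 0 < delta -> (forall y, `|y| < delta -> `|jump G c g x y| <= C * qmin y) ->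
  jadm (jump G c g x).
Proof.
move=> mG GB C0 d0 h; have mj := @measurable_jump G c g x mG.
by have [] := jadm_local mj C0 d0 h (fun y => jump_le c g x y GB).
Qed.

Lemma measurable_glue N phi u : open N -> (forall y, N y -> {for y, continuous phi}) ->
  measurable_fun setT u -> measurable_fun setT (glue N phi u).
Proof.
move=> oN cphi mu_ ; have mN := measurable_open oN.
have -> : [set: 'rV[R]_d] = N `|` ~` N by rewrite setUv.
apply/measurable_funU => //; first exact: measurableC.
split; last first.
  apply: (@eq_measurable_fun _ _ _ _ _ u); last exact: measurable_funTS.
  by move=> y; rewrite inE => Ny; rewrite glue_out.
apply: (@eq_measurable_fun _ _ _ _ _ phi); first by move=> y; rewrite inE => Ny; rewrite glue_in.
apply: (measurability _ (RGenOpens.measurableE R)) => _ [_ [a [b ->] <-]].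
apply: measurable_open; rewrite openE => y [Ny /= phiy].
have nN : nbhs y N by exact: open_nbhs_nbhs.
have nphi : nbhs y (phi @^-1` `]a, b[%classic).
  by apply: (cphi y Ny); apply: open_nbhs_nbhs; split => //; exact: interval_open.
exact: (@filterI _ _ (nbhs_filter y)).
Qed.

Variables (D : set 'rV[R]_d).

(** What [trig_solution] provides, stated without the process; the rest of the proof uses [u]
    through this property, its continuity and its bound. *)
Definition approximable (f u : 'rV[R]_d -> R) (A : R) :=
  forall e rho delta : R, 0 < e -> 0 < rho -> 0 < delta -> exists l,
  [/\ forall x, `|tp l x| <= A, forall x, `|x| <= rho -> `|tp l x - u x| <= e &
      forall x, (forall y, `|y - x| <= delta -> D y) -> `|Lt j l x + f x| <= e].

Lemma approximableN f u (A : R) : approximable f u A ->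
  approximable (fun x => - f x) (fun x => - u x) A.
Proof.
move=> h e rho delta e0 r0 d0; have [l [h1 h2 h3]] := h _ _ _ e0 r0 d0.
exists (scale_tp (-1) l); split=> x.
- by rewrite tp_scale mulN1r normrN.
- by move=> /h2; rewrite tp_scale mulN1r -opprB opprK normrN addrC.
- by move=> /h3; rewrite Lt_scale mulN1r -opprD normrN.
Qed.

(** Only [v] is a viscosity object, while [u] is represented by smooth almost-solutions; so no
    doubling of variables occurs. The sum of such a polynomial, a multiple of the barrier and a
    constant touches [v] from above at a point of [D], and its image under [L] is strictly below
    [- f] there. The premise [jadm] in the hypothesis on [v] serves supersolutions, where the sign
    of [jint] has to be changed. *)
Lemma comparison (f u v : 'rV[R]_d -> R) (A A' r M : R) lb :
  (forall x, D x -> `|x| <= r) -> (forall x, 1 <= tp lb x <= M) ->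
  (forall x, `|x| <= r -> Lt j lb x <= - 2) -> approximable f u A ->
  continuous u -> continuous v -> (forall x, `|v x| <= A') ->
  (forall x, ~ D x -> v x <= u x) ->
  (forall x N l, D x -> open N -> N x -> N `<=` D -> tp l x = v x ->
    (forall y, N y -> v y <= tp l y) ->
    jadm (jump (glue N (tp l) v) (tp l x) (grad (tp l) x) x) ->
    - f x <= laplacian (tp l) x + jint j (jump (glue N (tp l) v) (tp l x) (grad (tp l) x) x)) ->
  forall x, v x <= u x.
Proof.
move=> Dr hb hL ap cu cv vA vout visc z0; rewrite leNgt; apply/negP => uz.
have Dz0 : D z0 by apply: contrapT => /vout; rewrite leNgt uz.
have r0 : 0 <= r by apply: le_trans (Dr _ Dz0).
have M1 : 1 <= M by have /andP[a b] := hb 0; exact: le_trans b.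
have M0 : 0 < M by apply: lt_le_trans M1.
pose e3 := v z0 - u z0; have e30 : 0 < e3 by rewrite subr_gt0.
(* The barrier, at most [M], raises the polynomial by at most half of the excess [e3], so that [q]
   is still negative at [z0]; its generator gains [2 * e2], which beats the errors [e2 / 4] and
   [e2 / 2]. *)
pose e2 := e3 / (2 * M); have e20 : 0 < e2 by rewrite divr_gt0// mulr_gt0.
have e2M : e2 * M = e3 / 2 by rewrite /e2; field; rewrite gt_eqF.
have e23 : e2 <= e3 / 2 by rewrite -e2M ler_peMr// ltW.
have e24 : 0 < e2 / 4 by rewrite divr_gt0.
clearbody e2.
have cvu : continuous (fun x => v x - u x) by move=> x; apply: continuousB; [exact: cv|exact: cu].
have [del0 del00 hdel] := uniform_on_compact cvu (@compact_norm_le R d r) e24.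
pose del := del0 / 2; have del_gt0 : 0 < del by rewrite divr_gt0.
have del_lt : del < del0 by rewrite ltr_pdivrMr// ltr_pMr// ltr1n.
have [l_ [lA _ _]] := ap 1 1 1 ltr01 ltr01 ltr01.
have A0 : 0 <= A by apply: le_trans (lA 0).
have A'0 : 0 <= A' by apply: le_trans (vA 0).
pose T := A' + A; have T0 : 0 <= T by exact: addr_ge0.
have T1 : 0 < T + 1 by rewrite ltr_wpDl.
(* Beyond distance [rho1] the only comparison of [v] with the polynomial is by their bounds, of sum
   [T]. *)
have e2T : 0 < e2 / 2 / (T + 1) by apply: divr_gt0 => //; exact: divr_gt0.
have [rho1 rho11 [jt ht]] := jint_tail jm j0 jl e2T.
have rho0 : 0 < r + rho1 by lra.
have [l [{}lA lu lL]] := ap _ _ _ e24 rho0 del_gt0.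
pose l1 := l ++ scale_tp e2 lb.
have tpl1 x : tp l1 x = tp l x + e2 * tp lb x by rewrite tp_cat tp_scale.
pose q x := tp l1 x - v x.
have cq : continuous q by move=> x; apply: continuousB; [exact: continuous_tp|exact: cv].
have [|x0 x0r hmin] := @EVT_min_rV R d q _ _ (@compact_norm_le R d r) (continuous_subspaceT cq).
  by exists 0; rewrite /= normr0.
have {x0r} x0r : `|x0| <= r by move: x0r; rewrite inE.
have {}hmin y : `|y| <= r -> q x0 <= q y by move=> yr; apply: hmin; rewrite inE.
pose m := - q x0.
have m0 : 0 < m.
  rewrite oppr_gt0; apply: le_lt_trans (hmin z0 (Dr _ Dz0)) _.
  have := lu z0; rewrite ler_norml => /(_ _)/wrap[].
    by apply: le_trans (Dr _ Dz0) _; rewrite lerDl; apply: le_trans rho11.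
  move=> /andP[_ h1]; have /andP[_ h2] := hb z0.
  have h3 : e2 * tp lb z0 <= e3 / 2 by rewrite -e2M ler_pM2l.
  rewrite /q tpl1; move: h1 h3 e23; rewrite /e3; move: (tp lb z0) => B; clear -e20.
  by move=> h1 h3 h4; lra.
have rr1 x : `|x| <= r -> `|x| <= r + rho1 by move=> h; apply: le_trans h _; lra.
(* At a point outside [D] close to [x0] one has [v <= u]; by the modulus of continuity [v - u] would
   be at most [e2 / 4] at [x0], too small for [q x0 < 0]. *)
have x0D y : `|y - x0| <= del -> D y.
  move=> yx; apply: contrapT => /vout vy.
  have h1 := hdel x0 y x0r (le_lt_trans yx del_lt).
  move: h1; rewrite ler_norml => /andP[h1 _].
  have := lu x0 (rr1 _ x0r); rewrite ler_norml => /andP[h2 _].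
  have /andP[h3 _] := hb x0; have h4 : e2 <= e2 * tp lb x0 by rewrite ler_peMr// ltW.
  have : q x0 < 0 by rewrite -oppr_gt0.
  rewrite /q tpl1; lra.
have Dx0 : D x0 by apply: x0D; rewrite subrr normr0 ltW.
pose L := l1 ++ cst_tp m.
have tpL x : tp L x = tp l1 x + m by rewrite tp_cat tp_cst.
pose N : set 'rV[R]_d := ball x0 del.
have oN : open N by apply: ball_open.
have NP y : N y <-> `|y - x0| < del by exact: ball_normP.
have Nx0 : N x0 by apply/NP; rewrite subrr normr0.
have ND : N `<=` D by move=> y /NP yx; apply: x0D; exact: ltW.
have vL y : `|y| <= r -> v y <= tp L y.
  by move=> /hmin; rewrite tpL /m /q; lra.
have [BL BL0 hBL] := bmeas_bound (bmeas_tp L).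
have [_ [C C0 hC]] := jadm_jump_tp L x0.
pose G := glue N (tp L) v.
have Gin y : N y -> G y = tp L y by exact: glue_in.
have mG : measurable_fun setT G.
  apply: measurable_glue => //; first by move=> y _; exact: continuous_tp.
  exact: continuous_measurable_rV.
have GB y : `|G y| <= BL + A'.
  rewrite /G /glue; case: ifP => _; first by apply: le_trans (hBL y) _; rewrite lerDl.
  by apply: le_trans (vA y) _; rewrite lerDr.
have jG : jadm (jump G (tp L x0) (grad (tp L) x0) x0).
  apply: (jadm_jump mG GB C0 del_gt0) => y yd.
  rewrite /jump Gin; first exact: hC.
  by apply/NP; rewrite addrC addKr.
have := visc x0 N L Dx0 oN Nx0 ND.
rewrite {1}tpL => /(_ _ _)/wrap[]; first by rewrite /m /q; lra.
  by move=> y /ND /Dr; exact: vL.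
move=> /(_ jG).
apply/negP; rewrite -ltNge.
have jL := jadm_jump_tp L x0.
have jT := jadmZ T jt.
apply: (@le_lt_trans _ _ (laplacian (tp L) x0 + (jint j (fun y => tp L (x0 + y) - tp L x0 - \1_unit_ball y * dotv y (grad (tp L) x0)) +
   T * jint j (\1_[set y : 'rV[R]_d | rho1 < `|y|])))).
  rewrite lerD2l -(jintZ jm j0 jl T jt) -(jintD jm j0 jl jL jT).
  apply: (le_jint jm j0 jl jG (jadmD jL jT)) => y _; rewrite /jump -/G.
  suff : G (x0 + y) <= tp L (x0 + y) + T * \1_[set y : 'rV[R]_d | rho1 < `|y|] y.
    by move=> h; rewrite -!addrA [leRHS]addrC -!addrA addrC; lra.
  have [h|h] := leP `|y| rho1.
    rewrite indicE memNset/= ?mulr0 ?addr0; last by rewrite ltNge h.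
    have [/Gin ->//|nN] := pselect (N (x0 + y)).
    rewrite /G glue_out//; have [/Dr /vL//|nD] := pselect (D (x0 + y)).
    apply: le_trans (vout _ nD) _.
    have xy : `|x0 + y| <= r + rho1 by apply: le_trans (ler_normD _ _) _; exact: lerD.
    have := lu _ xy; rewrite ler_norml => /andP[h1 _].
    have /andP[h3 _] := hb (x0 + y); have h4 : e2 <= e2 * tp lb (x0 + y) by rewrite ler_peMr// ltW.
    by rewrite tpL tpl1; lra.
  rewrite indicE mem_set//= mulr1.
  have [/Gin ->//|nN] := pselect (N (x0 + y)); first by rewrite lerDl.
  rewrite /G glue_out//; have := vA (x0 + y); have := lA (x0 + y).
  rewrite !ler_norml => /andP[h1 _] /andP[_ h2].
  have /andP[h3 _] := hb (x0 + y); have h4 : e2 <= e2 * tp lb (x0 + y) by rewrite ler_peMr// ltW.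
  by rewrite tpL tpl1 /T; lra.
have := L_op_tp jm j0 jl L x0; rewrite /L_op -/(jint j (fun y => tp L (x0 + y) - tp L x0 - \1_unit_ball y * dotv y (grad (tp L) x0))) addrA => ->.
have -> : Lt j L x0 = Lt j l x0 + e2 * Lt j lb x0.
  by rewrite !Lt_cat Lt_cst addr0 Lt_scale.
have := lL x0 x0D; rewrite ler_norml => /andP[_ h1].
have h2 : e2 * Lt j lb x0 <= e2 * - 2 by rewrite ler_pM2l// hL.
have h3 : T * jint j (\1_[set y : 'rV[R]_d | rho1 < `|y|]) <= e2 / 2.
  apply: le_trans (ler_wpM2l T0 ht) _; rewrite mulrCA ger_pMr ?divr_gt0//.
  by rewrite ler_pdivrMr// mul1r lerDl.
move: h1 h2 h3; move: (jint _ _) => Q; lra.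
Qed.

End comparison.

(** * Existence *)

Section touching.
Context {R : realType} {d : nat}.
Implicit Types (x y z : 'rV[R]_d) (i k : 'I_d).
Implicit Types l : seq (R * 'rV[R]_d * R).
Variable j : 'rV[R]_d -> R.
Hypotheses (jm : measurable_fun ([set~ 0] : set 'rV[R]_d) j)
  (j0 : forall y : 'rV[R]_d, y != 0 -> 0 <= j y)
  (jl : (\int[lebesgue_rV d]_(y in [set~ 0%R]) (Num.min 1 (enorm y ^+ 2) * j y)%:E < +oo)%E).

Lemma trig_sum I (s : seq I) (F : I -> 'rV[R]_d -> R) :
  (forall c : I, trig (F c)) -> trig (fun x => \sum_(c <- s) F c x).
Proof.
move=> tF; elim: s => [|c s IH].
  by have := trig_cst (d := d) (0 : R); congr trig; apply/funext => x; rewrite big_nil.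
by have := trigD (tF c) IH; congr trig; apply/funext => x; rewrite big_cons.
Qed.

Lemma Lt_bounded l : exists2 B : R, 0 <= B & forall x, `|Lt j l x| <= B.
Proof.
elim: l => [|[[c z] a] l [B B0 hB]]; first by exists 0 => // x; rewrite /Lt big_nil normr0.
exists (`|c| * (`|dotv z z + sre j z| + `|sim j z|) + B).
  by rewrite addr_ge0// mulr_ge0// addr_ge0.
move=> x; rewrite /Lt big_cons /=; apply: le_trans (ler_normD _ _) _; apply: lerD; last exact: hB.
rewrite normrM; apply: ler_wpM2l => //; apply: le_trans (ler_normD _ _) _.
rewrite !normrM normrN; apply: lerD; rewrite ler_piMr//; [exact: cos_max|exact: sin_max].
Qed.

(** A trigonometric substitute for [|x - p|^2], so that the perturbed polynomial stays in the class
    where [L] is explicit. *)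
Definition well (p x : 'rV[R]_d) : R := \sum_(i <- index_enum 'I_d) (1 - cos (x 0 i - p 0 i)).

Lemma trig_well p : trig (well p).
Proof.
apply: trig_sum => i; apply: trigB; first exact: trig_cst.
have := trig_cosz (ebasis i) (- p 0 i); congr trig; apply/funext => x.
by rewrite dotvC dotv_ebasisr.
Qed.

Lemma well_ge0 p x : 0 <= well p x.
Proof. by apply: sumr_ge0 => i _; exact: oneBcos_ge0. Qed.

Lemma well_at p : well p p = 0.
Proof. by rewrite /well big1// => i _; rewrite subrr cos0 subrr. Qed.

Lemma well_le p x : well p x <= 2 * d%:R.
Proof.
apply: (@le_trans _ _ (\sum_(i < d) 2)); first by apply: ler_sum => i _; exact: oneBcos_le2.
by rewrite sumr_const card_ord -[_ *+ d]mulr_natr.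
Qed.

Lemma well_lower p x : `|x - p| <= 1 -> cos 1 ^+ 2 / 2 * `|x - p| ^+ 2 <= well p x.
Proof.
move=> xp; pose c : R := cos 1 ^+ 2 / 2.
have c0 : 0 < c by rewrite divr_gt0// exprn_gt0// cos1_gt0.
have w0 := well_ge0 p x.
have h : `|x - p| <= Num.sqrt (well p x / c).
  apply: norm_le_coord; first exact: sqrtr_ge0.
  move=> i; rewrite -sqrtr_sqr; apply: ler_wsqrtr; rewrite ler_pdivlMr// mulrC.
  have x1 : `|(x - p) 0 i| <= 1 by apply: le_trans (coord_le_norm _ _) xp.
  have : c * `|(x - p) 0 i| ^+ 2 <= 1 - cos `|(x - p) 0 i|.
    by apply: oneBcos_lower; rewrite normr_ge0 (le_trans x1)// ler1n.
  rewrite real_normK ?num_real// => h; apply: le_trans h _.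
  have -> : cos `|(x - p) 0 i| = cos (x 0 i - p 0 i).
    by rewrite !mxE; case: (ler0P (x 0 i - p 0 i)) => _ //; rewrite cosN.
  rewrite /well (bigD1_seq i) ?index_enum_uniq ?mem_index_enum//= lerDl.
  by apply: sumr_ge0 => k _; exact: oneBcos_ge0.
have wc : 0 <= well p x / c by apply: divr_ge0 => //; exact: ltW.
rewrite mulrC -ler_pdivlMr// -[leRHS]sqr_sqrtr//.
by rewrite ler_pXn2r// ?nnegrE ?sqrtr_ge0.
Qed.

Lemma compact_ball p (rr : R) : compact [set x : 'rV[R]_d | `|x - p| <= rr].
Proof.
apply: (subclosed_compact _ (@compact_norm_le R d (rr + `|p|))).
  apply: (@preimage_closed _ _ (fun x : 'rV[R]_d => `|x - p|) [set t | t <= rr]).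
    by move=> x _; exact: continuous_dist.
  exact: closed_le.
move=> x /= xp; rewrite -(subrK p x); apply: le_trans (ler_normD _ _) _.
by rewrite lerD2r.
Qed.

Variables (D N : set 'rV[R]_d) (phi f u : 'rV[R]_d -> R) (A : R).
Variables (a : 'I_d -> 'rV[R]_d -> R) (b : 'I_d -> 'I_d -> 'rV[R]_d -> R) (x0 : 'rV[R]_d).
Hypothesis H : C2_data N phi a b.
Hypotheses (oN : open N) (Nx0 : N x0) (ND : N `<=` D).
Hypotheses (phi_x0 : phi x0 = u x0) (u_le : forall y, N y -> u y <= phi y).
Hypotheses (cu : continuous u) (uA : forall x, `|u x| <= A) (ap : approximable j D f u A).
Hypothesis fc : forall e : R, 0 < e -> exists2 delta : R, 0 < delta &
  forall x, D x -> `|x - x0| < delta -> `|f x - f x0| <= e.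

Let A0 : 0 <= A. Proof. exact: le_trans (normr_ge0 _) (uA 0). Qed.

(** The bound on [(d + 2) * rho] ensures that vectors of sup norm below [rho] lie in the Euclidean
    unit ball, where the compensator is present, and that [2 * rho <= 1]. *)
Lemma hessian_ball : exists rho B : R, [/\ 0 < rho, (d%:R + 2) * rho <= 1, 0 <= B,
  forall y, `|y - x0| <= 2 * rho -> N y &
  forall i k y, `|y - x0| <= 2 * rho -> `|b i k y| <= B].
Proof.
pose Q (p : 'I_d * 'I_d) : set 'rV[R]_d := [set y | `|b p.1 p.2 x0 - b p.1 p.2 y| < 1].
have hQ p : nbhs x0 (Q p).
  have /cvgrPdist_lt/(_ _ ltr01) := @q_bc _ _ _ _ _ _ H p.1 p.2 x0 Nx0.
  by [].
have nQ := @filter_forall _ _ _ _ (nbhs_filter x0) hQ.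
have nN : nbhs x0 N by exact: open_nbhs_nbhs.
have /nbhs_ballP[rr /= rr0 hr] := @filterI _ _ (nbhs_filter x0) _ _ nN nQ.
pose rho := Num.min (rr / 4) (d%:R + 2)^-1.
have d2 : 0 < d%:R + 2 :> R by rewrite ltr_wpDl.
have rho0 : 0 < rho by rewrite lt_min invr_gt0 d2 divr_gt0.
have inr y : `|y - x0| <= 2 * rho -> ball x0 rr y.
  move=> yx; apply/ball_normP; apply: le_lt_trans yx _.
  apply: (@le_lt_trans _ _ (2 * (rr / 4))); first by rewrite ler_pM2l// ge_min lexx.
  by lra.
exists rho, (\sum_(p : 'I_d * 'I_d) `|b p.1 p.2 x0| + 1); split=> //.
- by rewrite mulrC -ler_pdivlMr// mul1r ge_min lexx orbT.
- by apply: addr_ge0 => //; exact: sumr_ge0.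
- by move=> y /inr /hr[].
move=> i k y /inr /hr[_ /(_ (i, k))]; rewrite /Q /= => h.
have -> : b i k y = b i k x0 - (b i k x0 - b i k y) by ring.
apply: le_trans (ler_normB _ _) _; apply: lerD; last exact: ltW.
rewrite (bigD1 (i, k))//= lerDl; exact: sumr_ge0.
Qed.

Variables (rho B : R).
Hypotheses (rho0 : 0 < rho) (rho1 : (d%:R + 2) * rho <= 1) (B0 : 0 <= B).
Hypothesis hN : forall y, `|y - x0| <= 2 * rho -> N y.
Hypothesis hB : forall i k y, `|y - x0| <= 2 * rho -> `|b i k y| <= B.

Let rho_le1 : rho <= 1.
Proof. by apply: le_trans rho1; rewrite ler_peMl ?(ltW rho0)// ler_wpDl// ler1n. Qed.

Let alpha x : 'rV[R]_d := \row_i a i x.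

Let alpha_bound : exists2 G : R, 0 <= G & forall x, `|x - x0| <= rho -> `|alpha x| <= G.
Proof.
exists (\sum_i `|a i x0| + d%:R * B * rho).
  by apply: addr_ge0; [exact: sumr_ge0|rewrite !mulr_ge0// ltW].
move=> x xr; have S0 : 0 <= \sum_i `|a i x0| by exact: sumr_ge0.
have d0 : 0 <= d%:R * B * rho by rewrite !mulr_ge0// ltW.
apply: norm_le_coord => [|i]; first exact: addr_ge0.
rewrite mxE; have -> : a i x = a i x0 + (a i (x0 + (x - x0)) - a i x0).
  by rewrite [x0 + _]addrC subrK; ring.
apply: le_trans (ler_normD _ _) _; apply: lerD.
  by rewrite (bigD1 i)//= lerDl; exact: sumr_ge0.
apply: le_trans (grad_lipschitz H hN hB i _ _) _ => //; first by rewrite subrr normr0 ltW.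
by apply: ler_wpM2l => //; exact: mulr_ge0.
Qed.

Let unit_small y : `|y| < rho -> \1_unit_ball y = 1 :> R.
Proof.
move=> yr; rewrite unit_ballE; case: ifP => // /negP[].
apply: le_trans (enorm_le y) _; apply: le_trans rho1.
apply: ler_pM => //; [by rewrite lerDl|exact: ltW].
Qed.

(** The increments from [x] of [phi] at small distance and of [q] at large distance. The constant
    [c] is the value at [x] of the penalization, which survives in the far part. *)
Let G (q : 'rV[R]_d -> R) (c : R) x : 'rV[R]_d -> R :=
  glue (ball 0 rho) (fun y => phi (x + y) - phi x) (fun y => q (x + y) - q x + c).

Let in0P y : ball (0 : 'rV[R]_d) rho y <-> `|y| < rho.
Proof. by split=> [/ball_normP|h]; [rewrite subr0|apply/ball_normP; rewrite subr0]. Qed.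

Let in_N x y : `|x - x0| <= rho -> `|y| < rho -> N (x + y).
Proof.
move=> xr yr; apply: hN; rewrite addrAC; apply: le_trans (ler_normD _ _) _.
by rewrite mulr_natl mulr2n; apply: lerD => //; exact: ltW.
Qed.

(** One constant for all [q] with the same bound and all [x] near [x0]: the Taylor bound of [phi]
    near the origin and the global bounds away from it. It is the domination needed to let the
    touching point tend to [x0]. *)
Let dominated : exists2 C : R, 0 <= C & forall (q : 'rV[R]_d -> R) (c : R) x, `|x - x0| <= rho ->
  measurable_fun setT q -> (forall y, `|q y| <= A) -> 0 <= c <= 1 ->
  jadm (jump (G q c x) 0 (alpha x) 0) /\
  forall y, `|jump (G q c x) 0 (alpha x) 0 y| <= C * qmin y.
Proof.
have [Bp hBp] := q_bd H; have [Ga Ga0 hGa] := alpha_bound.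
have Bp0 : 0 <= Bp by apply: le_trans (hBp _ Nx0).
pose C1 := d%:R ^+ 2 * B; have C10 : 0 <= C1 by rewrite mulr_ge0 ?sqr_ge0.
pose BG := Bp + Bp + (A + A + 1).
have m0 : 0 < Num.min 1 (rho ^+ 2) by rewrite lt_min ltr01 exprn_gt0.
have BG0 : 0 <= BG by rewrite !addr_ge0.
exists (C1 + (BG + d%:R * Ga) / Num.min 1 (rho ^+ 2)).
  by rewrite addr_ge0// divr_ge0 ?(ltW m0)// addr_ge0// mulr_ge0.
move=> q c x xr mq qA /andP[c0 c1].
have mG : measurable_fun setT (G q c x).
  apply: measurable_glue; first exact: ball_open.
    move=> y /in0P yr.
    have cy : {for y, continuous (fun y => phi (x + y))}.
      apply: (@continuous_comp _ _ _ (fun y => x + y) phi y); last exact: (q_c H (in_N xr yr)).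
      by apply: (@cvgD _ _ _ (nbhs y)); [exact: cvg_cst|exact: cvg_id].
    by apply: continuousB => //; exact: cst_continuous.
  apply: measurable_funD => //; apply: measurable_funB => //.
  by apply: (measurableT_comp mq); exact: measurable_rVD.
have GBd y : `|G q c x y| <= BG.
  rewrite /G /glue; case: ifP => [|_].
    rewrite inE => /in0P yr; apply: le_trans (ler_normB _ _) _.
    rewrite /BG -[leLHS]addr0; apply: lerD; last by rewrite !addr_ge0.
    apply: lerD; apply: hBp; first exact: in_N.
    by apply: hN; apply: le_trans xr _; rewrite ler_peMl ?(ltW rho0)// ler1n.
  rewrite /BG -[leLHS]add0r; apply: lerD; first exact: addr_ge0.
  apply: le_trans (ler_normD _ _) _; apply: lerD; last by rewrite ger0_norm.
  by apply: le_trans (ler_normB _ _) _; exact: lerD.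
have near0 y : `|y| < rho -> `|jump (G q c x) 0 (alpha x) 0 y| <= C1 * qmin y.
  move=> yr; rewrite /jump add0r subr0 /G glue_in; last exact/in0P.
  rewrite unit_small// mul1r.
  have -> : dotv y (alpha x) = \sum_k y 0 k * a k x by apply: eq_bigr => k _; rewrite mxE.
  apply: le_trans (taylor H hN hB xr (ltW yr)) _; apply: ler_wpM2l => //.
  by apply: qmin_near; apply: le_trans (ltW yr) rho_le1.
have far y : `|jump (G q c x) 0 (alpha x) 0 y| <= BG + d%:R * Ga.
  apply: le_trans (jump_le _ _ _ _ GBd) _; rewrite normr0 addr0 lerD2l ler_wpM2l//.
  exact: hGa.
exact: (jadm_local (measurable_jump _ _ _ mG) C10 rho0 near0 far).
Qed.

(** At a minimum [x] of [phi + eps * well x0 - tp l] the gradients are equal and the pure second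
    derivatives are ordered; the jump integrals are ordered because small increments compare by
    minimality. So the near equation for [tp l] becomes an inequality for the derivatives of [phi]
    at [x]. *)
Lemma touching_step ls (eps eta BL : R) : tp ls = well x0 -> (forall x, `|Lt j ls x| <= BL) ->
  0 < eps -> eps * (2 * d%:R) <= 1 -> 0 < eta <= rho ->
  exists l x, [/\ `|x - x0| <= eta, forall z, `|tp l z| <= A,
    forall z, `|z| <= eta^-1 -> `|tp l z - u z| <= eta &
    - f x - eta - eps * BL <= \sum_i b i i x +
      jint j (jump (G (tp l) (eps * well x0 x) x) 0 (alpha x) 0)].
Proof.
move=> lsE hBL eps0 epsd /andP[eta0 eta_rho].
pose cs : R := cos 1 ^+ 2 / 2.
have cs0 : 0 < cs by rewrite divr_gt0// exprn_gt0// cos1_gt0.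
have hwl z : `|z - x0| <= 1 -> cs * `|z - x0| ^+ 2 <= well x0 z by exact: well_lower.
clearbody cs.
(* At the minimum [eps * well x0 x <= 2 * e], since [phi] touches [u] at [x0] and [tp l] is within
   [e] of [u]. With [well_lower] this gives [|x - x0| <= eta]. *)
pose e := Num.min eta (eps * cs * eta ^+ 2 / 2).
have e0 : 0 < e by rewrite lt_min eta0; apply: divr_gt0 => //; rewrite !mulr_gt0.
have e_eta : e <= eta by rewrite ge_min lexx.
have e_eps : 2 * e <= eps * cs * eta ^+ 2.
  have : e <= eps * cs * eta ^+ 2 / 2 by rewrite ge_min lexx orbT.
  lra.
have ra0 : 0 < eta^-1 + `|x0| + 2 by rewrite ltr_wpDl// addr_ge0// invr_ge0 ltW.
have [l [lA lu lL]] := ap e0 ra0 rho0.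
pose m := scale_tp eps ls ++ scale_tp (-1) l.
have tpm z : tp m z = eps * well x0 z - tp l z by rewrite tp_cat !tp_scale lsE mulN1r.
pose q z := phi z + tp m z.
pose K : set 'rV[R]_d := [set x | `|x - x0| <= 2 * rho].
have cq : {within K, continuous q}.
  apply: continuous_in_subspaceT => z; rewrite inE => /hN Nz.
  by apply: continuousD; [exact: (q_c H Nz)|exact: continuous_tp].
have [|x xK hmin] := @EVT_min_rV R d q K _ (compact_ball (rr := 2 * rho)) cq.
  by exists x0; rewrite /K /= subrr normr0 mulr_ge0// ltW.
have {xK} xK : `|x - x0| <= 2 * rho by move: xK; rewrite inE.
have {}hmin y : `|y - x0| <= 2 * rho -> q x <= q y by move=> yr; apply: hmin; rewrite inE.
have Kx0 : `|x0 - x0| <= 2 * rho by rewrite subrr normr0 mulr_ge0// ltW.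
have rho2 : 2 * rho <= 1 by apply: le_trans rho1; rewrite ler_pM2r// lerDr.
have xa z : `|z - x0| <= 1 -> `|z| <= eta^-1 + `|x0| + 2.
  move=> zx; rewrite -(subrK x0 z); apply: le_trans (ler_normD _ _) _.
  have : 0 < eta^-1 by rewrite invr_gt0.
  by move: zx; move: (eta^-1) `|z - x0| => p1 p2; lra.
have w_small : eps * well x0 x <= 2 * e.
  have := hmin x0 Kx0; rewrite /q !tpm well_at mulr0 phi_x0.
  have h1 := u_le (hN xK).
  have := lu x (xa x (le_trans xK rho2)); have := lu x0 (xa x0 (le_trans Kx0 rho2)).
  rewrite !ler_norml => /andP[h2 h3] /andP[h4 h5]; lra.
have xeta : `|x - x0| <= eta.
  have h := hwl _ (le_trans xK rho2).
  rewrite -(ler_pXn2r (n := 2))// ?nnegrE ?(ltW eta0)//.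
  rewrite -(ler_pM2l cs0) -(ler_pM2l eps0).
  apply: (@le_trans _ _ (eps * well x0 x)); first by rewrite ler_pM2l.
  by apply: le_trans w_small _; rewrite [eps * (cs * _)]mulrA.
have xr : `|x - x0| <= rho := le_trans xeta eta_rho.
have near_x y : `|y - x| <= rho -> `|y - x0| <= 2 * rho.
  move=> yx; rewrite -(subrK x y) -addrA; apply: le_trans (ler_normD _ _) _.
  by rewrite mulr_natl mulr2n lerD.
have crit i : a i x + tp (dl i m) x = 0 /\ 0 <= b i i x + tp (dl i (dl i m)) x.
  apply: (min_test (q := q) (a := fun y => a i y + tp (dl i m) y) rho0).
  - move=> y /near_x /hN Ny; apply: is_deriveD; [exact: (q_d H)|exact: is_derive_tp].
  - by apply: is_deriveD; [apply: (q_dd H); exact: hN|exact: is_derive_tp].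
  - by move=> y /near_x /hmin.
have gradE : grad (tp l) x = alpha x + eps *: grad (tp ls) x.
  apply/rowP => i; rewrite !mxE !partial_tp; have [h _] := crit i.
  by move: h; rewrite dl_cat !dl_scale tp_cat !tp_scale; lra.
have lapE : laplacian (tp l) x - eps * laplacian (tp ls) x <= \sum_i b i i x.
  rewrite /laplacian mulr_sumr -sumrB; apply: ler_sum => i _.
  rewrite !partial_tp; have [_ h] := crit i.
  by move: h; rewrite !dl_cat !dl_scale tp_cat !tp_scale; lra.
exists l, x; split=> //.
  move=> z zr; apply: le_trans (lu z _) e_eta; apply: le_trans zr _.
  by rewrite -addrA lerDl addr_ge0.
have [Cd _ dom] := dominated.
have c01 : 0 <= eps * well x0 x <= 1.
  rewrite mulr_ge0 ?well_ge0 ?(ltW eps0)//=; apply: le_trans epsd.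
  by rewrite ler_pM2l// well_le.
have [jF _] := dom (tp l) _ x xr (bmeas_tp l).1 lA c01.
have jl_ := jadm_jump_tp l x; have jls := jadm_jump_tp ls x.
have El := L_op_tp jm j0 jl l x; have Els := L_op_tp jm j0 jl ls x.
move: El Els; rewrite /L_op.
rewrite -/(jint j (fun y => tp l (x + y) - tp l x - \1_unit_ball y * dotv y (grad (tp l) x))).
rewrite -/(jint j (fun y => tp ls (x + y) - tp ls x - \1_unit_ball y * dotv y (grad (tp ls) x))).
move=> El Els.
have hJ : jint j (fun y => tp l (x + y) - tp l x - \1_unit_ball y * dotv y (grad (tp l) x)) -
    eps * jint j (fun y => tp ls (x + y) - tp ls x - \1_unit_ball y * dotv y (grad (tp ls) x)) <=
    jint j (jump (G (tp l) (eps * well x0 x) x) 0 (alpha x) 0).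
  rewrite -(jintZ jm j0 jl eps jls) -(jintB jm j0 jl jl_ (jadmZ eps jls)).
  apply: (le_jint jm j0 jl (jadmB jl_ (jadmZ eps jls)) jF) => y _.
  rewrite gradE dotvDr dotvZr lsE /jump add0r subr0.
  set w := \1_unit_ball y; set p1 := dotv y (alpha x); set p2 := dotv y _.
  (* For [|y| < rho] this is minimality of [x]. For larger [y] nothing is known about [phi], and the
     nonnegative term [eps * well x0 (x + y)] is dropped. *)
  suff h : tp l (x + y) - tp l x - eps * (well x0 (x + y) - well x0 x) <=
      G (tp l) (eps * well x0 x) x y.
    have -> : tp l (x + y) - tp l x - w * (p1 + eps * p2) -
       eps * (well x0 (x + y) - well x0 x - w * p2) =
       tp l (x + y) - tp l x - eps * (well x0 (x + y) - well x0 x) - w * p1 by ring.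
    by rewrite lerD2r.
  rewrite /G; have [yr|yr] := pselect (`|y| < rho).
    rewrite glue_in; last exact/in0P.
    have := hmin (x + y); rewrite near_x; last by rewrite addrC addKr ltW.
    move=> /(_ isT); rewrite /q !tpm mulrBr.
    move: (eps * well x0 x) (eps * well x0 (x + y)) (tp l x) (tp l (x + y)) (phi x) (phi (x + y)).
    move=> c1 c2 c3 c4 c5 c6; rewrite -subr_ge0 => h; rewrite -subr_ge0.
    by apply: le_trans h _; rewrite le_eqVlt; apply/orP; left; apply/eqP; ring.
  rewrite glue_out; last by move/in0P.
  have : 0 <= eps * well x0 (x + y) by rewrite mulr_ge0 ?well_ge0 ?(ltW eps0).
  rewrite mulrBr; move: (eps * well x0 x) (eps * well x0 (x + y)) (tp l x) (tp l (x + y)).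
  move=> c1 c2 c3 c4 h; rewrite -subr_ge0; apply: le_trans h _.
  by rewrite le_eqVlt; apply/orP; left; apply/eqP; ring.
have := lL x (fun y yx => ND (hN (near_x y yx))).
rewrite ler_norml => /andP[h1 _].
have := hBL x; rewrite ler_norml => /andP[_ h2].
have h3 : eps * Lt j ls x <= eps * BL by rewrite ler_pM2l.
apply: le_trans (lerD lapE hJ).
set J1 := jint j _ in El *; set J2 := jint j _ in Els *.
have -> : laplacian (tp l) x - eps * laplacian (tp ls) x + (J1 - eps * J2) =
    Lt j l x - eps * Lt j ls x by rewrite -El -Els mulrDr opprD addrACA.
apply: lerB => //; rewrite addrC lerBlDr; apply: le_trans h1; by rewrite lerN2.
Qed.

Lemma cvg_at (psi : 'rV[R]_d -> R) z (z_ : nat -> 'rV[R]_d) : {for z, continuous psi} ->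
  (forall e : R, 0 < e -> exists n0 : nat, forall n, (n0 <= n)%N -> `|z_ n - z| <= e) ->
  psi (z_ n) @[n --> \oo] --> psi z.
Proof.
move=> cpsi hz; apply/cvgrPdist_le => e e0.
have /cvgrPdist_le/(_ _ e0)/nbhs_ballP[del /= del0 hdel] := @cpsi.
have d2 : 0 < del / 2 by rewrite divr_gt0.
have [n0 hn0] := hz _ d2; exists n0 => // n /= /hn0 h; apply: hdel; apply/ball_normP.
by apply: le_lt_trans h _; rewrite ltr_pdivrMr// ltr_pMr// ltr1n.
Qed.

Let rhoN n : R := rho / n.+1%:R.

Let rhoN_bounds n : 0 < rhoN n <= rho.
Proof. by rewrite divr_gt0//= ler_pdivrMr// ler_peMr ?ler1n// ltW. Qed.

Let rhoN_small (e : R) : 0 < e -> exists n0 : nat, forall n, (n0 <= n)%N -> rhoN n <= e.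
Proof.
move=> e0; have [n0 _ h] := near_infty_natSinv_lt (PosNum (divr_gt0 e0 rho0)).
exists n0 => n nn; have := h n nn => /= /ltW; rewrite ler_pdivlMr// => h'.
by rewrite /rhoN mulrC.
Qed.

Let alpha_lipschitz x : `|x - x0| <= rho -> `|alpha x - alpha x0| <= d%:R * B * `|x - x0|.
Proof.
move=> xr; apply: norm_le_coord => [|i]; first by rewrite !mulr_ge0.
rewrite !mxE; have -> : a i x = a i (x0 + (x - x0)) by rewrite [x0 + _]addrC subrK.
by apply: (grad_lipschitz H hN hB); rewrite ?subrr ?normr0 ?(ltW rho0).
Qed.

(** Limit of [touching_step] as the polynomials converge: the touching points tend to [x0], the
    second derivatives of [phi] are continuous, and the jump integrals converge by domination. The
    penalization disappears from the jump term because [well x0 x0 = 0]. *)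
Lemma touching_eps ls (eps BL : R) : tp ls = well x0 -> (forall x, `|Lt j ls x| <= BL) ->
  0 < eps -> eps * (2 * d%:R) <= 1 ->
  - f x0 - eps * BL <= \sum_i b i i x0 + jint j (jump (G u 0 x0) 0 (alpha x0) 0).
Proof.
move=> lsE hBL eps0 epsd.
have [C C0 dom] := dominated.
have h n := touching_step lsE hBL eps0 epsd (rhoN_bounds n).
have [l_ /choice[x_ hx]] := choice h.
have xn n : `|x_ n - x0| <= rhoN n by case: (hx n).
have xr n : `|x_ n - x0| <= rho by apply: le_trans (xn n) _; case/andP: (rhoN_bounds n).
have x_close (e : R) : 0 < e -> exists n0 : nat, forall n, (n0 <= n)%N -> `|x_ n - x0| <= e.
  by move=> /rhoN_small[n0 hn0]; exists n0 => n /hn0; exact: le_trans.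
have xy_close y (e : R) : 0 < e -> exists n0 : nat, forall n, (n0 <= n)%N -> `|x_ n + y - (x0 + y)| <= e.
  by move=> /x_close[n0 hn0]; exists n0 => n /hn0; rewrite opprD addrACA subrr addr0.
have hD x : `|x - x0| <= rho -> D x.
  by move=> h1; apply: ND; apply: hN; apply: le_trans h1 _; rewrite ler_peMl ?(ltW rho0)// ler1n.
have w01 x : 0 <= eps * well x0 x <= 1.
  rewrite mulr_ge0 ?well_ge0 ?(ltW eps0)//=; apply: le_trans epsd.
  by rewrite ler_pM2l// well_le.
pose F_ n := jump (G (tp (l_ n)) (eps * well x0 (x_ n)) (x_ n)) 0 (alpha (x_ n)) 0.
pose F := jump (G u 0 x0) 0 (alpha x0) 0.
have hF n : jadm (F_ n) /\ forall y, `|F_ n y| <= C * qmin y.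
  by have [_ lA _ _] := hx n; apply: dom => //; exact: (bmeas_tp _).1.
have cF y : y != 0 -> F_ n y @[n --> \oo] --> F y.
  move=> _; rewrite /F_ /F /jump !add0r.
  apply: cvgB; last first.
    apply: cvgMr.
    apply/cvgrPdist_le => e e0.
    have K0 : 0 < d%:R * `|y| * (d%:R * B) + 1 by rewrite ltr_wpDl// !mulr_ge0.
    have [n0 hn0] := x_close _ (divr_gt0 e0 K0); exists n0 => // n /= /hn0.
    rewrite ler_pdivlMr// => h1; rewrite distrC -dotvBr.
    apply: le_trans (dotv_le _ _) _; apply: le_trans h1.
    apply: (@le_trans _ _ (d%:R * `|y| * (d%:R * B * `|x_ n - x0|))).
      by rewrite ler_wpM2l ?mulr_ge0// alpha_lipschitz.
    by rewrite mulrDr mulr1 [leRHS]addrC -[leLHS]addr0 addrC lerD// le_eqVlt; apply/orP; left; apply/eqP; ring.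
  apply: cvgB; last exact: cvg_cst.
  rewrite /G; have [yr|yr] := pselect (`|y| < rho).
    have -> : (fun n => glue (ball 0 rho) (fun y => phi (x_ n + y) - phi (x_ n))
       (fun y => tp (l_ n) (x_ n + y) - tp (l_ n) (x_ n) + eps * well x0 (x_ n)) y) =
      (fun n => phi (x_ n + y) - phi (x_ n)).
      by apply/funext => n; rewrite glue_in//; exact/in0P.
    rewrite glue_in; last exact/in0P.
    apply: cvgB; last exact: (cvg_at (q_c H Nx0) x_close).
    apply: cvg_at (xy_close y); apply: (q_c H); apply: in_N => //.
    by rewrite subrr normr0 ltW.
  have -> : (fun n => glue (ball 0 rho) (fun y => phi (x_ n + y) - phi (x_ n))
       (fun y => tp (l_ n) (x_ n + y) - tp (l_ n) (x_ n) + eps * well x0 (x_ n)) y) =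
      (fun n => tp (l_ n) (x_ n + y) - tp (l_ n) (x_ n) + eps * well x0 (x_ n)).
    by apply/funext => n; rewrite glue_out//; move/in0P.
  rewrite glue_out; last by move/in0P.
  have cl (z : 'rV[R]_d) (z_ : nat -> 'rV[R]_d) :
     (forall e : R, 0 < e -> exists n0 : nat, forall n, (n0 <= n)%N -> `|z_ n - z| <= e) ->
     tp (l_ n) (z_ n) @[n --> \oo] --> u z.
    move=> hz; have -> : (fun n => tp (l_ n) (z_ n)) = (fun n => (tp (l_ n) (z_ n) - u (z_ n)) + u (z_ n)).
      by apply/funext => n; rewrite subrK.
    rewrite -[u z]add0r; apply: cvgD; last by apply: cvg_at hz; exact: cu.
    apply/cvgrPdist_le => e e0.
    (* The polynomial of index [n] is close to [u] on the ball of radius [(rhoN n)^-1], which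
       eventually contains the points [z_ n]. *)
    have z1 : 0 < (`|z| + 1)^-1 by rewrite invr_gt0 ltr_wpDl.
    have [n1 h1] := rhoN_small e0; have [n2 h2] := rhoN_small z1; have [n3 h3] := hz 1 ltr01.
    exists (maxn n1 (maxn n2 n3)) => // n /=; rewrite !geq_max => /and3P[m1 m2 m3].
    rewrite sub0r normrN; have [_ _ hu _] := hx n.
    apply: le_trans (hu _ _) (h1 n m1).
    have rn0 : 0 < rhoN n by case/andP: (rhoN_bounds n).
    apply: (@le_trans _ _ (`|z| + 1)).
      by rewrite -(subrK z (z_ n)) addrC; apply: le_trans (ler_normD _ _) _; rewrite lerD2l h3.
    by rewrite -[leLHS]invrK lef_pV2 ?posrE// h2.
  apply: cvgD; first by apply: cvgB; [apply: cl; exact: xy_close|exact: cl].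
  rewrite -(mulr0 eps); apply: cvgMr; rewrite -(well_at x0); apply: cvg_at x_close.
  by rewrite -lsE; exact: continuous_tp.
have cJ : jint j (F_ n) @[n --> \oo] --> jint j F.
  by apply: (@jint_dct R d j jm j0 jl F_ F C) => // [n|n y]; [exact: (hF n).1.1|exact: (hF n).2].
have cf : f (x_ n) @[n --> \oo] --> f x0.
  apply/cvgrPdist_le => e e0; have [del del0 hdel] := fc e0.
  have [n0 hn0] := x_close _ (divr_gt0 del0 (ltr0Sn R 1)).
  exists n0 => // n /= /hn0 h1; rewrite distrC; apply: hdel; first exact: hD.
  by apply: le_lt_trans h1 _; rewrite ltr_pdivrMr// ltr_pMr// ltr1n.
have ce : rhoN n @[n --> \oo] --> (0 : R).
  apply/cvgrPdist_le => e e0; have [n0 hn0] := rhoN_small e0; exists n0 => // n /= /hn0.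
  by rewrite sub0r normrN ger0_norm// ltW//; case/andP: (rhoN_bounds n).
have cb : \sum_i b i i (x_ n) @[n --> \oo] --> \sum_i b i i x0.
  apply: cvg_big => [x|i _]; first exact: add_continuous.
  by apply: cvg_at x_close; exact: (q_bc H).
have c : (- f (x_ n) - rhoN n - eps * BL) - (\sum_i b i i (x_ n) + jint j (F_ n)) @[n --> \oo] -->
    (- f x0 - 0 - eps * BL) - (\sum_i b i i x0 + jint j F).
  apply: cvgB; last exact: cvgD.
  apply: cvgB; last exact: cvg_cst.
  by apply: cvgB => //; exact: cvgN.
have := @cvgn_le _ _ _ 0 c; rewrite subr0 subr_le0; apply => n; rewrite subr_le0.
by case: (hx n).
Qed.

(** It remains to let [eps] tend to 0 and to enlarge the region where [phi] is used from the ball of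
    radius [rho] to [N]; as [u <= phi] on [N], this only increases the jump integral. *)
Lemma touching_ball : jadm (jump (glue N phi u) (phi x0) (alpha x0) x0) /\
  - f x0 <= \sum_i b i i x0 + jint j (jump (glue N phi u) (phi x0) (alpha x0) x0).
Proof.
have [ls lsE] := trig_well x0.
have [BL BL0 hBL] := Lt_bounded ls.
have [C C0 dom] := dominated.
have [Bp hBp] := q_bd H.
have c01 : 0 <= (0 : R) <= 1 by rewrite lexx ler01.
have r0 : `|x0 - x0| <= rho by rewrite subrr normr0 ltW.
have mu_ : measurable_fun setT u by exact: continuous_measurable_rV.
have [jF hF] := dom u 0 x0 r0 mu_ uA c01.
have mG : measurable_fun setT (glue N phi u).
  by apply: measurable_glue => // y Ny; exact: (q_c H).
have GB y : `|glue N phi u y| <= Bp + A.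
  have Bp0 : 0 <= Bp by apply: le_trans (hBp _ Nx0).
  have [Ny|Ny] := pselect (N y); first by rewrite glue_in//; apply: le_trans (hBp y Ny) _; rewrite lerDl.
  by rewrite glue_out//; apply: le_trans (uA y) _; rewrite lerDr.
have E y : `|y| < rho -> jump (glue N phi u) (phi x0) (alpha x0) x0 y = jump (G u 0 x0) 0 (alpha x0) 0 y.
  move=> yr; rewrite /jump add0r subr0 /G [glue (ball 0 rho) _ _ _]glue_in; last exact/in0P.
  by rewrite glue_in//; exact: in_N.
have jG : jadm (jump (glue N phi u) (phi x0) (alpha x0) x0).
  by apply: (jadm_jump mG GB C0 rho0) => y yr; rewrite E.
split=> //.
apply/ler_addgt0Pr => e e0.
pose eps := Num.min (e / (BL + 1)) (2 * d%:R + 1)^-1.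
have BL1 : 0 < BL + 1 by rewrite ltr_wpDl.
have d1 : 0 < 2 * d%:R + 1 :> R by rewrite ltr_wpDl// mulr_ge0.
have eps0 : 0 < eps by rewrite lt_min invr_gt0 d1 divr_gt0.
have epsd : eps * (2 * d%:R) <= 1.
  apply: (@le_trans _ _ (eps * (2 * d%:R + 1))); first by rewrite ler_pM2l// lerDl.
  by rewrite -ler_pdivlMr// mul1r ge_min lexx orbT.
have epsB : eps * BL <= e.
  apply: (@le_trans _ _ (eps * (BL + 1))); first by rewrite ler_pM2l// lerDl.
  by rewrite -ler_pdivlMr// ge_min lexx.
have h1 := touching_eps (esym lsE) hBL eps0 epsd.
have h2 : jint j (jump (G u 0 x0) 0 (alpha x0) 0) <= jint j (jump (glue N phi u) (phi x0) (alpha x0) x0).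
  apply: (le_jint jm j0 jl jF jG) => y _.
  have [yr|yr] := pselect (`|y| < rho); first by rewrite E.
  rewrite /jump add0r subr0 lerD2r /G glue_out; last by move/in0P.
  rewrite addr0 phi_x0 lerD2r.
  have [Ny|Ny] := pselect (N (x0 + y)); first by rewrite glue_in// u_le.
  by rewrite glue_out.
lra.
Qed.

End touching.

(** * Viscosity solutions: existence and comparison *)

Section viscosity.
Context {R : realType} {d : nat}.
Implicit Types (x y z : 'rV[R]_d) (i k : 'I_d) (A N D : set 'rV[R]_d) (u v phi f : 'rV[R]_d -> R).

Lemma within_dist A u q (e : R) : {within A, continuous u} -> A q -> 0 < e ->
  exists2 delta : R, 0 < delta & forall y, A y -> `|y - q| < delta -> `|u y - u q| <= e.
Proof.
move=> cu Aq e0.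
have h : nbhs_subspace (q : subspace A) (u @^-1` [set t | `|u q - t| <= e]).
  have c := cu q; apply: c; apply/nbhs_ballP; exists e => //= t; exact: ltW.
rewrite -(nbhs_subspace_in Aq) in h.
have /nbhs_ballP[delta /= d0 hd] := h; exists delta => // y Ay yq.
by rewrite distrC; apply: hd => //; exact/ball_normP.
Qed.

Lemma measurable_within A u : measurable A -> {within A, continuous u} -> measurable_fun A u.
Proof.
move=> mA cu; apply: (measurability _ (RGenOpens.measurableE R)) => _ [_ [a [b ->] <-]].
pose O : set 'rV[R]_d := [set x | exists2 delta : R, 0 < delta &
  forall y, A y -> `|y - x| < delta -> a < u y < b].
have oO : open O.
  rewrite openE => x [delta d0 hd]; apply/nbhs_ballP; exists (delta / 2); first by rewrite /= divr_gt0.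
  move=> y /ball_normP yx; exists (delta / 2); first by rewrite divr_gt0.
  move=> z Az zy; apply: hd => //; rewrite -(subrK y z) -addrA (splitr delta).
  by apply: le_lt_trans (ler_normD _ _) _; exact: ltrD.
rewrite (_ : A `&` _ = A `&` O); first by apply: measurableI => //; exact: measurable_open.
apply/seteqP; split=> x [Ax]; rewrite /= ?in_itv /=.
  move=> /andP[ax xb]; split=> //.
  have m0 : 0 < Num.min (u x - a) (b - u x) by rewrite lt_min !subr_gt0 ax.
  have m2 : 0 < Num.min (u x - a) (b - u x) / 2 by rewrite divr_gt0.
  have [delta d0 hd] := within_dist cu Ax m2; exists delta => // y Ay yx.
  have := hd y Ay yx; rewrite ler_norml => /andP[h1 h2].
  have h3 : Num.min (u x - a) (b - u x) <= u x - a by rewrite ge_min lexx.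
  have h4 : Num.min (u x - a) (b - u x) <= b - u x by rewrite ge_min lexx orbT.
  by move: h1 h2 h3 h4 m0; move: (Num.min _ _) => m h1 h2 h3 h4 m0; apply/andP; split; lra.
by move=> [delta d0 hd]; split=> //; apply: hd => //; rewrite subrr normr0.
Qed.

Lemma bounded_on_bound (T : Type) (V : normedModType R) (B : set T) (h : T -> V) :
  [bounded h t | t in B] -> exists2 M : R, 0 <= M & forall t, B t -> `|h t| <= M.
Proof.
move=> [M [Mr hM]]; exists (`|M| + 1); first by rewrite addr_ge0.
move=> t Bt; apply: (hM (`|M| + 1)) => //.
by apply: le_lt_trans (ler_norm M) _; rewrite ltrDl.
Qed.

Lemma uniform_within A u (e : R) : {within A, continuous u} -> compact A -> 0 < e ->
  exists2 delta : R, 0 < delta & forall x y, A x -> A y -> `|x - y| < delta -> `|u x - u y| <= e.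
Proof.
move=> cu cA e0; have e2 : 0 < e / 2 by rewrite divr_gt0.
have [|N hN] := @compact_uniform _ _ A
  (fun n y => A y -> forall x, A x -> `|x - y| < n.+1%:R^-1 -> `|u x - u y| <= e) cA; last first.
  by exists N.+1%:R^-1; [rewrite invr_gt0|move=> x y Ax Ay; exact: hN].
move=> q Aq; have [delta d0 hd] := within_dist cu Aq e2.
have d2 : 0 < delta / 2 by rewrite divr_gt0.
have [N _ hN] := near_infty_natSinv_lt (PosNum d2).
exists (delta / 2), N; split=> // n y Nn yq Ay x Ax xy.
have xq : `|x - q| < delta.
  rewrite -(subrK y x) -addrA (splitr delta); apply: le_lt_trans (ler_normD _ _) _.
  by apply: ltrD => //; apply: lt_trans xy _; exact: hN.
have yq' : `|y - q| < delta by apply: lt_trans yq _; rewrite ltr_pdivrMr// ltr_pMr// ltr1n.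
have -> : u x - u y = (u x - u q) - (u y - u q) by ring.
by apply: le_trans (ler_normB _ _) _; rewrite (splitr e) lerD// hd.
Qed.

Lemma continuous_lsc_in A u : continuous u -> lsc_in A u.
Proof.
move=> cu x a; rewrite lte_fin => ax; exists [set y | a < u y]; last by move=> y; rewrite lte_fin.
have h : nbhs (u x) [set t | a < t] by apply: open_nbhs_nbhs; split => //; exact: open_gt.
exact: (@continuous_subspaceT _ _ A u cu x _ h).
Qed.

Lemma continuous_usc_in A u : continuous u -> usc_in A u.
Proof.
by move=> cu; apply: (@continuous_lsc_in A (fun x => - u x)) => x; apply: continuousN; exact: cu.
Qed.

Variable j : 'rV[R]_d -> R.
Hypotheses (jm : measurable_fun ([set~ 0] : set 'rV[R]_d) j)
  (j0 : forall y : 'rV[R]_d, y != 0 -> 0 <= j y)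
  (jl : (\int[lebesgue_rV d]_(y in [set~ 0%R]) (Num.min 1 (enorm y ^+ 2) * j y)%:E < +oo)%E).

Lemma jump_glueN N phi u (c : R) (g x y : 'rV[R]_d) :
  jump (glue N (fun y => - phi y) (fun y => - u y)) (- c) (- g) x y = - jump (glue N phi u) c g x y.
Proof.
have E z : glue N (fun y => - phi y) (fun y => - u y) z = - glue N phi u z by rewrite /glue; case: ifP.
have dN : dotv y (- g) = - dotv y g.
  by rewrite /dotv -sumrN; apply: eq_bigr => i _; rewrite mxE mulrN.
by rewrite /jump E dN; ring.
Qed.

(** Admissibility is required since [jint] is linear only on integrable functions. *)
Lemma jint_glueN N phi u (c : R) (g x : 'rV[R]_d) :
  jadm (jump (glue N (fun y => - phi y) (fun y => - u y)) (- c) (- g) x) ->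
  jint j (jump (glue N (fun y => - phi y) (fun y => - u y)) (- c) (- g) x) =
  - jint j (jump (glue N phi u) c g x).
Proof.
set J := jump (glue N (fun y => - phi y) _) _ _ _ => jJ.
have E : jump (glue N phi u) c g x = fun y => - J y.
  by apply/funext => y; rewrite /J jump_glueN opprK.
by rewrite E (jintN jm j0 jl jJ) opprK.
Qed.

Variables (D : set 'rV[R]_d) (r : R).
Hypothesis Dr : forall x, D x -> `|x| <= r.

Lemma touching N phi f u (A : R) a b x0 : C2_data N phi a b -> open N -> N x0 -> N `<=` D ->
  phi x0 = u x0 -> (forall y, N y -> u y <= phi y) -> continuous u -> (forall x, `|u x| <= A) ->
  approximable j D f u A ->
  (forall e : R, 0 < e -> exists2 delta : R, 0 < delta &
    forall x, D x -> `|x - x0| < delta -> `|f x - f x0| <= e) ->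
  jadm (jump (glue N phi u) (phi x0) (\row_i a i x0) x0) /\
  - f x0 <= \sum_i b i i x0 + jint j (jump (glue N phi u) (phi x0) (\row_i a i x0) x0).
Proof.
move=> H oN Nx0 ND px0 ul cu uA ap fc.
have [rho [B [rho0 rho1 B0 hN hB]]] := hessian_ball H oN Nx0.
exact: (touching_ball jm j0 jl H oN Nx0 ND px0 ul cu uA ap fc rho0 rho1 B0 hN hB).
Qed.

(** The supersolution property is the subsolution property for [- u], [- f] and [- phi]: the data of
    a test function and approximability are stable under a change of sign. *)
Lemma approximable_viscosity f u (A : R) : continuous u -> (forall x, `|u x| <= A) ->
  approximable j D f u A ->
  (forall x0 (e : R), D x0 -> 0 < e -> exists2 delta : R, 0 < delta &
    forall x, D x -> `|x - x0| < delta -> `|f x - f x0| <= e) ->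
  viscosity_solution j D (fun x => - f x) u.
Proof.
move=> cu uA ap fc; have mu_ : measurable_fun setT u by exact: continuous_measurable_rV.
have bu : bounded_fun u.
  by exists A; split; [exact: num_real|move=> M AM x _; exact: le_trans (uA x) (ltW AM)].
split; split=> //; [exact: continuous_usc_in| |exact: continuous_lsc_in|].
- move=> x N phi Dx oN Nx ND hC e0 hle.
  have H := C2_closure_data oN (fun y Ny => Dr (ND y Ny)) hC.
  have px : phi x = u x by apply/eqP; rewrite -subr_eq0 e0.
  have ul y : N y -> u y <= phi y by move=> /hle; rewrite subr_ge0.
  rewrite L_op_glue//.
  by have [_] := touching H oN Nx ND px ul cu uA ap (fun e => fc x e Dx).
- move=> x N phi Dx oN Nx ND hC e0 hle.
  have H := C2_dataN (C2_closure_data oN (fun y Ny => Dr (ND y Ny)) hC).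
  have px : - phi x = - u x by congr (- _); apply/eqP; rewrite -subr_eq0 e0.
  have ul y : N y -> - u y <= - phi y by move=> /hle; rewrite subr_le0 lerN2.
  have cu' : continuous (fun x => - u x) by move=> y; apply: continuousN; exact: cu.
  have uA' y : `|- u y| <= A by rewrite normrN.
  have fc' (e : R) : 0 < e -> exists2 delta : R, 0 < delta &
      forall y, D y -> `|y - x| < delta -> `|- f y - - f x| <= e.
    move=> /(fc x e Dx)[delta d0 hd]; exists delta => // y Dy /(hd y Dy) h.
    by rewrite -opprD normrN.
  rewrite L_op_glue//.
  have [jJ] := touching H oN Nx ND px ul cu' uA' (approximableN ap) fc'.
  have gN : \row_i (- partial i phi x) = - grad phi x by apply/rowP => i; rewrite !mxE.
  rewrite gN in jJ *; rewrite jint_glueN// sumrN -opprD lerN2.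
  exact.
Qed.

Section uniqueness.
Variables (f u v : 'rV[R]_d -> R) (A M : R) (lb : seq (R * 'rV[R]_d * R)).
Hypotheses (hb : forall x, 1 <= tp lb x <= M) (hL : forall x, `|x| <= r -> Lt j lb x <= - 2).
Hypotheses (cu : continuous u) (ap : approximable j D f u A).
Hypotheses (cv : continuous v) (bv : bounded_fun v).

Let bound_v : exists A' : R, forall x, `|v x| <= A'.
Proof. by have [A' _ h] := bounded_on_bound bv; exists A' => x; exact: h. Qed.

(** A trigonometric polynomial is smooth on the whole space, hence a legitimate test function on
    every neighbourhood; the viscosity inequality for it is the hypothesis of [comparison]. *)
Lemma subsolution_le : viscosity_subsolution j D (fun x => - f x) v ->
  (forall x, ~ D x -> v x <= u x) -> forall x, v x <= u x.
Proof.
move=> [_ _ _ hv] vout; have [A' vA] := bound_v.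
apply: (comparison jm j0 jl Dr hb hL ap cu cv vA vout) => x N l Dx oN Nx ND e0 hle _.
have := hv x N (tp l) Dx oN Nx ND (C2_closure_tp (d := d) N l).
rewrite L_op_glue//; apply; first by rewrite e0 subrr.
by move=> y Ny; rewrite subr_ge0 hle.
Qed.

Lemma supersolution_ge : viscosity_supersolution j D (fun x => - f x) v ->
  (forall x, ~ D x -> u x <= v x) -> forall x, u x <= v x.
Proof.
move=> [_ _ _ hv] vout x'; have [A' vA] := bound_v; rewrite -lerN2.
apply: (comparison jm j0 jl Dr hb hL (approximableN ap) (u := fun x => - u x)
  (v := fun x => - v x) (A' := A')) => [y|y|y|y Dy|x N l Dx oN Nx ND e0 hle].
- by apply: continuousN; exact: cu.
- by apply: continuousN; exact: cv.
- by rewrite normrN.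
- by rewrite lerN2 vout.
pose l' := scale_tp (-1) l.
have tl : tp l = fun y => - tp l' y by apply/funext => y; rewrite tp_scale mulN1r opprK.
have gl : grad (tp l) x = - grad (tp l') x.
  by apply/rowP => i; rewrite !mxE !partial_tp dl_scale tp_scale mulN1r opprK.
have ll : laplacian (tp l) x = - laplacian (tp l') x.
  rewrite /laplacian -sumrN; apply: eq_bigr => i _.
  by rewrite !partial_tp !dl_scale tp_scale mulN1r opprK.
have := hv x N (tp l') Dx oN Nx ND (C2_closure_tp (d := d) N l').
rewrite L_op_glue// => h; rewrite ll gl tl => jJ; rewrite (jint_glueN jJ) -opprD lerN2.
apply: h; first by rewrite tp_scale mulN1r e0 opprK subrr.
by move=> y Ny; rewrite tp_scale mulN1r subr_le0 lerNl hle.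
Qed.

End uniqueness.
End viscosity.

Theorem theorem1p1 (R : realType) (d : nat) (d_gt0 : (0 < d)%N)
  (j : 'rV[R]_d -> R)
  (j_measurable : measurable_fun ([set~ 0] : set 'rV[R]_d) j)
  (j_ge0 : forall y, y != 0 -> 0 <= j y)
  (j_levy : (\int[lebesgue_rV d]_(y in [set~ 0%R])
               (Num.min 1 (enorm y ^+ 2) * j y)%:E < +oo)%E)
  (A1 : condition_A1 j)
  (dO : measure_display) (Omega : measurableType dO) (P : probability Omega R)
  (P_complete : measure_is_complete P)
  (W Y : R -> Omega -> 'rV[R]_d)
  (W_brownian : standard_brownian P W)
  (Y_levy : levy_process P Y) (Y_exponent : has_exponent P Y (psi j))
  (WY_independent : independent_processes P (fun t => W (2 * t)) Y)
  (D : set 'rV[R]_d) (D_bounded : bounded_set D)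
  (D_lipschitz : lipschitz_domain D)
  (f g : 'rV[R]_d -> R)
  (f_continuous : {within closure D, continuous f})
  (g_continuous : {within ~` D, continuous g})
  (g_bounded : [bounded g x | x in ~` D]) :
  let X := fun (t : R) (w : Omega) => W (2 * t) w + Y t w in
  let tau := fun (x : 'rV[R]_d) (w : Omega) =>
    exit_time D (fun t => x + X t w) in
  exists u : 'rV[R]_d -> R,
    unique (fun v : 'rV[R]_d -> R =>
      [/\ continuous v, bounded_fun v,
          viscosity_solution j D (fun x => - f x) v &
          forall x, ~ D x -> v x = g x]) u /\
    (forall x, D x ->
      (u x)%:E =
        ('E_P[fun w => (\int[lebesgue_measure]_(t in
                 [set t : R | 0 < t /\ (t%:E < tau x w)%E]) f (x + X t w))%R]
         + 'E_P[fun w => g (x + X (fine (tau x w)) w)%R])%E).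
Proof.
move=> X tau.
have S : setup P j W Y by [].
have oD : open D by case: D_lipschitz.
have mD : measurable D by exact: measurable_open.
have [r r0 Dr] := @bounded_on_bound R _ _ D id D_bounded.
have r1 : 0 < r + 1 by rewrite ltr_wpDl.
have {r0}Dr x : D x -> `|x| <= r + 1 by move=> /Dr h; apply: le_trans h _; rewrite lerDl.
have cK : compact (closure D) := @compact_closure R d D (r + 1) Dr.
have [Kf Kf0 hKf] := @bounded_on_bound R _ _ _ id (compact_bounded (continuous_compact f_continuous cK)).
have [Kg Kg0 hKg] := bounded_on_bound g_bounded.
have {}hKf x : D x -> `|f x| <= Kf.
  by move=> Dx; apply: hKf; exists x => //; exact: subset_closure.
have [lb [M [hb hL]]] := barrier_exists S (Ordinal d_gt0) r1.
have [t0 bb] := tp_barrier S hb hL.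
(* Nothing is assumed on [f] off the closure of [D] nor on [g] in [D]; extension by 0 yields bounded
   measurable functions with the same values where they matter. *)
pose f0 := glue D f (fun=> 0); pose g0 := glue D (fun=> 0) g.
have f0E x : D x -> f0 x = f x by exact: glue_in.
have g0E x : ~ D x -> g0 x = g x by exact: glue_out.
pose K := Kf + Kg.
have f0K x : `|f0 x| <= K.
  have [Dx|Dx] := pselect (D x); first by rewrite f0E// (le_trans (hKf x Dx))// lerDl.
  by rewrite /f0 glue_out// normr0 addr_ge0.
have g0K x : `|g0 x| <= K.
  have [Dx|Dx] := pselect (D x); first by rewrite /g0 glue_in// normr0 addr_ge0.
  by rewrite g0E// (le_trans (hKg x Dx))// lerDr.
have fD y : D y -> {for y, continuous f} by move=> Dy; exact: (within_open_for oD Dy f_continuous).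
have fc (e : R) : 0 < e -> exists2 delta : R, 0 < delta &
    forall x y, D x -> D y -> `|x - y| < delta -> `|f x - f y| <= e.
  move=> /(uniform_within f_continuous cK)[delta d0 hd]; exists delta => // x y Dx Dy.
  by apply: hd; exact: subset_closure.
have pb : data D f0 g0 K.
  split=> //.
  - split; last by exists K.
    by apply: measurable_glue => //; exact: measurable_cst.
  - split; last by exists K.
    rewrite -(setUv D); apply/measurable_funU => //; first exact: measurableC.
    split.
      apply: (@eq_measurable_fun _ _ _ _ _ (cst (0 : R))); last exact: measurable_cst.
      by move=> y; rewrite inE => Dy; rewrite /g0 glue_in.
    apply: (@eq_measurable_fun _ _ _ _ _ g).
      by move=> y; rewrite inE => Dy; rewrite g0E.
    by apply: measurable_within g_continuous; exact: measurableC.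
  - move=> e /fc[delta d0 hd]; exists delta => // x y Dx Dy; rewrite !f0E//; exact: hd.
  - move=> q e Dq e0; have [delta d0 hd] := within_dist g_continuous Dq e0.
    by exists delta => // x Dx; rewrite !g0E//; exact: hd.
have [V [e_ C]] := scheme_exists S bb pb Dr.
(* The whole sequence converges, pointwise: in [D] because the stochastic representation identifies
   the limit, outside because [V n] is constant in [n]. No subsequence is extracted; equicontinuity
   then makes the limit continuous. *)
have lim x : exists ux : R, V n x @[n --> \oo] --> ux /\ (D x -> ux%:E =
    ('E_P[fun w => (\int[lebesgue_measure]_(t in
             [set t : R | 0 < t /\ (t%:E < tau x w)%E]) f (x + X t w))%R]
     + 'E_P[fun w => g (x + X (fine (tau x w)) w)%R])%E).
  have [Dx|Dx] := pselect (D x).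
    have [ux h1 h2] := representation S C P_complete Dx (fun y Dy => esym (f0E y Dy))
      (fun y Dy => esym (g0E y Dy)).
    by exists ux.
  exists (g0 x); split=> //.
  by under eq_fun do rewrite (d_out (c_V C _) Dx); exact: cvg_cst.
have [u hu] := choice lim.
have Vu x : V n x @[n --> \oo] --> u x by case: (hu x).
have cu := solution_continuous S C Vu.
have uA := solution_norm C Vu.
have u_out x : ~ D x -> u x = g x.
  move=> Dx; rewrite -g0E// -(cvg_lim (@norm_hausdorff _ _) (@Vu x)); apply: cvg_lim.
    exact: norm_hausdorff.
  by under eq_fun do rewrite (d_out (c_V C _) Dx); exact: cvg_cst.
have ap : approximable j D f u (K * M).
  move=> e rho delta e0 rho0 delta0.
  have [l [h1 h2 h3]] := trig_solution S C Vu e0 rho0 delta0.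
  exists l; split=> // x hx; rewrite -f0E; first exact: h3.
  by apply: hx; rewrite subrr normr0 ltW.
have bu : bounded_fun u.
  by exists (K * M); split; [exact: num_real|move=> N KN x _; exact: le_trans (uA x) (ltW KN)].
exists u; split; last by move=> x Dx; have [_] := hu x; apply.
split.
  split=> //; apply: (approximable_viscosity j_measurable j_ge0 j_levy Dr cu uA ap).
  by move=> x0 e Dx0 /fc[delta d0 hd]; exists delta => // x Dx; exact: hd.
(* A second solution is compared with the constructed [u] in both directions, as a supersolution and
   as a subsolution. *)
move=> v [cv bv [sub super] v_out]; apply/funext => x; apply/eqP; rewrite eq_le; apply/andP; split.
  apply: (supersolution_ge j_measurable j_ge0 j_levy Dr hb hL cu ap cv bv super).
  by move=> y Dy; rewrite u_out// v_out.
apply: (subsolution_le j_measurable j_ge0 j_levy Dr hb hL cu ap cv bv sub).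
by move=> y Dy; rewrite u_out// v_out.
Qed.
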